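(* Let $A=\{A^u\}_{u\in U_1}$ be the Hessian field of the regularized Hamiltonian action functional $\mathcal{A}$ of a twisted Zeeman system (defined in the context). The weak Hessian field $A$ is almost extendable.
   Context: **Conventions.** $\mathbb{C}\simeq\mathbb{R}^2$ with real inner product $\langle z,w\rangle_0=\mathrm{Re}(\bar z w)$; $j_0$ is multiplication by $i$. $\mathbb{S}^1=\mathbb{R}/\mathbb{Z}$; $\langle\cdot,\cdot\rangle$ and $\|\cdot\|$ are the real $L^2$ inner product and norm over $[0,1]$; $'=\frac{d}{d\tau}$; a dot means $\partial_t$. $\mathcal{L}(X,Y)$ denotes bounded linear operators, $\mathcal{L}(X)=\mathcal{L}(X,X)$. **Twisted-periodic one-form.** $Q\subset\mathbb{C}$ is open with $0\in Q$, $\varsigma(z)=z^2$, $Z:=\varsigma^{-1}(Q)$. $\theta=\{\theta_t\}_{t\in\mathbb{R}}$ is a smooth family of $1$-forms on $Q$ with $\dot\theta_{t+1}=\dot\theta_t$ for all $t$ and such that for every $t$ there is a smooth function $f_t\colon Q\to\mathbb{R}$ with $\theta_{t+1}=\theta_t+df_t$; put $f:=f_0$. Write $\vartheta_t:=\varsigma^*\theta_t=a^1_t\,dx+a^2_t\,dy$, $\mathbf{a}_t=(a_t^1,a_t^2)\colon Z\to\mathbb{R}^2$ and $\mathrm{rot}\,\mathbf{a}_t=\partial_xa_t^2-\partial_ya_t^1$. Both $\dot{\mathbf{a}}_t$ and $\mathrm{rot}\,\mathbf{a}_t$ are $1$-periodic in $t$. **Spaces.** $h_k=W^{k,2}(\mathbb{S}^1,\mathbb{C})$,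 $H_k=W^{k,2}(\mathbb{S}^1,\mathbb{C}^2)=h_k\times h_k$ for $k=0,1,2$ (with $W^{0,2}=L^2$), $H_r=W^{r,2}(\mathbb{S}^1,\mathbb{C}^2)$ for real $r\in[0,1)$; $u_1=\{z\in h_1\mid z\not\equiv0,\ z(\tau)\in Z\ \forall\tau\}$, $u_2=u_1\cap h_2$, $U_1=u_1\times h_1\subset H_1$, $U_2=u_2\times h_2=U_1\cap H_2$. **Functional.** For $z\in u_1$ set $t_z(\tau)=\|z\|^{-2}\int_0^\tau|z(s)|^2ds$, $\tau\in[0,1]$. Let $$\mathcal{M}(z)=\int_0^1\vartheta_{t_z(\tau)}|_{z_\tau}z'_\tau\,d\tau-f(z_0^2),\qquad \mathcal{A}(z,\eta)=\langle\eta,z'\rangle+\mathcal{M}(z)-\frac{\|\eta\|^2}{8\|z\|^2}+\frac1{\|z\|^2}.$$ The $L^2$-gradient of $\mathcal{A}$ is the map $\mathrm{grad}\,\mathcal{A}\colon U_1\to H_0$, $$\mathrm{grad}\,\mathcal{A}|_{(z,\eta)}=\begin{pmatrix}-\eta'+\mathrm{grad}\,\mathcal{M}|_z-\frac{2z}{\|z\|^4}+\frac{\|\eta\|^2}{4\|z\|^4}z\\ z'-\frac{1}{4\|z\|^2}\eta\end{pmatrix},$$ where, as functions of $\tau\in[0,1]$, $$\mathrm{grad}\,\mathcal{M}|_z=-\frac{2z}{\|z\|^4}\int_0^1\Bigl(\int_0^\sigma|z_\rho|^2d\rho\Bigr)\langle\dot{\mathbf{a}}_{t_z(\sigma)}|_{z_\sigma},z'_\sigma\rangle_0\,d\sigma-\frac{|z|^2}{\|z\|^2}\dot{\mathbf{a}}_{t_z}|_z+\frac{2z}{\|z\|^2}\int_\tau^1\langle\dot{\mathbf{a}}_{t_z(\sigma)}|_{z_\sigma},z'_\sigma\rangle_0\,d\sigma-(\mathrm{rot}\,\mathbf{a}_{t_z}|_z)\,j_0z'.$$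 **Hessian field.** For $u=(z,\eta)\in U_1$, $A^u:=d(\mathrm{grad}\,\mathcal{A})|_u\colon H_1\to H_0$ is the derivative of the $L^2$-gradient at $u$. For $u\in U_2$, $A^u_2:=A^u|_{H_2}\colon H_2\to H_1$. **Weak Hessian field.** A weak Hessian field on $U_1$ is a map $u\mapsto A^u$ in $C^0(U_1,\mathcal{L}(H_1,H_0))\cap C^0(U_2,\mathcal{L}(H_2,H_1))$ (the second meaning: for $u\in U_2$ the restriction $A^u_2=A^u|_{H_2}$ maps $H_2$ to $H_1$, continuously in $u$) such that (Symmetry) $\langle A^ux,y\rangle_{H_0}=\langle x,A^uy\rangle_{H_0}$ for all $u\in U_1$, $x,y\in H_1$; (Fredholm) $A^u\colon H_1\to H_0$ is Fredholm of index zero for all $u\in U_1$ and $A^u_2\colon H_2\to H_1$ is Fredholm of index zero for all $u\in U_2$. **Almost extendable.** A weak Hessian field $A$ on $U_1$ is almost extendable (almost extends) if there is a decomposition $A=F+C$ with $F\in C^0(U_1,\mathcal{L}(H_1,H_0)\cap\mathcal{L}(H_2,H_1))$ and, for some $r\in[0,1)$, $C\in C^0(U_1,\mathcal{L}(H_r,H_0))\cap C^0(U_2,\mathcal{L}(H_1,H_1))$ such that: (F) for every $u\in U_1$, $F^u|_{H_2}\colon H_2\to H_1$ is Fredholm of index zero; (C) every $u\in U_1$ has an $H_1$-open neighborhood $V_u$ and a constant $\kappa$ such that for all $v,w\in V_u\cap H_2$ $$\|C^v-C^w\|_{\mathcal{L}(H_1)}\le\kappa\bigl(|v-w|_{H_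2}+\min\{|v|_{H_2},|w|_{H_2}\}\,|v-w|_{H_1}\bigr).$$
   Formalization: That A is a weak Hessian field is taken as a hypothesis: for general twisted-periodic θ it fails, since A^u maps some H_2 loops to non-periodic functions (e.g. θ_t = sin(8πt) x dy); it forces the time derivative of θ_t to be constant in t, the only case in which the claim holds. *)

(* Defs.v *)
From HB Require Import structures.
From mathcomp Require Import all_boot all_order all_algebra.
From mathcomp Require Import all_classical all_reals all_analysis.

Set Implicit Arguments.
Unset Strict Implicit.
Unset Printing Implicit Defensive.
Import Order.TTheory GRing.Theory Num.Theory.
Import numFieldNormedType.Exports.

Local Open Scope classical_set_scope.
Local Open Scope ring_scope.
Local Open Scope quotient_scope.

(** The real Hilbert space L^2(S^1, R): square integrable functions on [0, 1]
    modulo equality almost everywhere. *)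

Section L2_space.
Context {R : realType}.

Definition mu01 : {measure set (measurableTypeR R) -> \bar R} :=
  mrestr (@lebesgue_measure R) (measurable_itv `[0, 1]).

Definition Lfun01 : lmodType R := LfunType mu01 (lee1n 2).

Definition null_fun : {pred Lfun01} :=
  [pred f : Lfun01 | `[< (f : R -> R) = cst 0 %[ae mu01] >]].

Lemma null_fun_submod_closed : submod_closed null_fun.
Proof.
split.
  by apply/asboolP; exact: aeW.
move=> a f g /asboolP f0 /asboolP g0; apply/asboolP.
have F := ae_filter_ringOfSetsType mu01.
apply: filterS2 f0 g0 => x fx gx xT.
have /= -> : (a *: f + g : Lfun01) x = a * f x + g x by [].
by rewrite fx// gx//= mulr0 addr0.
Qed.

Let null_fun_zmod_closed : zmod_closed null_fun.
Proof.
have [n0 nD] := null_fun_submod_closed; split=> // f g nf ng.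
by rewrite addrC -scaleN1r nD.
Qed.

HB.instance Definition _ :=
  GRing.isZmodClosed.Build Lfun01 null_fun null_fun_zmod_closed.

Definition L2 : Type := Quotient.quot null_fun.

HB.instance Definition _ := GRing.Zmodule.on L2.
HB.instance Definition _ := EqQuotient.on L2.

Let scale (a : R) (z : L2) : L2 := \pi_L2 (a *: repr z).

Let pi_scale a (f : Lfun01) : scale a (\pi_L2 f) = \pi_L2 (a *: f).
Proof.
apply/eqP; rewrite -Quotient.idealrBE -scalerBr -[X in X \in _]addr0.
apply: (proj2 null_fun_submod_closed); last exact: rpred0.
by rewrite Quotient.idealrBE reprK.
Qed.

Let scaleA a b z : scale a (scale b z) = scale (a * b) z.
Proof. by elim/quotW: z => f; rewrite [scale b _]pi_scale pi_scale scalerA. Qed.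

Let scale1 : left_id 1 scale.
Proof. by elim/quotW=> f; rewrite pi_scale scale1r. Qed.

Let scaleDr : right_distributive scale +%R.
Proof.
move=> a; elim/quotW=> f; elim/quotW=> g.
by rewrite -raddfD !pi_scale -raddfD scalerDr.
Qed.

Let scaleDl z : {morph scale^~ z : a b / a + b}.
Proof.
by elim/quotW: z => f a b; rewrite !pi_scale -raddfD scalerDl.
Qed.

HB.instance Definition _ :=
  GRing.Zmodule_isLmodule.Build R L2 scaleA scale1 scaleDr scaleDl.

End L2_space.
Arguments L2 R : clear implicits.

(** Sobolev spaces of loops.  [S^1 = R/Z] is represented by [0, 1] with its
    end points identified, and C by R^2.  All spaces are linear subspaces,
    each with its own norm, of L^2(S^1, C^2). *)

Section sobolev.
Context {R : realType}.
Implicit Types z v : L2 R.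

Definition int01 (g : R -> R) : R :=
  \int[@lebesgue_measure R]_(t in `[0, 1]) g t.

Definition int0 (tau : R) (g : R -> R) : R :=
  \int[@lebesgue_measure R]_(t in `[0, tau]) g t.

Definition L2fun z : R -> R := (repr z : Lfun01).

Definition L2dot z v : R := int01 (fun t => L2fun z t * L2fun v t).

(* g is an absolutely continuous loop in the class z, with derivative v. *)
Definition ac_loop z v (g : R -> R) : Prop :=
  [/\ {in `[0, 1], forall tau, g tau = g 0 + int0 tau (L2fun v)},
      g 1 = g 0 & L2fun z = g %[ae mu01]].

(* z' and the continuous representative of z (on [0, 1]).  Both are uniquely
   determined if z is in W^{1,2}, and are junk otherwise. *)
Definition L2diff z : L2 R := xget 0 [set v | exists g, ac_loop z v g].

Definition loop z : R -> R := xget (cst 0) [set g | exists v, ac_loop z v g].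

Fixpoint sobolev (k : nat) : set (L2 R) :=
  if k is k'.+1 then
    [set z | (exists v g, ac_loop z v g) /\ sobolev k' (L2diff z)]
  else setT.

(* squared W^{k,2} norm: the sum of |z^(i)|^2 for i <= k *)
Definition sobolev_sqnorm (k : nat) z : R :=
  \sum_(i < k.+1) L2dot (iter i L2diff z) (iter i L2diff z).

(* Fractional order: Slobodeckij's double integral, with the distance of the
   circle R/Z.  In order 0 the space is L^2 itself. *)
Definition circle_dist (s t : R) : R := Num.min `|s - t| (1 - `|s - t|).

Definition slobodeckij (r : R) z : \bar R :=
  (\int[@lebesgue_measure R]_(s in `[0%R, 1%R])
   \int[@lebesgue_measure R]_(t in `[0%R, 1%R])
     ((L2fun z s - L2fun z t) ^+ 2 / (circle_dist s t) `^ (1 + 2 * r))%:E)%E.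

Definition frac_sobolev (r : R) : set (L2 R) :=
  [set z | r = 0 \/ (slobodeckij r z < +oo)%E].

Definition frac_sobolev_sqnorm (r : R) z : R :=
  L2dot z z + (if r == 0 then 0 else fine (slobodeckij r z)).

End sobolev.

Definition plane (R : realType) : normedModType R := (R^o * R^o)%type.

Definition hL2 (R : realType) : lmodType R := (L2 R * L2 R)%type.
Definition HL2 (R : realType) : lmodType R := (hL2 R * hL2 R)%type.

(** A linear subspace of V with its own norm.  Operators between such
    subspaces are total functions V -> V of which only the values on the
    domain matter, so that restricting an operator to a smaller space leaves
    the function unchanged. *)

Record nspace (R : realType) (V : lmodType R) := NSpace {
  dom :> V -> Prop;
  nrm : V -> R }.

Section operators.
Context {R : realType} {V : lmodType R}.
Implicit Types (X Y B : nspace V) (U S N : set V).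

Definition bounded_op X Y (T : V -> V) : Prop :=
  [/\ (forall x, X x -> Y (T x)),
      (forall a x y, X x -> X y -> T (a *: x + y) = a *: T x + T y) &
      exists M : R, forall x, X x -> nrm Y (T x) <= M * nrm X x].

(* ||T - T'||_{L(X,Y)} <= K *)
Definition op_dist_le X Y (T T' : V -> V) (K : R) : Prop :=
  forall x, X x -> nrm Y (T x - T' x) <= K * nrm X x.

(* A in C^0(U, L(X,Y)), where U carries the topology of the norm of B *)
Definition C0_op U B X Y (A : V -> V -> V) : Prop :=
  (forall u, U u -> bounded_op X Y (A u)) /\
  forall u, U u -> forall e : R, 0 < e -> exists2 d : R, 0 < d &
    forall w, U w -> nrm B (w - u) < d -> op_dist_le X Y (A w) (A u) e.

(* dim (S / N) = n, for linear subspaces N and S: e is a basis of S modulo N *)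
Definition has_dim_mod S N (n : nat) : Prop :=
  exists e : 'I_n -> V, (forall i, S (e i)) /\
    forall x, S x ->
      exists! c : 'rV[R]_n, N (x - \sum_(i < n) c ord0 i *: e i).

(* Between Banach spaces, a bounded operator with finite dimensional cokernel
   has closed range, so closedness need not be required. *)
Definition fredholm_of_index X Y (T : V -> V) (i : int) : Prop :=
  bounded_op X Y T /\
  exists m n : nat, [/\ has_dim_mod [set x | X x /\ T x = 0] [set 0] m,
    has_dim_mod (Y : set V) (T @` (X : set V)) n & i = m%:Z - n%:Z].

Definition open_in X U : Prop :=
  U `<=` (X : set V) /\ forall u, U u -> exists2 d : R, 0 < d &
    forall w, X w -> nrm X (w - u) < d -> U w.

(* Only the values of G near u in the norm of X matter. *)
Definition is_frechet X Y (G : V -> V) (u : V) (T : V -> V) : Prop :=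
  bounded_op X Y T /\
  forall e : R, 0 < e -> exists2 d : R, 0 < d &
    forall x, X x -> nrm X x < d ->
      nrm Y (G (u + x) - G u - T x) <= e * nrm X x.

End operators.

Section loop_spaces.
Context {R : realType}.

Definition hdot (z w : hL2 R) : R := L2dot z.1 w.1 + L2dot z.2 w.2.
Definition Hdot (u w : HL2 R) : R := hdot u.1 w.1 + hdot u.2 w.2.

Definition hspace (D : set (L2 R)) : set (hL2 R) := [set z | D z.1 /\ D z.2].

Definition Hspace (D : set (L2 R)) (q : L2 R -> R) : nspace (HL2 R) :=
  {| dom := [set u | hspace D u.1 /\ hspace D u.2];
     nrm := fun u =>
       Num.sqrt (q u.1.1 + q u.1.2 + q u.2.1 + q u.2.2) |}.

Definition h_ (k : nat) : set (hL2 R) := hspace (sobolev k).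
Definition H_ (k : nat) : nspace (HL2 R) :=
  Hspace (sobolev k) (sobolev_sqnorm k).
Definition Hfrac (r : R) : nspace (HL2 R) :=
  Hspace (frac_sobolev r) (frac_sobolev_sqnorm r).

Definition hdiff (z : hL2 R) : hL2 R := (L2diff z.1, L2diff z.2).

Definition hloop (z : hL2 R) (tau : R) : plane R :=
  (loop z.1 tau, loop z.2 tau).

Definition hfun (z : hL2 R) (tau : R) : plane R :=
  (L2fun z.1 tau, L2fun z.2 tau).

End loop_spaces.

Fixpoint Ck_on (R : realType) (V : normedModType R) (k : nat) (O : set V)
    (g : V -> R^o) : Prop :=
  if k is k'.+1 then
    (forall x, O x -> differentiable g x) /\
    (forall v, Ck_on k' O (fun x => 'D_v g x))
  else forall x, O x -> {for x, continuous g}.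

Definition smooth_on (R : realType) (V : normedModType R) (O : set V)
  (g : V -> R^o) : Prop := forall k, Ck_on k O g.

Section zeeman.
Context {R : realType}.
Local Notation C := (plane R).

Definition dot0 (z w : C) : R := z.1 * w.1 + z.2 * w.2.

Definition cmul (z w : C) : C :=
  (z.1 * w.1 - z.2 * w.2, z.1 * w.2 + z.2 * w.1).

Definition csqr (z : C) : C := cmul z z.

(* The one-form p_t dx + q_t dy is given by its coefficients, theta t = (p_t, q_t);
   f t is the function relating theta_{t+1} and theta_t. *)
Definition twisted_periodic (Q : set C) (theta : R -> C -> C)
    (f : R -> C -> R) : Prop :=
  [/\ smooth_on (setT `*` Q) (fun x : R^o * C => (theta x.1 x.2).1),
      smooth_on (setT `*` Q) (fun x : R^o * C => (theta x.1 x.2).2),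
      (forall t q, Q q ->
        'D_1 (fun s : R^o => theta s q) (t + 1) =
        'D_1 (fun s : R^o => theta s q) t),
      (forall t, smooth_on Q (f t)) &
      (forall t q, Q q -> theta (t + 1) q =
        theta t q + ('D_((1, 0) : C) (f t : C -> R^o) q,
                     'D_((0, 1) : C) (f t : C -> R^o) q))].

(* The pull back of theta_t under z |-> z^2, whose differential at z is
   v |-> 2 z v *)
Definition vartheta (theta : R -> C -> C) (t : R) (z v : C) : R :=
  dot0 (theta t (csqr z)) (2 *: cmul z v).

Definition u1 (Q : set C) : set (hL2 R) :=
  [set z | [/\ h_ 1 z, z <> 0 &
    {in `[0, 1], forall tau, Q (csqr (hloop z tau))}]].

Definition U1 (Q : set C) : set (HL2 R) :=
  [set u | u1 Q u.1 /\ h_ 1 u.2].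

Definition U2 (Q : set C) : set (HL2 R) := U1 Q `&` (H_ 2 : set _).

Definition time (z : hL2 R) (tau : R) : R :=
  int0 tau (fun s => dot0 (hloop z s) (hloop z s)) / hdot z z.

Definition magnetic (theta : R -> C -> C) (f0 : C -> R) (z : hL2 R) : R :=
  int01 (fun tau =>
    vartheta theta (time z tau) (hloop z tau) (hfun (hdiff z) tau))
  - f0 (csqr (hloop z 0)).

Definition action (theta : R -> C -> C) (f0 : C -> R) (u : HL2 R) : R :=
  let z := u.1 in let eta := u.2 in
  hdot eta (hdiff z) + magnetic theta f0 z
  - hdot eta eta / (8 * hdot z z) + (hdot z z)^-1.

(* S is Frechet differentiable at u on H_1, with derivative x |-> <g, x>_{L^2};
   g is unique since H_1 is dense in L^2. *)
Definition is_L2_gradient (S : HL2 R -> R) (u g : HL2 R) : Prop :=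
  forall e : R, 0 < e -> exists2 d : R, 0 < d &
    forall x, H_ 1 x -> nrm (H_ 1) x < d ->
      `|S (u + x) - S u - Hdot g x| <= e * nrm (H_ 1) x.

(* A^u = d(grad S)|_u as an operator H_1 -> H_0, for u in U_1 *)
Definition hessian_field (Q : set C) (S : HL2 R -> R)
    (A : HL2 R -> HL2 R -> HL2 R) : Prop :=
  exists2 G : HL2 R -> HL2 R,
    (forall u, U1 Q u -> is_L2_gradient S u (G u)) &
    (forall u, U1 Q u -> is_frechet (H_ 1) (H_ 0) G u (A u)).

Definition weak_hessian_field (Q : set C)
    (A : HL2 R -> HL2 R -> HL2 R) : Prop :=
  [/\ C0_op (U1 Q) (H_ 1) (H_ 1) (H_ 0) A,
      C0_op (U2 Q) (H_ 2) (H_ 2) (H_ 1) A,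
      (forall u x y, U1 Q u -> H_ 1 x -> H_ 1 y ->
        Hdot (A u x) y = Hdot x (A u y)),
      (forall u, U1 Q u -> fredholm_of_index (H_ 1) (H_ 0) (A u) 0) &
      (forall u, U2 Q u -> fredholm_of_index (H_ 2) (H_ 1) (A u) 0)].

Definition almost_extendable (Q : set C)
    (A : HL2 R -> HL2 R -> HL2 R) : Prop :=
  exists (F K : HL2 R -> HL2 R -> HL2 R) (r : R),
  [/\ (forall u x, U1 Q u -> H_ 1 x -> A u x = F u x + K u x),
      C0_op (U1 Q) (H_ 1) (H_ 1) (H_ 0) F /\
      C0_op (U1 Q) (H_ 1) (H_ 2) (H_ 1) F,
      0 <= r < 1 /\
      C0_op (U1 Q) (H_ 1) (Hfrac r) (H_ 0) K /\
      C0_op (U2 Q) (H_ 2) (H_ 1) (H_ 1) K,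
      (forall u, U1 Q u -> fredholm_of_index (H_ 2) (H_ 1) (F u) 0) &
      (forall u, U1 Q u -> exists (W : set (HL2 R)) (kappa : R),
        [/\ open_in (H_ 1) W, W u, W `<=` U1 Q &
        forall v w, W v -> H_ 2 v -> W w -> H_ 2 w ->
          op_dist_le (H_ 1) (H_ 1) (K v) (K w)
            (kappa * (nrm (H_ 2) (v - w) +
               Num.min (nrm (H_ 2) v) (nrm (H_ 2) w) * nrm (H_ 1) (v - w)))])].

End zeeman.

(* Main.v *)
From HB Require Import structures.
Require Import Defs.
From mathcomp Require Import all_boot all_order all_algebra.
From mathcomp Require Import all_classical all_reals all_analysis.
From mathcomp Require Import measurable_realfun.
From mathcomp Require Import ring lra.

(** The proof rests on a rigidity phenomenon.  At a constant loop [(p, 0)] the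
    Hessian sends a loop [v z] with real-valued [z], [z 0 = 0], to a function
    on [0, 1] whose values at the two ends differ by a multiple of the integral
    of [k z'], where [k t] is the time derivative of [vartheta_t] at [p] applied
    to [v].  Since the Hessian maps [H_2] to [H_1], this function is a periodic
    loop, so the integral vanishes; [z' = k - mean k] gives that [k] is
    constant.  Hence [vartheta_t = vartheta_0 + t d(f_0 o csqr)] for [t] in
    [0, 1], and an integration by parts makes the action
    [<eta, z'> + int a(z) z' - W / |z|^2] with [a = vartheta_0] and
    [W = int psi(z) - 1 + |eta|^2 / 8], [psi(z) = |z|^2 f_0(z^2)].

    Its Hessian is recovered from second order Taylor coefficients along lines
    by polarization, and splits as [F + K].  The operator
    [F (x, y) = (- y' - b j x', x')], [b = rot a], has coefficients that are
    W^{1,2} in the loop, and its kernel and cokernel are explicit and four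
    dimensional.  The operator [K] has multiplication entries, whose worst
    factors are products of [z'] with functions of [z], and entries of rank one.
    Multiplication by an L^2 function is bounded on W^{3/4,2}, which embeds in
    L^infinity, and products [z' g(z)] satisfy the estimate (C). *)

Set Implicit Arguments.
Unset Strict Implicit.
Unset Printing Implicit Defensive.
Import Order.TTheory GRing.Theory Num.Theory.
Import numFieldNormedType.Exports.

Local Open Scope classical_set_scope.
Local Open Scope ring_scope.
Local Open Scope quotient_scope.

(** The obstacle is the nonlocal time change: for a form with general time dependence the Hessian
    contains integrals from [tau] to 1 that need not close up at the ends of [0, 1]. At the constant
    loop [p] and in direction [v] the jump is [2 <p, v> / |p|^2] times the integral of [k z'], so
    [v] must not be orthogonal to [p]. The directions [p] and [p + i p] both qualify and span the
    plane; at [p = 0] the differential of the squaring map vanishes and the pull back with it.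

    Integrating the remaining time dependence by parts yields the boundary term [f_0(z_0^2)], which
    cancels the one in the action.

    The operators are known only as derivatives of some gradient, so their quadratic forms are read
    off from the action along lines. Every term that differentiates the argument goes to [F]: its
    coefficients involve only values of the loop and stay in W^{1,2} on all of U_1. Coefficients
    with [z'] are merely in L^2 there, which forces them into [K].

    Every order between 1/2 and 1 embeds in L^infinity; 3/4 gives the kernel exponent 5/2, which
    makes powers of lengths [q^4] integral. *)

Notation I01 := ([set` `[0%R, 1%R]] : set (measurableTypeR _)).

(** * Square integrable functions and absolutely continuous loops *)

Section integrals.
Context {R : realType}.
Notation mu := (@lebesgue_measure R).
Notation T := (measurableTypeR R).
Implicit Types (f g h : T -> R) (D : set T) (z w v : L2 R).

Definition ig D f := mu.-integrable D (EFin \o f).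

Lemma ig_meas D f : ig D f -> measurable_fun D f.
Proof. by move=> /(measurable_int mu) /measurable_EFinP. Qed.

Lemma igD D f g : measurable D -> ig D f -> ig D g -> ig D (fun t => f t + g t).
Proof.
move=> mD If Ig; exact: (integrableD mD If Ig).
Qed.

Lemma igZ D f c : measurable D -> ig D f -> ig D (fun t => c * f t).
Proof.
move=> mD If; exact: (integrableZl mD c If).
Qed.

Lemma igB D f g : measurable D -> ig D f -> ig D g -> ig D (fun t => f t - g t).
Proof.
move=> mD If Ig; exact: (integrableB mD If Ig).
Qed.

Lemma ig_le D f g : measurable D -> measurable_fun D f ->
  (forall t, D t -> `|f t| <= g t) -> ig D g -> ig D f.
Proof.
move=> mD mf fg Ig; apply: (le_integrable mD _ _ Ig); first exact/measurable_EFinP.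
by move=> t Dt /=; rewrite lee_fin (le_trans (fg _ Dt))// ler_norm.
Qed.

Lemma igS D E f : measurable D -> measurable E -> E `<=` D -> ig D f -> ig E f.
Proof. move=> mD mE ED; exact: integrableS. Qed.

Lemma Rint_ae D f g : measurable D -> measurable_fun D f -> measurable_fun D g ->
  {ae mu, forall t, D t -> f t = g t} ->
  \int[mu]_(t in D) f t = \int[mu]_(t in D) g t.
Proof.
move=> mD mf mg fg; congr fine; apply: ae_eq_integral => //; try exact/measurable_EFinP.
have F := ae_filter_ringOfSetsType mu.
by apply: filterS fg => t /= fg Dt; rewrite fg.
Qed.

Lemma Rint_sqr_eq0 D f : measurable D -> measurable_fun D f ->
  ig D (fun t => f t ^+ 2) ->
  \int[mu]_(t in D) (f t ^+ 2) = 0 -> {ae mu, forall t, D t -> f t = 0}.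
Proof.
move=> mD mf If f0.
have E : (\int[mu]_(t in D) `|(f t ^+ 2)%:E| = 0)%E.
  under eq_integral do rewrite gee0_abs ?lee_fin ?sqr_ge0//.
  rewrite -[LHS]fineK; last exact: (integrable_fin_num mD If).
  by congr (_%:E); exact: f0.
have mf2 : measurable_fun D (fun t => (f t ^+ 2)%:E).
  by apply/measurable_EFinP; exact: measurable_funX.
move/(ae_eq_integral_abs mu mD mf2) : E.
have F := ae_filter_ringOfSetsType mu.
apply: filterS => t /= H Dt.
by move: (H Dt) => -[]/eqP; rewrite sqrf_eq0 => /eqP.
Qed.

Lemma mI01 : measurable (I01 : set T). Proof. exact: measurable_itv. Qed.
Hint Resolve mI01 : core.

(** Almost everywhere on [0, 1] for Lebesgue measure, the form used by integrals over sets;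
    [mu01_aeP] translates from the measure that defines [L2]. *)
Definition ae01 (P : T -> Prop) := {ae mu, forall t, I01 t -> P t}.

Lemma ae01S (P P' : T -> Prop) :
  (forall t, I01 t -> P t -> P' t) -> ae01 P -> ae01 P'.
Proof.
have F := ae_filter_ringOfSetsType mu.
by move=> h; rewrite /ae01; apply: filterS => t Pt It; exact/h/Pt.
Qed.

Lemma ae01I (P P' : T -> Prop) : ae01 P -> ae01 P' -> ae01 (fun t => P t /\ P' t).
Proof.
have F := ae_filter_ringOfSetsType mu.
by rewrite /ae01; apply: filterS2 => t Pt Pt' It; split; [exact: Pt|exact: Pt'].
Qed.

Lemma ae01W (P : T -> Prop) : (forall t, I01 t -> P t) -> ae01 P.
Proof. by move=> h; rewrite /ae01; apply: aeW => t; exact: h. Qed.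

Lemma mu01_aeP f g : (f = g %[ae @mu01 R]) <-> ae01 (fun t => f t = g t).
Proof.
split=> -[N [mN N0 fN]].
- exists (N `&` I01); split => //; first exact: measurableI.
  move=> t /= /not_implyP[It fg]; split=> //.
  by apply: fN => /= /(_ Logic.I).
(* [mu01] does not charge the complement of [0, 1], so all of it may join the exceptional set. *)
- exists (N `|` ~` I01); split.
  + by apply: measurableU => //; exact: measurableC.
  + rewrite /mu01/= /mrestr setIUl setICl setU0.
    by apply: (@subset_measure0 _ _ _ mu _ N) => //; exact: measurableI.
  + move=> t /= fg; case: (pselect (I01 t)) => It; [left|by right].
    by apply: fN => /= H; apply: fg => _; exact: H.
Qed.

Lemma mu01_integral (f : T -> \bar R) : measurable_fun setT f ->
  (forall t, 0 <= f t)%E ->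
  (\int[@mu01 R]_t f t = \int[mu]_(t in I01) f t)%E.
Proof.
move=> mf f0.
rewrite -(setUv I01) ge0_integral_setU//; last 3 first.
- exact: measurableC.
- by rewrite setUv.
- exact/disj_setPCl.
rewrite [X in (_ + X)%E](_ : _ = 0%E) ?adde0; last first.
  rewrite (eq_measure_integral mzero); first by rewrite integral_measure_zero.
  move=> A mA AI; rewrite /mu01/= /mrestr; apply/eqP.
  rewrite (_ : A `&` I01 = set0) ?measure0//.
  by apply/seteqP; split => // x [/AI].
apply: eq_measure_integral => A mA AI; rewrite /mu01/= /mrestr.
by rewrite setIidl.
Qed.

(** Square integrability of an actual function, of which only the values on [0, 1] count: the
    counterpart of membership in [L2] before passing to classes. *)
Definition sqi f := measurable_fun I01 f /\ ig I01 (fun t => f t ^+ 2).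

Lemma L2fun_sqi z : sqi (L2fun z).
Proof.
rewrite /L2fun; case: (repr z) => f [[mf] [lf]]; split => /=.
  exact: measurable_funTS.
apply/integrableP; split.
  by apply/measurable_EFinP; apply: measurable_funX; exact: measurable_funTS.
move: lf; rewrite /finite_norm unlock => /lty_poweRy => /(_ _)/=.
rewrite invr_neq0// => /(_ isT); rewrite mu01_integral//; last first.
  rewrite (_ : (fun _ => _) = EFin \o (fun t => f t ^+ 2)); last first.
    by apply/funext => t /=; rewrite powR_mulrn// real_normK ?num_real.
  by apply/measurable_EFinP; exact: measurable_funX.
congr (_ < _)%E; apply: eq_integral => t _.
by rewrite /= powR_mulrn// real_normK ?num_real// ger0_norm ?sqr_ge0.
Qed.

Lemma L2_ext z w : ae01 (fun t => L2fun z t = L2fun w t) -> z = w.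
Proof.
move/mu01_aeP => zw; rewrite -[z]reprK -[w]reprK.
apply/eqP; rewrite -Quotient.idealrBE; apply/asboolP.
have F := ae_filter_ringOfSetsType (@mu01 R).
by apply: filterS zw => t /= zw _; rewrite [LHS]/=; move: (zw Logic.I);
  rewrite /L2fun => H; apply/eqP; rewrite subr_eq0; apply/eqP.
Qed.

Lemma L2_ex f : sqi f -> exists z, ae01 (fun t => L2fun z t = f t).
Proof.
move=> [mf if2].
(* Representatives in [L2] are measurable on the whole line, so [f] is extended by 0. *)
have fL : (f \_ I01) \in Lfun (@mu01 R) 2%:E.
  have mp : measurable_fun setT (f \_ I01) by apply/(measurable_restrictT _ _).1.
  rewrite inE; apply/andP; rewrite !inE/=; split => //.
  rewrite /finite_norm unlock; apply: poweR_lty.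
  rewrite mu01_integral//=; last first.
    rewrite (_ : (fun _ => _) = EFin \o (fun t => (f \_ I01) t ^+ 2)); last first.
      by apply/funext => t /=; rewrite powR_mulrn// real_normK ?num_real.
    by apply/measurable_EFinP; exact: measurable_funX.
  case/integrableP: if2 => _; congr (_ < _)%E; apply: eq_integral => t It.
  by rewrite /= powR_mulrn// real_normK ?num_real// patchE It ger0_norm// sqr_ge0.
exists (\pi_(L2 R) (Lfun_Sub (lee1n 2) fL)).
have /mu01_aeP H : L2fun (\pi_(L2 R) (Lfun_Sub (lee1n 2) fL)) = f \_ I01 %[ae @mu01 R].
  have /eqP : \pi_(L2 R) (repr (\pi_(L2 R) (Lfun_Sub (lee1n 2) fL))) = \pi_(L2 R) (Lfun_Sub (lee1n 2) fL).
    by rewrite reprK.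
  rewrite -Quotient.idealrBE => /asboolP.
  have F := ae_filter_ringOfSetsType (@mu01 R).
  apply: filterS => t /= zw _; move: (zw Logic.I) => /eqP.
  by rewrite [X in X == _]/= subr_eq0 => /eqP.
by apply: ae01S H => t It ->; rewrite patchE mem_set.
Qed.

(** The class of [f], and 0 if no element of [L2] agrees with [f] almost everywhere. *)
Definition toL2 f : L2 R := xget 0 [set z | ae01 (fun t => L2fun z t = f t)].

Lemma toL2E f : sqi f -> ae01 (fun t => L2fun (toL2 f) t = f t).
Proof. by move=> /L2_ex[z zf]; rewrite /toL2; case: xgetP => [y _//|/(_ z)]. Qed.

Lemma L2fun_pi (f : @Lfun01 R) : ae01 (fun t => L2fun (\pi_(L2 R) f) t = f t).
Proof.
apply/mu01_aeP.
have /eqP : \pi_(L2 R) (repr (\pi_(L2 R) f)) = \pi_(L2 R) f by rewrite reprK.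
rewrite -Quotient.idealrBE => /asboolP.
have F := ae_filter_ringOfSetsType (@mu01 R).
apply: filterS => t /= zw _; move: (zw Logic.I) => /eqP.
by rewrite [X in X == _]/= subr_eq0 => /eqP.
Qed.

Lemma L2funD z w : ae01 (fun t => L2fun (z + w) t = L2fun z t + L2fun w t).
Proof.
by have := L2fun_pi (repr z + repr w : @Lfun01 R); rewrite raddfD/= !reprK.
Qed.

Lemma L2funZ a z : ae01 (fun t => L2fun (a *: z) t = a * L2fun z t).
Proof. exact: L2fun_pi (a *: repr z : @Lfun01 R). Qed.

Lemma L2fun0 : ae01 (fun t => L2fun (0 : L2 R) t = 0).
Proof.
by have := L2funZ 0 0; rewrite scaler0; apply: ae01S => t _ ->; rewrite mul0r.
Qed.

Lemma toL2_uniq f z : ae01 (fun t => L2fun z t = f t) -> toL2 f = z.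
Proof.
move=> zf; have H : ae01 (fun t => L2fun (toL2 f) t = f t).
  by rewrite /toL2; case: xgetP => [y _//|/(_ z)].
by apply: L2_ext; apply: ae01S (ae01I H zf) => t _ [-> ->].
Qed.

Lemma toL2K z : toL2 (L2fun z) = z.
Proof. by apply: toL2_uniq; exact: ae01W. Qed.

Lemma muI01 : mu I01 = 1%E.
Proof. by rewrite lebesgue_measure_itv/= lte_fin ltr01 oppr0 adde0. Qed.

Lemma ig_cst (c : R) : ig I01 (cst c).
Proof.
have lt : (mu I01 < +oo)%E by rewrite muI01 ltry.
apply: measurable_bounded_integrable => //.
by exists `|c|; split => // x cx t _; rewrite /= ltW.
Qed.

Lemma sqi_meas f : sqi f -> measurable_fun I01 f. Proof. by case. Qed.

Lemma sqiM_ig f g : sqi f -> sqi g -> ig I01 (fun t => f t * g t).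
Proof.
move=> [mf If] [mg Ig].
apply: (ig_le _ _ _ (igD _ If Ig)) => //; first exact: measurable_funM.
by move=> t _; rewrite ler_norml; apply/andP; split; nra.
Qed.

Lemma sqi_cst c : sqi (cst c).
Proof. by split => //; exact: (ig_cst (c ^+ 2)). Qed.

Lemma sqi_ig f : sqi f -> ig I01 f.
Proof.
move=> sf; have := sqiM_ig (sqi_cst 1) sf.
by congr (ig _ _); apply/funext => t; rewrite mul1r.
Qed.

Lemma sqiZ c f : sqi f -> sqi (fun t => c * f t).
Proof.
move=> [mf If]; split; first exact: measurable_funM.
rewrite (_ : (fun _ => _) = fun t => c ^+ 2 * (f t ^+ 2)); first exact: igZ.
by apply/funext => t; rewrite exprMn.
Qed.

Lemma sqiD f g : sqi f -> sqi g -> sqi (fun t => f t + g t).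
Proof.
move=> [mf If] [mg Ig]; split; first exact: measurable_funD.
apply: (ig_le _ _ _ (igZ 2 _ (igD _ If Ig))) => //.
  by apply: measurable_funX; exact: measurable_funD.
by move=> t _; rewrite ger0_norm ?sqr_ge0//; have := sqr_ge0 (f t - g t); nra.
Qed.

Lemma sqiB f g : sqi f -> sqi g -> sqi (fun t => f t - g t).
Proof.
move=> sf sg; have := sqiD sf (sqiZ (-1) sg).
by congr sqi; apply/funext => t; rewrite mulN1r.
Qed.

Lemma sqiM_bd f g c : measurable_fun I01 g -> (forall t, I01 t -> `|g t| <= c) ->
  sqi f -> sqi (fun t => g t * f t).
Proof.
move=> mg gc [mf If]; split; first exact: measurable_funM.
apply: (ig_le _ _ _ (igZ (c ^+ 2) _ If)) => //.
  by apply: measurable_funX; exact: measurable_funM.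
move=> t It; rewrite ger0_norm ?sqr_ge0// exprMn ler_wpM2r ?sqr_ge0//.
by rewrite -real_normK ?num_real// ler_sqr ?nnegrE ?gc// (le_trans _ (gc _ It)).
Qed.

Lemma sqi_bd g c : measurable_fun I01 g -> (forall t, I01 t -> `|g t| <= c) -> sqi g.
Proof.
move=> mg gc; have := sqiM_bd mg gc (sqi_cst 1).
by congr sqi; apply/funext => t; rewrite mulr1.
Qed.

Lemma eq_sqi f g : (forall t, I01 t -> f t = g t) -> sqi f -> sqi g.
Proof.
move=> fg [mf If]; split.
  by apply: eq_measurable_fun mf => t /set_mem/fg.
by apply: eq_integrable If => // t /set_mem/fg /= ->.
Qed.

Lemma cont_meas f : {within I01, continuous f} -> measurable_fun I01 f.
Proof. exact: subspace_continuous_measurable_fun. Qed.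

Lemma cont_bd f : {within I01, continuous f} ->
  exists c, forall t, I01 t -> `|f t| <= c.
Proof.
move=> cf; have := @EVT_max R (fun t => `|f t|) 0 1 ler01.
case=> [|c cI fc]; last by exists `|f c| => t /fc.
by move=> t; apply: continuous_comp (cf t) _; exact: norm_continuous.
Qed.

Lemma sqi_cont f : {within I01, continuous f} -> sqi f.
Proof. by move=> cf; have [c fc] := cont_bd cf; exact: sqi_bd (cont_meas cf) fc. Qed.

Lemma CS_Rint D f g : measurable D -> ig D (fun t => f t * g t) ->
  ig D (fun t => f t ^+ 2) -> ig D (fun t => g t ^+ 2) ->
  (\int[mu]_(t in D) (f t * g t)) ^+ 2 <=
  \int[mu]_(t in D) (f t ^+ 2) * \int[mu]_(t in D) (g t ^+ 2).
Proof.
move=> mD Ifg If Ig.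
set A := \int[mu]_(t in D) (f t ^+ 2); set B := \int[mu]_(t in D) (f t * g t).
set C := \int[mu]_(t in D) (g t ^+ 2).
have P a b : 0 <= a ^+ 2 * A + 2 * a * b * B + b ^+ 2 * C.
  have : 0 <= \int[mu]_(t in D) ((a * f t + b * g t) ^+ 2).
    by apply: Rintegral_ge0 => t _; exact: sqr_ge0.
  congr (_ <= _).
  rewrite (_ : (fun t => _) = fun t => (a ^+ 2 * (f t ^+ 2) + 2 * a * b * (f t * g t)) + b ^+ 2 * (g t ^+ 2)); last by apply/funext => t; ring.
  by rewrite !RintegralD ?RintegralZl//; [exact: igZ|exact: igZ|apply: igD => //; exact: igZ|exact: igZ].
have A0 : 0 <= A by have := P 1 0; lra.
have C0 : 0 <= C by have := P 0 1; lra.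
have [A1|A1] := eqVneq A 0.
  suff : B = 0 by move=> ->; rewrite expr0n/= mulr_ge0.
  apply: contrapT => /eqP B0.
  (* With [A = 0] the form is affine in its first argument; this argument gives it the value -1. *)
  have := P (- (C + 1) / (2 * B)) 1; rewrite A1.
  have -> : 2 * (- (C + 1) / (2 * B)) * 1 * B = - (C + 1).
    by field.
  by rewrite !expr1n; lra.
have := P (- B) A.
have -> : (- B) ^+ 2 * A + 2 * - B * A * B + A ^+ 2 * C = A * (A * C - B ^+ 2) by ring.
by rewrite pmulr_rge0 ?subr_ge0// lt_neqAle eq_sym A1.
Qed.

End integrals.

(** * Absolutely continuous functions on [0, 1] *)

Section ac.
Context {R : realType}.
Notation mu := (@lebesgue_measure R).
Notation T := (measurableTypeR R).
Implicit Types (f g h v w : T -> R) (D : set T) (z : L2 R).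
Local Hint Resolve mI01 : core.

Lemma I01E (t : R) : (I01 : set T) t <-> 0 <= t <= 1.
Proof. by rewrite /= in_itv. Qed.

Definition it (a b : R) f := \int[mu]_(t in `[a, b]) f t.

Lemma subI (a b : R) : 0 <= a -> b <= 1 -> [set` `[a, b]] `<=` (I01 : set T).
Proof.
by move=> a0 b1 t /=; rewrite !in_itv/= => /andP[at_ tb]; apply/andP; split; lra.
Qed.

Lemma ig_itv f (a b : R) : 0 <= a -> b <= 1 -> ig I01 f -> ig `[a, b] f.
Proof. by move=> a0 b1; apply: igS => //; exact: subI. Qed.

Lemma it_split f (a b : R) : ig I01 f -> 0 <= a -> a <= b -> b <= 1 ->
  int0 b f = int0 a f + it a b f.
Proof.
move=> If a0 ab b1.
have Ib : ig `[0, b] f by exact: ig_itv.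
have := @Rintegral_itvB R f (BLeft 0) (BRight b) a Ib.
rewrite !bnd_simp => /(_ a0 ab) H.
have -> : it a b f = \int[mu]_(t in `]a, b]) f t.
  rewrite /it -Rintegral_itv_obnd_cbnd//; apply: igS Ib => //=.
  by move=> t /=; rewrite !in_itv/= => /andP[? ->]; rewrite andbT; lra.
by rewrite -H addrC subrK.
Qed.

Lemma int00 f : int0 0 f = 0.
Proof. by rewrite /int0 set_itv1 Rintegral_set1. Qed.

Lemma itD a b f g : ig `[a, b] f -> ig `[a, b] g ->
  it a b (fun t => f t + g t) = it a b f + it a b g.
Proof. by move=> *; rewrite /it RintegralD. Qed.

Lemma itB a b f g : ig `[a, b] f -> ig `[a, b] g ->
  it a b (fun t => f t - g t) = it a b f - it a b g.
Proof. by move=> *; rewrite /it RintegralB. Qed.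

Lemma itZ a b c f : ig `[a, b] f -> it a b (fun t => c * f t) = c * it a b f.
Proof. by move=> *; rewrite /it RintegralZl. Qed.

Lemma it_cst a b (c : R) : a <= b -> it a b (cst c) = c * (b - a).
Proof.
move=> ab; transitivity (c * fine (mu `[a, b])).
  by rewrite /it Rintegral_cst.
rewrite lebesgue_measure_itv/= lte_fin.
by move: ab; rewrite le_eqVlt => /predU1P[->|->//]; rewrite ltxx subrr.
Qed.

Lemma it_le a b f g : ig `[a, b] f -> ig `[a, b] g ->
  (forall t, a <= t <= b -> f t <= g t) -> it a b f <= it a b g.
Proof. by move=> If Ig fg; apply: le_Rintegral => // t /=; rewrite in_itv; exact: fg. Qed.

Lemma it_norm a b f : ig `[a, b] f -> `|it a b f| <= it a b (fun t => `|f t|).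
Proof. by move=> If; exact: le_normr_Rintegral. Qed.

Lemma it_ge0 a b f : (forall t, a <= t <= b -> 0 <= f t) -> 0 <= it a b f.
Proof. by move=> f0; apply: Rintegral_ge0 => t /=; rewrite in_itv; exact: f0. Qed.

Lemma ae01_it a b f g : 0 <= a -> b <= 1 -> ig I01 f -> ig I01 g ->
  ae01 (fun t => f t = g t) -> it a b f = it a b g.
Proof.
move=> a0 b1 If Ig fg; apply: Rint_ae => //.
- exact: ig_meas (ig_itv a0 b1 If).
- exact: ig_meas (ig_itv a0 b1 Ig).
have F := ae_filter_ringOfSetsType mu.
move: fg; rewrite /ae01; apply: filterS => t fg tab.
by apply: fg; exact: (subI a0 b1) tab.
Qed.

Lemma ig_norm D f : ig D f -> ig D (fun t => `|f t|).
Proof. exact: integrable_norm. Qed.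

Lemma CS_it a b f g : 0 <= a -> b <= 1 -> sqi f -> sqi g ->
  (it a b (fun t => f t * g t)) ^+ 2 <=
  it a b (fun t => f t ^+ 2) * it a b (fun t => g t ^+ 2).
Proof.
move=> a0 b1 sf sg; apply: CS_Rint => //; apply: ig_itv => //.
- exact: sqiM_ig.
- by case: sf.
- by case: sg.
Qed.

Lemma sqi_norm f : sqi f -> sqi (fun t => `|f t|).
Proof.
case=> mf If; split; first exact: measurableT_comp.
rewrite (_ : (fun _ => _) = fun t => f t ^+ 2)//.
by apply/funext => t; rewrite real_normK ?num_real.
Qed.

Lemma CS1_it a b f : 0 <= a -> a <= b -> b <= 1 -> sqi f ->
  (it a b f) ^+ 2 <= (b - a) * it a b (fun t => f t ^+ 2).
Proof.
move=> a0 ab b1 sf; have := CS_it a0 b1 (sqi_cst 1) sf.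
rewrite (_ : (fun t => cst 1 t * f t) = f); last by apply/funext => t /=; rewrite mul1r.
rewrite (_ : (fun t => cst 1 t ^+ 2) = cst 1); last by apply/funext => t /=; rewrite expr1n.
by rewrite it_cst// mul1r.
Qed.

Lemma it_mono a b c d f : c <= a -> b <= d -> ig `[c, d] f -> (forall t, 0 <= f t) ->
  it a b f <= it c d f.
Proof.
move=> ca bd If f0.
have sb : [set` `[a, b]] `<=` ([set` `[c, d]] : set T).
  by move=> t /=; rewrite !in_itv/= => /andP[? ?]; apply/andP; split; lra.
have Iab : ig `[a, b] f by apply: igS If.
rewrite /it /Rintegral fine_le//; try exact: integrable_fin_num.
apply: ge0_subset_integral => //.
- by apply/measurable_EFinP; exact: ig_meas If.
- by move=> t _; rewrite lee_fin.
Qed.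

(** Absolute continuity with square integrable derivative, stated as the fundamental theorem of
    calculus. Periodicity is kept apart, in [acl], since primitives and the time change are not
    loops. *)
Definition ac g v := sqi v /\ forall t : R, 0 <= t <= 1 -> g t = g 0 + int0 t v.

Lemma ac_sub g v a b : ac g v -> 0 <= a -> a <= b -> b <= 1 -> g b - g a = it a b v.
Proof.
move=> [sv gE] a0 ab b1; rewrite (gE b) ?(gE a) ?(@it_split v a b)//; try lra.
exact: sqi_ig.
Qed.

Lemma ac_cont g v : ac g v -> {within I01, continuous g}.
Proof.
move=> [sv gE].
have := @parameterized_integral_continuous R 0 1 v ler01 (sqi_ig sv).
move=> H; apply: (@subspace_eq_continuous _ _ _ (fun t => g 0 + int0 t v)).
  by move=> t /set_mem; rewrite I01E => /gE.
by move=> t; apply: cvgD; [exact: cvg_cst|exact: H].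
Qed.

Lemma within_contP (f : R -> R) :
  {within I01, continuous f} <->
  forall t : R, 0 <= t <= 1 -> forall e : R, 0 < e -> exists2 d : R, 0 < d &
    forall s : R, 0 <= s <= 1 -> `|s - t| < d -> `|f s - f t| < e.
Proof.
split.
  move=> /subspace_continuousP cf t t01 e e0; have := cf t.
  rewrite /= in_itv => /(_ t01) /cvgrPdist_lt /(_ e e0)[d /= d0 H].
  exists d => // s s01 st; rewrite distrC; apply: H; last by rewrite /= in_itv.
  by rewrite /= distrC.
move=> H; apply/subspace_continuousP => t; rewrite /= in_itv => /H{}H.
apply/cvgrPdist_lt => e /H[d d0 {}H].
exists d => //= s sd; rewrite in_itv => s01; rewrite distrC; apply: H => //.
by rewrite distrC.
Qed.

(** A nonzero value would persist on an interval, which has positive length and yet would lie in the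
    exceptional null set. *)
Lemma ae0_cont f : {within I01, continuous f} -> ae01 (fun t => f t = 0) ->
  forall t : R, 0 <= t <= 1 -> f t = 0.
Proof.
move=> /within_contP cf f0 t t01; apply: contrapT => /eqP ft0.
have [|d d0 fd] := cf t t01 `|f t|; first by rewrite normr_gt0.
(* Cut off at 0 and 1, the interval remains nondegenerate even when [t] is an end point. *)
pose a := Num.max 0 (t - d / 2); pose b := Num.min 1 (t + d / 2).
have ab : a < b.
  by rewrite /a /b lt_min !gt_max; apply/andP; split; apply/andP; split; lra.
have [N [mN N0 fN]] := f0.
have sN : [set` `]a, b[] `<=` N.
  move=> s; rewrite /= in_itv/= /a /b !lt_min !gt_max.
  move=> /andP[/andP[s0 st1] /andP[s1 st2]].
  apply: fN => /=; apply/not_implyP; split; first by rewrite in_itv/=; apply/andP; split; lra.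
  move=> fs0; have := fd s.
  have -> : (0 <= s <= 1) by apply/andP; split; lra.
  have -> : `|s - t| < d by rewrite ltr_norml; apply/andP; split; lra.
  by move=> /(_ isT isT); rewrite fs0 sub0r normrN ltxx.
have H : mu `]a, b[ = 0%E.
  exact: (@subset_measure0 _ _ _ mu _ _ (measurable_itv _) mN sN N0).
by move: H; rewrite lebesgue_measure_itv/= lte_fin ab => -[] /eqP; rewrite subr_eq0 gt_eqF.
Qed.

(** Lebesgue's differentiation theorem recovers the integrand almost everywhere as the derivative of
    its primitive, here the zero function. *)
Lemma int0_eq0 v : ig I01 v -> (forall t : R, 0 <= t <= 1 -> int0 t v = 0) ->
  ae01 (fun t => v t = 0).
Proof.
move=> Iv v0.
have IS : ig setT (v \_ I01).
  by rewrite /ig -restrict_EFin; apply/integrable_restrict => //=; rewrite setTI.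
have := @FTC1 R (v \_ I01) (BLeft 0) _ (integrable_locally mI01 Iv).
move=> /(_ _)[].
  by move=> y; apply: igS IS.
move=> N [mN N0 fN].
have m1 (x : R) : measurable ([set x] : set T) by exact: measurable_set1.
(* At 0 and 1 the primitive is known on one side only, so both points join the exceptional set. *)
exists (N `|` [set 0] `|` [set 1]); split.
- by apply: measurableU; [apply: measurableU; [exact: mN|exact: m1]|exact: m1].
- have mx0 (x : R) : mu [set x] = 0%E by exact: lebesgue_measure_set1.
  have mN1 : measurable (N `|` [set 0]) by apply: measurableU; [exact: mN|exact: m1].
  by rewrite (measureU0 mN1 (m1 1) (mx0 1)) (measureU0 mN (m1 0) (mx0 0)).
move=> t /= /not_implyP[]; rewrite in_itv/= => /andP[t0 t1] vt.
have [->|tn0] := eqVneq t 0; first by left; right.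
have [->|tn1] := eqVneq t 1; first by right.
left; left; apply: fN => /= H; apply: vt.
have tp : 0 < t by rewrite lt_neqAle eq_sym tn0.
have tl : t < 1 by rewrite lt_neqAle tn1.
have [|_ ] := H; first by rewrite lte_fin.
have It : t \in (I01 : set T) by rewrite inE/= in_itv/= t0.
rewrite patchE It => <-.
have D0 : 'D_1 (cst 0 : R^o -> R^o) (t : R^o) = 0 by rewrite derive_cst.
rewrite derive1E -[RHS]D0; apply: near_eq_derive.
near=> s; have : (s : R) \in (`]0, 1[ : interval R).
  by near: s; apply: near_in_itvoo; rewrite in_itv/=; apply/andP.
rewrite in_itv/= => /andP[s0 s1].
rewrite -[RHS](v0 s); last by rewrite !ltW.
rewrite /int0; apply: eq_Rintegral => r; rewrite inE/= in_itv/= => /andP[r0 rs].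
have Ir : r \in (I01 : set T) by rewrite inE/= in_itv/= r0 (le_trans rs)// ltW.
by rewrite patchE Ir.
Unshelve. all: by end_near. Qed.

End ac.

(** * Uniqueness of continuous representatives and weak derivatives *)

Section loops.
Context {R : realType}.
Notation T := (measurableTypeR R).
Implicit Types (f g h v w : T -> R) (z y : L2 R).
Local Hint Resolve mI01 : core.

(* The increments over [n] equal subintervals sum up to [O(1/n)]. *)
Lemma small_increments_cst (D w : R -> R) (C d : R) : 0 <= C -> 0 < d ->
  ig I01 w -> (forall t, 0 <= w t) ->
  (forall a b, 0 <= a -> a <= b -> b <= 1 -> b - a <= d ->
     `|D b - D a| <= C * (b - a) * it a b w) ->
  forall t, 0 <= t <= 1 -> D t = D 0.
Proof.
move=> C0 d0 Iw w0 DD t /andP[t0 t1]; apply: contrapT => /eqP Dt0.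
pose x := `|D t - D 0|.
have x0 : 0 < x by rewrite normr_gt0 subr_eq0.
pose W := it 0 1 w.
have W0 : 0 <= W by apply: it_ge0.
(* [n > 1 / d] makes the subintervals short enough for the hypothesis, and [n > C W / x] will
   contradict [x <= C W / n], the sum of the bounds. *)
pose n := (Num.truncn (d^-1 + C * W / x)).+1.
have nd : d^-1 + C * W / x < n%:R by apply: truncnS_gt.
have n0 : (0 : R) < n%:R by rewrite ltr0n.
have CW0 : 0 <= C * W / x by rewrite divr_ge0 ?mulr_ge0// ltW.
have di0 : 0 < d^-1 by rewrite invr_gt0.
have nd1 : n%:R^-1 <= d.
  by rewrite -[d]invrK lef_pV2 ?posrE//; lra.
have H k : (k <= n)%N -> `|D (k%:R / n%:R * t) - D 0| <= C / n%:R * it 0 (k%:R / n%:R * t) w.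
  elim: k => [_|k IH kn].
    by rewrite !mul0r subrr normr0 mulr_ge0// ?divr_ge0// ?it_ge0// ltW.
  have {}IH := IH (ltnW kn).
  set a := k%:R / n%:R * t in IH *; set b := k.+1%:R / n%:R * t.
  have ba : b - a = t / n%:R by rewrite /a /b -natr1; field; rewrite gt_eqF.
  have a0 : 0 <= a by rewrite mulr_ge0// divr_ge0.
  have ab : a <= b by rewrite -subr_ge0 ba divr_ge0// ltW.
  have b1 : b <= 1.
    rewrite /b (le_trans _ t1)// ler_piMl// ler_pdivrMr// mul1r ler_nat//.
  have tn : t / n%:R <= n%:R^-1 by rewrite ler_piMl// invr_ge0 ltW.
  have bd : b - a <= d by rewrite ba (le_trans tn).
  have := DD a b a0 ab b1 bd.
  have -> : it 0 b w = it 0 a w + it a b w by exact: it_split.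
  have iw0 : 0 <= it a b w by apply: it_ge0.
  have : C * (b - a) * it a b w <= C / n%:R * it a b w.
    by apply: ler_wpM2r => //; apply: ler_wpM2l => //; rewrite ba.
  have := ler_normD (D b - D a) (D a - D 0).
  by rewrite addrA subrK mulrDr; lra.
have := H n (leqnn n); rewrite divff ?gt_eqF// mul1r -/x.
have : it 0 t w <= W by apply: it_mono.
move=> tW xn.
have : x * n%:R <= C * W.
  rewrite -ler_pdivlMr// (le_trans xn)// mulrAC; apply: ler_wpM2r; first by rewrite invr_ge0 ltW.
  exact: ler_wpM2l.
have : C * W / x < n%:R by lra.
by rewrite ltr_pdivrMr// mulrC; lra.
Qed.

Definition acl g v := ac g v /\ g 1 = g 0.

Lemma acD f g v w : ac f v -> ac g w -> ac (fun t => f t + g t) (fun t => v t + w t).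
Proof.
move=> [sv fE] [sw gE]; split; first exact: sqiD.
move=> t /andP[t0 t1]; rewrite fE ?t0// gE ?t0//.
have -> : int0 t (fun t => v t + w t) = int0 t v + int0 t w.
  by rewrite /int0; apply: itD; apply: ig_itv => //; exact: sqi_ig.
ring.
Qed.

Lemma acZ f v c : ac f v -> ac (fun t => c * f t) (fun t => c * v t).
Proof.
move=> [sv fE]; split; first exact: sqiZ.
move=> t /andP[t0 t1]; rewrite fE ?t0//.
have -> : int0 t (fun t => c * v t) = c * int0 t v.
  by rewrite /int0; apply: itZ; apply: ig_itv => //; exact: sqi_ig.
ring.
Qed.

Lemma ac_cst (c : R) : ac (cst c : T -> R) (cst 0).
Proof.
split=> [|t /andP[t0 t1]]; first exact: sqi_cst.
by have := it_cst 0 t0; rewrite /int0 /it => ->; rewrite mul0r addr0.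
Qed.

Lemma aclD f g v w : acl f v -> acl g w -> acl (fun t => f t + g t) (fun t => v t + w t).
Proof. by move=> [af f1] [ag g1]; split; [exact: acD|rewrite f1 g1]. Qed.

Lemma aclZ f v c : acl f v -> acl (fun t => c * f t) (fun t => c * v t).
Proof. by move=> [af f1]; split; [exact: acZ|rewrite f1]. Qed.

Lemma acl_cst (c : R) : acl (cst c : T -> R) (cst 0).
Proof. by split; first exact: ac_cst. Qed.

Lemma ac_int v : sqi v -> ac (fun t => int0 t v) v.
Proof. by move=> sv; split=> // t _; rewrite int00 add0r. Qed.

Lemma ac_eq f g v : (forall t : R, 0 <= t <= 1 -> f t = g t) -> ac f v -> ac g v.
Proof.
move=> fg [sv fE]; split=> // t t01; rewrite -fg// -fg ?lexx ?ler01//; exact: fE.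
Qed.

Lemma acl_eq f g v : (forall t : R, 0 <= t <= 1 -> f t = g t) -> acl f v -> acl g v.
Proof.
move=> fg [af f1]; split; first exact: ac_eq af.
by rewrite -!fg ?lexx ?ler01.
Qed.

Lemma ac_eqd f v w : sqi w -> ae01 (fun t => v t = w t) -> ac f v -> ac f w.
Proof.
move=> sw vw [sv fE]; split=> // t /andP[t0 t1]; rewrite fE ?t0//; congr (_ + _).
by rewrite /int0; apply: ae01_it => //; exact: sqi_ig.
Qed.

Lemma acl_sqi f v : ac f v -> sqi f.
Proof. by move=> /ac_cont; exact: sqi_cont. Qed.

(** The difference is continuous and vanishes almost everywhere, hence everywhere; then the
    primitive of the difference of the derivatives vanishes too, and [int0_eq0] applies. *)
Lemma ac_uniq f g v w : ac f v -> ac g w -> ae01 (fun t => f t = g t) ->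
  (forall t : R, 0 <= t <= 1 -> f t = g t) /\ ae01 (fun t => v t = w t).
Proof.
move=> af ag fg.
have ad : ac (fun t => f t + -1 * g t) (fun t => v t + -1 * w t).
  by apply: acD => //; exact: acZ.
have d0 (t : R) : 0 <= t <= 1 -> f t + -1 * g t = 0.
  apply: (ae0_cont (ac_cont ad)); apply: ae01S fg => s _ ->; ring.
split=> [t /d0|]; first by lra.
have := int0_eq0 (sqi_ig ad.1).
move=> H.
have : ae01 (fun t => v t + -1 * w t = 0).
  apply: H => t t01; have := ad.2 _ t01.
  by rewrite !d0 ?lexx ?ler01//; lra.
by apply: ae01S => t _; lra.
Qed.

Lemma ac_loopP z y g :
  ac_loop z y g <-> acl g (L2fun y) /\ ae01 (fun t => L2fun z t = g t).
Proof.
split.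
  move=> [gE g1 /mu01_aeP zg]; split=> //; split=> //; split; first exact: L2fun_sqi.
  by move=> t t01; apply: gE; rewrite in_itv.
move=> [[[sv gE] g1] zg]; by split=> //; exact/mu01_aeP.
Qed.

(** [L2diff] and [loop] pick arbitrary witnesses; uniqueness identifies them with whatever
    representative and derivative are at hand. All later computations with them go through this. *)
Lemma sob1_char z g v : ae01 (fun t => L2fun z t = g t) -> acl g v ->
  [/\ sobolev 1 z, L2diff z = toL2 v &
      forall t : R, 0 <= t <= 1 -> loop z t = g t].
Proof.
move=> zg [ag g1].
have agL : ac g (L2fun (toL2 v)).
  apply: (ac_eqd _ _ ag); first exact: L2fun_sqi.
  by apply: ae01S (toL2E ag.1) => t _ ->.
have H : ac_loop z (toL2 v) g by apply/ac_loopP.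
split.
- by split=> //; exists (toL2 v), g.
- rewrite /L2diff; case: xgetP => [y _ /= [g' /ac_loopP[[ag' _] zg']]|/(_ (toL2 v))[]]; last by exists g.
  apply: L2_ext; apply: (proj2 (ac_uniq ag' agL _)).
  by apply: ae01S (ae01I zg zg') => t _ [<- <-].
- rewrite /loop; case: xgetP => [g' _ /= [y /ac_loopP[[ag' _] zg']]|/(_ g)[]]; last by exists (toL2 v).
  apply: (proj1 (ac_uniq ag' agL _)).
  by apply: ae01S (ae01I zg zg') => t _ [<- <-].
Qed.

Lemma sob1P z : sobolev 1 z ->
  acl (loop z) (L2fun (L2diff z)) /\ ae01 (fun t => L2fun z t = loop z t).
Proof.
move=> [[y [g]] /ac_loopP[ag zg] _]; have [_ dE lE] := sob1_char zg ag.
rewrite dE toL2K; split.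
  by apply: acl_eq ag => t /lE.
by apply: ae01S zg => t; rewrite I01E => t01 ->; rewrite lE.
Qed.

Lemma sob1_toL2 g v : acl g v ->
  [/\ sobolev 1 (toL2 g), L2diff (toL2 g) = toL2 v &
      forall t : R, 0 <= t <= 1 -> loop (toL2 g) t = g t].
Proof.
by move=> ag; apply: sob1_char => //; apply: toL2E; exact: acl_sqi ag.1.
Qed.

Lemma toL2_lin a f g : sqi f -> sqi g ->
  toL2 (fun t => a * f t + g t) = a *: toL2 f + toL2 g.
Proof.
move=> sf sg; apply: toL2_uniq.
have := ae01I (ae01I (L2funD (a *: toL2 f) (toL2 g)) (L2funZ a (toL2 f))) (ae01I (toL2E sf) (toL2E sg)).
by apply: ae01S => t _ [[-> ->] [-> ->]].
Qed.

Lemma sob1_lin a z y : sobolev 1 z -> sobolev 1 y ->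
  [/\ sobolev 1 (a *: z + y), L2diff (a *: z + y) = a *: L2diff z + L2diff y &
      forall t : R, 0 <= t <= 1 -> loop (a *: z + y) t = a * loop z t + loop y t].
Proof.
move=> /sob1P[az ez] /sob1P[ay ey].
have H : acl (fun t => a * loop z t + loop y t)
    (fun t => a * L2fun (L2diff z) t + L2fun (L2diff y) t).
  by apply: aclD => //; exact: aclZ.
have [|s1 d1 l1] := sob1_char _ H (z := a *: z + y).
  have := ae01I (ae01I (L2funD (a *: z) y) (L2funZ a z)) (ae01I ez ey).
  by apply: ae01S => t _ [[-> ->] [-> ->]].
split=> //; rewrite d1 toL2_lin ?toL2K//; exact: L2fun_sqi.
Qed.

Lemma sob1_0 : sobolev 1 (0 : L2 R).
Proof.
by have [] := @sob1_char 0 (cst 0) (cst 0) (@L2fun0 R) (acl_cst 0).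
Qed.

End loops.

(** * Smooth functions of time and position *)

Definition V3 (R : realType) : normedModType R := (R^o * plane R)%type.

Section smooth.
Context {R : realType}.
Notation V := (V3 R).
Implicit Types (O K : set V) (g : V -> R^o) (G : 'I_3 -> V -> R^o).

Definition co (i : 'I_3) (v : V) : R :=
  match val i with 0%N => v.1 | 1%N => v.2.1 | _ => v.2.2 end.

Lemma co_norm i v : `|co i v| <= `|v|.
Proof.
case: v => [a [b c]]; rewrite /co /=; case: i => [[|[|i]] hi] /=;
  by rewrite !prod_normE/= !le_max lexx ?orbT.
Qed.

Lemma norm_co (v : V) : `|v| <= \sum_i `|co i v|.
Proof.
rewrite !big_ord_recl big_ord0 /co /= addr0; case: v => [a [b c]] /=.
rewrite !prod_normE/= !ge_max; have := normr_ge0 (a : R); have := normr_ge0 (b : R); have := normr_ge0 (c : R) => ? ? ?; apply/and3P; split; lra.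
Qed.

Lemma coD i v w : co i (v + w) = co i v + co i w.
Proof. by rewrite /co; case: (val i) => [|[|?]]. Qed.
Lemma coZ i (a : R) v : co i (a *: v) = a * co i v.
Proof. by rewrite /co; case: (val i) => [|[|?]]. Qed.
Lemma coN i v : co i (- v) = - co i v.
Proof. by rewrite /co; case: (val i) => [|[|?]]. Qed.

Definition grad_on O g G := forall x, O x ->
  differentiable g x /\ forall v, 'D_v g x = \sum_i co i v * G i x.

(* C^k with the partial derivatives as explicit functions, the form in which
   the Taylor estimates use them; coordinate 0 of V3 is time. *)
Fixpoint sm (k : nat) O g : Prop :=
  if k is k'.+1 then exists2 G, grad_on O g G & forall i, sm k' O (G i)
  else forall x, O x -> {for x, continuous g}.

Lemma sm_cont k O g x : sm k O g -> O x -> {for x, continuous g}.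
Proof.
case: k => [|k] /=; first exact.
by move=> [G gG _] /gG[/differentiable_continuous].
Qed.

Lemma smS k O g : sm k.+1 O g -> sm k O g.
Proof.
elim: k g => [|k IH] g.
  by move=> sg x Ox; exact: sm_cont sg Ox.
by move=> /= [G gG sG]; exists G => // i; apply: IH; exact: sG.
Qed.

Lemma sm_le k m O g : (k <= m)%N -> sm m O g -> sm k O g.
Proof.
elim: m => [|m IH]; first by rewrite leqn0 => /eqP ->.
by rewrite leq_eqVlt => /predU1P[->//|]; rewrite ltnS => /IH{}IH /smS.
Qed.

Lemma line_derive g (x h : V) (s : R) : differentiable g (x + s *: h) ->
  is_derive (s : R^o) 1 (fun r : R^o => g (x + r *: h)) ('D_h g (x + s *: h)).
Proof.
move=> dg; have dd : derivable g (x + s *: h) h by exact: diff_derivable.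
have E : (fun k : R^o => k^-1 *: (((fun r : R^o => g (x + r *: h)) \o shift (s : R^o)) (k *: (1 : R^o)) -
     g (x + s *: h))) = (fun k : R^o => k^-1 *: ((g \o shift (x + s *: h)) (k *: h) - g (x + s *: h))).
  apply/funext => k /=; congr (_ *: (g _ - _)).
  by rewrite [k *: 1]mulr1 scalerDl addrCA.
by split; [rewrite /derivable E|rewrite /derive E].
Qed.

Lemma mean_bound (f df : R -> R) (B : R) :
  (forall s : R, 0 <= s <= 1 -> is_derive (s : R^o) 1 (f : R^o -> R^o) (df s)) ->
  (forall s : R, 0 <= s <= 1 -> `|df s| <= B) -> `|f 1 - f 0| <= B.
Proof.
move=> fd dB; have [||c] := @MVT R f df 0 1 ltr01.
- by move=> s; rewrite in_itv/= => /andP[s0 s1]; apply: fd; rewrite !ltW.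
- apply: derivable_within_continuous => s; rewrite in_itv/= => s01.
  by have [] := fd s s01.
rewrite in_itv/= => /andP[c0 c1] ->; rewrite subr0 mulr1; apply: dB.
by rewrite !ltW.
Qed.

Lemma ball_seg (x p q : V) (d s : R) : `|p - x| < d -> `|q - x| < d -> 0 <= s <= 1 ->
  `|p + s *: (q - p) - x| < d.
Proof.
move=> px qx /andP[s0 s1].
have -> : p + s *: (q - p) - x = (1 - s) *: (p - x) + s *: (q - x).
  by rewrite !scalerBr !scalerBl !scale1r; rewrite !addrA; apply/eqP; rewrite -subr_eq0; apply/eqP;
     rewrite -[s *: x in X in _ - X]/(s *: x); ring.
apply: (le_lt_trans (ler_normD _ _)); rewrite !normrZ (ger0_norm s0) ger0_norm ?subr_ge0//.
have [->|sn0] := eqVneq s 0; first by rewrite subr0 mul1r mul0r addr0.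
have sp : 0 < s by rewrite lt_neqAle eq_sym sn0.
have := ler_wpM2l (_ : 0 <= 1 - s) (ltW px).
rewrite subr_ge0 => /(_ s1) h1.
have h2 : s * `|q - x| < s * d by rewrite ltr_pM2l.
lra.
Qed.

Definition lip_ball O g (x : V) (d C : R) := forall p q, `|p - x| < d -> `|q - x| < d ->
  [/\ O p, `|g p| <= C & `|g p - g q| <= C * `|p - q|].

(** Near [x] the partial derivatives exceed their values at [x] by at most 1 in absolute value, and
    the mean value theorem applies along segments because balls are convex. *)
Lemma sm_lip O g x : open O -> O x -> sm 1 O g ->
  exists d C : R, [/\ 0 < d, 0 <= C & lip_ball O g x d C].
Proof.
move=> oO Ox [G gG cG].
have bdd (f : V -> R^o) : {for x, continuous f} -> \forall y \near x, `|f y| <= `|f x| + 1.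
  move=> /cvgrPdist_le /(_ 1 ltr01); apply: filterS => y fy.
  by rewrite -lerBlDl (le_trans (lerB_dist _ _))// distrC.
pose C0 : R := \sum_i (`|G i x| + 1).
have C00 : 0 <= C0 by apply: sumr_ge0 => i _; rewrite addr_ge0.
have : \forall y \near x, [/\ O y, `|g y| <= `|g x| + 1 & forall i, `|G i y| <= `|G i x| + 1].
  have nG : \forall y \near x, forall i, `|G i y| <= `|G i x| + 1.
    apply: (@filter_forall V _ (fun i y => `|G i y| <= `|G i x| + 1) (nbhs x)) => i.
    by apply: bdd; exact: cG.
  have ng : \forall y \near x, `|g y| <= `|g x| + 1.
    by apply: bdd; apply: differentiable_continuous; case: (gG x Ox).
  have nO : \forall y \near x, O y by exact: open_nbhs_nbhs.
  by apply: filterS3 nO ng nG => y.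
move=> /nbhs_ballP[d /= d0 H]; exists d, (C0 + `|g x| + 1); split => //.
  by rewrite !addr_ge0.
have {}H y : `|y - x| < d -> [/\ O y, `|g y| <= `|g x| + 1 & forall i, `|G i y| <= `|G i x| + 1].
  by move=> yx; apply: H; rewrite -ball_normE /= distrC.
move=> p q px qx; have [Op gp _] := H p px; split=> //.
  by rewrite (le_trans gp)// -addrA lerDr.
apply: (@le_trans _ _ (C0 * `|p - q|)); last first.
  by rewrite ler_wpM2r// -addrA lerDl addr_ge0.
have := @mean_bound (fun s => g (q + s *: (p - q))) (fun s => 'D_(p - q) g (q + s *: (p - q))).
rewrite scale1r scale0r addr0 [q + _]addrC subrK; apply => s s01.
  apply: line_derive; have [Os _ _] := H _ (ball_seg qx px s01).
  by case: (gG _ Os).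
have [Os _ Gs] := H _ (ball_seg qx px s01).
have [_ ->] := gG _ Os; apply: (le_trans (ler_norm_sum _ _ _)).
rewrite mulr_suml; apply: ler_sum => i _; rewrite normrM mulrC.
by apply: ler_pM => //; exact: co_norm.
Qed.

Lemma lip_ball_mono O g x d C d' C' : d' <= d -> C <= C' ->
  lip_ball O g x d C -> lip_ball O g x d' C'.
Proof.
move=> dd CC H p q px qx.
have [Op gp gpq] := H p q (lt_le_trans px dd) (lt_le_trans qx dd).
split=> //; first exact: le_trans gp _.
by rewrite (le_trans gpq)// ler_wpM2r.
Qed.

Lemma sm_ulip O g K : open O -> compact K -> K `<=` O -> sm 1 O g ->
  exists d C : R, [/\ 0 < d, 0 <= C & forall x, K x -> lip_ball O g x d C].
Proof.
move=> oO /compact_near_coveringP cK KO sg.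
(* One parameter [i] serves both as constant and as inverse radius, so that uniformity over [K]
   becomes a single statement for large [i], to which compactness applies. *)
have [M [Mr H]] : \forall i \near +oo, K `<=` (fun x => lip_ball O g x (i : R)^-1 i).
  apply: cK => x /KO Ox; have [d [C [d0 C0 dC]]] := sm_lip oO Ox sg.
  pose M : R := Num.max C (2 / d).
  exists ([set y : V | `|y - x| < d / 2], [set i : R | M < i]) => /=.
    split; last by exists M; split; rewrite ?num_real.
    apply/nbhs_ballP; exists (d / 2) => /=; first by rewrite divr_gt0.
    by move=> y; rewrite -ball_normE /= distrC.
  move=> [y i] /= [yx Mi] p q px qx.
  have [Ci di] : C < i /\ 2 / d < i by move: Mi; rewrite /M gt_max => /andP.
  have i0 : 0 < i by rewrite (le_lt_trans C0).
  have id2 : i^-1 < d / 2.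
    by rewrite -[ltRHS]invrK ltf_pV2 ?posrE ?invr_gt0 ?divr_gt0// invf_div.
  have near_x r : `|r - y| < i^-1 -> `|r - x| < d.
    move=> ry; have -> : r - x = (r - y) + (y - x) by rewrite addrA subrK.
    by rewrite (le_lt_trans (ler_normD _ _))//; lra.
  have [Op gp gpq] := dC p q (near_x p px) (near_x q qx).
  split=> //; first by rewrite (le_trans gp)// ltW.
  by rewrite (le_trans gpq)// ler_wpM2r// ltW.
pose i := Num.max M 0 + 1.
have i0 : 0 < i by rewrite ltr_wpDl// le_max lexx orbT.
exists i^-1, i; split; rewrite ?invr_gt0// ?ltW//.
by apply: H; rewrite /i ltr_pwDr// le_max lexx.
Qed.

Lemma sm_ulips (I : finType) O (g : I -> V -> R^o) K :
  open O -> compact K -> K `<=` O -> (forall i, sm 1 O (g i)) ->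
  exists d C : R, [/\ 0 < d, 0 <= C & forall x, K x -> forall i, lip_ball O (g i) x d C].
Proof.
move=> oO cK KO sg.
have H i : exists dC : R * R, [/\ 0 < dC.1, 0 <= dC.2 & forall x, K x -> lip_ball O (g i) x dC.1 dC.2].
  by have [d [C ?]] := sm_ulip oO cK KO (sg i); exists (d, C).
have /choice[e He] := H.
exists (\big[Num.min/1]_i (e i).1), (\sum_i (e i).2); split.
- by elim/big_ind : _ => [|x y x0 y0|i _]; rewrite ?ltr01// ?lt_min ?x0//; case: (He i).
- by apply: sumr_ge0 => i _; case: (He i).
- move=> x Kx i; have [d0 C0 /(_ x Kx)] := He i; apply: lip_ball_mono.
    by rewrite (bigD1 i)//= ge_min lexx.
  rewrite (bigD1 i)//= lerDl; apply: sumr_ge0 => j _; by case: (He j).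
Qed.

Lemma is_derive_lin (L s : R) : is_derive (s : R^o) 1 (fun r : R^o => r * L : R^o) L.
Proof.
have -> : (fun s : R^o => s * L) = L \*: (id : R^o -> R^o).
  by apply/funext => r; rewrite /= [RHS]mulrC.
have := @is_deriveZ R R^o R^o id L s 1 1 (is_derive_id _ _).
by rewrite [L *: 1]mulr1.
Qed.

Lemma is_derive_quad (L s : R) :
  is_derive (s : R^o) 1 (fun r : R^o => 2^-1 * (r ^+ 2 * L) : R^o) (s * L).
Proof.
have -> : (fun s : R^o => 2^-1 * (s ^+ 2 * L)) = (2^-1 * L) \*: ((id : R^o -> R) ^+ 2).
  by apply/funext => r; rewrite /= -[RHS]/(2^-1 * L * (r ^+ 2)); ring.
have := @is_deriveZ R R^o R^o _ (2^-1 * L) s 1 _ (@is_deriveX R R^o id 2 s 1 1 (is_derive_id _ _)).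
by congr (is_derive _ _ _ _); rewrite /= -[LHS]/(2^-1 * L * ((2%:R * s ^+ 1) * 1)); field.
Qed.

(** Along the segment, [g] minus its linear part has a derivative made of increments of the [G i],
    each controlled by the Lipschitz constant. The factor 3 counts the coordinates. *)
Lemma ball_taylor1 O g G x d C : 0 <= C -> grad_on O g G ->
  (forall i, lip_ball O (G i) x d C) -> forall p q, `|p - x| < d -> `|q - x| < d ->
  `|g q - g p - \sum_i co i (q - p) * G i p| <= 3 * C * `|q - p| ^+ 2.
Proof.
move=> C0 gG lG p q px qx; set h := q - p; set L := \sum_i _.
have := @mean_bound (fun s => g (p + s *: h) - s * L) (fun s => 'D_h g (p + s *: h) - L).
rewrite scale1r scale0r addr0 mul1r mul0r subr0 [p + _]addrC subrK addrAC; apply => s s01.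
  have [Os _ _] := lG ord0 _ _ (ball_seg px qx s01) px.
  apply: is_deriveB; first by apply: line_derive; case: (gG _ Os).
  exact: is_derive_lin.
have [Os _ _] := lG ord0 _ _ (ball_seg px qx s01) px.
have [_ ->] := gG _ Os; rewrite -sumrB (le_trans (ler_norm_sum _ _ _))//.
have -> : 3 * C * `|h| ^+ 2 = \sum_(i < 3) (C * `|h| ^+ 2).
  by rewrite sumr_const card_ord; ring.
apply: ler_sum => i _; rewrite -mulrBr normrM mulrC.
have [_ _ H] := lG i _ _ (ball_seg px qx s01) px.
rewrite [_ - p]addrC addKr normrZ in H.
rewrite expr2 mulrA; apply: ler_pM => //; last exact: co_norm.
apply: (le_trans H); rewrite ler_wpM2l// ler_piMl//.
by case/andP: s01 => s0 s1; rewrite ger0_norm.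
Qed.

(** After subtraction of the quadratic polynomial, the derivative along the segment is a sum of
    first order remainders of the [G i]; [ball_taylor1] bounds each of them, and [9 = 3 * 3]. *)
Lemma ball_taylor2 O g G (H : 'I_3 -> 'I_3 -> V -> R^o) x d C : 0 <= C ->
  grad_on O g G -> (forall i, grad_on O (G i) (H i)) ->
  (forall i j, lip_ball O (H i j) x d C) ->
  forall p q, `|p - x| < d -> `|q - x| < d ->
  `|g q - g p - \sum_i co i (q - p) * G i p
    - 2^-1 * \sum_i \sum_j co i (q - p) * co j (q - p) * H i j p|
     <= 9 * C * `|q - p| ^+ 3.
Proof.
move=> C0 gG gH lH p q px qx; set h := q - p.
pose L := \sum_i co i h * G i p; pose Q := \sum_i \sum_j co i h * co j h * H i j p.
rewrite -/L -/Q.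
have := @mean_bound (fun s => g (p + s *: h) - s * L - 2^-1 * (s ^+ 2 * Q))
  (fun s => 'D_h g (p + s *: h) - L - s * Q).
rewrite scale1r scale0r addr0 mul1r mul0r [p + _]addrC subrK expr1n mul1r expr0n/= mul0r mulr0 !subr0.
have -> : g q - L - 2^-1 * Q - g p = g q - g p - L - 2^-1 * Q by ring.
move=> HH; apply: HH => s s01.
  have [Os _ _] := lH ord0 ord0 _ _ (ball_seg px qx s01) px.
  apply: is_deriveB.
    apply: is_deriveB; first by apply: line_derive; case: (gG _ Os).
    exact: is_derive_lin.
  exact: is_derive_quad.
have [Os _ _] := lH ord0 ord0 _ _ (ball_seg px qx s01) px.
have [_ ->] := gG _ Os; rewrite -sumrB mulr_sumr -sumrB (le_trans (ler_norm_sum _ _ _))//.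
have -> : 9 * C * `|h| ^+ 3 = \sum_(i < 3) (3 * C * `|h| ^+ 3).
  by rewrite sumr_const card_ord; ring.
apply: ler_sum => i _.
have -> : co i h * G i (p + s *: h) - co i h * G i p - s * (\sum_j co i h * co j h * H i j p)
  = co i h * (G i (p + s *: h) - G i p - \sum_j co j (s *: h) * H i j p).
  rewrite !mulrBr; congr (_ - _); rewrite !mulr_sumr; apply: eq_bigr => j _.
  by rewrite coZ; ring.
have := ball_taylor1 C0 (gH i) (lH i) px (ball_seg px qx s01).
rewrite [p + s *: h - p]addrC addKr normrZ => T.
rewrite normrM mulrC exprSr [3 * C * _]mulrA; apply: ler_pM => //; last exact: co_norm.
apply: (le_trans T); rewrite ler_wpM2l ?mulr_ge0// exprMn ler_piMl ?sqr_ge0//.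
by case/andP: s01 => s0 s1; rewrite exprn_ile1// ?normr_ge0// ger0_norm.
Qed.

End smooth.

(** * The chain rule along absolutely continuous paths *)

Section chain.
Context {R : realType}.
Notation V := (V3 R).
Notation T := (measurableTypeR R).
Implicit Types (O K : set V) (g : V -> R^o) (G : 'I_3 -> V -> R^o).
Implicit Types (x v : 'I_3 -> T -> R).
Local Hint Resolve mI01 : core.

Definition mk3 x (t : R) : V := (x ord0 t, (x (lift ord0 ord0) t, x ord_max t)).

Lemma co_mk3 x t i : co i (mk3 x t) = x i t.
Proof.
case: i => [[|[|[|//]]] hi]; rewrite /co /mk3/=;
  by congr (x _ _); apply/val_inj.
Qed.

Lemma mk3_cont x : (forall i, {within I01, continuous (x i)}) ->
  {within I01, continuous (mk3 x : R -> V)}.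
Proof.
move=> cx; apply/subspace_continuousP => t It.
have c i : (x i : R -> R^o) y @[y --> within I01 (nbhs t)] --> x i t.
  by have /subspace_continuousP/(_ t It) := cx i.
exact: (cvg_pair (c _) (cvg_pair (c _) (c _))).
Qed.

Lemma mk3_compact x : (forall i, {within I01, continuous (x i)}) ->
  compact (mk3 x @` (I01 : set R)).
Proof.
move=> cx; apply: continuous_compact; first exact: mk3_cont.
exact: segment_compact.
Qed.

Lemma path_cont O g k x : (forall i, {within I01, continuous (x i)}) -> sm k O g ->
  (forall t : R, 0 <= t <= 1 -> O (mk3 x t)) ->
  {within I01, continuous (fun t => g (mk3 x t) : R)}.
Proof.
move=> cx sg Ox; apply/subspace_continuousP => t; rewrite I01E => t01.
have /subspace_continuousP/(_ t) := mk3_cont cx; rewrite /= in_itv => /(_ t01) c.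
by apply: (cvg_comp _ _ c); exact: sm_cont sg (Ox _ t01).
Qed.

Lemma sqi_sum (I : finType) (f : I -> T -> R) : (forall i, sqi (f i)) ->
  sqi (fun t => \sum_i f i t).
Proof.
move=> sf; have -> : (fun t => \sum_i f i t) = \sum_i f i.
  by apply/funext => t; rewrite fct_sumE.
elim/big_ind: _ => // [|a b sa sb]; first exact: sqi_cst.
exact: sqiD.
Qed.

Lemma it_sum (I : finType) (f : I -> T -> R) a b : (forall i, ig `[a, b] (f i)) ->
  it a b (fun t => \sum_i f i t) = \sum_i it a b (f i).
Proof.
move=> sf; have -> : (fun t => \sum_i f i t) = \sum_i f i.
  by apply/funext => t; rewrite fct_sumE.
suff [] : ig `[a, b] (\sum_i f i) /\ it a b (\sum_i f i) = \sum_i it a b (f i) by [].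
apply: (big_ind2 (fun (F : T -> R) (r : R) => ig `[a, b] F /\ it a b F = r)) => //.
- split; last by rewrite /it Rintegral_cst// mul0r.
  exact: integrable0.
- by move=> F x1 G x2 [IF <-] [IG <-]; split; [exact: igD|exact: itD].
Qed.

(** The path need not be differentiable everywhere, so both sides are compared through their
    increments: on a short interval these differ by a multiple of the squared displacement, and
    [small_increments_cst] makes the difference constant. *)
Lemma chain O g G x v : open O -> (forall i, ac (x i) (v i)) ->
  (forall t : R, 0 <= t <= 1 -> O (mk3 x t)) ->
  grad_on O g G -> (forall i, sm 1 O (G i)) ->
  ac (fun t => g (mk3 x t) : R) (fun t => \sum_i G i (mk3 x t) * v i t).
Proof.
move=> oO acx Ox gG sG.
have cx i : {within I01, continuous (x i)} by exact: ac_cont (acx i).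
have [|d [C [d0 C0 lG]]] := sm_ulips oO (mk3_compact cx) _ sG.
  by move=> _ [t + <-]; rewrite /= in_itv; exact: Ox.
have {}lG t : 0 <= t <= 1 -> forall i, lip_ball O (G i) (mk3 x t) d C.
  by move=> t01; apply: lG; exists t => //; rewrite /= in_itv.
pose Gx i t := G i (mk3 x t); pose w t := \sum_i Gx i t * v i t.
have mGx i : measurable_fun I01 (Gx i) by apply: cont_meas; exact: path_cont Ox.
have bGx i t : I01 t -> `|Gx i t| <= C.
  rewrite I01E => t01; move: (lG t t01 i (mk3 x t) (mk3 x t)).
  by rewrite subrr normr0 => /(_ d0 d0)[].
have sv i : sqi (v i) := (acx i).1.
have sGv i : sqi (fun t => Gx i t * v i t) by exact: sqiM_bd (mGx i) (bGx i) (sv i).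
have sw : sqi w by exact: sqi_sum.
split=> // t t01.
(* [nu] bounds the speed of the path, so its integral over an interval bounds the displacement. *)
pose nu t := \sum_i `|v i t|.
have snu : sqi nu by apply: sqi_sum => i; exact: sqi_norm.
have nu0 s : 0 <= nu s by exact: sumr_ge0.
have igab f a b : 0 <= a -> b <= 1 -> sqi f -> ig `[a, b] f.
  by move=> a0 b1 /sqi_ig; exact: ig_itv.
have xab i a b : 0 <= a -> a <= b -> b <= 1 -> `|x i b - x i a| <= it a b (fun t => `|v i t|).
  by move=> a0 ab b1; rewrite (ac_sub (acx i))// it_norm//; exact: igab.
have gab a b : 0 <= a -> a <= b -> b <= 1 -> `|mk3 x b - mk3 x a| <= it a b nu.
  move=> a0 ab b1; rewrite (le_trans (norm_co _))// /nu it_sum; last first.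
    by move=> i; apply: igab => //; exact: sqi_norm.
  by apply: ler_sum => i _; rewrite coD coN !co_mk3; exact: xab.
pose W := it 0 1 (fun t => nu t ^+ 2).
have W0 : 0 <= W by apply: it_ge0 => s _; exact: sqr_ge0.
(* On intervals of length at most [d^2 / (W + 1)], Cauchy-Schwarz keeps the displacement below
   [d]. *)
have d'0 : 0 < d ^+ 2 / (W + 1) by rewrite divr_gt0 ?exprn_gt0// ltr_wpDl.
have inu2 : ig I01 (fun t => nu t ^+ 2) by case: snu.
have mab a b : 0 <= a -> a <= b -> b <= 1 -> b - a <= d ^+ 2 / (W + 1) -> it a b nu < d.
  move=> a0 ab b1 bad.
  have : it a b nu ^+ 2 < d ^+ 2.
    apply: (le_lt_trans (CS1_it a0 ab b1 snu)).
    have H1 : it a b (fun t => nu t ^+ 2) <= W.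
      by apply: it_mono => // s; exact: sqr_ge0.
    have W1 : 0 < W + 1 by rewrite ltr_wpDl.
    apply: (@le_lt_trans _ _ (d ^+ 2 / (W + 1) * W)).
      have i0 : 0 <= it a b (fun t => nu t ^+ 2) by apply: it_ge0 => s _; exact: sqr_ge0.
      by apply: ler_pM => //; rewrite subr_ge0.
    rewrite mulrAC ltr_pdivrMr// ltr_pM2l ?exprn_gt0//; lra.
  have i0 : 0 <= it a b nu by apply: it_ge0.
  by rewrite ltr_sqr// ?nnegrE// ltW.
suff : g (mk3 x t) - int0 t w = g (mk3 x 0) - int0 0 w.
  by rewrite int00 subr0 => <-; rewrite subrK.
apply: (@small_increments_cst _ (fun t => g (mk3 x t) - int0 t w)
  (fun t => nu t ^+ 2) (4 * C) (d ^+ 2 / (W + 1))) => //.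
- by rewrite mulr_ge0.
- by move=> s; exact: sqr_ge0.
move=> a b a0 ab b1 bad {t t01}.
have m_d := mab a b a0 ab b1 bad.
set m := it a b nu in m_d.
have m0 : 0 <= m by apply: it_ge0.
have a01 : 0 <= a <= 1 by rewrite a0 (le_trans ab).
have near_a t : a <= t <= b -> `|mk3 x t - mk3 x a| <= m.
  move=> /andP[at_ tb]; rewrite (le_trans (gab a t a0 at_ _)) ?(le_trans tb)//.
  apply: it_mono => //; exact: igab.
rewrite (@it_split _ w a b)//; last exact: sqi_ig.
(* The increment is a Taylor remainder at [a], at most [3 C m^2], plus the error of freezing the
   partial derivatives at [a], at most [C m^2]. This is the origin of the constant [4 C]. *)
have -> : g (mk3 x b) - (int0 a w + it a b w) - (g (mk3 x a) - int0 a w) =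
  (g (mk3 x b) - g (mk3 x a) - \sum_i (x i b - x i a) * Gx i a) +
  \sum_i ((x i b - x i a) * Gx i a - it a b (fun t => Gx i t * v i t)).
  rewrite sumrB /w it_sum; last by move=> i; exact: igab.
  by ring.
apply: (le_trans (ler_normD _ _)).
have P1 : `|g (mk3 x b) - g (mk3 x a) - \sum_i (x i b - x i a) * Gx i a| <= 3 * C * m ^+ 2.
  have := @ball_taylor1 _ O g G (mk3 x a) d C C0 gG (lG a a01) (mk3 x a) (mk3 x b).
  rewrite subrr normr0 => /(_ d0 (le_lt_trans (near_a b _) m_d)); rewrite ab lexx => /(_ isT).
  under eq_bigr do rewrite coD coN !co_mk3.
  move=> /le_trans; apply; apply: ler_wpM2l; first by rewrite mulr_ge0.
  by rewrite ler_sqr ?nnegrE//; apply: near_a; rewrite ab lexx.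
have P2 : `|\sum_i ((x i b - x i a) * Gx i a - it a b (fun t => Gx i t * v i t))| <= C * m ^+ 2.
  apply: (le_trans (ler_norm_sum _ _ _)).
  have -> : C * m ^+ 2 = \sum_i (C * m * it a b (fun t => `|v i t|)).
    have Em : m = \sum_i it a b (fun t => `|v i t|).
      by rewrite /m /nu it_sum// => i; apply: igab => //; exact: sqi_norm.
    by rewrite -mulr_sumr -Em expr2 mulrA.
  apply: ler_sum => i _.
  rewrite (ac_sub (acx i))// mulrC -[Gx i a * _]itZ; last exact: igab.
  rewrite -itB; [|by apply: igZ => //; exact: igab|exact: igab].
  have i1 : ig `[a, b] (fun t => Gx i a * v i t - Gx i t * v i t).
    by apply: igB => //; [apply: igZ => //; exact: igab|exact: igab].
  apply: (le_trans (it_norm i1)); rewrite -itZ; last by apply: igab => //; exact: sqi_norm.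
  apply: it_le; [exact: ig_norm|by apply: igZ => //; apply: igab => //; exact: sqi_norm|].
  move=> t tab; rewrite -mulrBl normrM ler_wpM2r//.
  have nt := near_a t tab.
  have := lG a a01 i (mk3 x a) (mk3 x t).
  rewrite subrr normr0 => /(_ d0 (le_lt_trans nt m_d))[_ _ H].
  by rewrite (le_trans H)// ler_wpM2l// distrC.
have := CS1_it a0 ab b1 snu; rewrite -/m => P3.
have : 4 * C * m ^+ 2 <= 4 * C * ((b - a) * it a b (fun t => nu t ^+ 2)).
  by rewrite ler_wpM2l// mulr_ge0.
by rewrite mulrA; lra.
Qed.

End chain.

(** * Closure properties of smooth functions and the squaring map *)

Section smooth_closure.
Context {R : realType}.
Notation V := (V3 R).
Implicit Types (O K : set V) (g h : V -> R^o) (G : 'I_3 -> V -> R^o).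

Lemma sm_cst k O (c : R) : sm k O (cst c : V -> R^o).
Proof.
elim: k c => [|k IH] c /=; first by move=> x _; exact: cvg_cst.
exists (fun _ => cst 0) => // x _; split=> [|v]; first exact: differentiable_cst.
by rewrite derive_cst big1// => i _; rewrite mulr0.
Qed.

Lemma sm_add k O g h : sm k O g -> sm k O h -> sm k O (fun x => g x + h x).
Proof.
elim: k g h => [|k IH] g h /=.
  by move=> sg sh x Ox; apply: cvgD; [exact: sg|exact: sh].
move=> [G gG sG] [H hH sH]; exists (fun i x => G i x + H i x); last by move=> i; exact: IH.
move=> x Ox; have [dg Dg] := gG x Ox; have [dh Dh] := hH x Ox.
split=> [|v]; first exact: differentiableD.
rewrite [LHS]deriveD; [|exact: diff_derivable|exact: diff_derivable].
by rewrite Dg Dh -big_split/=; apply: eq_bigr => i _; rewrite mulrDr.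
Qed.

Lemma sm_mul k O g h : sm k O g -> sm k O h -> sm k O (fun x => g x * h x).
Proof.
elim: k g h => [|k IH] g h.
  by move=> sg sh x Ox; apply: cvgM; [exact: sg|exact: sh].
move=> sg' sh'; have [sg sh] := (smS sg', smS sh'); move: sg' sh' => /=.
move=> [G gG sG] [H hH sH]; exists (fun i x => g x * H i x + h x * G i x); last first.
  by move=> i; apply: sm_add; exact: IH.
move=> x Ox; have [dg Dg] := gG x Ox; have [dh Dh] := hH x Ox.
split=> [|v]; first exact: differentiableM.
rewrite [LHS]deriveM; [|exact: diff_derivable|exact: diff_derivable].
rewrite Dg Dh /= -[X in X + _]/(g x * _) -[X in _ + X]/(h x * _) !mulr_sumr -big_split/=.
by apply: eq_bigr => i _; ring.
Qed.

Lemma sm_scale k O (c : R) g : sm k O g -> sm k O (fun x => c * g x).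
Proof. by move=> sg; apply: sm_mul => //; exact: sm_cst. Qed.

Lemma sm_opp k O g : sm k O g -> sm k O (fun x => - g x).
Proof.
move=> /(sm_scale (-1)); congr (sm _ _ _); apply/funext => x; by rewrite mulN1r.
Qed.

Definition co' (i : 'I_3) : V -> R^o := @co R i.
Lemma co_linear i : linear (co' i).
Proof. by move=> a x y; rewrite /co' coD coZ. Qed.
HB.instance Definition _ i := GRing.isLinear.Build R V R^o _ (co' i) (co_linear i).

Lemma co_continuous i : continuous (co' i).
Proof.
suff H (x : V) : {for x, continuous (co' i)} by move=> x; exact: H.
apply/cvgrPdist_lt => e e0.
have : \forall y \near x, `|x - y| < e by apply/nbhs_normP; exists e.
by apply: filterS => y; rewrite /co' -coN -coD; exact: le_lt_trans (co_norm _ _).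
Qed.

Lemma sm_co k O i : sm k O (@co R i : V -> R^o).
Proof.
case: k => [|k] /=; first by move=> x _; exact: (@co_continuous i).
exists (fun j => cst (i == j)%:R) => [x Ox|j]; last exact: sm_cst.
split=> [|v]; first exact: (linear_differentiable _ (@co_continuous i)).
rewrite deriveE; last exact: (linear_differentiable _ (@co_continuous i)).
rewrite (diff_lin _ (@co_continuous i)) (bigD1 i)//= eqxx mulr1 big1 ?addr0// => j ji.
by rewrite eq_sym (negbTE ji) mulr0.
Qed.

Definition e3 (i : 'I_3) : V := ((val i == 0%N)%:R, ((val i == 1%N)%:R, (val i == 2%N)%:R)).

Lemma e3E (v : V) : v = \sum_i co i v *: e3 i.
Proof.
rewrite !big_ord_recl big_ord0 addr0 /e3 /co/=; case: v => [a [b c]] /=.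
by congr (_, (_, _)); rewrite /= ?scaler0 ?scaler1 ?addr0 ?add0r// [RHS]mulr1.
Qed.

(** [Ck_on] asks for derivatives in all directions; by linearity of the differential the three
    coordinate directions carry the whole information. *)
Lemma Ck_sm k O g : Ck_on k O g -> sm k O g.
Proof.
elim: k g => [|k IH] g //= [dg Cg].
exists (fun i x => 'D_(e3 i) g x) => [x Ox|i]; last by apply: IH; exact: Cg.
split=> [|v]; first exact: dg.
rewrite deriveE; last exact: dg.
rewrite {1}(e3E v) linear_sum; apply: eq_bigr => i _.
by rewrite linearZ -deriveE//; exact: dg.
Qed.

Lemma Ck_sm_snd k (Q : set (plane R)) (f : plane R -> R^o) : Ck_on k Q f ->
  sm k ([set: R^o] `*` Q) (fun x => f x.2).
Proof.
have csnd : continuous (snd : V -> plane R) by move=> x; exact: cvg_snd.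
have lsnd : linear (snd : V -> plane R) by [].
pose S : {linear V -> plane R} := HB.pack (snd : V -> plane R) (GRing.isLinear.Build _ _ _ _ _ lsnd).
elim: k f => [|k IH] f /=.
  move=> cf x [_ Qx]; apply: (@continuous_comp _ _ _ (snd : V -> plane R) f); first exact: csnd.
  exact: cf.
move=> [df Cf].
exists (fun i x => 'D_((e3 i).2) f x.2) => [x [_ Qx]|i]; last by apply: (IH (fun y => 'D_((e3 i).2) f y)); exact: Cf.
have dS : differentiable (snd : V -> plane R) x := linear_differentiable _ (csnd : continuous S).
have dfx := df _ Qx.
split=> [|v]; first exact: (differentiable_comp dS dfx).
rewrite deriveE; last exact: (differentiable_comp dS dfx).
rewrite (diff_comp dS dfx)/= (diff_lin x (csnd : continuous S))/=.
have E : v.2 = \sum_i co i v *: (e3 i).2.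
  by rewrite [in LHS](e3E v) -[LHS]/(S _) linear_sum.
rewrite E linear_sum; apply: eq_bigr => i _.
by rewrite linearZ -deriveE.
Qed.

End smooth_closure.

Section square.
Context {R : realType}.
Notation V := (V3 R).
Implicit Types (O K : set V) (g h : V -> R^o) (G : 'I_3 -> V -> R^o).

Definition i0 : 'I_3 := ord0.
Definition i1 : 'I_3 := lift ord0 ord0.
Definition i2 : 'I_3 := ord_max.

Lemma sum3 (W : zmodType) (F : 'I_3 -> W) : \sum_i F i = F i0 + (F i1 + F i2).
Proof.
rewrite !big_ord_recl big_ord0 addr0; congr (_ + (F _ + F _)); exact/val_inj.
Qed.

Definition sqm (x : V) : V := (x.1, csqr x.2).

Definition dsqm (x v : V) : V :=
  (v.1, (2 * (x.2.1 * v.2.1 - x.2.2 * v.2.2), 2 * (x.2.1 * v.2.2 + x.2.2 * v.2.1))).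

Lemma is_diff_co i (x : V) : is_diff x (co' i) (co' i).
Proof.
apply: DiffDef; first exact: (linear_differentiable _ (@co_continuous R i)).
by rewrite (diff_lin _ (@co_continuous R i)).
Qed.

Lemma is_diff_sqm (x : V) : is_diff x sqm (dsqm x).
Proof.
have H i : is_diff x (co' i) (co' i) by exact: is_diff_co.
have := is_diff_pair (H i0) (is_diff_pair (is_diffB (is_diffM (H i1) (H i1)) (is_diffM (H i2) (H i2)))
  (is_diffD (is_diffM (H i1) (H i2)) (is_diffM (H i2) (H i1)))).
move=> D; apply: (is_diff_eq D); apply/funext => v.
rewrite /dsqm /= /co' /co/=; congr (_, (_, _)).
  by rewrite -[LHS]/((x.2.1 * v.2.1 + x.2.1 * v.2.1) - (x.2.2 * v.2.2 + x.2.2 * v.2.2)); ring.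
by rewrite -[LHS]/((x.2.1 * v.2.2 + x.2.2 * v.2.1) + (x.2.2 * v.2.1 + x.2.1 * v.2.2)); ring.
Qed.

Lemma sqm_continuous : continuous sqm.
Proof.
suff H (x : V) : {for x, continuous sqm} by move=> x; exact: H.
by apply: differentiable_continuous; case: (is_diff_sqm x).
Qed.

Lemma sm_sqm k O g : sm k O g -> sm k (sqm @^-1` O) (fun x => g (sqm x)).
Proof.
elim: k g => [|k IH] g /=.
  move=> cg x Ox; apply: (@continuous_comp _ _ _ sqm g); first exact: sqm_continuous.
  exact: cg.
move=> [G gG sG].
pose Gs i (x : V) : R^o := G i (sqm x).
(* The transpose of the real matrix of multiplication by [2 z] acts on the spatial gradient; the
   time derivative is unchanged. *)
exists (fun i x => match val i with
  | 0%N => Gs i0 x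
  | 1%N => 2 * (co i1 x * Gs i1 x + co i2 x * Gs i2 x)
  | _ => 2 * (- (co i2 x * Gs i1 x) + co i1 x * Gs i2 x) end) => [x Ox|i].
  have [dsq Dsq] := is_diff_sqm x; have [dg Dg] := gG _ Ox.
  split=> [|v]; first exact: differentiable_comp dsq dg.
  rewrite deriveE; last exact: differentiable_comp dsq dg.
  rewrite (diff_comp dsq dg)/= Dsq -deriveE// Dg !sum3 /= /Gs /co /dsqm/=; ring.
have s0 := IH _ (sG i0); have s1 := IH _ (sG i1); have s2 := IH _ (sG i2).
case: i => [[|[|i]] hi] /=; first exact: s0.
  by apply: sm_scale; apply: sm_add; apply: sm_mul => //; exact: sm_co.
by apply: sm_scale; apply: sm_add; [apply: sm_opp|]; apply: sm_mul => //; exact: sm_co.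
Qed.

End square.

(** * Norms on W^{1,2} and pointwise products *)

Section norms.
Context {R : realType}.
Notation T := (measurableTypeR R).
Implicit Types (f g v w : T -> R) (z y : L2 R).
Local Hint Resolve mI01 : core.

(** The chain rule for the product of the two spatial coordinates, along a path whose time
    coordinate is held at 0. *)
Lemma ac_mul f g v w : ac f v -> ac g w ->
  ac (fun t => f t * g t) (fun t => f t * w t + g t * v t).
Proof.
move=> af ag.
pose x (i : 'I_3) : T -> R := match val i with 0%N => cst 0 | 1%N => f | _ => g end.
pose xv (i : 'I_3) : T -> R := match val i with 0%N => cst 0 | 1%N => v | _ => w end.
have acx i : ac (x i) (xv i).
  rewrite /x /xv; case: (val i) => [|[|_]] //; exact: ac_cst.
pose G (i : 'I_3) : V3 R -> R^o := match val i with 0%N => cst 0 | 1%N => @co R i2 | _ => @co R i1 end.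
have gG : grad_on setT (fun x : V3 R => co i1 x * co i2 x : R^o) G.
  move=> p _; have d i : differentiable (@co R i : V3 R -> R^o) p.
    exact: (linear_differentiable _ (@co_continuous R i)).
  have De i u : 'D_u (@co R i : V3 R -> R^o) p = co i u.
    by rewrite deriveE// (diff_lin _ (@co_continuous R i)).
  split=> [|u]; first exact: differentiableM.
  rewrite [LHS]deriveM; [|exact: diff_derivable|exact: diff_derivable].
  rewrite !De sum3 /G/= -[LHS]/(co i1 p * co i2 u + co i2 p * co i1 u).
  by rewrite mulr0 add0r addrC mulrC [X in _ + X]mulrC.
have sG i : sm 1 setT (G i).
  rewrite /G; case: (val i) => [|[|_]]; [exact: sm_cst|exact: sm_co|exact: sm_co].
have := @chain R setT _ G x xv openT acx (fun _ _ => I) gG sG.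
set D := (fun t => \sum_i _) => H.
have := H; rewrite (_ : D = fun t => f t * w t + g t * v t).
  by apply: ac_eq => t _; rewrite !co_mk3.
by apply/funext => t; rewrite /D sum3 /G/= !co_mk3 /xv /x/= mul0r add0r addrC.
Qed.

Lemma acl_mul f g v w : acl f v -> acl g w ->
  acl (fun t => f t * g t) (fun t => f t * w t + g t * v t).
Proof. by move=> [af f1] [ag g1]; split; [exact: ac_mul|rewrite f1 g1]. Qed.

(** The L^2 norm. [n1] and [n2] are sums of such norms, equivalent to those given by
    [sobolev_sqnorm] (see [equiv1], [equiv2]) and more convenient for the Leibniz rule. *)
Definition N0 z : R := Num.sqrt (L2dot z z).
Definition n1 z : R := N0 z + N0 (L2diff z).
Definition n2 z : R := N0 z + n1 (L2diff z).

Lemma int01E f : int01 f = it 0 1 f. Proof. by []. Qed.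

Lemma N0_ge0 z : 0 <= N0 z. Proof. exact: sqrtr_ge0. Qed.
Lemma n1_ge0 z : 0 <= n1 z. Proof. by rewrite addr_ge0 ?N0_ge0. Qed.
Lemma n2_ge0 z : 0 <= n2 z. Proof. by rewrite addr_ge0 ?N0_ge0 ?n1_ge0. Qed.
Lemma N0_n1 z : N0 z <= n1 z. Proof. by rewrite lerDl N0_ge0. Qed.
Lemma N0d_n1 z : N0 (L2diff z) <= n1 z. Proof. by rewrite lerDr N0_ge0. Qed.
Lemma n1_n2 z : n1 z <= n2 z. Proof. by rewrite lerD2l lerDl N0_ge0. Qed.
Lemma n1d_n2 z : n1 (L2diff z) <= n2 z. Proof. by rewrite lerDr N0_ge0. Qed.

Lemma L2dotC z y : L2dot z y = L2dot y z.
Proof. by rewrite /L2dot; congr (int01 _); apply/funext => t; rewrite mulrC. Qed.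

Lemma igM_L2 z y : ig I01 (fun t => L2fun z t * L2fun y t).
Proof. by apply: sqiM_ig; exact: L2fun_sqi. Qed.

Lemma L2dot_ae z y f g : sqi f -> sqi g ->
  ae01 (fun t => L2fun z t = f t) -> ae01 (fun t => L2fun y t = g t) ->
  L2dot z y = it 0 1 (fun t => f t * g t).
Proof.
move=> sf sg zf yg; apply: ae01_it => //; [exact: igM_L2|exact: sqiM_ig|].
by apply: ae01S (ae01I zf yg) => t _ [-> ->].
Qed.

Lemma L2dot_toL2 f g : sqi f -> sqi g ->
  L2dot (toL2 f) (toL2 g) = it 0 1 (fun t => f t * g t).
Proof. by move=> sf sg; apply: L2dot_ae => //; exact: toL2E. Qed.

Lemma L2dotD z1 z2 y : L2dot (z1 + z2) y = L2dot z1 y + L2dot z2 y.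
Proof.
rewrite /L2dot !int01E -itD; [|exact: igM_L2|exact: igM_L2].
apply: ae01_it => //; [exact: igM_L2|by apply: igD => //; exact: igM_L2|].
by apply: ae01S (L2funD z1 z2) => t _ ->; rewrite mulrDl.
Qed.

Lemma L2dotZ a z y : L2dot (a *: z) y = a * L2dot z y.
Proof.
rewrite /L2dot !int01E -itZ; last exact: igM_L2.
apply: ae01_it => //; [exact: igM_L2|by apply: igZ => //; exact: igM_L2|].
by apply: ae01S (L2funZ a z) => t _ ->; rewrite mulrA.
Qed.

Lemma L2dotDr z y1 y2 : L2dot z (y1 + y2) = L2dot z y1 + L2dot z y2.
Proof. by rewrite L2dotC L2dotD !(L2dotC z). Qed.
Lemma L2dotZr a z y : L2dot z (a *: y) = a * L2dot z y.
Proof. by rewrite L2dotC L2dotZ (L2dotC z). Qed.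
Lemma L2dotN z y : L2dot (- z) y = - L2dot z y.
Proof. by rewrite -scaleN1r L2dotZ mulN1r. Qed.
Lemma L2dotNr z y : L2dot z (- y) = - L2dot z y.
Proof. by rewrite L2dotC L2dotN L2dotC. Qed.

Lemma L2dot_ge0 z : 0 <= L2dot z z.
Proof. by apply: it_ge0 => t _; rewrite -expr2 sqr_ge0. Qed.

Lemma N0_sqr z : N0 z ^+ 2 = L2dot z z.
Proof. by rewrite sqr_sqrtr// L2dot_ge0. Qed.

Lemma L2dot_CS z y : `|L2dot z y| <= N0 z * N0 y.
Proof.
rewrite -ler_sqr ?nnegrE ?mulr_ge0 ?N0_ge0// exprMn !N0_sqr real_normK ?num_real//.
have := CS_it (lexx 0) (lexx 1) (L2fun_sqi z) (L2fun_sqi y).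
by move=> /le_trans; apply; rewrite /L2dot !int01E; under eq_fun do rewrite expr2.
Qed.

Lemma N0D z y : N0 (z + y) <= N0 z + N0 y.
Proof.
rewrite -ler_sqr ?nnegrE ?addr_ge0 ?N0_ge0// N0_sqr L2dotD !L2dotDr (L2dotC y z).
have := L2dot_CS z y; have := ler_norm (L2dot z y).
by rewrite -!N0_sqr; nra.
Qed.

Lemma N0Z a z : N0 (a *: z) = `|a| * N0 z.
Proof.
by rewrite /N0 L2dotZ L2dotZr mulrA -expr2 sqrtrM ?sqr_ge0// sqrtr_sqr.
Qed.

Lemma N0_eq0 z : N0 z = 0 -> z = 0.
Proof.
move=> z0; have : L2dot z z = 0 by rewrite -N0_sqr z0 expr0n.
rewrite /L2dot; have -> : (fun t => L2fun z t * L2fun z t) = (fun t => L2fun z t ^+ 2) by [].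
move/Rint_sqr_eq0 => -/(_ mI01 (sqi_meas (L2fun_sqi z)) (L2fun_sqi z).2) H.
by apply: L2_ext; apply: ae01S (ae01I H (@L2fun0 R)) => t _ [-> ->].
Qed.

Lemma N0_toL2 f : sqi f -> N0 (toL2 f) ^+ 2 = it 0 1 (fun t => f t ^+ 2).
Proof. by move=> sf; rewrite N0_sqr L2dot_toL2. Qed.

Lemma L1_N0 f z : sqi f -> ae01 (fun t => L2fun z t = f t) ->
  it 0 1 (fun t => `|f t|) <= N0 z.
Proof.
move=> sf zf; rewrite -ler_sqr ?nnegrE ?N0_ge0//; last exact: it_ge0.
rewrite N0_sqr (L2dot_ae sf sf zf zf).
have := CS1_it (lexx 0) ler01 (lexx 1) (sqi_norm sf).
rewrite subr0 mul1r => /le_trans; apply; rewrite /it.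
by under eq_Rintegral do rewrite real_normK ?num_real// expr2.
Qed.

Lemma n1D z y : sobolev 1 z -> sobolev 1 y -> n1 (z + y) <= n1 z + n1 y.
Proof.
move=> sz sy; have := sob1_lin 1 sz sy; rewrite !scale1r => -[_ dE _].
by rewrite /n1 dE addrACA lerD ?N0D.
Qed.

Lemma sob1D z y : sobolev 1 z -> sobolev 1 y -> sobolev 1 (z + y).
Proof. by move=> sz sy; have := sob1_lin 1 sz sy; rewrite scale1r => -[]. Qed.

Lemma sob1Z a z : sobolev 1 z -> sobolev 1 (a *: z) /\ L2diff (a *: z) = a *: L2diff z
  /\ forall t : R, 0 <= t <= 1 -> loop (a *: z) t = a * loop z t.
Proof.
move=> /sob1P[az ez]; have H := aclZ a az.
have [|s d l] := sob1_char _ H (z := a *: z).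
  by apply: ae01S (ae01I (L2funZ a z) ez) => t _ [-> ->].
by split=> //; split=> //; rewrite d; apply: toL2_uniq; exact: L2funZ.
Qed.

Lemma n1Z a z : sobolev 1 z -> n1 (a *: z) = `|a| * n1 z.
Proof. by move=> /(sob1Z a)[_ [dE _]]; rewrite /n1 dE !N0Z mulrDr. Qed.

(** [|g t|] is at most [|g s|] plus the L^1 norm of the derivative; averaging over [s] gives the
    embedding in L^infinity with constant 1. *)
Lemma loop_sup z (t : R) : sobolev 1 z -> 0 <= t <= 1 -> `|loop z t| <= n1 z.
Proof.
move=> /sob1P[[az _] ez] /andP[t0 t1].
set g := loop z in az ez *; set v := L2fun (L2diff z) in az.
have sv : sqi v := az.1.
have sg : sqi g := acl_sqi az.
have iv : ig I01 (fun t => `|v t|) by apply: sqi_ig; exact: sqi_norm.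
pose V := it 0 1 (fun t => `|v t|).
have H s : 0 <= s <= 1 -> `|g t| <= `|g s| + V.
  move=> /andP[s0 s1].
  suff : `|g t - g s| <= V by have := ler_normD (g t - g s) (g s); rewrite subrK; lra.
  have P a b : 0 <= a -> a <= b -> b <= 1 -> `|g b - g a| <= V.
    move=> a0 ab b1; rewrite (ac_sub az)// (le_trans (it_norm _))//.
      by apply: ig_itv => //; exact: sqi_ig.
    exact: it_mono.
  by have [ts|/ltW st] := leP t s; [rewrite distrC|]; exact: P.
have -> : `|g t| = it 0 1 (cst `|g t|) by rewrite it_cst// subr0 mulr1.
have ign : ig I01 (fun t => `|g t|) by apply: sqi_ig; exact: sqi_norm.
apply: (@le_trans _ _ (it 0 1 (fun s => `|g s| + cst V s))).
  by apply: it_le; [exact: ig_cst|apply: igD => //; exact: ig_cst|exact: H].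
rewrite itD//; last exact: ig_cst.
rewrite it_cst// subr0 mulr1 lerD//; first exact: L1_N0.
by apply: L1_N0 => //; exact: ae01W.
Qed.

(** Meaningful when one factor is essentially bounded, as it is in every use: the product is then
    square integrable. *)
Definition pr z y : L2 R := toL2 (fun t => L2fun z t * L2fun y t).

Lemma pr_sob1 z y : sobolev 1 z -> sobolev 1 y ->
  [/\ sobolev 1 (pr z y),
      L2diff (pr z y) = toL2 (fun t => loop z t * L2fun (L2diff y) t + loop y t * L2fun (L2diff z) t) &
      forall t : R, 0 <= t <= 1 -> loop (pr z y) t = loop z t * loop y t].
Proof.
move=> /sob1P[az ez] /sob1P[ay ey].
have H := acl_mul az ay.
have -> : pr z y = toL2 (fun t => loop z t * loop y t).
  apply: toL2_uniq; have := toL2E (acl_sqi H.1).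
  move=> E; apply: ae01S (ae01I E (ae01I ez ey)) => t _ [-> [-> ->]] //.
exact: sob1_toL2.
Qed.

Lemma N0_mul_bd z f y (c : R) : sqi f -> ae01 (fun t => `|L2fun y t| <= c) ->
  ae01 (fun t => L2fun z t = f t * L2fun y t) -> 0 <= c -> N0 z <= c * N0 (toL2 f).
Proof.
move=> sf yc zE c0; rewrite -ler_sqr ?nnegrE ?mulr_ge0 ?N0_ge0// exprMn N0_toL2// N0_sqr.
rewrite -itZ; last by case: sf.
rewrite /L2dot int01E.
(* The pointwise bound holds only almost everywhere; the truncation [h] obeys it everywhere and has
   the same integral. *)
pose h t := Num.min (L2fun z t ^+ 2) (c ^+ 2 * f t ^+ 2).
have I2 : ig I01 (fun t => c ^+ 2 * f t ^+ 2) by apply: igZ => //; case: sf.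
have mh : measurable_fun I01 h.
  apply: measurable_minr; first by apply: measurable_funX; case: (L2fun_sqi z).
  exact: ig_meas I2.
have Ih : ig I01 h.
  apply: (ig_le _ _ _ I2) => // t _; rewrite /h ger0_norm ?ge_min ?lexx ?orbT//.
  by rewrite le_min sqr_ge0 mulr_ge0 ?sqr_ge0.
have -> : it 0 1 (fun t => L2fun z t * L2fun z t) = it 0 1 h.
  apply: ae01_it => //; first exact: igM_L2.
  apply: ae01S (ae01I yc zE) => t _ [yt zt]; rewrite /h -expr2; apply/esym/min_idPl.
  rewrite zt exprMn mulrC ler_wpM2r ?sqr_ge0//.
  by rewrite -real_normK ?num_real// ler_sqr ?nnegrE.
by apply: it_le => // t _; rewrite /h ge_min lexx orbT.
Qed.

End norms.

(** * Operator matrices on H_k *)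

Section components.
Context {R : realType}.
Implicit Types (u v w x : HL2 R) (z y : L2 R) (D : set (L2 R)) (q n : L2 R -> R).

(** Components [o0] and [o1] are those of [z], [o2] and [o3] those of [eta]. *)
Definition cp u (i : 'I_4) : L2 R :=
  match val i with 0%N => u.1.1 | 1%N => u.1.2 | 2%N => u.2.1 | _ => u.2.2 end.

Definition o0 : 'I_4 := @Ordinal 4 0 isT.
Definition o1 : 'I_4 := @Ordinal 4 1 isT.
Definition o2 : 'I_4 := @Ordinal 4 2 isT.
Definition o3 : 'I_4 := @Ordinal 4 3 isT.

Definition mkH (f : 'I_4 -> L2 R) : HL2 R := ((f o0, f o1), (f o2, f o3)).

Lemma sum4 (W : nmodType) (F : 'I_4 -> W) : \sum_i F i = F o0 + (F o1 + (F o2 + F o3)).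
Proof.
rewrite !big_ord_recl big_ord0 addr0; congr (F _ + (F _ + (F _ + F _))); exact/val_inj.
Qed.

Lemma all4 (P : 'I_4 -> Prop) : P o0 -> P o1 -> P o2 -> P o3 -> forall i, P i.
Proof.
move=> p0 p1 p2 p3 [[|[|[|[|//]]]] hi].
- by rewrite (_ : Ordinal hi = o0)//; apply/val_inj.
- by rewrite (_ : Ordinal hi = o1)//; apply/val_inj.
- by rewrite (_ : Ordinal hi = o2)//; apply/val_inj.
- by rewrite (_ : Ordinal hi = o3)//; apply/val_inj.
Qed.

Lemma cp_mkH f i : cp (mkH f) i = f i.
Proof. by move: i; apply: all4. Qed.

Lemma cp_ext u w : (forall i, cp u i = cp w i) -> u = w.
Proof.
case: u w => [[a b] [c d]] [[a' b'] [c' d']] H.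
by move: (H o0) (H o1) (H o2) (H o3); rewrite /cp/= => -> -> -> ->.
Qed.

Lemma cpD u w i : cp (u + w) i = cp u i + cp w i.
Proof. by rewrite /cp; case: (val i) => [|[|[|?]]]. Qed.
Lemma cpN u i : cp (- u) i = - cp u i.
Proof. by rewrite /cp; case: (val i) => [|[|[|?]]]. Qed.
Lemma cpZ (a : R) u i : cp (a *: u) i = a *: cp u i.
Proof. by rewrite /cp; case: (val i) => [|[|[|?]]]. Qed.
Lemma cpB u w i : cp (u - w) i = cp u i - cp w i.
Proof. by rewrite cpD cpN. Qed.

Lemma domE D q u : Hspace D q u <-> forall i, D (cp u i).
Proof.
split=> [[[? ?] [? ?]]|H]; first exact: all4.
by split; split; [apply: (H o0)|apply: (H o1)|apply: (H o2)|apply: (H o3)].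
Qed.

Lemma h_E k (z : hL2 R) (y : hL2 R) : h_ k z -> h_ k y -> H_ k ((z, y) : HL2 R).
Proof. by []. Qed.

Lemma nrmE D q u : nrm (Hspace D q) u = Num.sqrt (\sum_i q (cp u i)).
Proof. by rewrite sum4 /= !addrA. Qed.

Lemma HdotE u w : Hdot u w = \sum_i L2dot (cp u i) (cp w i).
Proof. by rewrite sum4 /Hdot /hdot addrA. Qed.

Definition hn n u : R := \sum_i n (cp u i).

(** Relates a squared norm [q] from the definition of the spaces to a norm [n] that is easier to
    estimate. Constants are harmless for continuity as well as for (C). *)
Definition equiv_norm D q n := [/\ forall z, 0 <= n z,
  forall z, D z -> q z <= n z ^+ 2 &
  exists2 c : R, 0 < c & forall z, D z -> n z ^+ 2 <= c ^+ 2 * q z].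

Definition subadditive_on D n := forall z y, D z -> D y -> D (z + y) /\ n (z + y) <= n z + n y.

Lemma hn_ge0 n u : (forall z, 0 <= n z) -> 0 <= hn n u.
Proof. by move=> n0; exact: sumr_ge0. Qed.

Lemma cp_hn n u i : (forall z, 0 <= n z) -> n (cp u i) <= hn n u.
Proof. by move=> n0; rewrite /hn (bigD1 i)//= lerDl sumr_ge0. Qed.

Lemma nrm_le D q n u : equiv_norm D q n -> Hspace D q u -> nrm (Hspace D q) u <= hn n u.
Proof.
move=> [n0 qn _] /domE Du; rewrite nrmE -(ger0_norm (hn_ge0 u n0)) -sqrtr_sqr ler_wsqrtr//.
rewrite /hn expr2 mulr_suml; apply: ler_sum => i _.
by rewrite (le_trans (qn _ (Du i)))// expr2 ler_wpM2l//; exact: cp_hn.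
Qed.

Lemma nrm_ge0 D q u : 0 <= nrm (Hspace D q) u.
Proof. exact: sqrtr_ge0. Qed.

Lemma le_nrm D q n : equiv_norm D q n ->
  exists2 c : R, 0 < c & forall u, Hspace D q u -> hn n u <= c * nrm (Hspace D q) u.
Proof.
move=> [n0 qn [c c0 nq]]; exists (4 * c); first by rewrite mulr_gt0.
move=> u /domE Du.
have qp i : 0 <= q (cp u i).
  by have := le_trans (sqr_ge0 _) (nq _ (Du i)); rewrite pmulr_rge0// exprn_gt0.
have -> : 4 * c * nrm (Hspace D q) u = \sum_(i < 4) (c * nrm (Hspace D q) u).
  by rewrite sumr_const card_ord; ring.
apply: ler_sum => i _.
have cn0 : 0 <= c * nrm (Hspace D q) u by rewrite mulr_ge0 ?nrm_ge0// ltW.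
rewrite -ler_sqr ?nnegrE// exprMn nrmE sqr_sqrtr ?sumr_ge0//.
apply: (le_trans (nq _ (Du i))); rewrite ler_pM2l ?exprn_gt0//.
by rewrite (bigD1 i)//= lerDl sumr_ge0.
Qed.

Lemma sob_sub1 : subadditive_on (sobolev 1) (@n1 R).
Proof. by move=> z y sz sy; split; [exact: sob1D|exact: n1D]. Qed.

Lemma sob_sub0 : subadditive_on (sobolev 0) (@N0 R).
Proof. by move=> z y _ _; split => //; exact: N0D. Qed.

Lemma sob2E z : sobolev 2 z <-> sobolev 1 z /\ sobolev 1 (L2diff z).
Proof. by split=> [[a b]|[[a _] b]]. Qed.

Lemma L2diffD z y : sobolev 1 z -> sobolev 1 y -> L2diff (z + y) = L2diff z + L2diff y.
Proof. by move=> sz sy; have := sob1_lin 1 sz sy; rewrite !scale1r => -[]. Qed.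

Lemma equiv0 : equiv_norm (sobolev 0) (@sobolev_sqnorm R 0) (@N0 R).
Proof.
split; first exact: N0_ge0.
  by move=> z _; rewrite N0_sqr /sobolev_sqnorm big_ord_recl big_ord0 addr0.
by exists 1 => // z _; rewrite N0_sqr /sobolev_sqnorm big_ord_recl big_ord0 addr0 expr1n mul1r.
Qed.

Lemma sqnorm1 z : sobolev_sqnorm 1 z = N0 z ^+ 2 + N0 (L2diff z) ^+ 2.
Proof. by rewrite /sobolev_sqnorm !big_ord_recl big_ord0 addr0 !N0_sqr. Qed.

Lemma sqnorm2 z : sobolev_sqnorm 2 z =
  N0 z ^+ 2 + (N0 (L2diff z) ^+ 2 + N0 (L2diff (L2diff z)) ^+ 2).
Proof. by rewrite /sobolev_sqnorm !big_ord_recl big_ord0 addr0 !N0_sqr. Qed.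

Lemma equiv1 : equiv_norm (sobolev 1) (@sobolev_sqnorm R 1) (@n1 R).
Proof.
split; first exact: n1_ge0.
  by move=> z _; rewrite sqnorm1 /n1; have := N0_ge0 z; have := N0_ge0 (L2diff z); nra.
by exists 2 => // z _; rewrite sqnorm1 /n1; have := N0_ge0 z; have := N0_ge0 (L2diff z); nra.
Qed.

Lemma equiv2 : equiv_norm (sobolev 2) (@sobolev_sqnorm R 2) (@n2 R).
Proof.
split; first exact: n2_ge0.
  move=> z _; rewrite sqnorm2 /n2 /n1; have := N0_ge0 z; have := N0_ge0 (L2diff z).
  by have := N0_ge0 (L2diff (L2diff z)); nra.
exists 2 => // z _; rewrite sqnorm2 /n2 /n1.
move: (N0 z) (N0 _) (N0 _) => a b c.
have := sqr_ge0 (a - b); have := sqr_ge0 (a - c); have := sqr_ge0 (b - c).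
have := sqr_ge0 a; have := sqr_ge0 b; have := sqr_ge0 c; nra.
Qed.

Notation h1 := (hn (@n1 R)).

Lemma h1D u w : H_ 1 u -> H_ 1 w -> H_ 1 (u + w) /\ h1 (u + w) <= h1 u + h1 w.
Proof.
move=> /domE su /domE sw; split.
  by apply/domE => i; rewrite cpD; exact: sob1D.
by rewrite /hn -big_split; apply: ler_sum => i _; rewrite cpD n1D.
Qed.

Lemma h1Z (a : R) u : H_ 1 u -> H_ 1 (a *: u) /\ h1 (a *: u) = `|a| * h1 u.
Proof.
move=> /domE su; split.
  by apply/domE => i; rewrite cpZ; exact: (sob1Z a (su i)).1.
by rewrite /hn mulr_sumr; apply: eq_bigr => i _; rewrite cpZ n1Z.
Qed.

Lemma h1B u w : H_ 1 u -> H_ 1 w -> H_ 1 (u - w) /\ h1 (u - w) <= h1 u + h1 w.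
Proof.
move=> su sw; have [sN] := h1Z (-1) sw; rewrite scaleN1r normrN1 mul1r in sN * => <-.
by apply: h1D => //; rewrite -scaleN1r.
Qed.

Definition mop (T : 'I_4 -> 'I_4 -> HL2 R -> L2 R -> L2 R) u x : HL2 R :=
  mkH (fun i => \sum_j T i j u (cp x j)).

Definition bdd_on DX nX DY nY (T : L2 R -> L2 R) :=
  [/\ forall z, DX z -> DY (T z),
      forall a z y, DX z -> DX y -> T (a *: z + y) = a *: T z + T y &
      exists M : R, forall z, DX z -> nY (T z) <= M * nX z].

Definition entry_C0 (U : set (HL2 R)) (nB : L2 R -> R) DX nX DY nY
    (T : HL2 R -> L2 R -> L2 R) :=
  (forall u, U u -> bdd_on DX nX DY nY (T u)) /\
  forall u, U u -> forall e : R, 0 < e -> exists2 d : R, 0 < d &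
    forall w, U w -> hn nB (w - u) < d -> forall z, DX z ->
      nY (T w z - T u z) <= e * nX z.

Lemma sum_sub (I : finType) D n (f : I -> L2 R) : D 0 -> n 0 = 0 -> subadditive_on D n ->
  (forall i, D (f i)) -> D (\sum_i f i) /\ n (\sum_i f i) <= \sum_i n (f i).
Proof.
move=> D0 n0 Dn Df.
apply: (big_ind2 (fun z (r : R) => D z /\ n z <= r)) => //; first by rewrite n0.
move=> z a y b [Dz za] [Dy yb]; have [Dzy nzy] := Dn _ _ Dz Dy; split=> //.
by rewrite (le_trans nzy)// lerD.
Qed.

Lemma C0_op_mop U DB qB nB DX qX nX DY qY nY T :
  equiv_norm DB qB nB -> equiv_norm DX qX nX -> equiv_norm DY qY nY ->
  (forall u w, U u -> U w -> Hspace DB qB (w - u)) ->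
  DY 0 -> nY 0 = 0 -> subadditive_on DY nY ->
  (forall z, DY z -> DY (- z)) ->
  (forall i j, entry_C0 U nB DX nX DY nY (T i j)) ->
  C0_op U (Hspace DB qB) (Hspace DX qX) (Hspace DY qY) (mop T).
Proof.
move=> eB eX eY UB DY0 nY0 sY NY TC.
have [cX cX0 hX] := le_nrm eX.
have nX0 : forall z, 0 <= nX z by case: eX.
have nY00 : forall z, 0 <= nY z by case: eY.
have Dmop u x : U u -> Hspace DX qX x -> Hspace DY qY (mop T u x).
  move=> Uu /domE Dx; apply/domE => i; rewrite cp_mkH.
  apply: (proj1 (sum_sub DY0 nY0 sY _)) => j.
  by have [/(_ u Uu)[H _ _] _] := TC i j; exact/H/Dx.
split=> u Uu.
  split; first by move=> x; exact: Dmop.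
    move=> a x y /domE Dx /domE Dy; apply: cp_ext => i.
    rewrite cpD cpZ !cp_mkH scaler_sumr -big_split; apply: eq_bigr => j _.
    by rewrite cpD cpZ; have [/(_ u Uu)[_ H _] _] := TC i j; rewrite H.
  have /choice[M MP] : forall ij : 'I_4 * 'I_4, exists M : R, forall z, DX z ->
      nY (T ij.1 ij.2 u z) <= M * nX z.
    by move=> [i j]; have [/(_ u Uu)[_ _ H] _] := TC i j.
  pose N := \sum_i \sum_j `|M (i, j)|.
  exists (N * cX) => x Dx.
  rewrite (le_trans (nrm_le eY (Dmop u x Uu Dx)))// -mulrA.
  have N0 : 0 <= N by apply: sumr_ge0 => i _; exact: sumr_ge0.
  apply: (@le_trans _ _ (N * hn nX x)); last by rewrite ler_wpM2l ?hX.
  rewrite /N /hn mulr_suml; apply: ler_sum => i _; rewrite cp_mkH.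
  move/domE : Dx => Dx.
  apply: (le_trans (proj2 (sum_sub DY0 nY0 sY _))) => [j|].
    by have [/(_ u Uu)[H _ _] _] := TC i j; exact/H/Dx.
  rewrite mulr_suml; apply: ler_sum => j _.
  apply: (le_trans (MP (i, j) _ (Dx j))).
  apply: (@le_trans _ _ (`|M (i, j)| * nX (cp x j))).
    by rewrite ler_wpM2r// ler_norm.
  by rewrite ler_wpM2l//; exact: cp_hn.
(* There are 16 entries, and [cX] converts the sum of the component norms into the norm of the
   space. *)
move=> e e0; pose e' := e / (16 * cX).
have e'0 : 0 < e' by rewrite divr_gt0// mulr_gt0.
have [cB cB0 hB] := le_nrm eB.
have /choice[d dP] : forall ij : 'I_4 * 'I_4, exists d : R, 0 < d /\
    forall w, U w -> hn nB (w - u) < d -> forall z, DX z ->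
      nY (T ij.1 ij.2 w z - T ij.1 ij.2 u z) <= e' * nX z.
  by move=> [i j]; have [_ /(_ u Uu e' e'0)[d d0 H]] := TC i j; exists d.
pose d0 := \big[Num.min/1]_ij d ij.
have d00 : 0 < d0.
  by rewrite /d0; elim/big_ind: _ => // [x y x0 y0|i _]; [rewrite lt_min x0|case: (dP i)].
exists (d0 / cB); first by rewrite divr_gt0.
move=> w Uw; rewrite ltr_pdivlMr// mulrC => wu x Dx.
have hwu : hn nB (w - u) < d0 by apply: le_lt_trans wu; apply: hB; exact: UB.
have DB' : Hspace DY qY (mop T w x - mop T u x).
  apply/domE => i; rewrite cpB; apply: (proj1 (sY _ _ _ _)).
    by have /domE := Dmop w x Uw Dx; apply.
  by apply: NY; have /domE := Dmop u x Uu Dx; apply.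
apply: (le_trans (nrm_le eY DB')).
apply: (@le_trans _ _ (16 * e' * hn nX x)); last first.
  have -> : e = 16 * e' * cX by rewrite /e'; field; rewrite gt_eqF.
  by rewrite -[leRHS]mulrA ler_wpM2l ?hX// mulr_ge0// ltW.
have -> : 16 * e' * hn nX x = \sum_(i < 4) \sum_(j < 4) e' * hn nX x.
  by rewrite !sumr_const card_ord; ring.
apply: ler_sum => i _; rewrite cpB !cp_mkH -sumrB.
move/domE : Dx => Dx.
have DT v j : U v -> DY (T i j v (cp x j)).
  by move=> Uv; have [/(_ v Uv)[H _ _] _] := TC i j; exact/H/Dx.
apply: (le_trans (proj2 (sum_sub DY0 nY0 sY _))) => [j|].
  by apply: (proj1 (sY _ _ _ _)); [exact: DT|apply: NY; exact: DT].
apply: ler_sum => j _.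
have dj : d0 <= d (i, j) by rewrite /d0 (bigD1 (i, j))//= ge_min lexx.
apply: (le_trans ((dP (i, j)).2 w Uw (lt_le_trans hwu dj) _ (Dx j))).
by apply: ler_wpM2l; [exact: ltW|exact: cp_hn].
Qed.

End components.

Notation h1 := (hn (@n1 _)).
Notation h2 := (hn (@n2 _)).

Lemma hnE (R : realType) (n : L2 R -> R) u : hn n u = \sum_i n (cp u i).
Proof. by []. Qed.
Lemma n1E (R : realType) (z : L2 R) : n1 z = N0 z + N0 (L2diff z).
Proof. by []. Qed.
Global Opaque hn N0 n1 n2 L2diff toL2.

(** * Multiplication by bounded functions and the algebra W^{1,2} *)

Section products.
Context {R : realType}.
Notation mu := (@lebesgue_measure R).
Notation T := (measurableTypeR R).
Implicit Types (f g : T -> R) (x y z m : L2 R).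
Local Hint Resolve mI01 : core.

Lemma ig_ae f g : measurable_fun I01 f -> ae01 (fun t => f t = g t) -> ig I01 g ->
  ig I01 f.
Proof.
move=> mf fg Ig; apply/integrableP; split; first exact/measurable_EFinP.
case/integrableP : (Ig) => _; congr (_ < _)%E; apply: ae_eq_integral => //.
- by apply/measurable_EFinP; apply: measurableT_comp => //; exact: ig_meas Ig.
- by apply/measurable_EFinP; exact: measurableT_comp.
have F := ae_filter_ringOfSetsType mu.
by move: fg; rewrite /ae01; apply: filterS => t /= fg It; rewrite fg.
Qed.

Definition essb (c : R) y := ae01 (fun t => `|L2fun y t| <= c).

Lemma pr_sqi z y c : essb c y -> sqi (fun t => L2fun z t * L2fun y t).
Proof.
move=> yc.
have [mz _] := L2fun_sqi z; have [my _] := L2fun_sqi y.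
(* Truncating [y] changes it on a null set only and makes the bound hold at every point. *)
pose g t := Num.max (- `|c|) (Num.min (L2fun y t) `|c|).
have mg : measurable_fun I01 g.
  by apply: measurable_maxr => //; exact: measurable_minr.
have gc t : I01 t -> `|g t| <= `|c|.
  move=> _; rewrite ler_norml /g le_max lexx /= ge_max ge_min lexx orbT andbT.
  by have := normr_ge0 c; lra.
split; first exact: measurable_funM.
apply: (@ig_ae _ (fun t => (g t * L2fun z t) ^+ 2)).
- by apply: measurable_funX; exact: measurable_funM.
- apply: ae01S yc => t _ yc; rewrite mulrC; congr ((_ * _) ^+ 2).
  have := ler_norm c; move: yc; rewrite ler_norml => /andP[yc1 yc2] cc.
  have h1 : L2fun y t <= `|c| by lra.
  rewrite /g (min_idPl h1); apply/esym/max_idPr; lra.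
- by have [] := sqiM_bd mg gc (L2fun_sqi z).
Qed.

Lemma prC z y : pr z y = pr y z.
Proof. by rewrite /pr; congr toL2; apply/funext => t; rewrite mulrC. Qed.

Lemma prE z y c : essb c y -> ae01 (fun t => L2fun (pr z y) t = L2fun z t * L2fun y t).
Proof. by move=> /(pr_sqi z)/toL2E. Qed.

Lemma N0_pr z y c : 0 <= c -> essb c y -> N0 (pr z y) <= c * N0 z.
Proof.
move=> c0 yc; rewrite -{2}[z]toL2K; apply: (N0_mul_bd _ yc) => //; first exact: L2fun_sqi.
exact: prE yc.
Qed.

Lemma pr_linl a z z' y c : essb c y -> pr (a *: z + z') y = a *: pr z y + pr z' y.
Proof.
move=> yc; apply: L2_ext.
have H1 := ae01I (prE (a *: z + z') yc) (ae01I (prE z yc) (prE z' yc)).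
have H2 := ae01I (ae01I (L2funD (a *: z) z') (L2funZ a z))
  (ae01I (L2funD (a *: pr z y) (pr z' y)) (L2funZ a (pr z y))).
apply: ae01S (ae01I H1 H2) => t _ [[-> [e1 e2]] [[-> ->] [-> ->]]].
by rewrite e1 e2; ring.
Qed.

Lemma pr_linr a z y y' c c' : essb c y -> essb c' y' ->
  pr z (a *: y + y') = a *: pr z y + pr z y'.
Proof.
move=> yc yc'.
have bd : essb (`|a| * c + c') (a *: y + y').
  apply: ae01S (ae01I (ae01I yc yc') (ae01I (L2funD (a *: y) y') (L2funZ a y))) => t _ [[h h'] [-> ->]].
  by rewrite (le_trans (ler_normD _ _))// lerD// normrM ler_wpM2l.
apply: L2_ext.
have H1 := ae01I (prE z bd) (ae01I (prE z yc) (prE z yc')).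
have H2 := ae01I (ae01I (L2funD (a *: y) y') (L2funZ a y))
  (ae01I (L2funD (a *: pr z y) (pr z y')) (L2funZ a (pr z y))).
apply: ae01S (ae01I H1 H2) => t _ [[-> [e1 e2]] [[-> ->] [-> ->]]].
by rewrite e1 e2; ring.
Qed.

Lemma sob1_essb z : sobolev 1 z -> essb (n1 z) z.
Proof.
move=> sz; have [_ ez] := sob1P sz.
by apply: ae01S ez => t; rewrite I01E => t01 ->; exact: loop_sup.
Qed.

Lemma N0_pr1 z y : sobolev 1 y -> N0 (pr z y) <= n1 y * N0 z.
Proof. by move=> sy; apply: N0_pr; [exact: n1_ge0|exact: sob1_essb]. Qed.

Lemma n1_pr_arith (a b a' b' p q r s : R) : 0 <= a -> 0 <= b -> 0 <= a' -> 0 <= b' ->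
  p <= (b + b') * a -> q <= (a + a') * b' -> r <= (b + b') * a' -> s <= q + r ->
  p + s <= 2 * (a + a') * (b + b').
Proof.
move=> a0 b0 a'0 b'0 *; have := mulr_ge0 a0 b0; have := mulr_ge0 a0 b'0.
have := mulr_ge0 a'0 b0; have := mulr_ge0 a'0 b'0; lra.
Qed.

(** In each Leibniz term the factor without derivative is bounded by its W^{1,2} norm. *)
Lemma n1_pr z y : sobolev 1 z -> sobolev 1 y -> n1 (pr z y) <= 2 * n1 z * n1 y.
Proof.
move=> sz sy; have [_ dE _] := pr_sob1 sz sy.
have [_ ez] := sob1P sz; have [_ ey] := sob1P sy.
have -> : n1 (pr z y) = N0 (pr z y) + N0 (pr (L2diff y) z + pr (L2diff z) y).
  rewrite n1E dE; congr (_ + N0 _); apply: toL2_uniq.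
  have H := ae01I (prE (L2diff y) (sob1_essb sz)) (prE (L2diff z) (sob1_essb sy)).
  apply: ae01S (ae01I (L2funD (pr (L2diff y) z) (pr (L2diff z) y)) (ae01I H (ae01I ez ey))).
  by move=> t _ [-> [[-> ->] [-> ->]]]; ring.
have := N0D (pr (L2diff y) z) (pr (L2diff z) y).
have := N0_pr1 z sy; have := N0_pr1 (L2diff y) sz; have := N0_pr1 (L2diff z) sy.
rewrite !n1E => A1 A2 A3 A4.
exact: (@n1_pr_arith (N0 z) (N0 y) (N0 (L2diff z)) (N0 (L2diff y)) _ _ _ _
  (N0_ge0 z) (N0_ge0 y) (N0_ge0 (L2diff z)) (N0_ge0 (L2diff y)) A3 A2 A1 A4).
Qed.

End products.

(** * Locally Lipschitz families over U_1 *)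

Section families.
Context {R : realType}.
Variable U : set (HL2 R).
Hypothesis U1 : forall u, U u -> H_ 1 u.
Implicit Types (u v w : HL2 R).

Lemma lt_min2 (x a b : R) : x < Num.min a b -> x < a /\ x < b.
Proof. by rewrite lt_min => /andP. Qed.

(** Statements about pairs of points near [u] for the norm of [H_1], with radius and constant
    depending on [u] only. Continuity in [u] and condition (C) are both obtained from this shape,
    and [loc2] combines such statements. *)
Definition loc (P : R -> HL2 R -> HL2 R -> Prop) := forall u, U u ->
  exists d k : R, [/\ 0 < d, 0 <= k & forall v w, U v -> U w ->
    h1 (v - u) < d -> h1 (w - u) < d -> P k v w].

Lemma loc2 (F : R -> R -> R) (P P' Q : R -> HL2 R -> HL2 R -> Prop) :
  (forall a b, 0 <= a -> 0 <= b -> 0 <= F a b) ->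
  (forall a b v w, 0 <= a -> 0 <= b -> U v -> U w -> P a v w -> P a w v ->
     P' b v w -> P' b w v -> Q (F a b) v w) ->
  loc P -> loc P' -> loc Q.
Proof.
move=> F0 H LP LP' u Uu.
have [d [k [d0 k0 HP]]] := LP u Uu; have [d' [k' [d'0 k'0 HP']]] := LP' u Uu.
exists (Num.min d d'), (F k k'); split; [by rewrite lt_min d0|exact: F0|].
move=> v w Uv Uw /lt_min2[vd vd'] /lt_min2[wd wd'].
by apply: H => //; [exact: HP|exact: HP|exact: HP'|exact: HP'].
Qed.

Lemma loc1 (F : R -> R) (P Q : R -> HL2 R -> HL2 R -> Prop) :
  (forall a, 0 <= a -> 0 <= F a) ->
  (forall a v w, 0 <= a -> U v -> U w -> P a v w -> P a w v -> Q (F a) v w) ->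
  loc P -> loc Q.
Proof.
move=> F0 H LP; apply: (@loc2 (fun a _ => F a) P P) (LP) (LP); first by move=> a b ? _; exact: F0.
by move=> a b v w a0 _ Uv Uw p1 p2 _ _; exact: H.
Qed.

Definition lipG (W : zmodType) (D : W -> Prop) (n : W -> R) (m : HL2 R -> W) :=
  loc (fun k v w => [/\ D (m v), n (m v) <= k & n (m v - m w) <= k * h1 (v - w)]).

Definition lipS := @lipG R (fun _ => True) Num.norm.
Definition lip1 := @lipG (L2 R) (sobolev 1) (@n1 R).
Definition lip0 := @lipG (L2 R) (fun _ => True) (@N0 R).

Lemma h1_ge0 u : 0 <= h1 u. Proof. by apply: hn_ge0; exact: n1_ge0. Qed.

(** One proof for products of scalars, scaling, inner products and multiplication. The difference
    splits into two terms of size [C a b] times the distance, whence the factor 2. *)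
Lemma lipG_bilin (W1 W2 W3 : zmodType) D1 D2 (D3 : W3 -> Prop) m1n m2n m3n
    (B : W1 -> W2 -> W3) (C : R) (m1 : HL2 R -> W1) (m2 : HL2 R -> W2) :
  0 <= C -> (forall x, 0 <= m1n x) -> (forall x, 0 <= m2n x) ->
  (forall x y, D1 x -> D1 y -> D1 (x - y)) -> (forall x y, D2 x -> D2 y -> D2 (x - y)) ->
  (forall x y, D1 x -> D2 y -> D3 (B x y) /\ m3n (B x y) <= C * m1n x * m2n y) ->
  (forall x y, D3 x -> D3 y -> m3n (x + y) <= m3n x + m3n y) ->
  (forall x x' y y', D1 x -> D1 x' -> D2 y -> D2 y' ->
    B x y - B x' y' = B (x - x') y + B x' (y - y')) ->
  lipG D1 m1n m1 -> lipG D2 m2n m2 -> lipG D3 m3n (fun v => B (m1 v) (m2 v)).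
Proof.
move=> C0 n10 n20 D1B D2B BC n3D BB.
apply: (@loc2 (fun a b => 2 * C * a * b)) => [a b a0 b0|]; first by rewrite !mulr_ge0.
move=> a b v w a0 b0 Uv Uw [Dv av lv] [Dw aw _] [D'v bv l'v] [D'w bw _].
have h0 := h1_ge0 (v - w).
have [D3v Bv] := BC _ _ Dv D'v.
split=> //.
  apply: (le_trans Bv); have : C * m1n (m1 v) * m2n (m2 v) <= C * a * b.
    by apply: ler_pM => //; rewrite ?mulr_ge0//; exact: ler_wpM2l.
  have : 0 <= C * a * b by rewrite !mulr_ge0.
  lra.
rewrite BB//.
have [e1 f1] := BC _ _ (D1B _ _ Dv Dw) D'v; have [e2 f2] := BC _ _ Dw (D2B _ _ D'v D'w).
apply: (le_trans (n3D _ _ e1 e2)).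
have g1 : m3n (B (m1 v - m1 w) (m2 v)) <= C * (a * h1 (v - w)) * b.
  apply: (le_trans f1); apply: ler_pM => //; rewrite ?mulr_ge0//; exact: ler_wpM2l.
have g2 : m3n (B (m1 w) (m2 v - m2 w)) <= C * a * (b * h1 (v - w)).
  apply: (le_trans f2); apply: ler_pM => //; rewrite ?mulr_ge0//; exact: ler_wpM2l.
lra.
Qed.

Lemma lipG_add (W : zmodType) (D : W -> Prop) (n : W -> R) m m' :
  (forall x y, D x -> D y -> D (x + y) /\ n (x + y) <= n x + n y) ->
  (forall x y, D x -> D y -> D (x - y)) ->
  lipG D n m -> lipG D n m' -> lipG D n (fun v => m v + m' v).
Proof.
move=> nD DB; apply: (@loc2 (fun a b => a + b)) => [a b a0 b0|]; first exact: addr_ge0.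
move=> a b v w a0 b0 Uv Uw [Dv av lv] [Dw aw _] [D'v bv l'v] [D'w bw _].
have [Dp np] := nD _ _ Dv D'v.
split=> //; first by apply: (le_trans np); exact: lerD.
rewrite opprD addrACA.
have [_ np'] := nD _ _ (DB _ _ Dv Dw) (DB _ _ D'v D'w).
by apply: (le_trans np'); rewrite mulrDl lerD.
Qed.

Lemma lipG_cst (W : zmodType) (D : W -> Prop) (n : W -> R) (c : W) :
  D c -> n 0 = 0 -> lipG D n (fun _ => c).
Proof.
move=> Dc n0 u Uu; exists 1, `|n c|; split=> // v w _ _ _ _; split=> //.
  exact: ler_norm.
by rewrite subrr n0 mulr_ge0// h1_ge0.
Qed.

Lemma sob1B (z y : L2 R) : sobolev 1 z -> sobolev 1 y -> sobolev 1 (z - y).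
Proof. by move=> sz /(sob1Z (-1))[sy _]; rewrite -scaleN1r; exact: sob1D. Qed.

Lemma lipS_mul a b : lipS a -> lipS b -> lipS (fun v => a v * b v).
Proof.
apply: (@lipG_bilin R R R _ _ _ _ _ _ *%R 1) => //.
- by move=> x y _ _; rewrite mul1r normrM.
- by move=> x y _ _; exact: ler_normD.
- by move=> x x' y y' _ _ _ _; ring.
Qed.

Lemma lipS_add a b : lipS a -> lipS b -> lipS (fun v => a v + b v).
Proof. by apply: lipG_add => // x y _ _; split=> //; exact: ler_normD. Qed.

Lemma lipS_cst (c : R) : lipS (fun _ => c).
Proof. by apply: lipG_cst => //; rewrite normr0. Qed.

Lemma half_bound (x y : R) : `|y - x| <= `|x| / 2 -> `|x| / 2 <= `|y|.
Proof. by have := lerB_dist x y; rewrite distrC; lra. Qed.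

Lemma lipS_inv a : (forall u, U u -> a u != 0) -> lipS a -> lipS (fun v => (a v)^-1).
Proof.
move=> a0 La u Uu; have [d [k [d0 k0 H]]] := La u Uu.
have au0 : 0 < `|a u| by rewrite normr_gt0 a0.
(* Within this radius [a v] stays within [|a u| / 2] of [a u], so inverses are at most [2 / |a u|];
   [k + 1] avoids a vanishing denominator. *)
pose d' := Num.min d (`|a u| / (2 * (k + 1))).
have k1 : 0 < k + 1 by rewrite ltr_wpDl.
exists d', (Num.max (2 / `|a u|) (k * (2 / `|a u|) ^+ 2)); split.
- by rewrite lt_min d0 divr_gt0// mulr_gt0.
- by rewrite le_max divr_ge0.
have N v : U v -> h1 (v - u) < d' -> h1 (v - u) < d /\ `|a u| / 2 <= `|a v|.
  move=> Uv /lt_min2[vd vd']; split=> //.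
  have uu : h1 (u - u) < d.
    suff -> : h1 (u - u) = 0 by [].
    rewrite hnE big1// => i _; rewrite cpB subrr.
    by have := n1Z 0 (@sob1_0 R); rewrite scale0r normr0 mul0r.
  have [_ _ l] := H v u Uv Uu vd uu.
  have : k * h1 (v - u) <= `|a u| / 2.
    have : (k + 1) * h1 (v - u) <= `|a u| / 2.
      by move: vd'; rewrite invfM mulrA ltr_pdivlMr// mulrC => /ltW.
    by apply: le_trans; apply: ler_wpM2r; [exact: h1_ge0|rewrite lerDl].
  by move=> kh; exact: half_bound (le_trans l kh).
move=> v w Uv Uw vd wd; have [vd' av] := N v Uv vd; have [wd' aw] := N w Uw wd.
have [_ _ l] := H v w Uv Uw vd' wd'.
have h2 : 0 < `|a u| / 2 by rewrite divr_gt0.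
have E : (2 / `|a u|) = (`|a u| / 2)^-1 by rewrite invf_div.
have iv x : U x -> `|a u| / 2 <= `|a x| -> `|(a x)^-1| <= 2 / `|a u|.
  by move=> Ux ax; rewrite E normfV lef_pV2 ?posrE// normr_gt0 a0.
split=> //; first by rewrite le_max iv.
have -> : (a v)^-1 - (a w)^-1 = (a w - a v) * ((a v)^-1 * (a w)^-1).
  by have := a0 v Uv; have := a0 w Uw => h h'; field; rewrite h h'.
apply: (@le_trans _ _ (k * (2 / `|a u|) ^+ 2 * h1 (v - w))); last first.
  by rewrite ler_wpM2r ?h1_ge0// le_max lexx orbT.
rewrite normrM distrC mulrAC; apply: ler_pM => //.
by rewrite normrM expr2; apply: ler_pM => //; exact: iv.
Qed.

Lemma lip1_cp i : lip1 (fun v => cp v i).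
Proof.
move=> u Uu; exists 1, (h1 u + 1); split=> //; first by rewrite addr_ge0 ?h1_ge0.
move=> v w Uv Uw vd wd; have /domE sv := U1 Uv; have /domE sw := U1 Uw.
have /domE su := U1 Uu.
split=> //.
  have -> : cp v i = cp u i + cp (v - u) i by rewrite cpB addrC subrK.
  apply: le_trans (n1D _ _) _ => //; first by rewrite cpB; exact: sob1B.
  by apply: lerD; [exact: cp_hn n1_ge0|apply: le_trans (ltW vd); exact: cp_hn n1_ge0].
rewrite -cpB; apply: (le_trans (cp_hn (v - w) i (@n1_ge0 R))).
by rewrite ler_peMl ?h1_ge0// lerDr h1_ge0.
Qed.

Lemma lip1_lip0 m : lip1 m -> lip0 m.
Proof.
move=> L; apply: (@loc1 id _ _ _ _ L); first by [].
move=> a v w a0 Uv Uw [_ mv lv] _; split; first by [].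
- exact: le_trans (N0_n1 _) mv.
- exact: le_trans (N0_n1 _) lv.
Qed.

Lemma lip0_dcp i : lip0 (fun v => L2diff (cp v i)).
Proof.
apply: (@loc1 id _ _ _ _ (lip1_cp i)); first by [].
move=> a v w a0 Uv Uw [sv mv lv] [sw _ _]; split; first by [].
- exact: le_trans (N0d_n1 _) mv.
- have -> : L2diff (cp v i) - L2diff (cp w i) = L2diff (cp v i - cp w i).
    have [sN [dN _]] := sob1Z (-1) sw.
    rewrite !scaleN1r in sN dN.
    by rewrite -dN -L2diffD.
  exact: le_trans (N0d_n1 _) lv.
Qed.

Lemma lip1_add m m' : lip1 m -> lip1 m' -> lip1 (fun v => m v + m' v).
Proof.
apply: lipG_add => // x y; first exact: sob_sub1.
exact: sob1B.
Qed.

Lemma lip1_scale a m : lipS a -> lip1 m -> lip1 (fun v => a v *: m v).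
Proof.
apply: (@lipG_bilin R (L2 R) (L2 R) _ _ _ _ _ _ (fun a z => a *: z) 1) => //.
- exact: n1_ge0.
- exact: sob1B.
- by move=> x y _ sy; rewrite mul1r n1Z//; split=> //; exact: (sob1Z x sy).1.
- exact: n1D.
- by move=> x x' y y' _ _ _ _; rewrite scalerBl scalerBr addrA subrK.
Qed.

Lemma pr_subl (z z' y : L2 R) c : essb c y -> pr (z - z') y = pr z y - pr z' y.
Proof. by move=> yc; rewrite -[- z']scaleN1r addrC (pr_linl _ _ _ yc) scaleN1r addrC. Qed.

Lemma lipS_dot m m' : lip0 m -> lip0 m' -> lipS (fun v => L2dot (m v) (m' v)).
Proof.
apply: (@lipG_bilin (L2 R) (L2 R) R _ _ _ _ _ _ (@L2dot R) 1) => //.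
- exact: N0_ge0.
- exact: N0_ge0.
- by move=> x y _ _; rewrite mul1r; split=> //; exact: L2dot_CS.
- by move=> x y _ _; exact: ler_normD.
- by move=> x x' y y' _ _ _ _; rewrite L2dotD L2dotDr L2dotN L2dotNr; ring.
Qed.

End families.

(** * Superposition operators *)

Section superposition.
Context {R : realType}.
Variable U : set (HL2 R).
Hypothesis U1 : forall u, U u -> H_ 1 u.
Notation T := (measurableTypeR R).
Implicit Types (u v w : HL2 R).
Local Hint Resolve mI01 : core.

(** The loop [z] as a path in [V3]. Its time coordinate is frozen at 0, because the reduced
    functional uses the coefficients of the form at time 0 only. *)
Definition gamx v (i : 'I_3) : T -> R :=
  match val i with 0%N => cst 0 | 1%N => loop (cp v o0) | _ => loop (cp v o1) end.
Definition gamd v (i : 'I_3) : T -> R :=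
  match val i with 0%N => cst 0 | 1%N => L2fun (L2diff (cp v o0))
                 | _ => L2fun (L2diff (cp v o1)) end.
Definition gam v (t : R) : V3 R := mk3 (gamx v) t.

Lemma gam_acl v i : H_ 1 v -> acl (gamx v i) (gamd v i).
Proof.
move=> /domE sv; rewrite /gamx /gamd; case: (val i) => [|[|_]].
- exact: acl_cst.
- by have [] := sob1P (sv o0).
- by have [] := sob1P (sv o1).
Qed.

Lemma gamE v t : gam v t = (0, (loop (cp v o0) t, loop (cp v o1) t)).
Proof. by []. Qed.

Lemma loopB (z y : L2 R) (t : R) : sobolev 1 z -> sobolev 1 y -> 0 <= t <= 1 ->
  loop (z - y) t = loop z t - loop y t.
Proof.
move=> sz sy t01; have [sN [_ lN]] := sob1Z (-1) sy; rewrite scaleN1r in sN lN.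
have := sob1_lin 1 sz sN; rewrite scale1r => -[_ _ /(_ t t01) ->].
by rewrite lN// mul1r mulN1r.
Qed.

Lemma gamB v w t : H_ 1 v -> H_ 1 w -> 0 <= t <= 1 -> `|gam v t - gam w t| <= h1 (v - w).
Proof.
move=> /domE sv /domE sw t01; apply: (le_trans (norm_co _)).
rewrite sum3 !coD !coN !co_mk3 /gamx/= subrr normr0 add0r.
rewrite -(loopB (sv o0) (sw o0) t01) -(loopB (sv o1) (sw o1) t01) -!cpB.
rewrite hnE sum4; apply: lerD.
  by apply: loop_sup => //; rewrite cpB; apply: sob1B.
apply: (@le_trans _ _ (n1 (cp (v - w) o1))).
  by apply: loop_sup => //; rewrite cpB; apply: sob1B.
by rewrite lerDl addr_ge0 ?n1_ge0.
Qed.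

Lemma gam_compact v : H_ 1 v -> compact (gam v @` (I01 : set R)).
Proof. by move=> sv; apply: mk3_compact => i; exact: ac_cont (gam_acl i sv).1. Qed.

Variable O : set (V3 R).
Hypothesis oO : open O.
Hypothesis UO : forall v, U v -> forall t : R, 0 <= t <= 1 -> O (gam v t).
Implicit Types (g : V3 R -> R^o).

(** The superposition (Nemytskii) operator of [g]. *)
Definition sup g v : L2 R := toL2 (fun t => g (gam v t) : R).

Lemma sup_sqi k g v : U v -> sm k O g -> sqi (fun t => g (gam v t) : R).
Proof.
move=> Uv sg; apply: sqi_cont; apply: path_cont sg _; last exact: UO.
by move=> i; exact: ac_cont (gam_acl i (U1 Uv)).1.
Qed.

(** Locally Lipschitz into L^infinity, as required of a factor that multiplies an L^2 function. *)
Definition lipB (m : HL2 R -> L2 R) := loc U (fun k v w =>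
  essb k (m v) /\ essb (k * h1 (v - w)) (m v - m w)).

(** Loops close to [u] in [H_1] are uniformly close to it, so they remain in a neighbourhood of the
    compact image of [u] on which [g] has one Lipschitz constant. *)
Lemma sup_lipB g : sm 1 O g -> lipB (sup g).
Proof.
move=> sg u Uu; have KO : gam u @` (I01 : set R) `<=` O.
  by move=> _ [t + <-]; rewrite /= in_itv; exact: UO.
have [d [C [d0 C0 lg]]] := sm_ulip oO (gam_compact (U1 Uu)) KO sg.
exists d, C; split=> // v w Uv Uw vd wd.
have ev := toL2E (sup_sqi Uv sg); have ew := toL2E (sup_sqi Uw sg).
have H t : 0 <= t <= 1 -> [/\ O (gam v t), `|g (gam v t)| <= C &
    `|g (gam v t) - g (gam w t)| <= C * `|gam v t - gam w t|].
  move=> t01; apply: (lg (gam u t)); first by exists t => //; rewrite /= in_itv.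
  - by apply: le_lt_trans vd; apply: gamB => //; exact: U1.
  - by apply: le_lt_trans wd; apply: gamB => //; exact: U1.
split.
  by apply: ae01S ev => t; rewrite I01E /sup => /H[_ + _] ->.
have := ae01I (ae01I ev ew) (ae01I (L2funD (sup g v) (- sup g w)) (L2funZ (-1) (sup g w))).
rewrite scaleN1r; apply: ae01S => t; rewrite I01E => t01 [[e1 e2] [-> ->]].
rewrite /sup e1 e2 mulN1r; have [_ _ l] := H t t01; apply: (le_trans l).
by apply: ler_wpM2l => //; apply: gamB => //; exact: U1.
Qed.

Lemma essb_N0 (z : L2 R) c : 0 <= c -> essb c z -> N0 z <= c.
Proof.
move=> c0 zc; have := @N0_mul_bd R z (cst 1) z c (sqi_cst 1) zc.
have -> : N0 (toL2 (cst 1) : L2 R) = 1.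
  apply/eqP; rewrite -(@eqrXn2 _ 2)// ?N0_ge0// N0_toL2; last exact: sqi_cst.
  by rewrite (_ : (fun t => _) = cst (1 ^+ 2))// it_cst// subr0 mulr1.
rewrite mulr1; apply => //; apply: ae01W => t _; by rewrite mul1r.
Qed.

Lemma lipB_lip0 m : lipB m -> lip0 U m.
Proof.
move=> L; apply: (@loc1 _ _ id _ _ _ _ L); first by [].
move=> a v w a0 Uv Uw [e1 e2] _; split; first by [].
- exact: essb_N0.
- by apply: essb_N0 => //; rewrite mulr_ge0// h1_ge0.
Qed.

Lemma pr_subr (x y y' : L2 R) c c' : essb c y -> essb c' y' -> pr x (y - y') = pr x y - pr x y'.
Proof.
move=> yc yc'; have := pr_linr (-1) x yc' yc; rewrite !scaleN1r [_ + y]addrC => ->.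
by rewrite addrC.
Qed.

Lemma lipB_pr z m : lip0 U z -> lipB m -> lip0 U (fun v => pr (z v) (m v)).
Proof.
apply: (@loc2 _ _ (fun a b => 2 * a * b)); first by move=> a b a0 b0; rewrite !mulr_ge0.
move=> a b v w a0 b0 Uv Uw [_ zv lv] [_ zw _] [mv lm] [mw _].
have hh := h1_ge0 (v - w).
split; first by [].
  apply: (le_trans (N0_pr _ b0 mv)); rewrite mulrC.
  apply: (@le_trans _ _ (a * b)); first exact: ler_wpM2r.
  by rewrite -mulrA ler_peMl ?mulr_ge0// ler1n.
have -> : pr (z v) (m v) - pr (z w) (m w) = pr (z v - z w) (m v) + pr (z w) (m v - m w).
  by rewrite (pr_subl _ _ mv) (pr_subr _ mv mw) addrA subrK.
apply: (le_trans (N0D _ _)).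
have e1 : N0 (pr (z v - z w) (m v)) <= b * (a * h1 (v - w)).
  by apply: (le_trans (N0_pr _ b0 mv)); exact: ler_wpM2l.
have e2 : N0 (pr (z w) (m v - m w)) <= b * h1 (v - w) * a.
  by apply: (le_trans (N0_pr _ (mulr_ge0 b0 hh) lm)); apply: ler_wpM2l => //; exact: mulr_ge0.
apply: (le_trans (lerD e1 e2)).
by move: (h1 _) => h; rewrite le_eqVlt; apply/orP; left; apply/eqP; ring.
Qed.

Lemma lip1_of_lip0 m : (forall v, U v -> sobolev 1 (m v)) -> lip0 U m ->
  lip0 U (fun v => L2diff (m v)) -> lip1 U m.
Proof.
move=> sm; apply: (@loc2 _ _ (fun a b => a + b)); first by move=> a b *; exact: addr_ge0.
move=> a b v w a0 b0 Uv Uw [_ zv lv] _ [_ mv lm] _; split; first exact: sm.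
  by rewrite n1E lerD.
have [sN [dN _]] := sob1Z (-1) (sm _ Uw); rewrite !scaleN1r in sN dN.
by rewrite n1E mulrDl (L2diffD (sm _ Uv) sN) dN lerD.
Qed.

Lemma h1_subrr v : h1 (v - v) = 0.
Proof.
rewrite hnE big1// => i _; rewrite cpB subrr.
by have := n1Z 0 (@sob1_0 R); rewrite scale0r normr0 mul0r.
Qed.

Lemma lipB_essb m v : lipB m -> U v -> exists c, essb c (m v).
Proof.
move=> L Uv; have [d [k [d0 _ H]]] := L v Uv; exists k.
by have [] := H v v Uv Uv; rewrite ?h1_subrr.
Qed.

Lemma sup_sob1 g (G : 'I_3 -> V3 R -> R^o) v : U v -> grad_on O g G -> (forall i, sm 1 O (G i)) ->
  [/\ sobolev 1 (sup g v),
      L2diff (sup g v) = pr (L2diff (cp v o0)) (sup (G i1) v) + pr (L2diff (cp v o1)) (sup (G i2) v) &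
      forall t : R, 0 <= t <= 1 -> loop (sup g v) t = g (gam v t)].
Proof.
move=> Uv gG sG.
have ac1 := chain oO (fun i => (gam_acl i (U1 Uv)).1) (UO Uv) gG sG.
have a1 : acl (fun t => g (gam v t) : R) (fun t => \sum_i G i (gam v t) * gamd v i t).
  split; first exact: ac1.
  congr g; rewrite !gamE; have /domE sv := U1 Uv.
  have [[_ l0] _] := sob1P (sv o0); have [[_ l1] _] := sob1P (sv o1).
  by rewrite l0 l1.
have [s d l] := sob1_toL2 a1; split=> //.
have [c1 e1] := lipB_essb (sup_lipB (sG i1)) Uv.
have [c2 e2] := lipB_essb (sup_lipB (sG i2)) Uv.
rewrite /sup d; apply: toL2_uniq.
have A1 := ae01I (prE (L2diff (cp v o0)) e1) (prE (L2diff (cp v o1)) e2).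
have A2 := ae01I (toL2E (sup_sqi Uv (sG i1))) (toL2E (sup_sqi Uv (sG i2))).
have A3 := L2funD (pr (L2diff (cp v o0)) (sup (G i1) v)) (pr (L2diff (cp v o1)) (sup (G i2) v)).
apply: ae01S (ae01I A3 (ae01I A1 A2)) => t _ [-> [[-> ->] [f1 f2]]].
by rewrite /sup f1 f2 sum3 /gamd/= mulr0 add0r mulrC [X in _ + X]mulrC.
Qed.

(** The derivative of [g o z] is [z'] times the gradient of [g] along [z]. The first factor is
    Lipschitz into L^2 and the second into L^infinity, which takes one derivative of [g] more. *)
Lemma sup_lip1 g : sm 2 O g -> lip1 U (sup g).
Proof.
move=> sg2; have [G gG sG] := sg2.
have sg1 : sm 1 O g by exact: smS.
apply: lip1_of_lip0.
- by move=> v Uv; have [] := sup_sob1 Uv gG sG.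
- by apply: lipB_lip0; exact: sup_lipB.
- have L : lip0 U (fun v => pr (L2diff (cp v o0)) (sup (G i1) v) + pr (L2diff (cp v o1)) (sup (G i2) v)).
    apply: lipG_add; first by move=> x y _ _; split=> //; exact: N0D.
    + by [].
    + by apply: lipB_pr; [exact: lip0_dcp|exact: sup_lipB].
    + by apply: lipB_pr; [exact: lip0_dcp|exact: sup_lipB].
  move=> u Uu; have [d [k [d0 k0 H]]] := L u Uu; exists d, k; split=> //.
  move=> v w Uv Uw vd wd; have := H v w Uv Uw vd wd.
  have [_ -> _] := sup_sob1 Uv gG sG; have [_ -> _] := sup_sob1 Uw gG sG; exact.
Qed.

End superposition.

(** * Multipliers and operator entries subject to (C) *)

Section operators.
Context {R : realType}.
Variable U : set (HL2 R).
Hypothesis U1 : forall u, U u -> H_ 1 u.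
Implicit Types (u v w : HL2 R) (m : HL2 R -> L2 R).

(* The right hand side of condition (C), in norms equivalent to those of H_k. *)
Definition gap v w : R := h2 (v - w) + Num.min (h2 v) (h2 w) * h1 (v - w).

(* The admissible multipliers: locally Lipschitz into L^2 on U, and with the
   estimate (C) in W^{1,2} at points of H_2. *)
Definition nice m := lip0 U m /\ loc U (fun k v w => H_ 2 v -> H_ 2 w ->
  sobolev 1 (m v) /\ n1 (m v - m w) <= k * gap v w).

Lemma h2_ge0 u : 0 <= h2 u. Proof. by apply: hn_ge0; exact: n2_ge0. Qed.

Lemma h1_h2 u : h1 u <= h2 u.
Proof. by rewrite !hnE; apply: ler_sum => i _; exact: n1_n2. Qed.

Lemma min_ge0 (a b : R) : 0 <= a -> 0 <= b -> 0 <= Num.min a b.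
Proof. by rewrite le_min => -> ->. Qed.

Lemma h1_gap v w : h1 (v - w) <= gap v w.
Proof.
apply: (le_trans (h1_h2 _)); rewrite /gap lerDl; apply: mulr_ge0; last exact: h1_ge0.
by apply: min_ge0; exact: h2_ge0.
Qed.

Lemma gap_ge0 v w : 0 <= gap v w.
Proof. exact: le_trans (h1_ge0 _) (h1_gap v w). Qed.

Lemma nice_lip1 m : lip1 U m -> nice m.
Proof.
move=> L; split; first exact: lip1_lip0.
apply: (@loc1 _ _ id _ _ _ _ L); first by [].
move=> a v w a0 Uv Uw [sv mv lv] _ _ _; split; first by [].
by apply: (le_trans lv); apply: ler_wpM2l => //; exact: h1_gap.
Qed.

Lemma nice_add m m' : nice m -> nice m' -> nice (fun v => m v + m' v).
Proof.
move=> [L0 L1] [L0' L1']; split.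
  by apply: lipG_add; [move=> x y _ _; split=> //; exact: N0D|by []|exact: L0|exact: L0'].
apply: (@loc2 _ _ (fun a b => a + b) _ _ _ _ _ L1 L1'); first by move=> a b *; exact: addr_ge0.
move=> a b v w a0 b0 Uv Uw p pw p' pw' v2 w2.
have [sv lv] := p v2 w2; have [sv' lv'] := p' v2 w2.
have [sw _] := pw w2 v2; have [sw' _] := pw' w2 v2.
split; first exact: sob1D.
rewrite opprD addrACA mulrDl; apply: (le_trans (n1D _ _)); rewrite ?lerD//; exact: sob1B.
Qed.

Lemma H2_sob v i : H_ 2 v -> sobolev 1 (cp v i) /\ sobolev 1 (L2diff (cp v i)).
Proof. by move=> /domE/(_ i)/sob2E. Qed.

Lemma min_arith (k X p q g2 a : R) : 0 <= k -> 0 <= a ->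
  X <= 2 * (k * a) * p + 2 * k * g2 -> X <= 2 * (k * a) * q + 2 * k * g2 ->
  X <= 2 * k * (g2 + Num.min p q * a).
Proof.
move=> k0 a0 X1 X2.
by rewrite /Num.min; case: ifP => _; [apply: (le_trans X1)|apply: (le_trans X2)];
  rewrite le_eqVlt; apply/orP; left; apply/eqP; ring.
Qed.

(** The minimum in (C) comes from splitting the difference of [v' b(v)] and [w' b(w)] in two ways:
    the factor that is not subtracted, and so carries a second derivative, can be [v'] or [w']. *)
Lemma nice_prd b i : lip1 U b -> nice (fun v => pr (L2diff (cp v i)) (b v)).
Proof.
move=> L; split.
  have := @lipG_bilin R U (L2 R) (L2 R) (L2 R) (fun _ => True) (sobolev 1) (fun _ => True)
    (@N0 R) (@n1 R) (@N0 R) (@pr R) 1 (fun v => L2diff (cp v i)) b.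
  apply => //.
  - exact: N0_ge0.
  - exact: n1_ge0.
  - exact: sob1B.
  - by move=> x y _ sy; split=> //; rewrite mul1r mulrC; exact: N0_pr1.
  - by move=> x y _ _; exact: N0D.
  - move=> x x' y y' _ _ sy sy'.
    by rewrite (pr_subl _ _ (sob1_essb sy)) (pr_subr _ (sob1_essb sy) (sob1_essb sy')) addrA subrK.
  - exact: lip0_dcp.
apply: (@loc1 _ _ (fun a => 2 * a) _ _ _ _ L); first by move=> a a0; rewrite mulr_ge0.
move=> a v w a0 Uv Uw [sv bv lv] [sw bw _] v2 w2.
have [zv dzv] := H2_sob i v2; have [zw dzw] := H2_sob i w2.
split; first by have [] := pr_sob1 dzv sv.
have Ed : L2diff (cp v i) - L2diff (cp w i) = L2diff (cp (v - w) i).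
  have [sN [dN _]] := sob1Z (-1) zw; rewrite !scaleN1r in sN dN.
  by rewrite cpB (L2diffD zv sN) dN.
have n2d x : n1 (L2diff (cp x i)) <= h2 x.
  by apply: (le_trans (n1d_n2 _)); apply: cp_hn; exact: n2_ge0.
have hh := h1_ge0 (v - w).
have E1 : pr (L2diff (cp v i)) (b v) - pr (L2diff (cp w i)) (b w) =
  pr (L2diff (cp v i)) (b v - b w) + pr (L2diff (cp (v - w) i)) (b w).
  rewrite -Ed (pr_subr _ (sob1_essb sv) (sob1_essb sw)).
  by rewrite (pr_subl _ _ (sob1_essb sw)) addrA subrK.
have E2 : pr (L2diff (cp v i)) (b v) - pr (L2diff (cp w i)) (b w) =
  pr (L2diff (cp w i)) (b v - b w) + pr (L2diff (cp (v - w) i)) (b v).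
  rewrite -Ed (pr_subr _ (sob1_essb sv) (sob1_essb sw)).
  by rewrite (pr_subl _ _ (sob1_essb sv)) [RHS]addrC addrA subrK.
have sB := sob1B sv sw; have dzB : sobolev 1 (L2diff (cp (v - w) i)) by rewrite -Ed; exact: sob1B.
have B x c : sobolev 1 (L2diff (cp x i)) -> sobolev 1 c -> n1 c <= a ->
  n1 (pr (L2diff (cp x i)) (b v - b w) + pr (L2diff (cp (v - w) i)) c) <=
  2 * (a * h1 (v - w)) * h2 x + 2 * a * h2 (v - w).
  move=> sx sc ca; have [s1 _ _] := pr_sob1 sx sB; have [s2 _ _] := pr_sob1 dzB sc.
  apply: (le_trans (n1D s1 s2)); apply: lerD.
    apply: (le_trans (n1_pr sx sB)); rewrite mulrAC.
    apply: ler_pM; [by rewrite mulr_ge0 ?n1_ge0|exact: n1_ge0| |exact: n2d].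
    exact: ler_wpM2l.
  apply: (le_trans (n1_pr dzB sc)); rewrite mulrAC.
  apply: ler_pM; [by rewrite mulr_ge0 ?n1_ge0|exact: n1_ge0| |exact: n2d].
  exact: ler_wpM2l.
apply: min_arith => //.
  by rewrite E1; exact: B.
by rewrite E2; exact: B.
Qed.

Variables (r : R) (C : R).
Definition Nr (x : L2 R) : R := Num.sqrt (frac_sobolev_sqnorm r x).
Hypothesis C0 : 0 <= C.
Hypothesis frac_essb : forall x, frac_sobolev r x -> essb (C * Nr x) x.
Hypothesis N0_Nr : forall x : L2 R, frac_sobolev r x -> N0 x <= Nr x.

Lemma Nr_ge0 x : 0 <= Nr x. Proof. exact: sqrtr_ge0. Qed.

(* The admissible entries of K.  The four clauses yield linearity, continuity
   into L(H_r, H_0), boundedness on H_1 at points of H_2, and (C). *)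
Definition opnice (T : HL2 R -> L2 R -> L2 R) := [/\
  forall v, U v -> forall (a : R) (z y : L2 R),
    (frac_sobolev r z /\ frac_sobolev r y) \/ (sobolev 1 z /\ sobolev 1 y) ->
    T v (a *: z + y) = a *: T v z + T v y,
  loc U (fun k v w => forall x, frac_sobolev r x ->
    N0 (T v x) <= k * Nr x /\ N0 (T v x - T w x) <= k * h1 (v - w) * Nr x),
  forall v, U v -> H_ 2 v -> (forall x, sobolev 1 x -> sobolev 1 (T v x)) /\
    exists M : R, forall x, sobolev 1 x -> n1 (T v x) <= M * n1 x &
  loc U (fun k v w => H_ 2 v -> H_ 2 w -> forall x, sobolev 1 x ->
    n1 (T v x - T w x) <= k * gap v w * n1 x)].

Lemma d_v v (d : R) : 0 < d -> h1 (v - v) < d.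
Proof. by rewrite h1_subrr. Qed.

Lemma opnice_mult m : nice m -> opnice (fun v x => pr (m v) x).
Proof.
move=> [L0 L1]; split.
- move=> v Uv a z y [[fz fy]|[sz sy]].
    exact: pr_linr (frac_essb fz) (frac_essb fy).
  exact: pr_linr (sob1_essb sz) (sob1_essb sy).
- apply: (@loc1 _ _ (fun a => C * a) _ _ _ _ L0); first by move=> a a0; exact: mulr_ge0.
  move=> a v w a0 Uv Uw [_ mv lv] _ x fx.
  have xb := frac_essb fx; have CN : 0 <= C * Nr x by rewrite mulr_ge0 ?Nr_ge0.
  split.
    apply: (le_trans (N0_pr _ CN xb)); rewrite [leRHS]mulrAC.
    exact: ler_wpM2l.
  have -> : C * a * h1 (v - w) * Nr x = C * Nr x * (a * h1 (v - w)).
    by move: (h1 _) (Nr x) => h N; ring.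
  rewrite -(pr_subl _ _ xb).
  by apply: (le_trans (N0_pr _ CN xb)); apply: ler_wpM2l.
- move=> v Uv v2; have [d [k [d0 k0 H]]] := L1 v Uv.
  have [sm _] := H v v Uv Uv (d_v v d0) (d_v v d0) v2 v2.
  split=> [x sx|]; first by have [] := pr_sob1 sm sx.
  by exists (2 * n1 (m v)) => x sx; exact: n1_pr.
- apply: (@loc1 _ _ (fun a => 2 * a) _ _ _ _ L1); first by move=> a a0; rewrite mulr_ge0.
  move=> a v w a0 Uv Uw p pw v2 w2 x sx.
  have [sv lv] := p v2 w2; have [sw _] := pw w2 v2.
  rewrite -(pr_subl _ _ (sob1_essb sx)); apply: (le_trans (n1_pr (sob1B sv sw) sx)).
  by apply: ler_wpM2r; [exact: n1_ge0|rewrite -mulrA; apply: ler_wpM2l].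
Qed.

Lemma dbl_arith (a b X : R) : 0 <= a -> 0 <= b -> 0 <= X -> a * X * b <= 2 * a * b * X.
Proof.
move=> a0 b0 X0; have := mulr_ge0 (mulr_ge0 a0 b0) X0; lra.
Qed.

(** Both [p] and [e] are Lipschitz into W^{1,2} for the [H_1] distance, which is dominated by the
    right hand side of (C); the functional [L2dot (p v)] is controlled by the L^2 norm of its
    argument. *)
Lemma opnice_rank1 p e : lip1 U p -> lip1 U e -> opnice (fun v x => L2dot (p v) x *: e v).
Proof.
move=> Lp Le.
(* One estimate for both target norms: [n] is [N0] with [h] the [H_1] distance, and later [n1] with
   [h] the gap. *)
have aux (a b h X : R) (D : L2 R -> Prop) (n : L2 R -> R) v w x : 0 <= a -> 0 <= b ->
   0 <= h -> N0 x <= X -> (forall z, 0 <= n z) ->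
   (forall z y, D z -> D y -> n (z + y) <= n z + n y) ->
   (forall c z, D z -> D (c *: z)) -> (forall c z, D z -> n (c *: z) = `|c| * n z) ->
   N0 (p w) <= a -> N0 (p v - p w) <= a * h -> D (e v) -> D (e v - e w) ->
   n (e v) <= b -> n (e v - e w) <= b * h ->
   n (L2dot (p v) x *: e v - L2dot (p w) x *: e w) <= 2 * a * b * h * X.
  move=> a0' b0 h0 xX n0 nD DZ nZ pw lp De De' ev le.
  have X0 : 0 <= X by apply: le_trans xX; exact: N0_ge0.
  have -> : L2dot (p v) x *: e v - L2dot (p w) x *: e w =
    L2dot (p v - p w) x *: e v + L2dot (p w) x *: (e v - e w).
    by rewrite L2dotD L2dotN scalerBr scalerBl addrA subrK.
  apply: (le_trans (nD _ _ (DZ _ _ De) (DZ _ _ De'))); rewrite !nZ//.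
  have t1 : `|L2dot (p v - p w) x| * n (e v) <= a * h * X * b.
    apply: ler_pM => //; apply: (le_trans (L2dot_CS _ _)).
    by apply: ler_pM => //; exact: N0_ge0.
  have t2 : `|L2dot (p w) x| * n (e v - e w) <= a * X * (b * h).
    apply: ler_pM => //; apply: (le_trans (L2dot_CS _ _)).
    by apply: ler_pM => //; exact: N0_ge0.
  apply: (le_trans (lerD t1 t2)).
  by rewrite le_eqVlt; apply/orP; left; apply/eqP; ring.
split.
- by move=> v Uv a z y _; rewrite L2dotDr L2dotZr scalerDl scalerA.
- apply: (@loc2 _ _ (fun a b => 2 * a * b) _ _ _ _ _ Lp Le); first by move=> a b *; rewrite !mulr_ge0.
  move=> a b v w a0 b0 Uv Uw [sv pv lv] [_ pw _] [tv ev l'v] [tw ew _] x fx.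
  have xX := N0_Nr fx; split.
    rewrite N0Z; apply: (@le_trans _ _ (a * Nr x * b)).
      apply: ler_pM => //; first exact: N0_ge0.
        apply: (le_trans (L2dot_CS _ _)); apply: ler_pM => //; try exact: N0_ge0.
        exact: le_trans (N0_n1 _) pv.
      exact: le_trans (N0_n1 _) ev.
    exact: dbl_arith (Nr_ge0 x).
  apply: (aux a b _ _ (fun _ => True) (@N0 R)) => //; rewrite ?h1_ge0//.
  - exact: N0_ge0.
  - by move=> z y _ _; exact: N0D.
  - by move=> c z _; exact: N0Z.
  - exact: le_trans (N0_n1 _) pw.
  - exact: le_trans (N0_n1 _) lv.
  - exact: le_trans (N0_n1 _) ev.
  - exact: le_trans (N0_n1 _) l'v.
- move=> v Uv v2; have [d [k [d0 k0 H]]] := Le v Uv.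
  have [se _ _] := H v v Uv Uv (d_v v d0) (d_v v d0).
  split=> [x sx|]; first exact: (sob1Z _ se).1.
  exists (N0 (p v) * n1 (e v)) => x sx; rewrite (n1Z _ se) mulrAC.
  apply: ler_wpM2r; first exact: n1_ge0.
  apply: (le_trans (L2dot_CS _ _)); apply: ler_wpM2l; first exact: N0_ge0.
  exact: N0_n1.
- apply: (@loc2 _ _ (fun a b => 2 * a * b) _ _ _ _ _ Lp Le); first by move=> a b *; rewrite !mulr_ge0.
  move=> a b v w a0 b0 Uv Uw [sv pv lv] [_ pw _] [tv ev l'v] [tw ew _] v2 w2 x sx.
  have G0 := gap_ge0 v w.
  apply: (aux a b _ _ (sobolev 1) (@n1 R)) => //.
  - exact: N0_n1.
  - exact: n1_ge0.
  - exact: n1D.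
  - by move=> c z sz; exact: (sob1Z c sz).1.
  - by move=> c z; exact: n1Z.
  - exact: le_trans (N0_n1 _) pw.
  - apply: (le_trans (N0_n1 _)); apply: (le_trans lv); apply: ler_wpM2l => //; exact: h1_gap.
  - exact: sob1B.
  - apply: (le_trans l'v); apply: ler_wpM2l => //; exact: h1_gap.
Qed.

Lemma opnice_add T T' : opnice T -> opnice T' -> opnice (fun v x => T v x + T' v x).
Proof.
move=> [A1 A2 A3 A4] [B1 B2 B3 B4]; split.
- move=> v Uv a z y H; rewrite (A1 v Uv a z y H) (B1 v Uv a z y H) scalerDr.
  by rewrite addrACA.
- apply: (@loc2 _ _ (fun a b => a + b) _ _ _ _ _ A2 B2); first by move=> a b *; exact: addr_ge0.
  move=> a b v w a0 b0 Uv Uw p _ p' _ x fx.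
  have [x1 x2] := p x fx; have [y1 y2] := p' x fx; split.
    by rewrite mulrDl; apply: (le_trans (N0D _ _)); exact: lerD.
  by rewrite opprD addrACA !mulrDl; apply: (le_trans (N0D _ _)); exact: lerD.
- move=> v Uv v2; have [s [M HM]] := A3 v Uv v2; have [s' [M' HM']] := B3 v Uv v2.
  split=> [x sx|]; first exact: sob1D (s x sx) (s' x sx).
  exists (M + M') => x sx; rewrite mulrDl; apply: (le_trans (n1D (s x sx) (s' x sx))).
  by apply: lerD; [exact: HM|exact: HM'].
- apply: (@loc2 _ _ (fun a b => a + b) _ _ _ _ _ A4 B4); first by move=> a b *; exact: addr_ge0.
  move=> a b v w a0 b0 Uv Uw p _ p' _ v2 w2 x sx.
  have [s _] := A3 v Uv v2; have [s' _] := B3 v Uv v2.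
  have [t _] := A3 w Uw w2; have [t' _] := B3 w Uw w2.
  have e1 := sob1B (s x sx) (t x sx); have e2 := sob1B (s' x sx) (t' x sx).
  rewrite opprD addrACA !mulrDl; apply: (le_trans (n1D e1 e2)).
  by apply: lerD; [exact: p|exact: p'].
Qed.

End operators.

(** * From estimates of entries to operator matrices *)

Section matrices.
Context {R : realType}.
Variable U : set (HL2 R).
Hypothesis U1 : forall u, U u -> H_ 1 u.
Implicit Types (u v w x : HL2 R).

Lemma small_arith (k h e : R) : 0 <= k -> 0 <= h -> h < e / (k + 1) -> k * h <= e.
Proof.
move=> k0 hh; rewrite ltr_pdivlMr ?ltr_wpDl// mulrDr mulr1 mulrC.
by move=> H; apply: ltW; apply: le_lt_trans H; rewrite lerDl.
Qed.

Lemma lt_minr (a b : R) : 0 < a -> 0 < b -> 0 < Num.min a b.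
Proof. by rewrite lt_min => -> ->. Qed.

Lemma loc_entry_C0 nB DX nX DY nY (T : HL2 R -> L2 R -> L2 R) (UU : set (HL2 R)) :
  (forall z, 0 <= nX z) -> (forall z, 0 <= nB z) ->
  (forall u, UU u -> bdd_on DX nX DY nY (T u)) ->
  (forall u, UU u -> exists d k : R, [/\ 0 < d, 0 <= k & forall w, UU w -> hn nB (w - u) < d ->
     forall z, DX z -> nY (T w z - T u z) <= k * hn nB (w - u) * nX z]) ->
  entry_C0 UU nB DX nX DY nY T.
Proof.
move=> nX0 nB0 bT H; split; first exact: bT.
move=> u Uu e e0; have [d [k [d0 k0 {}H]]] := H u Uu.
have k1 : 0 < e / (k + 1) by rewrite divr_gt0// ltr_wpDl.
exists (Num.min d (e / (k + 1))); first exact: lt_minr.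
move=> w Uw /lt_min2[wd we] z Dz; apply: (le_trans (H w Uw wd z Dz)).
by apply: ler_wpM2r => //; apply: small_arith => //; exact: hn_ge0.
Qed.

Lemma N00 : N0 (0 : L2 R) = 0.
Proof. by rewrite -(scale0r 0) N0Z normr0 mul0r. Qed.

Lemma n10 : n1 (0 : L2 R) = 0.
Proof. by have := n1Z 0 (@sob1_0 R); rewrite scale0r normr0 mul0r. Qed.

Lemma sob1N (z : L2 R) : sobolev 1 z -> sobolev 1 (- z).
Proof. by move=> /(sob1Z (-1))[+ _]; rewrite scaleN1r. Qed.

Lemma UB u w : U u -> U w -> H_ 1 (w - u).
Proof. by move=> /U1 su /U1 sw; exact: (h1B sw su).1. Qed.

Section K.
Variables (r C : R).
Hypothesis C0 : 0 <= C.
Hypothesis frac_essb : forall x : L2 R, frac_sobolev r x -> essb (C * Nr r x) x.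
Hypothesis N0_Nr : forall x : L2 R, frac_sobolev r x -> N0 x <= Nr r x.
Variable T : 'I_4 -> 'I_4 -> HL2 R -> L2 R -> L2 R.
Hypothesis nT : forall i j, opnice U r (T i j).

Lemma frac_ge0 (x : L2 R) : 0 <= frac_sobolev_sqnorm r x.
Proof.
rewrite /frac_sobolev_sqnorm addr_ge0 ?L2dot_ge0//; case: ifP => // _.
apply: fine_ge0; apply: integral_ge0 => s _; apply: integral_ge0 => t _.
by rewrite lee_fin divr_ge0 ?sqr_ge0// powR_ge0.
Qed.

Lemma equivr : equiv_norm (frac_sobolev r) (frac_sobolev_sqnorm r) (Nr r).
Proof.
split; first exact: Nr_ge0.
  by move=> z _; rewrite /Nr sqr_sqrtr// frac_ge0.
by exists 1 => // z _; rewrite /Nr sqr_sqrtr ?frac_ge0// expr1n mul1r.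
Qed.

Lemma mop_C0r : C0_op U (H_ 1) (Hfrac r) (H_ 0) (mop T).
Proof.
apply: (C0_op_mop equiv1 equivr equiv0).
- exact: UB.
- by [].
- exact: N00.
- exact: sob_sub0.
- by [].
move=> i j; have [lT bT _ _] := nT i j.
apply: loc_entry_C0; first exact: Nr_ge0.
- exact: n1_ge0.
- move=> u Uu; have [d [k [d0 k0 H]]] := bT u Uu; split; first by [].
    by move=> a z y fz fy; apply: lT => //; left.
  by exists k => z fz; have [] := H u u Uu Uu (d_v _ d0) (d_v _ d0) z fz.
- move=> u Uu; have [d [k [d0 k0 H]]] := bT u Uu; exists d, k; split=> // w Uw wd z fz.
  by have [] := H w u Uw Uu wd (d_v _ d0) z fz.
Qed.

Lemma gap_arith (k a p q s : R) : 0 <= k -> 0 <= a -> 0 <= s -> s <= p -> 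
  k * (p + Num.min q a * s) <= k * (1 + a) * p.
Proof.
move=> k0 a0 s0 sp; rewrite -mulrA ler_wpM2l// mulrDl mul1r lerD2l.
by apply: (@le_trans _ _ (a * s)); [rewrite ler_wpM2r// ge_min lexx orbT|rewrite ler_wpM2l].
Qed.

(** At a fixed [u] in [H_2] the minimum in [gap] is at most [h2 u], so (C) implies a local Lipschitz
    estimate for the [H_2] distance. *)
Lemma mop_C01 : C0_op (U `&` (H_ 2 : set _)) (H_ 2) (H_ 1) (H_ 1) (mop T).
Proof.
apply: (@C0_op_mop R (U `&` (H_ 2 : set _)) (sobolev 2) (sobolev_sqnorm 2) (@n2 R)
  (sobolev 1) (sobolev_sqnorm 1) (@n1 R) (sobolev 1) (sobolev_sqnorm 1) (@n1 R) T
  equiv2 equiv1 equiv1).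
- move=> u w [_ /domE su] [_ /domE sw]; apply/domE => i; rewrite cpB.
  have /sob2E[a b] := sw i; have /sob2E[c d] := su i; apply/sob2E.
  split; first exact: sob1B.
  by rewrite (L2diffD a (sob1N c)); have [_ [e _]] := sob1Z (-1) c;
    rewrite !scaleN1r in e; rewrite e; exact: sob1B.
- exact: sob1_0.
- exact: n10.
- exact: sob_sub1.
- exact: sob1N.
move=> i j; have [lT _ sT bT] := nT i j.
apply: loc_entry_C0; first exact: n1_ge0.
- exact: n2_ge0.
- move=> u [Uu u2]; have [sTu MT] := sT u Uu u2; split; first by [].
    by move=> a z y fz fy; apply: lT => //; right.
  exact: MT.
- move=> u [Uu u2]; have [d [k [d0 k0 H]]] := bT u Uu; exists d, (k * (1 + h2 u)).
  split; [exact: d0|by rewrite mulr_ge0// addr_ge0// h2_ge0|].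
  move=> w [Uw w2] wd z sz.
  apply: (le_trans (H w u Uw Uu (le_lt_trans (h1_h2 _) wd) (d_v _ d0) w2 u2 z sz)).
  apply: ler_wpM2r; first exact: n1_ge0.
  by apply: gap_arith; [exact: k0|exact: h2_ge0|exact: h1_ge0|exact: h1_h2].
Qed.

Lemma loc_fin (I : finType) (P : I -> R -> HL2 R -> HL2 R -> Prop) :
  (forall i k k' v w, k <= k' -> P i k v w -> P i k' v w) ->
  (forall i, loc U (P i)) -> loc U (fun k v w => forall i, P i k v w).
Proof.
move=> mono LP u Uu.
have /choice[e He] : forall i, exists e : R * R, [/\ 0 < e.1, 0 <= e.2 & forall v w, U v -> U w ->
    h1 (v - u) < e.1 -> h1 (w - u) < e.1 -> P i e.2 v w].
  by move=> i; have [d [k H]] := LP i u Uu; exists (d, k).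
exists (\big[Num.min/1]_i (e i).1), (\sum_i (e i).2); split.
- by elim/big_ind: _ => // [x y x0 y0|i _]; [exact: lt_minr|case: (He i)].
- by apply: sumr_ge0 => i _; case: (He i).
move=> v w Uv Uw vd wd i; have [d0 k0 H] := He i.
apply: (mono i (e i).2).
  by rewrite (bigD1 i)//= lerDl sumr_ge0// => j _; case: (He j).
have le : \big[Num.min/1]_i (e i).1 <= (e i).1 by rewrite (bigD1 i)//= ge_min lexx.
by apply: H => //; [exact: lt_le_trans vd le|exact: lt_le_trans wd le].
Qed.

Hypothesis Uopen : open_in (H_ 1) U.

Lemma gapC_arith (k g2 g1 p q a b c1 c2 N2 N1 M2 M2' : R) : 0 <= k -> 0 < c1 -> 0 < c2 ->
  0 <= N1 -> 0 <= M2 -> 0 <= M2' -> 0 <= g1 -> 0 <= N2 ->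
  g2 <= c2 * N2 -> g1 <= c1 * N1 -> p <= c2 * M2 -> q <= c2 * M2' ->
  a <= 16 * (k * (g2 + Num.min p q * g1) * b) -> 0 <= b ->
  a <= 16 * k * c2 * (1 + c1) * (N2 + Num.min M2 M2' * N1) * b.
Proof.
move=> k0 c10 c20 N10 M20 M2'0 g10 N20 h1 h2 h3 h4 ha b0; apply: (le_trans ha).
have m0 : 0 <= Num.min M2 M2' by exact: min_ge0.
have mm : Num.min p q <= c2 * Num.min M2 M2'.
  by rewrite minr_pMr ?(ltW c20)// le_min !ge_min h3 h4 orbT.
have t1 : Num.min p q * g1 <= c2 * Num.min M2 M2' * (c1 * N1).
  apply: (@le_trans _ _ (c2 * Num.min M2 M2' * g1)); first exact: ler_wpM2r.
  by apply: ler_wpM2l => //; rewrite mulr_ge0// ltW.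
rewrite -[X in _ <= X * b]mulrA -!mulrA ler_wpM2l// ler_wpM2l// [leRHS]mulrA [leRHS]mulrA ler_wpM2r//.
move: (Num.min p q * g1) (Num.min M2 M2') m0 t1 => t m m0 t1.
have := mulr_ge0 (ltW c20) (mulr_ge0 m0 N10); have := mulr_ge0 (ltW c20) (mulr_ge0 (ltW c10) N20).
by lra.
Qed.

Lemma fin_arith (A X h N c : R) : 0 <= A -> 0 <= X -> h <= c * N -> A * X * h <= A * c * X * N.
Proof.
move=> A0 X0 hN; have -> : A * c * X * N = A * X * (c * N) by ring.
by apply: ler_wpM2l => //; exact: mulr_ge0.
Qed.

Lemma mop_lip u : U u -> exists (W : set (HL2 R)) (kappa : R),
  [/\ open_in (H_ 1) W, W u, W `<=` U &
    forall v w, W v -> H_ 2 v -> W w -> H_ 2 w ->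
      op_dist_le (H_ 1) (H_ 1) (mop T v) (mop T w)
        (kappa * (nrm (H_ 2) (v - w) +
           Num.min (nrm (H_ 2) v) (nrm (H_ 2) w) * nrm (H_ 1) (v - w)))].
Proof.
move=> Uu.
have [d [k [d0 k0 H]]] := @loc_fin _ (fun ij k v w => H_ 2 v -> H_ 2 w -> forall x : L2 R, sobolev 1 x ->
    n1 (T ij.1 ij.2 v x - T ij.1 ij.2 w x) <= k * gap v w * n1 x)
  (fun ij k k' v w kk' p hv hw y sy => le_trans (p hv hw y sy)
     (ler_wpM2r (n1_ge0 y) (ler_wpM2r (gap_ge0 v w) kk')))
  (fun ij => let: And4 _ _ _ h := nT ij.1 ij.2 in h) u Uu.
have [c1 c10 hc1] := le_nrm (@equiv1 R).
have [c2 c20 hc2] := le_nrm (@equiv2 R).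
(* 16 counts the entries, [c2 * (1 + c1)] passes from [gap] to the norms of [H_2] and [H_1], and the
   last [c1] does the same for the argument [x]. *)
exists [set v | U v /\ h1 (v - u) < d], (16 * k * c2 * (1 + c1) * c1); split.
- split; first by move=> v [/U1].
  move=> v [Uv vd]; have [_ /(_ v Uv)[d' d'0 H']] := Uopen.
  exists (Num.min d' ((d - h1 (v - u)) / c1)).
    by apply: lt_minr => //; rewrite divr_gt0// subr_gt0.
  move=> w sw /lt_min2[wd' wd]; have Uw := H' w sw wd'; split; first exact: Uw.
  have -> : w - u = (w - v) + (v - u) by rewrite addrA subrK.
  have s1 := UB Uv Uw; have s2 := UB Uu Uv.
  apply: (le_lt_trans (h1D s1 s2).2); rewrite -ltrBrDr.
  apply: (le_lt_trans (hc1 _ s1)).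
  by move: wd; rewrite ltr_pdivlMr// mulrC.
- by split; [|exact: d_v].
- by move=> v [].
move=> v w [Uv vd] v2 [Uw wd] w2 x sx.
have sx' : forall i, sobolev 1 (cp x i) := (@domE R (sobolev 1) (sobolev_sqnorm 1) x).1 sx.
have S v' j i : U v' -> H_ 2 v' -> sobolev 1 (T i j v' (cp x j)).
  by move=> Uv' v2'; have [_ _ /(_ v' Uv' v2')[s _] _] := nT i j; exact: s.
have D j i := sob1B (S v j i Uv v2) (S w j i Uw w2).
have E i : cp (mop T v x - mop T w x) i = \sum_j (T i j v (cp x j) - T i j w (cp x j)).
  by rewrite cpB !cp_mkH sumrB.
have sE : H_ 1 (mop T v x - mop T w x).
  by apply/domE => i; rewrite E; exact: (sum_sub sob1_0 n10 sob_sub1 (D^~ i)).1.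
have B : nrm (H_ 1) (mop T v x - mop T w x) <= 16 * (k * gap v w * h1 x).
  apply: (le_trans (nrm_le equiv1 sE)).
  have -> : 16 * (k * gap v w * h1 x) = \sum_(i < 4) \sum_(j < 4) k * gap v w * h1 x.
    by rewrite !sumr_const card_ord; move: (gap v w) (h1 x) => g h; ring.
  rewrite hnE; apply: ler_sum => i _; rewrite E.
  apply: (le_trans (sum_sub sob1_0 n10 sob_sub1 (D^~ i)).2); apply: ler_sum => j _.
  apply: (le_trans (H v w Uv Uw vd wd (i, j) v2 w2 (cp x j) (sx' j))).
  apply: ler_wpM2l; first by rewrite mulr_ge0// gap_ge0.
  by apply: cp_hn; exact: n1_ge0.
have svw := UB Uw Uv.
have svw2 : H_ 2 (v - w).
  apply/domE => i; rewrite cpB.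
  have [a b] := H2_sob i v2; have [c e] := H2_sob i w2; apply/sob2E.
  split; first exact: sob1B.
  by rewrite (L2diffD a (sob1N c)); have [_ [f _]] := sob1Z (-1) c;
    rewrite !scaleN1r in f; rewrite f; exact: sob1B.
have B' : nrm (H_ 1) (mop T v x - mop T w x) <= 16 * k * c2 * (1 + c1) *
    (nrm (H_ 2) (v - w) + Num.min (nrm (H_ 2) v) (nrm (H_ 2) w) * nrm (H_ 1) (v - w)) * h1 x.
  apply: (gapC_arith k0 c10 c20 (sqrtr_ge0 _) (sqrtr_ge0 _) (sqrtr_ge0 _) (h1_ge0 _) (sqrtr_ge0 _)
     (hc2 _ svw2) (hc1 _ svw) (hc2 _ v2) (hc2 _ w2) B (h1_ge0 _)).
have X0 : 0 <= nrm (H_ 2) (v - w) + Num.min (nrm (H_ 2) v) (nrm (H_ 2) w) * nrm (H_ 1) (v - w).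
  by rewrite addr_ge0 ?sqrtr_ge0// mulr_ge0 ?sqrtr_ge0//; apply: min_ge0; exact: sqrtr_ge0.
apply: (le_trans B'); apply: (fin_arith _ X0 (hc1 _ sx)).
by rewrite !mulr_ge0// ?addr_ge0// ltW.

Qed.

End K.

Section F.
Variable b : 'I_4 -> 'I_4 -> HL2 R -> L2 R.
Hypothesis lb : forall i j, lip1 U (b i j).

(** An entry of [F] differentiates its argument and multiplies by a coefficient that is Lipschitz
    into W^{1,2}. *)
Definition dop (i j : 'I_4) v (y : L2 R) : L2 R := pr (L2diff y) (b i j v).

Lemma dop_lin i j v (a : R) (z y : L2 R) : U v -> sobolev 1 z -> sobolev 1 y ->
  dop i j v (a *: z + y) = a *: dop i j v z + dop i j v y.
Proof.
move=> Uv sz sy; have [d [k [d0 _ H]]] := lb i j Uv.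
have [sb _ _] := H v v Uv Uv (d_v _ d0) (d_v _ d0).
rewrite /dop; have [_ -> _] := sob1_lin a sz sy.
exact: pr_linl (sob1_essb sb).
Qed.

Lemma dop_sub i j v w (y : L2 R) : sobolev 1 (b i j v) -> sobolev 1 (b i j w) ->
  dop i j w y - dop i j v y = pr (L2diff y) (b i j w - b i j v).
Proof. by move=> sv sw; rewrite /dop (pr_subr _ (sob1_essb sw) (sob1_essb sv)). Qed.

Lemma mop_dop10 : C0_op U (H_ 1) (H_ 1) (H_ 0) (mop dop).
Proof.
apply: (@C0_op_mop R U (sobolev 1) (sobolev_sqnorm 1) (@n1 R)
  (sobolev 1) (sobolev_sqnorm 1) (@n1 R) (sobolev 0) (sobolev_sqnorm 0) (@N0 R) dop
  equiv1 equiv1 equiv0).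
- exact: UB.
- by [].
- exact: N00.
- exact: sob_sub0.
- by [].
move=> i j; apply: loc_entry_C0; first exact: n1_ge0.
- exact: n1_ge0.
- move=> u Uu; have [d [k [d0 k0 H]]] := lb i j Uu.
  have [sb bk _] := H u u Uu Uu (d_v _ d0) (d_v _ d0); split; first by [].
    by move=> a z y sz sy; exact: dop_lin.
  exists k => z sz; apply: (le_trans (N0_pr1 _ sb)).
  by apply: ler_pM; [exact: n1_ge0|exact: N0_ge0|exact: bk|exact: N0d_n1].
- move=> u Uu; have [d [k [d0 k0 H]]] := lb i j Uu; exists d, k; split=> // w Uw wd z sz.
  have [sw _ l] := H w u Uw Uu wd (d_v _ d0).
  have [su _ _] := H u w Uu Uw (d_v _ d0) wd.
  rewrite (dop_sub _ su sw); apply: (le_trans (N0_pr1 _ (sob1B sw su))).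
  by apply: ler_pM; [exact: n1_ge0|exact: N0_ge0|exact: l|exact: N0d_n1].
Qed.

(** The coefficients vary continuously in W^{1,2} with respect to the [H_1] norm of the base point,
    and W^{1,2} is an algebra; hence no second derivatives of the base point enter. *)
Lemma mop_dop21 : C0_op U (H_ 1) (H_ 2) (H_ 1) (mop dop).
Proof.
apply: (@C0_op_mop R U (sobolev 1) (sobolev_sqnorm 1) (@n1 R)
  (sobolev 2) (sobolev_sqnorm 2) (@n2 R) (sobolev 1) (sobolev_sqnorm 1) (@n1 R) dop
  equiv1 equiv2 equiv1).
- exact: UB.
- exact: sob1_0.
- exact: n10.
- exact: sob_sub1.
- exact: sob1N.
move=> i j; apply: loc_entry_C0; first exact: n2_ge0.
- exact: n1_ge0.
- move=> u Uu; have [d [k [d0 k0 H]]] := lb i j Uu.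
  have [sb bk _] := H u u Uu Uu (d_v _ d0) (d_v _ d0); split.
  + by move=> z /sob2E[sz dz]; have [] := pr_sob1 dz sb.
  + by move=> a z y /sob2E[sz _] /sob2E[sy _]; exact: dop_lin.
  + exists (2 * k) => z /sob2E[sz dz]; apply: (le_trans (n1_pr dz sb)); rewrite mulrAC.
    apply: ler_pM; [by rewrite mulr_ge0// n1_ge0|exact: n1_ge0| |exact: n1d_n2].
    exact: ler_wpM2l.
- move=> u Uu; have [d [k [d0 k0 H]]] := lb i j Uu; exists d, (2 * k).
  split; [by []|exact: mulr_ge0|] => w Uw wd z /sob2E[sz dz].
  have [sw _ l] := H w u Uw Uu wd (d_v _ d0).
  have [su _ _] := H u w Uu Uw (d_v _ d0) wd.
  rewrite (dop_sub _ su sw); apply: (le_trans (n1_pr dz (sob1B sw su))); rewrite mulrAC.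
  apply: ler_pM; [by rewrite mulr_ge0// n1_ge0|exact: n1_ge0| |exact: n1d_n2].
  by rewrite -mulrA; apply: ler_wpM2l.
Qed.

End F.
End matrices.

(** * The Fredholm property of the first order part *)

Section fredholm.
Context {R : realType}.
Local Hint Resolve mI01 : core.
Implicit Types (z y : L2 R).

(** The functionals [m] are dual to [e] and cut out [N], which forces the coordinates of [x] to be
    the numbers [m i x]. *)
Lemma has_dim_dual (V : lmodType R) (S N : set V) n (m : 'I_n -> V -> R) (e : 'I_n -> V) :
  (forall i, S (e i)) ->
  (forall x (c : 'I_n -> R), S x -> S (x - \sum_i c i *: e i)) ->
  (forall x (c : 'I_n -> R) i, S x -> m i (x - \sum_i c i *: e i) = m i x - c i) ->
  (forall x, S x -> (N x <-> forall i, m i x = 0)) ->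
  has_dim_mod S N n.
Proof.
move=> Se SB mB NE; exists e; split=> // x Sx.
exists (\row_i m i x); split.
  apply/(NE _ (SB x _ Sx)) => i; rewrite mB// mxE subrr//.
move=> c /(NE _ (SB x _ Sx)) H; apply/rowP => i.
by have := H i; rewrite mB// mxE => /eqP; rewrite subr_eq0 => /eqP.
Qed.

Definition mn z : R := it 0 1 (L2fun z).
Definition one : L2 R := toL2 (cst 1).

Lemma ig_L2 z : ig I01 (L2fun z). Proof. exact: sqi_ig (L2fun_sqi z). Qed.

Lemma mn_lin (a : R) z y : mn (a *: z + y) = a * mn z + mn y.
Proof.
rewrite /mn -itZ; last exact: ig_L2.
rewrite -itD; [|by apply: igZ => //; exact: ig_L2|exact: ig_L2].
apply: ae01_it => //; [exact: ig_L2|apply: igD => //; [by apply: igZ => //; exact: ig_L2|exact: ig_L2]|].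
by apply: ae01S (ae01I (L2funD (a *: z) y) (L2funZ a z)) => t _ [-> ->].
Qed.

Lemma mnD z y : mn (z + y) = mn z + mn y.
Proof. by have := mn_lin 1 z y; rewrite scale1r mul1r. Qed.
Lemma mn0 : mn 0 = 0.
Proof. by have := mn_lin 1 0 0; rewrite scaler0 addr0 mul1r; lra. Qed.
Lemma mnZ (a : R) z : mn (a *: z) = a * mn z.
Proof. by have := mn_lin a z 0; rewrite !addr0 mn0 addr0. Qed.
Lemma mnN z : mn (- z) = - mn z.
Proof. by rewrite -scaleN1r mnZ mulN1r. Qed.

Lemma oneE : ae01 (fun t => L2fun one t = 1).
Proof. exact: toL2E (sqi_cst 1). Qed.

Lemma mn1 : mn one = 1.
Proof.
rewrite /mn (@ae01_it _ _ _ _ (cst 1))//; first by rewrite it_cst// subr0 mulr1.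
- exact: ig_L2.
- exact: ig_cst.
- exact: oneE.
Qed.

Lemma one_sob1 : sobolev 1 one /\ L2diff one = 0 /\ forall t : R, 0 <= t <= 1 -> loop one t = 1.
Proof.
have [s d l] := sob1_toL2 (acl_cst (1 : R)); split=> //; split=> //.
by rewrite /one d; apply: toL2_uniq; exact: L2fun0.
Qed.

Lemma sob2_one (c : R) : sobolev 2 (c *: one).
Proof.
have [s [d _]] := one_sob1; have [s' [d' _]] := sob1Z c s.
by apply/sob2E; split=> //; rewrite d' d scaler0; exact: sob1_0.
Qed.

Lemma mn_diff z : sobolev 1 z -> mn (L2diff z) = 0.
Proof.
move=> /sob1P[[az l1] _]; rewrite /mn.
by rewrite -(ac_sub az)// l1 subrr.
Qed.

Lemma prim_ex z : mn z = 0 -> exists2 y, sobolev 1 y & L2diff y = z.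
Proof.
move=> mz; have H : acl (fun t => int0 t (L2fun z)) (L2fun z).
  by split; [apply: ac_int; exact: L2fun_sqi|rewrite int00].
have [s d _] := sob1_toL2 H; eexists; first exact: s.
by rewrite d toL2K.
Qed.

Lemma diff0_one z : sobolev 1 z -> L2diff z = 0 -> z = mn z *: one.
Proof.
move=> sz dz; have [[[_ lE] _] ez] := sob1P sz.
have c (t : R) : 0 <= t <= 1 -> loop z t = loop z 0.
  move=> /andP[t0 t1]; rewrite lE ?t0// dz.
  have -> : int0 t (L2fun (0 : L2 R)) = 0; last by rewrite addr0.
  have := @ae01_it R 0 t (L2fun 0) (cst 0) (lexx 0) t1 (ig_L2 0) (ig_cst 0) (@L2fun0 R).
  by rewrite /int0 /it => ->; have := it_cst 0 t0; rewrite /it mul0r.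
have zE : z = loop z 0 *: one.
  apply: L2_ext; apply: ae01S (ae01I ez (ae01I (L2funZ (loop z 0) one) oneE)) => t.
  by rewrite I01E => t01 [-> [-> ->]]; rewrite c// mulr1.
by rewrite {2}zE mnZ mn1 mulr1.
Qed.

Lemma pr_one z : pr one z = z.
Proof.
rewrite prC; apply: toL2_uniq; apply: ae01S oneE => t _ ->; by rewrite mulr1.
Qed.

Lemma pr0 z : pr 0 z = 0.
Proof.
apply: toL2_uniq; apply: ae01S (@L2fun0 R) => t _ ->; by rewrite mul0r.
Qed.

Variable b : L2 R.
Hypothesis sb : sobolev 1 b.
Variable F : HL2 R -> HL2 R.
Hypothesis bF : bounded_op (H_ 2) (H_ 1) F.
Hypothesis FE : forall x : HL2 R, H_ 2 x -> [/\ cp (F x) o0 = pr (L2diff (cp x o1)) b - L2diff (cp x o2),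
  cp (F x) o1 = - pr (L2diff (cp x o0)) b - L2diff (cp x o3),
  cp (F x) o2 = L2diff (cp x o0) & cp (F x) o3 = L2diff (cp x o1)].

Definition eK (i : 'I_4) : HL2 R := mkH (fun j => ((i == j)%:R : R) *: one).

Lemma cp0 j : cp (0 : HL2 R) j = 0.
Proof. by rewrite /cp; case: (val j) => [|[|[|?]]]. Qed.

Lemma cp_sum n (c : 'I_n -> R) (e : 'I_n -> HL2 R) j :
  cp (\sum_i c i *: e i) j = \sum_i c i *: cp (e i) j.
Proof.
rewrite (big_morph (fun x => cp x j) (fun u w => cpD u w j) (cp0 j)).
by apply: eq_bigr => i _; rewrite cpZ.
Qed.

Lemma cp_eK (c : 'I_4 -> R) j : cp (\sum_i c i *: eK i) j = c j *: one.
Proof.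
rewrite cp_sum (bigD1 j)//= cp_mkH eqxx scale1r big1 ?addr0// => i /negbTE ij.
by rewrite cp_mkH ij scale0r scaler0.
Qed.

Lemma dom_H k (x : HL2 R) : H_ k x <-> forall i, sobolev k (cp x i).
Proof. exact: domE. Qed.

Lemma sob2_lin (a : R) z y : sobolev 2 z -> sobolev 2 y -> sobolev 2 (a *: z + y).
Proof.
move=> /sob2E[sz dz] /sob2E[sy dy]; have [s d _] := sob1_lin a sz sy.
by apply/sob2E; rewrite d; split=> //; have [] := sob1_lin a dz dy.
Qed.

(** The last two rows give that the first two components have zero derivative; the first two rows
    then give the same for the others. *)
Lemma F_kernel (x : HL2 R) : H_ 2 x -> F x = 0 <-> forall i, L2diff (cp x i) = 0.
Proof.
move=> x2; have [e0 e1 e2 e3] := FE x2; split=> [F0|d0].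
  move: e0 e1 e2 e3; rewrite F0 !cp0 => e0 e1 e2 e3.
  have e0' : L2diff (cp x o2) = 0.
    by apply/eqP; rewrite -oppr_eq0; apply/eqP; rewrite e0 -e3 pr0 sub0r.
  have e1' : L2diff (cp x o3) = 0.
    by apply/eqP; rewrite -oppr_eq0; apply/eqP; rewrite e1 -e2 pr0 oppr0 sub0r.
  by apply: all4.
apply: cp_ext => i; rewrite cp0; move: i; apply: all4.
- by rewrite e0 !d0 pr0 oppr0 addr0.
- by rewrite e1 !d0 pr0 oppr0 addr0.
- by rewrite e2 d0.
- by rewrite e3 d0.
Qed.

Lemma ker_dim : has_dim_mod [set x | H_ 2 x /\ F x = 0] [set 0] 4.
Proof.
have eK2 i : H_ 2 (eK i) by apply/dom_H => j; rewrite cp_mkH; exact: sob2_one.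
have dK i j : L2diff (cp (eK i) j) = 0.
  rewrite cp_mkH; have [s [d _]] := one_sob1; have [_ [d' _]] := sob1Z ((i == j)%:R : R) s.
  by rewrite d' d scaler0.
have [s1 [d1 _]] := one_sob1.
apply: (@has_dim_dual _ _ _ 4 (fun i x => mn (cp x i)) eK).
- by move=> i; split; [exact: eK2|apply/(F_kernel (eK2 i)) => j].
- move=> x c [/dom_H x2 Fx].
  have x2' : H_ 2 (x - \sum_i c i *: eK i).
    apply/dom_H => j; rewrite cpB cp_eK -scaleNr addrC.
    by have := sob2_lin 1 (sob2_one (- c j)) (x2 j); rewrite scale1r.
  split=> //; apply/(F_kernel x2') => j; rewrite cpB cp_eK -scaleNr.
  have [sx _] := (sob2E _).1 (x2 j); have [so [dso _]] := sob1Z (- c j) s1.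
  rewrite (L2diffD sx so) dso d1 scaler0 addr0.
  by apply: (F_kernel _).1 => //; exact/dom_H.
- by move=> x c i _; rewrite cpB cp_eK mnD mnN mnZ mn1 mulr1.
- move=> x [x2 /(F_kernel x2) Fx]; split=> [->|m0]; first by move=> i; rewrite cp0 mn0.
  apply: cp_ext => i; rewrite cp0.
  have [sx _] := (sob2E _).1 ((dom_H 2 x).1 x2 i).
  by rewrite (diff0_one sx (Fx i)) m0 scale0r.
Qed.

(** The solvability conditions of [F x = y]. The components [y2 = x0'] and [y3 = x1'] have mean 0,
    and so have [y0 - b y3 = - x2'] and [y1 + b y2 = - x3']. *)
Definition mC (i : 'I_4) (y : HL2 R) : R := match val i with
  | 0%N => mn (cp y o0) - mn (pr (cp y o3) b) | 1%N => mn (cp y o1) + mn (pr (cp y o2) b)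
  | 2%N => mn (cp y o2) | _ => mn (cp y o3) end.

(** Constants corrected by [b] and [-b], so that the basis is dual to [mC] in spite of its terms
    with [b]. *)
Definition eC (i : 'I_4) : HL2 R := mkH (fun j => match val i, val j with
  | 2%N, 1%N => - b | 3%N, 0%N => b | _, _ => ((i == j)%:R : R) *: one end).

Lemma mC_lin i (a : R) (x y : HL2 R) : mC i (a *: x + y) = a * mC i x + mC i y.
Proof.
rewrite /mC; case: (val i) => [|[|[|?]]]; rewrite !cpD !cpZ !mn_lin ?(pr_linl _ _ _ (sob1_essb sb)) ?mn_lin //; ring.
Qed.

Lemma mC0 i : mC i 0 = 0.
Proof. by rewrite /mC !cp0 pr0 !mn0 subrr addr0; case: (val i) => [|[|[|?]]]. Qed.

Lemma mC_sum i (c : 'I_4 -> R) (e : 'I_4 -> HL2 R) : mC i (\sum_j c j *: e j) = \sum_j c j * mC i (e j).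
Proof.
have D (x y : HL2 R) : mC i (x + y) = mC i x + mC i y by have := mC_lin i 1 x y; rewrite scale1r mul1r.
rewrite (big_morph (mC i) D (mC0 i)); apply: eq_bigr => j _.
by have := mC_lin i (c j) (e j) 0; rewrite !addr0 mC0 addr0.
Qed.

Lemma mC_eC i j : mC i (eC j) = (i == j)%:R.
Proof.
rewrite /mC !cp_mkH; move: j; apply: all4; move: i; apply: all4;
  rewrite /= ?eqxx ?scale0r ?scale1r ?pr0 ?pr_one ?mnN ?mn0 ?mn1 ?addr0 ?subr0 ?addNr ?subrr//.
Qed.

Lemma sob1_eC i : H_ 1 (eC i).
Proof.
have H (c : R) : sobolev 1 (c *: one) by have [] := (sob2E _).1 (sob2_one c).
apply/dom_H => j; rewrite cp_mkH; move: j; apply: all4; move: i; apply: all4; rewrite /=; do ?exact: H.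
  exact: sb.
exact: sob1N sb.
Qed.

Lemma F_range (y : HL2 R) : H_ 1 y -> (F @` (H_ 2 : set _)) y <-> forall i, mC i y = 0.
Proof.
move=> /dom_H sy; split.
  move=> [x x2 <-]; have [e0 e1 e2 e3] := FE x2.
  have s i : mn (L2diff (cp x i)) = 0.
    by apply: mn_diff; have [] := (sob2E _).1 ((dom_H 2 x).1 x2 i).
  apply: all4; rewrite /mC/= ?e0 ?e1 ?e2 ?e3 ?mnD ?mnN ?s ?oppr0 ?addr0 ?subrr ?addNr//.
move=> m0.
have sp z : sobolev 1 z -> sobolev 1 (pr z b) by move=> sz; have [] := pr_sob1 sz sb.
have [x0 s0 d0] : exists2 x, sobolev 1 x & L2diff x = cp y o2 by apply: prim_ex; exact: (m0 o2).
have [x1 s1 d1] : exists2 x, sobolev 1 x & L2diff x = cp y o3 by apply: prim_ex; exact: (m0 o3).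
have [x2 s2 d2] : exists2 x, sobolev 1 x & L2diff x = pr (cp y o3) b - cp y o0.
  by apply: prim_ex; have := m0 o0; rewrite /mC/= mnD mnN; lra.
have [x3 s3 d3] : exists2 x, sobolev 1 x & L2diff x = - pr (cp y o2) b - cp y o1.
  by apply: prim_ex; have := m0 o1; rewrite /mC/= mnD !mnN; lra.
have X2 : H_ 2 (((x0, x1), (x2, x3)) : HL2 R).
  apply/dom_H; apply: all4; apply/sob2E; split=> //.
  - by rewrite d0; exact: sy.
  - by rewrite d1; exact: sy.
  - by rewrite d2; apply: sob1B; [apply: sp|]; exact: sy.
  - by rewrite d3; apply: sob1B; [apply: sob1N; apply: sp|]; exact: sy.
exists ((x0, x1), (x2, x3)) => //; have [e0 e1 e2 e3] := FE X2.
apply: cp_ext; apply: all4.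
- by rewrite e0 /cp/= d1 d2 opprB addrC subrK.
- by rewrite e1 /cp/= d0 d3 opprB opprK addrC addrK.
- by rewrite e2.
- by rewrite e3.
Qed.

Lemma coker_dim : has_dim_mod (H_ 1 : set _) (F @` (H_ 2 : set _)) 4.
Proof.
have LB (x : HL2 R) (c : 'I_4 -> R) : H_ 1 x -> H_ 1 (x - \sum_i c i *: eC i).
  move=> /dom_H sx; apply/dom_H => j; rewrite cpB; apply: sob1B => //.
  rewrite cp_sum; apply: (sum_sub sob1_0 (@n10 R) (@sob_sub1 R) _).1 => i.
  by have s := (dom_H 1 _).1 (sob1_eC i) j; exact: (sob1Z _ s).1.
apply: (@has_dim_dual _ _ _ 4 mC eC) => //.
- exact: sob1_eC.
- move=> x c i _; have := mC_lin i (-1) (\sum_i c i *: eC i) x.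
  rewrite scaleN1r [- _ + x]addrC => ->; rewrite mC_sum (bigD1 i)//= mC_eC eqxx big1 => [|j /negbTE ji].
    by rewrite mulr1 addr0 mulN1r addrC.
  by rewrite mC_eC eq_sym ji mulr0.
- exact: F_range.
Qed.

Lemma F_fredholm : fredholm_of_index (H_ 2) (H_ 1) F 0.
Proof. by split=> //; exists 4, 4; split; [exact: ker_dim|exact: coker_dim|]. Qed.

End fredholm.

(** * The embedding of W^{3/4,2} in L^infinity *)

Section fractional.
Context {R : realType}.
Notation mu := (@lebesgue_measure R).
Notation T := (measurableTypeR R).
Local Hint Resolve mI01 : core.

(* [f2] is not assumed measurable *)
Lemma ge0_le_int (D : set T) (f1 f2 : T -> \bar R) :
  (forall x, D x -> 0 <= f1 x)%E -> (forall x, D x -> f1 x <= f2 x)%E ->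
  (\int[mu]_(x in D) f1 x <= \int[mu]_(x in D) f2 x)%E.
Proof.
move=> f10 f12; rewrite (integral_mkcond D f1) (integral_mkcond D f2).
have h10 x : (0 <= (f1 \_ D) x)%E by apply: erestrict_ge0.
have h12 x : ((f1 \_ D) x <= (f2 \_ D) x)%E.
  by rewrite !patchE; case: ifP => // /set_mem; exact: f12.
have h20 x : (0 <= (f2 \_ D) x)%E by exact: le_trans (h12 x).
rewrite !ge0_integralTE//; apply: le_ereal_sup => _ [h hf <-]; exists h => // x.
exact: le_trans (hf x) (h12 x).
Qed.

Variable g : T -> R.
Hypothesis sg : sqi g.
Let p : R := 1 + 2 * (3 / 4).
Let K (a b : R) : R := (g a - g b) ^+ 2 / (circle_dist a b) `^ p.
Let H (a : R) : \bar R := (\int[mu]_(b in `[0%R, 1%R]) (K a b)%:E)%E.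
Let S : \bar R := (\int[mu]_(a in `[0%R, 1%R]) H a)%E.

Lemma K_ge0 a b : 0 <= K a b.
Proof. by rewrite /K divr_ge0 ?sqr_ge0// powR_ge0. Qed.

Lemma H_ge0 a : (0 <= H a)%E.
Proof. by apply: integral_ge0 => b _; rewrite lee_fin K_ge0. Qed.

Lemma ge0_sub_int (A B : set T) (f : T -> \bar R) : A `<=` B ->
  (forall x, B x -> 0 <= f x)%E -> (\int[mu]_(x in A) f x <= \int[mu]_(x in B) f x)%E.
Proof.
move=> AB f0; rewrite (integral_mkcond A f) (integral_mkcond B f).
have hA x : (0 <= (f \_ A) x)%E by apply: erestrict_ge0 => y /AB; exact: f0.
apply: ge0_le_int => x _ //; rewrite !patchE; case: ifPn => [/set_mem/AB xB|_].
  by rewrite mem_set.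
by case: ifPn => // /set_mem; exact: f0.
Qed.

(** Lengths are written as fourth powers because [(q^4)^(5/2) = q^10]. The circle distance never
    exceeds the distance on the line, which is the direction needed. *)
Lemma circle_le (q a b : R) : 0 < q -> q ^+ 4 < 1 -> 0 <= a <= 1 -> 0 <= b <= 1 ->
  `|a - b| <= q ^+ 4 -> (g a - g b) ^+ 2 <= q ^+ 10 * K a b.
Proof.
move=> q0 q1 a01 b01 ab; rewrite /K.
set d := circle_dist a b.
have dq : d <= q ^+ 4 by rewrite /d /circle_dist ge_min ab.
have [->|ab0] := eqVneq a b.
  by rewrite subrr expr0n/= mul0r mulr0.
have d0 : 0 < d.
  rewrite /d /circle_dist lt_min normr_gt0 subr_eq0 ab0/= subr_gt0.
  exact: le_lt_trans q1.
have dp : d `^ p <= q ^+ 10.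
  have -> : q ^+ 10 = (q ^+ 4) `^ p.
    rewrite -(powR_mulrn 4 (ltW q0)) -powRrM -(powR_mulrn 10 (ltW q0)); congr (_ `^ _).
    by rewrite /p; field.
  by apply: ge0_ler_powR; rewrite ?nnegrE ?exprn_ge0 ?(ltW d0) ?(ltW q0)// /p; lra.
have dp0 : 0 < d `^ p by exact: powR_gt0.
by rewrite mulrA ler_pdivlMr// mulrC ler_wpM2r ?sqr_ge0.
Qed.

Lemma EFin_it (a b : R) (f : T -> R) : ig `[a, b] f ->
  ((it a b f)%:E = \int[mu]_(t in [set` `[a, b]]) (f t)%:E)%E.
Proof. by move=> If; rewrite /it /Rintegral fineK//; exact: integrable_fin_num. Qed.

Definition avg (c l : R) := it c (c + l) g / l.

Lemma avg_dev (c l : R) (A : R) : 0 < l -> 0 <= c -> c + l <= 1 ->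
  (avg c l - A) ^+ 2 <= it c (c + l) (fun b => (g b - A) ^+ 2) / l.
Proof.
move=> l0 c0 cl; have cc : c <= c + l by rewrite lerDl ltW.
have s1 : sqi (fun b => g b - A) by apply: sqiB => //; exact: sqi_cst.
have H1 := CS1_it c0 cc cl s1.
have E : it c (c + l) (fun b => g b - A) = l * (avg c l - A).
  rewrite (@itB _ _ _ g (cst A)); [|by apply: ig_itv => //; exact: sqi_ig|by apply: ig_itv => //; exact: ig_cst].
  by rewrite it_cst// /avg; field; rewrite gt_eqF.
move: H1; rewrite E addrAC subrr add0r exprMn expr2 -mulrA ler_pM2l//.
by rewrite ler_pdivlMr// [l * _]mulrC.
Qed.

(** The kernel contributes [q^-10] and Cauchy-Schwarz over an interval of length [q^4] returns
    [q^4], whence the exponent 6. *)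
Lemma step1 (q c a : R) : 0 < q -> q ^+ 4 < 1 -> 0 <= c -> c + q ^+ 4 <= 1 -> c <= a <= c + q ^+ 4 ->
  (((g a - avg c (q ^+ 4)) ^+ 2 * q ^- 6)%:E <= H a)%E.
Proof.
move=> q0 q1 c0 cl /andP[ca ac]; set l := q ^+ 4 in cl ac q1 *.
have l0 : 0 < l by rewrite exprn_gt0.
have sf : sqi (fun b => g b - g a) by apply: sqiB => //; exact: sqi_cst.
have If : ig `[c, c + l] (fun b => (g b - g a) ^+ 2) by apply: ig_itv => //; case: sf.
apply: (@le_trans _ _ ((q ^- 10 * it c (c + l) (fun b => (g b - g a) ^+ 2))%:E)).
  rewrite lee_fin; have := avg_dev (g a) l0 c0 cl; rewrite -sqrrN opprB => h.
  have -> : q ^- 10 * it c (c + l) (fun b => (g b - g a) ^+ 2) =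
     it c (c + l) (fun b => (g b - g a) ^+ 2) / l * q ^- 6.
    by rewrite /l; field; rewrite gt_eqF.
  by rewrite ler_wpM2r// invr_ge0 exprn_ge0// ltW.
rewrite -itZ// EFin_it; last exact: igZ.
have Hs : (\int[mu]_(b in ([set` `[c, c + l]%R] : set T)) (K a b)%:E <= H a)%E.
  apply: ge0_sub_int; first exact: subI.
  by move=> x _; rewrite lee_fin K_ge0.
apply: (le_trans _ Hs); apply: ge0_le_int => b; rewrite /= in_itv/= => /andP[cb bc]; rewrite lee_fin.
  by rewrite mulr_ge0 ?sqr_ge0// invr_ge0 exprn_ge0// ltW.
rewrite mulrC ler_pdivrMr ?exprn_gt0// -sqrrN opprB mulrC.
apply: circle_le => //; try (apply/andP; split; lra).
by rewrite -/l ler_norml; apply/andP; split; lra.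
Qed.

Hypothesis Sfin : (S < +oo)%E.
Let B : R := fine S.

Lemma B_ge0 : 0 <= B.
Proof. by apply: fine_ge0; apply: integral_ge0 => a _; exact: H_ge0. Qed.

Lemma BE : (B%:E = S)%E.
Proof.
rewrite /B fineK// ge0_fin_numE//.
by apply: integral_ge0 => a _; exact: H_ge0.
Qed.

(** [step1] integrated over the smaller interval bounds the mean square deviation there by [q^6 B];
    dividing by its length [q^4 / 16] leaves [16 q^2 B], the square of the bound. *)
Lemma step2 (q c c' : R) : 0 < q -> q ^+ 4 < 1 -> 0 <= c -> c + q ^+ 4 <= 1 ->
  c <= c' -> c' + (q / 2) ^+ 4 <= c + q ^+ 4 ->
  `|avg c' ((q / 2) ^+ 4) - avg c (q ^+ 4)| <= 4 * q * Num.sqrt B.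
Proof.
move=> q0 q1 c0 cl cc cl'; set l' := (q / 2) ^+ 4 in cl' *; set A := avg c _.
have l'0 : 0 < l' by rewrite exprn_gt0// divr_gt0.
have c'0 : 0 <= c' by exact: le_trans cc.
have c'1 : c' + l' <= 1 by exact: le_trans cl.
have sf : sqi (fun b => g b - A) by apply: sqiB => //; exact: sqi_cst.
have If : ig `[c', c' + l'] (fun b => (g b - A) ^+ 2) by apply: ig_itv => //; case: sf.
have h1 := avg_dev A l'0 c'0 c'1.
have h2 : q ^- 6 * it c' (c' + l') (fun b => (g b - A) ^+ 2) <= B.
  rewrite -lee_fin BE -itZ// EFin_it; last exact: igZ.
  have Hs : (\int[mu]_(b in ([set` `[c', c' + l']%R] : set T)) H b <= S)%E.
    apply: ge0_sub_int; first exact: subI.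
    by move=> x _; exact: H_ge0.
  apply: (le_trans _ Hs); apply: ge0_le_int => b; rewrite /= in_itv/= => /andP[cb bc].
    by rewrite lee_fin mulr_ge0 ?sqr_ge0// invr_ge0 exprn_ge0// ltW.
  rewrite mulrC; apply: step1 => //; apply/andP; split.
    exact: le_trans cb.
  exact: le_trans cl'.
rewrite -ler_sqr ?nnegrE ?mulr_ge0 ?sqrtr_ge0 ?(ltW q0)//.
rewrite real_normK ?num_real// exprMn sqr_sqrtr ?B_ge0//.
apply: (le_trans h1); rewrite ler_pdivrMr//.
have -> : (4 * q) ^+ 2 * B * l' = q ^+ 6 * B by rewrite /l'; field.
by rewrite ler_pdivrMl ?exprn_gt0// in h2.
Qed.

(** The first interval has length 1/16, hence the factor 16. The later differences are
    [4 * 2^-(k+1)] times the root of [B] and add up to at most 4 times this root. *)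
Lemma small_avgs (c : nat -> R) (k0 : nat) : 
  (forall k, 0 <= c k) -> (forall k, c k + (2 ^- k.+1) ^+ 4 <= 1) ->
  (forall k, c k <= c k.+1) ->
  (forall k, c k.+1 + (2 ^- k.+2) ^+ 4 <= c k + (2 ^- k.+1) ^+ 4) ->
  `|avg (c k0) ((2 ^- k0.+1) ^+ 4)| <= 16 * it 0 1 (fun t => `|g t|) + 4 * Num.sqrt B.
Proof.
move=> c0 c1 cm cM.
suff AV k : `|avg (c k) ((2 ^- k.+1) ^+ 4)| <=
    16 * it 0 1 (fun t => `|g t|) + 4 * Num.sqrt B * (1 - 2 ^- k).
  apply: (le_trans (AV k0)); rewrite lerD2l; apply: ler_piMr.
    by rewrite mulr_ge0 ?sqrtr_ge0.
  by rewrite lerBlDr lerDl invr_ge0 exprn_ge0.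
have q0 j : (0 : R) < 2 ^- j by rewrite invr_gt0 exprn_gt0.
elim: k => [|k IH].
  rewrite expr0 invr1 subrr mulr0 addr0 /avg normrM mulrC.
  have -> : `|((2 ^- 1) ^+ 4 : R)^-1| = 16 by rewrite ger0_norm; [field|rewrite invr_ge0 exprn_ge0// ltW].
  rewrite ler_wpM2l//.
  have cc : c 0%N <= c 0%N + (2 ^- 1) ^+ 4 by rewrite lerDl exprn_ge0// ltW.
  apply: (le_trans (it_norm _)); first by apply: ig_itv => //; exact: sqi_ig.
  by apply: it_mono => //; apply: sqi_ig; exact: sqi_norm.
have E2 : (2 ^- k.+2 : R) = 2 ^- k.+1 / 2 by rewrite [2 ^+ k.+2]exprS invfM mulrC.
have q1 : ((2 ^- k.+1) ^+ 4 : R) < 1.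
  by rewrite exprn_ilt1// invf_lt1 ?exprn_gt0// exprn_egt1// ltr1n.
have := @step2 (2 ^- k.+1) (c k) (c k.+1) (q0 _) q1 (c0 k) (c1 k) (cm k).
rewrite -E2 => /(_ (cM k)) h.
have := ler_normD (avg (c k.+1) ((2 ^- k.+2) ^+ 4) - avg (c k) ((2 ^- k.+1) ^+ 4)) (avg (c k) ((2 ^- k.+1) ^+ 4)).
rewrite subrK => h'; apply: (le_trans h').
have Ek : (2 ^- k : R) = 2 * 2 ^- k.+1 by rewrite exprS invfM mulrA divff// mul1r.
move: h IH; rewrite Ek; move: (2 ^- k.+1) (Num.sqrt B) => x y; lra.
Qed.

(* Averages over nested intervals of length 16^-k: by Cauchy-Schwarz against
   the Slobodeckij kernel consecutive averages differ by a geometric sequence,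
   and at Lebesgue points they converge to the value. *)
Lemma essb_frac : ae01 (fun s => `|g s| <= 16 * it 0 1 (fun t => `|g t|) + 4 * Num.sqrt B).
Proof.
pose M := 16 * it 0 1 (fun t => `|g t|) + 4 * Num.sqrt B; rewrite -/M.
have Ig := sqi_ig sg.
have IS : ig setT (g \_ I01).
  by rewrite /ig -restrict_EFin; apply/integrable_restrict => //=; rewrite setTI.
have := @FTC1 R (g \_ I01) (BLeft 0) _ (integrable_locally mI01 Ig).
move=> /(_ _)[]; first by move=> y; apply: igS IS.
move=> N [mN N0' fN].
have m1 (x : R) : measurable ([set x] : set T) by exact: measurable_set1.
exists (N `|` [set 0] `|` [set 1]); split.
- by apply: measurableU; [apply: measurableU; [exact: mN|exact: m1]|exact: m1].
- have mx0 (x : R) : mu [set x] = 0%E by exact: lebesgue_measure_set1.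
  have mN1 : measurable (N `|` [set 0]) by apply: measurableU; [exact: mN|exact: m1].
  by rewrite (measureU0 mN1 (m1 1) (mx0 1)) (measureU0 mN (m1 0) (mx0 0)).
move=> t /= /not_implyP[]; rewrite in_itv/= => /andP[t0 t1] vt.
have [->|tn0] := eqVneq t 0; first by left; right.
have [->|tn1] := eqVneq t 1; first by right.
left; left; apply: fN => /= H'; apply: vt.
have tp : 0 < t by rewrite lt_neqAle eq_sym tn0.
have tl : t < 1 by rewrite lt_neqAle tn1.
have [|dF F'] := H'; first by rewrite lte_fin.
have It : t \in (I01 : set T) by rewrite inE/= in_itv/= t0.
rewrite patchE It derive1E in F'.
pose F (y : R) := int0 y g.
have FE (y : R) : 0 <= y <= 1 -> (\int[mu]_(t in `[0, y]) (g \_ I01) t)%R = F y.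
  move=> /andP[y0 y1]; apply: eq_Rintegral => r; rewrite inE/= in_itv/= => /andP[r0 ry].
  have Ir : r \in (I01 : set T) by rewrite inE/= in_itv/= r0 (le_trans ry).
  by rewrite patchE Ir.
have L : h^-1 *: (\int[mu]_(t in `[0, (h *: 1 + t)%R]) (g \_ I01) t - F t) @[h --> (0:R^o)^'] --> (g t : R^o).
  by rewrite -F' -(FE t) ?t0//; exact: dF.
rewrite leNgt; apply/negP => Mg.
have e0 : 0 < `|g t| - M by rewrite subr_gt0.
move/cvgrPdist_lt/(_ _ e0) : L => [d /= d0 L].
have {}L (h : R) : h != 0 -> `|h| < d -> 0 <= t + h <= 1 -> M < `|(F (t + h) - F t) / h|.
  move=> h0 hd th; have := L h; rewrite /= sub0r normrN => /(_ hd h0).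
  have -> : h^-1 *: (\int[mu]_(t in `[0, (h *: 1 + t)%R]) (g \_ I01) t - F t) = (F (t + h) - F t) / h.
    by rewrite -[h *: 1]/(h * 1) mulr1 [h + t]addrC FE// -[LHS]/(_^-1 * _) mulrC.
  by have := lerB_dist (g t) ((F (t + h) - F t) / h) => a b; move: (le_lt_trans a b); rewrite ltrD2l ltrN2.
have [k kd] : exists k : nat, ((2 ^- k.+1) ^+ 4 : R) < d.
  (* [2^-(k+1)] is below [d] since [2^(k+1) >= k + 1 > 1 / d], and its fourth power is smaller
     still. *)
  pose k := Num.truncn (d^-1); exists k.
  have kd : d^-1 < k.+1%:R by exact: truncnS_gt.
  have k2 : (k.+1%:R : R) <= 2 ^+ k.+1 by rewrite -natrX ler_nat ltnW// ltn_expl.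
  have x1 : (2 ^- k.+1 : R) <= 1 by rewrite invf_le1 ?exprn_gt0// exprn_ege1// ler1n.
  have x0 : (0 : R) < 2 ^- k.+1 by rewrite invr_gt0 exprn_gt0.
  apply: (@le_lt_trans _ _ (2 ^- k.+1)).
    by rewrite -[leRHS]expr1 ler_wiXn2l// ltW.
  rewrite -[d]invrK ltf_pV2 ?posrE ?invr_gt0 ?exprn_gt0//; exact: lt_le_trans kd k2.
have q0 j : (0 : R) < (2 ^- j) ^+ 4 by rewrite exprn_gt0// invr_gt0 exprn_gt0.
have qd j : ((2 ^- j.+2) ^+ 4 : R) <= (2 ^- j.+1) ^+ 4.
  rewrite lerXn2r ?nnegrE ?invr_ge0 ?exprn_ge0// lef_pV2 ?posrE ?exprn_gt0//.
  by rewrite ler_weXn2l// ler1n.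
have qh j : ((2 ^- j.+1) ^+ 4 : R) <= 2^-1.
  elim: j => [|j IH]; last exact: le_trans (qd j) IH.
  by rewrite expr1 ler_iXnr ?invr_ge0// invf_le1 ?ler1n.
have kd' := kd; set l := (2 ^- k.+1) ^+ 4 in kd kd' *.
have l0 : 0 < l := q0 _.
have lh : l <= 2^-1 := qh k.
(* The intervals have length at most 1/2; placing them to the right of [t] in the left half and to
   the left of [t] in the right half keeps them inside [0, 1]. *)
have [th|th] := leP t (2^-1).
- have A := @small_avgs (fun=> t) k (fun=> t0) _ (fun=> lexx t) _.
  have {}A : `|avg t l| <= M.
    apply: A => j; last by rewrite lerD2l.
    by have := qh j; lra.
  have th1 : 0 <= t + l <= 1 by apply/andP; split; lra.
  have := L l; rewrite gt_eqF// ger0_norm ?(ltW l0)// => /(_ isT kd th1).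
  rewrite ltNge; case/negP; move: A; congr (`| _ / _ | <= _).
  rewrite /F (@it_split _ g t (t + l))//; [by rewrite addrAC subrr add0r|lra|by case/andP: th1].
- have A := @small_avgs (fun j => t - (2 ^- j.+1) ^+ 4) k.
  have {}A : `|avg (t - l) l| <= M.
    apply: A => j.
    + by have := qh j; lra.
    + by rewrite subrK.
    + by rewrite lerD2l lerN2.
    + by rewrite !subrK.
  have th1 : 0 <= t - l <= 1 by apply/andP; split; lra.
  have := L (- l); rewrite oppr_eq0 gt_eqF// normrN ger0_norm ?(ltW l0)// => /(_ isT kd th1).
  rewrite ltNge; case/negP; move: A; congr (`| _ | <= _).
  rewrite /avg subrK /F (@it_split _ g (t - l) t)//; [|by case/andP: th1|lra].
  rewrite invrN mulrN -mulNr; congr (_ / _); ring.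
Qed.

End fractional.

Section frac_embedding.
Context {R : realType}.
Local Hint Resolve mI01 : core.
Notation r0 := (3 / 4 : R).

Lemma frac_sqnormE (x : L2 R) : frac_sobolev_sqnorm r0 x = L2dot x x + fine (slobodeckij r0 x).
Proof. by rewrite /frac_sobolev_sqnorm; case: eqP => // /eqP; rewrite gt_eqF. Qed.

Lemma slob_ge0 (x : L2 R) : 0 <= fine (slobodeckij r0 x).
Proof.
apply: fine_ge0; apply: integral_ge0 => s _; apply: integral_ge0 => t _.
by rewrite lee_fin divr_ge0 ?sqr_ge0// powR_ge0.
Qed.

Lemma N0_le_Nr (x : L2 R) : frac_sobolev r0 x -> N0 x <= Nr r0 x.
Proof.
move=> _; rewrite -ler_sqr ?nnegrE ?N0_ge0 ?Nr_ge0// N0_sqr /Nr sqr_sqrtr ?frac_ge0//.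
by rewrite frac_sqnormE lerDl slob_ge0.
Qed.

(** [20 = 16 + 4]: the L^1 norm and the root of the Slobodeckij integral are both at most [Nr]. *)
Lemma frac_embedding (x : L2 R) : frac_sobolev r0 x -> essb (20 * Nr r0 x) x.
Proof.
move=> fx; have S : (slobodeckij r0 x < +oo)%E.
  by case: fx => // /eqP; rewrite gt_eqF.
have sx := L2fun_sqi x.
apply: ae01S (essb_frac sx S) => t _ /le_trans; apply.
have h1 := L1_N0 sx (ae01W (fun t _ => erefl)) (z := x).
have h2 := N0_le_Nr fx.
have h3 : Num.sqrt (fine (slobodeckij r0 x)) <= Nr r0 x.
  by rewrite /Nr ler_wsqrtr// frac_sqnormE lerDr L2dot_ge0.
have -> : 20 * Nr r0 x = 16 * Nr r0 x + 4 * Nr r0 x by move: (Nr _ x) => N; ring.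
by apply: lerD; rewrite ler_wpM2l//; exact: le_trans h2.
Qed.

End frac_embedding.

(** * The Hessian from second order Taylor expansions *)

Section taylor2.
Context {R : realType}.
Implicit Types (f g : R -> R).

(** A second order expansion at 0 with cubic remainder. It presupposes no derivative of [f], is
    stable under algebraic operations, and suffices to identify a second derivative known to exist
    ([T2_second]). *)
Definition T2 f (a b c : R) := exists d C : R, [/\ 0 < d, 0 <= C &
  forall s : R, `|s| < d -> `|f s - (a + b * s + c * s ^+ 2)| <= C * `|s| ^+ 3].

Lemma T2_poly f (a b c : R) : (forall s, f s = a + b * s + c * s ^+ 2) -> T2 f a b c.
Proof. by move=> H; exists 1, 0; split=> // s _; rewrite H subrr normr0 mul0r. Qed.

Lemma T2_eq f g (a b c d : R) : 0 < d -> (forall s : R, `|s| < d -> f s = g s) ->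
  T2 f a b c -> T2 g a b c.
Proof.
move=> d0 H [d' [C [d'0 C0 B]]]; exists (Num.min d d'), C; split=> //; first exact: lt_minr.
by move=> s /lt_min2[sd sd']; rewrite -H//; exact: B.
Qed.

Lemma T2_coef f (a b c a' b' c' : R) : a = a' -> b = b' -> c = c' -> T2 f a b c -> T2 f a' b' c'.
Proof. by move=> <- <- <-. Qed.

Lemma T2_add f g (a b c a' b' c' : R) : T2 f a b c -> T2 g a' b' c' ->
  T2 (fun s => f s + g s) (a + a') (b + b') (c + c').
Proof.
move=> [d [C [d0 C0 B]]] [d' [C' [d'0 C'0 B']]].
exists (Num.min d d'), (C + C'); split; [exact: lt_minr|exact: addr_ge0|].
move=> s /lt_min2[sd sd'].
have -> : f s + g s - (a + a' + (b + b') * s + (c + c') * s ^+ 2) =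
  (f s - (a + b * s + c * s ^+ 2)) + (g s - (a' + b' * s + c' * s ^+ 2)) by ring.
rewrite mulrDl; apply: (le_trans (ler_normD _ _)); apply: lerD; [exact: B|exact: B'].
Qed.

Lemma T2_mul f g (a b c a' b' c' : R) : T2 f a b c -> T2 g a' b' c' ->
  T2 (fun s => f s * g s) (a * a') (a * b' + b * a') (a * c' + b * b' + c * a').
Proof.
move=> [d [C [d0 C0 B]]] [d' [C' [d'0 C'0 B']]].
pose M := `|a| + `|b| + `|c|; pose M' := `|a'| + `|b'| + `|c'|.
have M0 : 0 <= M by rewrite !addr_ge0.
have M'0 : 0 <= M' by rewrite !addr_ge0.
exists (Num.min 1 (Num.min d d')), (C * (M' + C') + M * C' + M * M').
split; first by apply: lt_minr => //; exact: lt_minr.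
  by rewrite !addr_ge0// mulr_ge0// addr_ge0.
move=> s /lt_min2[s1 /lt_min2[sd sd']].
have {}B := B s sd; have {}B' := B' s sd'.
have s0 : 0 <= `|s| by [].
have x3 : `|s| ^+ 3 <= 1 by rewrite exprn_ile1// ltW.
have x30 : 0 <= `|s| ^+ 3 by rewrite exprn_ge0.
have x2 : `|s| ^+ 2 <= 1 by rewrite exprn_ile1// ltW.
have x20 : 0 <= `|s| ^+ 2 by rewrite exprn_ge0.
set p := a + b * s + c * s ^+ 2 in B *; set q := a' + b' * s + c' * s ^+ 2 in B' *.
have pM : `|p| <= M.
  apply: (le_trans (ler_normD _ _)); apply: lerD; last by rewrite normrM normrX ler_piMr.
  by apply: (le_trans (ler_normD _ _)); apply: lerD => //; rewrite normrM ler_piMr// ltW.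
have qM : `|q| <= M'.
  apply: (le_trans (ler_normD _ _)); apply: lerD; last by rewrite normrM normrX ler_piMr.
  by apply: (le_trans (ler_normD _ _)); apply: lerD => //; rewrite normrM ler_piMr// ltW.
have gM : `|g s| <= M' + C'.
  have -> : g s = q + (g s - q) by ring.
  apply: (le_trans (ler_normD _ _)); apply: lerD => //; apply: (le_trans B').
  by rewrite ler_piMr.
(* Two remainders times bounded factors, plus the terms of order at least 3 in the product of the
   two quadratic polynomials. *)
have -> : f s * g s - (a * a' + (a * b' + b * a') * s + (a * c' + b * b' + c * a') * s ^+ 2) =
  (f s - p) * g s + p * (g s - q) + s ^+ 3 * (b * c' + c * b' + c * c' * s).
  by rewrite /p /q; ring.
rewrite [leRHS]mulrDl; apply: (le_trans (ler_normD _ _)); apply: lerD.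
  rewrite [leRHS]mulrDl; apply: (le_trans (ler_normD _ _)); apply: lerD.
    rewrite normrM mulrAC; apply: ler_pM => //.
  by rewrite normrM -mulrA; apply: ler_pM.
rewrite normrM normrX mulrC; apply: ler_wpM2r => //.
have e1 : `|b * c' + c * b' + c * c' * s| <= `|b| * `|c'| + `|c| * `|b'| + `|c| * `|c'|.
  apply: (le_trans (ler_normD _ _)); apply: lerD.
    by apply: (le_trans (ler_normD _ _)); rewrite !normrM.
  by rewrite !normrM ler_piMr ?mulr_ge0// ltW.
apply: (le_trans e1); rewrite /M /M'.
have := normr_ge0 a; have := normr_ge0 b; have := normr_ge0 c.
have := normr_ge0 a'; have := normr_ge0 b'; have := normr_ge0 c'.
move: (`|a|) (`|b|) (`|c|) (`|a'|) (`|b'|) (`|c'|) => k1 k2 k3 k4 k5 k6 h6 h5 h4 h3 h2 h1'.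
rewrite -subr_ge0.
have -> : (k1 + k2 + k3) * (k4 + k5 + k6) - (k2 * k6 + k3 * k5 + k3 * k6) =
  k1 * k4 + k1 * k5 + k1 * k6 + k2 * k4 + k2 * k5 + k3 * k4 by ring.
by rewrite !addr_ge0// mulr_ge0.
Qed.

Lemma T2_cst (k : R) : T2 (fun _ => k) k 0 0.
Proof. by apply: T2_poly => s; ring. Qed.

Lemma T2_scale f (k a b c : R) : T2 f a b c -> T2 (fun s => k * f s) (k * a) (k * b) (k * c).
Proof.
by move=> h; apply: T2_coef (T2_mul (T2_cst k) h); rewrite ?mul0r ?addr0.
Qed.

Lemma T2_opp f (a b c : R) : T2 f a b c -> T2 (fun s => - f s) (- a) (- b) (- c).
Proof.
move=> /(T2_scale (-1)); rewrite !mulN1r; apply: (T2_eq (d := 1)) => // s _.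
by rewrite mulN1r.
Qed.

Lemma T2_bound f (a b c : R) : T2 f a b c -> exists d C : R,
  [/\ 0 < d, 0 <= C & forall s : R, `|s| < d -> `|f s - a| <= C * `|s|].
Proof.
move=> [d [C [d0 C0 B]]]; exists (Num.min 1 d), (C + `|b| + `|c|).
split; first exact: lt_minr; first by rewrite !addr_ge0.
move=> s /lt_min2[s1 sd].
have -> : f s - a = (f s - (a + b * s + c * s ^+ 2)) + b * s + c * s ^+ 2 by ring.
rewrite !mulrDl; apply: (le_trans (ler_normD _ _)); apply: lerD.
  apply: (le_trans (ler_normD _ _)); apply: lerD; last by rewrite normrM.
  apply: (le_trans (B s sd)); apply: ler_wpM2l => //.
  by rewrite ler_iXnr// ltW.
by rewrite normrM normrX; apply: ler_wpM2l => //; rewrite ler_iXnr// ltW.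
Qed.

(** The product of [f] with the claimed polynomial expands as 1 with cubic error, by [T2_mul];
    dividing by [f] is safe as long as [|f|] is at least [|a| / 2]. *)
Lemma T2_inv f (a b c : R) : a != 0 -> T2 f a b c ->
  T2 (fun s => (f s)^-1) a^-1 (- b / a ^+ 2) (b ^+ 2 / a ^+ 3 - c / a ^+ 2).
Proof.
move=> a0 h; pose q s := a^-1 + - b / a ^+ 2 * s + (b ^+ 2 / a ^+ 3 - c / a ^+ 2) * s ^+ 2.
have qq : T2 q a^-1 (- b / a ^+ 2) (b ^+ 2 / a ^+ 3 - c / a ^+ 2) by apply: T2_poly.
have [d1 [C1 [d10 C10 B1]]] := T2_bound h.
have [d2 [C2 [d20 C20 B2]]] : T2 (fun s => f s * q s) 1 0 0.
  by apply: T2_coef (T2_mul h qq); field.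
have d3 : 0 < `|a| / 2 / (C1 + 1) by rewrite !divr_gt0 ?normr_gt0// ltr_wpDl.
exists (Num.min (`|a| / 2 / (C1 + 1)) (Num.min d1 d2)), (C2 * (2 / `|a|)).
split; first by apply: lt_minr => //; exact: lt_minr.
  by rewrite mulr_ge0// divr_ge0.
move=> s /lt_min2[s1 /lt_min2[sd1 sd2]].
have fa : `|a| / 2 <= `|f s|.
  apply: half_bound; apply: (le_trans (B1 s sd1)); apply: small_arith => //.
have f0 : 0 < `|f s| by apply: lt_le_trans fa; rewrite divr_gt0 ?normr_gt0.
have fn : f s != 0 by rewrite -normr_gt0.
rewrite -/(q s).
have -> : (f s)^-1 - q s = - (f s * q s - (1 + 0 * s + 0 * s ^+ 2)) / f s by field.
rewrite normrM normrN normfV mulrAC; apply: ler_pM => //; first exact: B2.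
rewrite -[2 / _]invrK invf_div lef_pV2 ?posrE//.
by rewrite divr_gt0 ?normr_gt0.
Qed.

Lemma deriv_eps (f : R -> R) (s l : R) :
  (forall e : R, 0 < e -> exists2 d : R, 0 < d & forall r : R, `|r| < d ->
     `|f (s + r) - f s - r * l| <= e * `|r|) ->
  is_derive (s : R^o) 1 (f : R^o -> R^o) l.
Proof.
move=> H.
have L : h^-1 *: ((f : R^o -> R^o) (h *: 1 + s) - f s) @[h --> (0:R^o)^'] --> (l : R^o).
  apply/cvgrPdist_lt => e e0; have [d d0 B] := H (e / 2) (divr_gt0 e0 (ltr0n _ 2)).
  exists d => //= r; rewrite /= sub0r normrN => rd r0.
  have {}B := B r rd.
  rewrite distrC -[r *: 1]/(r * 1) mulr1 -[r^-1 *: _]/(r^-1 * _).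
  have -> : r^-1 * (f (r + s) - f s) - l = r^-1 * (f (s + r) - f s - r * l).
    by rewrite [RHS]mulrBr [r + s]addrC mulKf.
  rewrite normrM normfV; apply: (le_lt_trans (y := e / 2)).
    by rewrite ler_pdivrMl ?normr_gt0// [leRHS]mulrC.
  by rewrite ltr_pdivrMr// ltr_pMr// ltr1n.
by split; [apply/cvg_ex; exists l|exact: cvg_lim L].
Qed.

(* The symmetric second difference of f cancels a and b. *)
Lemma T2_second (f f1 : R -> R) (a b c m d0 : R) : 0 < d0 ->
  (forall s : R, `|s| < d0 -> is_derive (s : R^o) 1 (f : R^o -> R^o) (f1 s)) ->
  (forall e : R, 0 < e -> exists2 d : R, 0 < d & forall s : R, `|s| < d ->
     `|f1 s - f1 0 - s * m| <= e * `|s|) ->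
  T2 f a b c -> m = 2 * c.
Proof.
move=> d00 Df Hm [d1 [C [d10 C0 B]]].
apply/eqP; rewrite -subr_eq0 -normr_le0; apply/ler_addgt0Pr => e e0; rewrite add0r.
have [d d_0 Be] := Hm (e / 4) (divr_gt0 e0 (ltr0n _ 4)).
(* The last entry makes [C s] at most [e / 4]; together with the [e / 2] from the mean value theorem
   the total error is [e]. *)
pose del := Num.min d0 (Num.min d (Num.min d1 (e / 4 / (C + 1)))).
have de0 : 0 < del.
  rewrite /del; apply: lt_minr => //; apply: lt_minr => //; apply: lt_minr => //.
  by rewrite !divr_gt0// ltr_wpDl.
have [s sE] : exists s, s = del / 2 by exists (del / 2).
have s0 : 0 < s by rewrite sE divr_gt0.
have : `|s| < del by rewrite gtr0_norm// sE ltr_pdivrMr// ltr_pMr// ltr1n.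
rewrite /del => /lt_min2[sd0 /lt_min2[sd /lt_min2[sd1 se]]].
have f0 : f 0 = a.
  have := B 0; rewrite normr0 => /(_ d10).
  by rewrite !expr0n/= !mulr0 !addr0 normr_le0 subr_eq0 => /eqP.
(* The second difference at scale [r s], minus its expected value. Its derivative in [r] is small
   because [f1] is nearly affine with slope [m]. *)
pose F (r : R) := f (r * s) + f (- (r * s)) - r ^+ 2 * s ^+ 2 * m.
pose F1 (r : R) := s * f1 (r * s) + - s * f1 (- (r * s)) - 2 * r * s ^+ 2 * m.
have rs (r : R) : 0 <= r <= 1 -> `|r * s| <= `|s|.
  by move=> /andP[r0 r1]; rewrite normrM ler_piMl// ger0_norm.
have DF (r : R) : 0 <= r <= 1 -> is_derive (r : R^o) 1 (F : R^o -> R^o) (F1 r).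
  move=> r01; have rl := rs r r01.
  have Lp : is_derive (r : R^o) 1 (fun r : R^o => r * s : R^o) s by exact: is_derive_lin.
  have Ln : is_derive (r : R^o) 1 (fun r : R^o => - (r * s) : R^o) (- s).
    by apply: is_deriveN.
  have A1 : is_derive (r * s : R^o) 1 (f : R^o -> R^o) (f1 (r * s)).
    by apply: Df; apply: le_lt_trans sd0.
  have A2 : is_derive (- (r * s) : R^o) 1 (f : R^o -> R^o) (f1 (- (r * s))).
    by apply: Df; rewrite normrN; apply: le_lt_trans sd0.
  have B1 := @is_derive1_comp R f (fun r => r * s) r _ _ A1 Lp.
  have B2 := @is_derive1_comp R f (fun r => - (r * s)) r _ _ A2 Ln.
  have B3 := is_derive_quad (2 * s ^+ 2 * m) r.
  have := is_deriveB (is_deriveD B1 B2) B3.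
  congr (is_derive _ _ _ _); last by rewrite /F1; ring.
  apply/funext => t; rewrite /F.
  have -> : t ^+ 2 * s ^+ 2 * m = 2^-1 * (t ^+ 2 * (2 * s ^+ 2 * m)) by field.
  by [].
have EB : `|F 1 - F 0| <= e / 2 * s ^+ 2.
  apply: (mean_bound DF) => r r01; have rl := rs r r01.
  have h1' := Be (r * s) (le_lt_trans rl sd).
  have h2' := Be (- (r * s)); rewrite normrN in h2'; have {}h2' := h2' (le_lt_trans rl sd).
  rewrite /F1.
  have -> : s * f1 (r * s) + - s * f1 (- (r * s)) - 2 * r * s ^+ 2 * m =
    s * (f1 (r * s) - f1 0 - r * s * m) - s * (f1 (- (r * s)) - f1 0 - - (r * s) * m) by ring.
  apply: (le_trans (ler_normB _ _)); rewrite !normrM.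
  rewrite (gtr0_norm s0) in rl *.
  have -> : e / 2 * s ^+ 2 = s * (e / 4 * s) + s * (e / 4 * s) by field.
  have e4 : 0 <= e / 4 by rewrite divr_ge0// ltW.
  by apply: lerD; (apply: ler_wpM2l; first exact: ltW);
    [apply: (le_trans h1')|apply: (le_trans h2')]; apply: ler_wpM2l.
have Bp := B s sd1; have Bn := B (- s); rewrite normrN in Bn; have {}Bn := Bn sd1.
have K : `|(m - 2 * c) * s ^+ 2| <= (e / 2 + 2 * (C * s)) * s ^+ 2.
  have -> : (m - 2 * c) * s ^+ 2 = (f s - (a + b * s + c * s ^+ 2)) +
    (f (- s) - (a + b * - s + c * (- s) ^+ 2)) - (F 1 - F 0).
    by rewrite /F !mul1r !mul0r oppr0 f0; ring.
  have -> : (e / 2 + 2 * (C * s)) * s ^+ 2 = C * s ^+ 3 + C * s ^+ 3 + e / 2 * s ^+ 2 by ring.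
  rewrite (gtr0_norm s0) in Bp Bn.
  apply: (le_trans (ler_normB _ _)); apply: lerD => //.
  by apply: (le_trans (ler_normD _ _)); apply: lerD.
rewrite normrM (ger0_norm (sqr_ge0 s)) ler_pM2r ?exprn_gt0// in K.
apply: (le_trans K).
have Cs : C * s <= e / 4.
  rewrite (gtr0_norm s0) in se; apply: small_arith => //; exact: ltW.
by move: Cs; move: (C * s) => x; lra.
Qed.

End taylor2.

(** * Openness of U_1 and second derivatives along lines *)

Section setup.
Context {R : realType}.
Implicit Types (u v w x y : HL2 R).
Local Hint Resolve mI01 : core.
Variable Q : set (plane R).
Hypothesis Qopen : open Q.

(** The product of the time line with Z, the domain of the pulled back coefficients. *)
Definition OQ : set (V3 R) := sqm @^-1` ([set: R^o] `*` Q).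

Lemma OQ_open : open OQ.
Proof.
have -> : OQ = (snd \o sqm) @^-1` Q by apply/seteqP; split=> x; [case|split].
have c : continuous ((snd : V3 R -> plane R) \o sqm).
  by move=> x; apply: continuous_comp; [exact: sqm_continuous|exact: cvg_snd].
by move/continuousP : c; apply.
Qed.

Lemma OQE (t : R) (z : plane R) : OQ (t, z) <-> Q (csqr z).
Proof. by split=> [[]|]. Qed.

Lemma U1_H1 u : U1 Q u -> H_ 1 u.
Proof. by move=> [[h _ _] k]; exact: h_E. Qed.

Lemma U1_OQ u : U1 Q u -> forall t : R, 0 <= t <= 1 -> OQ (gam u t).
Proof.
by move=> [[_ _ h] _] t t01; rewrite gamE; apply/OQE; apply: (h t); rewrite in_itv.
Qed.

Lemma U1E u : H_ 1 u -> u.1 <> 0 -> (forall t : R, 0 <= t <= 1 -> OQ (gam u t)) -> U1 Q u.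
Proof.
move=> [a b] n h; split; [split=> //|exact: b].
by move=> t; rewrite in_itv/= => /h; rewrite gamE => /OQE.
Qed.

Lemma cp01_0 u : (cp u o0 = 0 /\ cp u o1 = 0) <-> u.1 = 0.
Proof. by case: u => [[a b] z]; rewrite /cp /=; split=> [[-> ->]|[-> ->]]. Qed.

Definition mss u : R := L2dot (cp u o0) (cp u o0) + L2dot (cp u o1) (cp u o1).

Lemma mssE u : mss u = hdot u.1 u.1. Proof. by []. Qed.

Lemma mss_gt0 u : u.1 <> 0 -> 0 < mss u.
Proof.
move=> n; rewrite lt_neqAle eq_sym; apply/andP; split; last by rewrite addr_ge0// L2dot_ge0.
apply/eqP => m0; apply: n; apply/cp01_0.
have := m0; rewrite /mss => /eqP; rewrite paddr_eq0 ?L2dot_ge0// -!N0_sqr !sqrf_eq0.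
by move=> /andP[/eqP a /eqP b]; split; exact: N0_eq0.
Qed.

Lemma U1_open_in : open_in (H_ 1) (U1 Q).
Proof.
split=> [u|u Uu]; first exact: U1_H1.
have Hu := U1_H1 Uu.
have Ksub : gam u @` (I01 : set R) `<=` OQ.
  by move=> _ [t /I01E t01 <-]; exact: U1_OQ.
(* Applied to a constant function, this yields merely a uniform radius: all points within [d] of the
   image of [u] lie in [OQ]. *)
have [d [C [d0 C0 L]]] := sm_ulip OQ_open (gam_compact Hu) Ksub (@sm_cst R 1 OQ 0).
(* A nonzero component of [z] stays nonzero under perturbations smaller than its L^2 norm. *)
have [i [oi ni]] : exists i, (i = o0 \/ i = o1) /\ 0 < N0 (cp u i).
  have [[_ n _] _] := Uu.
  apply/not_existsP => H; apply: n; apply/cp01_0.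
  by split; apply: N0_eq0; apply/eqP; rewrite eq_le N0_ge0 andbT leNgt; apply/negP => k;
    [apply: (H o0)|apply: (H o1)]; split=> //; [left|right].
have [c c0 hc] := le_nrm (@equiv1 R).
exists (Num.min (d / c) (N0 (cp u i) / c)).
  by apply: lt_minr; [exact: divr_gt0 d0 c0|exact: divr_gt0 ni c0].
move=> w Hw /lt_min2[].
have Hwu : H_ 1 (w - u) by case: (h1B Hw Hu).
have le1 := hc _ Hwu.
rewrite !ltr_pdivlMr// => n1' n2'.
have {n1'}n1' : h1 (w - u) < d by apply: le_lt_trans le1 _; rewrite mulrC.
have {n2'}n2' : h1 (w - u) < N0 (cp u i) by apply: le_lt_trans le1 _; rewrite mulrC.
apply: U1E => // [w0|t t01].
  have /cp01_0[a b] := w0.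
  have wi : cp w i = 0 by case: oi => ->.
  have := le_lt_trans (le_trans (N0_n1 _) (@cp_hn R _ (w - u) i (@n1_ge0 R))) n2'.
  by rewrite cpB wi sub0r -scaleN1r N0Z normrN normr1 mul1r ltxx.
have K : (gam u @` (I01 : set R)) (gam u t) by exists t => //; apply/I01E.
have [] := L _ K (gam w t) (gam w t) _ _ => //; apply: le_lt_trans n1'; exact: gamB.
Qed.

Lemma U1_sub u x : U1 Q u -> H_ 1 x -> exists2 d : R, 0 < d &
  forall s : R, `|s| < d -> U1 Q (u + s *: x).
Proof.
move=> Uu Hx; have [_ /(_ u Uu)[d d0 h]] := U1_open_in.
exists (d / (h1 x + 1)); first by rewrite divr_gt0// ltr_wpDl// h1_ge0.
move=> s sd; have [Hsx nsx] := h1Z s Hx.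
apply: h; first by case: (h1D (U1_H1 Uu) Hsx).
rewrite addrC addKr; apply: (le_lt_trans (nrm_le (@equiv1 R) Hsx)).
rewrite nsx; apply: (le_lt_trans (y := `|s| * (h1 x + 1))).
  by apply: ler_wpM2l => //; rewrite lerDl.
by rewrite -ltr_pdivlMr// ltr_wpDl// h1_ge0.
Qed.

Section hessian.
Variables (S : HL2 R -> R) (A : HL2 R -> HL2 R -> HL2 R).
Hypothesis SA : hessian_field Q S A.

Lemma HdotZl (a : R) u w : Hdot (a *: u) w = a * Hdot u w.
Proof. by rewrite !HdotE mulr_sumr; apply: eq_bigr => i _; rewrite cpZ L2dotZ. Qed.
Lemma HdotZr (a : R) u w : Hdot u (a *: w) = a * Hdot u w.
Proof. by rewrite !HdotE mulr_sumr; apply: eq_bigr => i _; rewrite cpZ L2dotZr. Qed.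
Lemma HdotD u v w : Hdot (u + v) w = Hdot u w + Hdot v w.
Proof. by rewrite !HdotE -big_split; apply: eq_bigr => i _; rewrite cpD L2dotD. Qed.
Lemma HdotDr u v w : Hdot u (v + w) = Hdot u v + Hdot u w.
Proof. by rewrite !HdotE -big_split; apply: eq_bigr => i _; rewrite cpD L2dotDr. Qed.
Lemma HdotBl u v w : Hdot (u - v) w = Hdot u w - Hdot v w.
Proof. by rewrite HdotD -scaleN1r HdotZl mulN1r. Qed.

Lemma Hdot_CS u w : `|Hdot u w| <= nrm (H_ 0) u * h1 w * 4.
Proof.
rewrite HdotE (le_trans (ler_norm_sum _ _ _))//.
have -> : nrm (H_ 0) u * h1 w * 4 = \sum_(i < 4) (nrm (H_ 0) u * h1 w).
  by rewrite sumr_const card_ord mulr_natr.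
apply: ler_sum => i _; apply: (le_trans (L2dot_CS _ _)).
apply: ler_pM; rewrite ?N0_ge0//; last first.
  by apply: (le_trans (N0_n1 _)); exact: (@cp_hn R _ w i (@n1_ge0 R)).
have q0 (j : 'I_4) : 0 <= sobolev_sqnorm 0 (cp u j).
  by rewrite /sobolev_sqnorm sumr_ge0// => k _; exact: L2dot_ge0.
rewrite -ler_sqr ?nnegrE ?N0_ge0 ?sqrtr_ge0// N0_sqr nrmE sqr_sqrtr ?sumr_ge0//.
rewrite (bigD1 i)//= {1}/sobolev_sqnorm big_ord_recl big_ord0 addr0/= lerDl.
by rewrite sumr_ge0.
Qed.

(** Along the line the action has derivative [Hdot (G _) x] near 0, and this is differentiable at 0
    with derivative [Hdot (A u x) x]; [T2_second] compares it with the Taylor coefficient. *)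
Lemma hess_quad u x (a b c : R) : U1 Q u -> H_ 1 x ->
  T2 (fun s => S (u + s *: x)) a b c -> Hdot (A u x) x = 2 * c.
Proof.
move=> Uu Hx; have [G gG fG] := SA.
have [d d0 dU] := U1_sub Uu Hx.
have k0 : 0 < h1 x + 1 by rewrite ltr_wpDl// h1_ge0.
have small (r d' : R) : `|r| < d' / (h1 x + 1) -> [/\ H_ 1 (r *: x), nrm (H_ 1) (r *: x) < d'
    & nrm (H_ 1) (r *: x) <= `|r| * (h1 x + 1)].
  move=> rd; have [Hsx nsx] := h1Z r Hx.
  have le : nrm (H_ 1) (r *: x) <= `|r| * (h1 x + 1).
    apply: (le_trans (nrm_le (@equiv1 R) Hsx)); rewrite nsx.
    by apply: ler_wpM2l => //; rewrite lerDl.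
  by split=> //; apply: (le_lt_trans le); rewrite -ltr_pdivlMr.
apply: (T2_second (f1 := fun s => Hdot (G (u + s *: x)) x) d0).
  move=> s sd; apply: deriv_eps => e e0.
  have [d' d'0 H] := gG _ (dU s sd) (e / (h1 x + 1)) (divr_gt0 e0 k0).
  exists (d' / (h1 x + 1)); first exact: divr_gt0.
  move=> r rd; have [Hr nr1 nr2] := small r d' rd.
  have := H _ Hr nr1; rewrite -[u + s *: x + r *: x]addrA -scalerDl HdotZr => /le_trans; apply.
  rewrite mulrAC ler_pdivrMr// -mulrA; apply: ler_wpM2l; [exact: ltW|exact: nr2].
move=> e e0.
have [_ F] := fG u Uu.
have k1 : 0 < (h1 x + 1) * h1 x * 4 + 1 by rewrite ltr_wpDl// !mulr_ge0 ?h1_ge0// ltW.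
have [d' d'0 H] := F (e / ((h1 x + 1) * h1 x * 4 + 1)) (divr_gt0 e0 k1).
exists (d' / (h1 x + 1)); first exact: divr_gt0.
move=> r rd; have [Hr nr1 nr2] := small r d' rd.
have K := H _ Hr nr1.
have [Hb _] := fG u Uu.
have lA : A u (r *: x) = r *: A u x.
  have [_ lin _] := Hb.
  have H0 : H_ 1 (0 : HL2 R) by apply/dom_H => i; rewrite cp0; exact: sob1_0.
  have A0 : A u 0 = 0.
    have := lin 1 0 0 H0 H0; rewrite !scale1r addr0 => /eqP.
    by rewrite -subr_eq0 opprD addrA subrr sub0r oppr_eq0 => /eqP.
  by have := lin r x 0 Hx H0; rewrite !addr0 A0 addr0.
rewrite lA in K.
have -> : Hdot (G (u + r *: x)) x - Hdot (G (u + 0 *: x)) x - r * Hdot (A u x) x =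
    Hdot (G (u + r *: x) - G u - r *: A u x) x.
  by rewrite scale0r addr0 !HdotBl HdotZl.
apply: (le_trans (Hdot_CS _ _)).
have nn : 0 <= nrm (H_ 1) (r *: x) by exact: sqrtr_ge0.
have hh : 0 <= h1 x by exact: h1_ge0.
move: (nrm (H_ 1) (r *: x)) (nrm (H_ 0) _) (h1 x) K nr2 k1 k0 nn hh => N M k K nr2 k1 k0 nn hh.
apply: (@le_trans _ _ (e / ((k + 1) * k * 4 + 1) * (`|r| * (k + 1)) * k * 4)).
  rewrite !ler_wpM2r//; apply: (le_trans K); apply: ler_wpM2l => //.
  by rewrite divr_ge0// ltW.
have -> : e / ((k + 1) * k * 4 + 1) * (`|r| * (k + 1)) * k * 4 =
  e * `|r| * (((k + 1) * k * 4) / ((k + 1) * k * 4 + 1)) by field; rewrite gt_eqF.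
by rewrite ler_piMr ?mulr_ge0 ?(ltW e0)// ler_pdivrMr// mul1r lerDl.
Qed.

Hypothesis A_weak : weak_hessian_field Q A.

(** Symmetry of [A u] allows polarization. Since [c] is half the quadratic form, no factor
    remains. *)
Lemma hess_polar u x y (c : HL2 R -> R) : U1 Q u -> H_ 1 x -> H_ 1 y ->
  (forall w, w = x \/ w = y \/ w = x + y -> exists a b : R, T2 (fun s => S (u + s *: w)) a b (c w)) ->
  Hdot (A u x) y = c (x + y) - c x - c y.
Proof.
move=> Uu Hx Hy H.
have [a1 [b1 T1]] := H x (or_introl erefl).
have [a2 [b2 T2']] := H y (or_intror (or_introl erefl)).
have [a3 [b3 T3]] := H (x + y) (or_intror (or_intror erefl)).
have Hxy : H_ 1 (x + y) by case: (h1D Hx Hy).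
have Q1 := hess_quad Uu Hx T1; have Q2 := hess_quad Uu Hy T2'; have Q3 := hess_quad Uu Hxy T3.
have [B _ sy _ _] := A_weak.
have [B1 _] := B; have [_ lin _] := B1 u Uu.
have lA : A u (x + y) = A u x + A u y by have := lin 1 x y Hx Hy; rewrite !scale1r.
have S1 := sy u y x Uu Hy Hx.
have HC : Hdot y (A u x) = Hdot (A u x) y by rewrite !HdotE; apply: eq_bigr => i _; rewrite L2dotC.
move: Q3; rewrite lA HdotD !HdotDr S1 HC Q1 Q2.
move: (Hdot _ _) (c _) (c _) (c _) => p q r s; lra.
Qed.

End hessian.
End setup.

(** * Integration by parts and density of test loops *)

Section calculus.
Context {R : realType}.
Notation T := (measurableTypeR R).
Implicit Types (f g : T -> R) (x y z h w : L2 R).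
Local Hint Resolve mI01 : core.

Lemma L2dot_itE z y : L2dot z y = it 0 1 (fun t => L2fun z t * L2fun y t).
Proof. by []. Qed.

Lemma L2dot_pr3 x h w c : essb c h -> L2dot (pr x h) w = L2dot (pr w h) x.
Proof.
move=> bg; rewrite !L2dot_itE; apply: ae01_it => //; try exact: igM_L2.
apply: ae01S (ae01I (prE x bg) (prE w bg)) => t _ [-> ->]; ring.
Qed.

Lemma L2dot_pr4 x y h w c c' d : essb c x -> essb c' y -> essb d h ->
  L2dot (pr x (pr y h)) w = L2dot (pr (pr w h) x) y.
Proof.
move=> bx by' bh; rewrite !L2dot_itE [pr x _]prC; apply: ae01_it => //; try exact: igM_L2.
have := ae01I (prE (pr y h) bx) (ae01I (prE y bh) (ae01I (prE (pr w h) bx) (prE w bh))).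
by apply: ae01S => t _ [-> [-> [-> ->]]]; ring.
Qed.

Lemma L2diff_pr z y : sobolev 1 z -> sobolev 1 y ->
  L2diff (pr z y) = pr (L2diff z) y + pr (L2diff y) z.
Proof.
move=> sz sy; have [_ -> _] := pr_sob1 sz sy; apply: toL2_uniq.
have := ae01I (L2funD (pr (L2diff z) y) (pr (L2diff y) z)) (ae01I (prE (L2diff z) (sob1_essb sy)) (prE (L2diff y) (sob1_essb sz))).
have [_ ez] := sob1P sz; have [_ ey] := sob1P sy.
move=> H; apply: ae01S (ae01I H (ae01I ez ey)) => t _ [[-> [-> ->]] [-> ->]]; ring.
Qed.

Lemma sob1_pr z y : sobolev 1 z -> sobolev 1 y -> sobolev 1 (pr z y).
Proof. by move=> sz sy; case: (pr_sob1 sz sy). Qed.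

Lemma L2dot_one z : L2dot z one = mn z.
Proof.
rewrite L2dot_itE /mn; apply: ae01_it => //; [exact: igM_L2|exact: ig_L2|].
by apply: ae01S oneE => t _ ->; rewrite mulr1.
Qed.

Lemma L2dot_pr1 x y c : essb c y -> L2dot (pr x y) one = L2dot y x.
Proof.
move=> b; rewrite L2dot_one L2dot_itE /mn; apply: ae01_it => //; [exact: ig_L2|exact: igM_L2|].
by apply: ae01S (prE x b) => t _ ->; rewrite mulrC.
Qed.

Lemma ibp z y : sobolev 1 z -> sobolev 1 y -> L2dot z (L2diff y) = - L2dot (L2diff z) y.
Proof.
move=> sz sy; have := mn_diff (sob1_pr sz sy).
rewrite L2diff_pr// mnD -!L2dot_one (L2dot_pr1 _ (sob1_essb sy)) (L2dot_pr1 _ (sob1_essb sz)).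
by rewrite L2dotC addrC => /eqP; rewrite addr_eq0 => /eqP.
Qed.

(* Test with the primitive of F - mean F, F being the primitive of f. *)
Lemma density f : sqi f -> (forall g g' : T -> R, acl g g' -> g 0 = 0 ->
  it 0 1 (fun t => f t * g t) = 0) -> ae01 (fun t => f t = 0).
Proof.
move=> sf H; have If := sqi_ig sf.
pose F (t : R) := int0 t f.
have aF : ac F f by exact: ac_int.
have cF := ac_cont aF; have sF := sqi_cont cF.
pose c := it 0 1 F.
have sFc : sqi (fun t => F t - c) by apply: sqiB => //; exact: sqi_cst.
have ag := ac_int sFc.
have g1 : int0 1 (fun t => F t - c) = 0.
  have IF := sqi_ig sF.
  have := @itB R 0 1 F (cst c); rewrite it_cst// subr0 mulr1 /c subrr; apply => //.
  exact: ig_cst.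
have lg : acl (fun t => int0 t (fun t => F t - c)) (fun t => F t - c).
  by split=> //; rewrite g1 int00.
have {H}H := H _ _ lg (int00 _).
have am := ac_mul aF (proj1 lg).
have := proj2 am 1; rewrite g1 !mulr0 int00 mulr0 add0r ler01 lexx => /(_ isT).
have sm1 : sqi (fun t => F t * (F t - c)).
  have [k kb] := cont_bd cF; apply: (sqiM_bd (c := k)) => //; exact: sqi_meas.
have sm2 : sqi (fun t => int0 t (fun t => F t - c) * f t).
  have cg := ac_cont ag; have [k kb] := cont_bd cg; apply: (sqiM_bd (c := k)) => //.
  exact: cont_meas.
have := @itD R 0 1 _ _ (sqi_ig sm1) (sqi_ig sm2).
rewrite -[int0 1 _]/(it 0 1 _) => -> .
have -> : it 0 1 (fun t => int0 t (fun t => F t - c) * f t) = 0.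
  by rewrite -[RHS]H; congr (it 0 1 _); apply/funext => t; rewrite mulrC.
(* [F] is orthogonal to [F - c]; as the latter has mean 0, it is orthogonal to itself. *)
rewrite addr0 => E.
have Sq : it 0 1 (fun t => (F t - c) ^+ 2) = 0.
  have -> : (fun t => (F t - c) ^+ 2) = (fun t => F t * (F t - c) - c * (F t - c)).
    by apply/funext => t; ring.
  rewrite itB; [|exact: sqi_ig|by apply: sqi_ig; apply: sqiZ].
  by rewrite -E itZ -?[it 0 1 (fun t => F t - c)]/(int0 1 _) ?g1 ?mulr0 ?subrr//; exact: sqi_ig.
have ae := @Rint_sqr_eq0 R I01 _ mI01 (sqi_meas sFc) (proj2 sFc) Sq.
have cFc : {within I01, continuous (fun t => F t - c)}.
  apply: (@ac_cont R _ f); apply: ac_eqd (acD aF (ac_cst (- c))) => //.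
  by apply: ae01W => t _; rewrite addr0.
have K := ae0_cont cFc ae.
apply: int0_eq0 => // t t01.
have := K t t01; have := K 0; rewrite lexx ler01 => /(_ isT).
by rewrite /F int00 => k0 kt; apply: (addIr (- c)); rewrite kt k0.
Qed.

Lemma L2_density h : (forall y, sobolev 1 y -> L2dot h y = 0) -> h = 0.
Proof.
move=> H; apply: L2_ext; apply: ae01S (ae01I (density (L2fun_sqi h) _) L2fun0).
  by move=> t _ [-> ->].
move=> g g' lg _; have [sg _ _] := sob1_toL2 lg.
have sq := acl_sqi (proj1 lg).
rewrite -[RHS](H _ sg) L2dot_itE.
apply: ae01_it => //; [apply: sqiM_ig => //; exact: L2fun_sqi|exact: igM_L2|].
by apply: ae01S (toL2E sq) => t _ ->.
Qed.

End calculus.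

(** * Taylor expansion of superposition operators *)

Section sup_taylor.
Context {R : realType}.
Notation T := (measurableTypeR R).
Implicit Types (u v w x y : HL2 R).
Local Hint Resolve mI01 : core.
Variable Q : set (plane R).
Hypothesis Qopen : open Q.
Notation O := (OQ Q).
Notation oO := (OQ_open Qopen).
Notation U := (U1 Q).

(** The [z] part of [u], indexed by the coordinates of [V3] with time component 0, so that sums over
    partial derivatives can be written uniformly. *)
Definition xv u (i : 'I_3) : L2 R :=
  match val i with 0%N => 0 | 1%N => cp u o0 | _ => cp u o1 end.

Lemma xv_lin (a : R) u v i : xv (a *: u + v) i = a *: xv u i + xv v i.
Proof.
rewrite /xv; case: (val i) => [|[|_]]; by rewrite ?scaler0 ?addr0// cpD cpZ.
Qed.

Lemma xvD u v i : xv (u + v) i = xv u i + xv v i.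
Proof. by rewrite -[u]scale1r xv_lin !scale1r. Qed.

Lemma xv_sob1 u i : H_ 1 u -> sobolev 1 (xv u i).
Proof.
move=> /dom_H Hu; rewrite /xv; case: (val i) => [|[|_]]; [exact: sob1_0|exact: Hu|exact: Hu].
Qed.

Lemma gamx_xv u i (t : R) : 0 <= t <= 1 -> gamx u i t = loop (xv u i) t.
Proof.
move=> t01; rewrite /gamx /xv; case: (val i) => [|[|_]] //.
have [_ _ h] := @sob1_char R 0 (cst 0) (cst 0) (ae01S (fun t _ h => h) L2fun0) (acl_cst 0).
by rewrite h.
Qed.

Lemma co_gam u i t : co i (gam u t) = gamx u i t.
Proof. exact: co_mk3. Qed.

Lemma gam_lin u x (s t : R) i : H_ 1 u -> H_ 1 x -> 0 <= t <= 1 ->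
  co i (gam (u + s *: x) t - gam u t) = s * loop (xv x i) t.
Proof.
move=> Hu Hx t01; rewrite coD coN !co_gam !gamx_xv// [u + _]addrC xv_lin.
by have [_ _ ->//] := sob1_lin s (xv_sob1 i Hx) (xv_sob1 i Hu); rewrite addrK.
Qed.

Section taylor.
Variables (g : V3 R -> R^o) (G : 'I_3 -> V3 R -> R^o) (H : 'I_3 -> 'I_3 -> V3 R -> R^o).
Hypothesis gG : grad_on O g G.
Hypothesis GH : forall i, grad_on O (G i) (H i).
Hypothesis sH : forall i j, sm 1 O (H i j).

Let sG i : sm 2 O (G i). Proof. by exists (H i). Qed.
Let sg : sm 3 O g. Proof. by exists G. Qed.

Lemma essb_sup k (f : V3 R -> R^o) u : U u -> sm k.+1 O f -> exists c, essb c (sup f u).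
Proof.
move=> Uu sf; have UO := @U1_OQ R Q; have UH := @U1_H1 R Q.
have s1 := sm_le (isT : (1 <= k.+1)%N) sf.
exact: (lipB_essb (sup_lipB UH oO UO s1) Uu).
Qed.

Lemma sup_E k (f : V3 R -> R^o) u : U u -> sm k O f ->
  ae01 (fun t => L2fun (sup f u) t = f (gam u t)).
Proof.
move=> Uu sf; apply: toL2E; exact: (sup_sqi (@U1_H1 R Q) (@U1_OQ R Q) Uu sf).
Qed.

Lemma L2fun_sum (I : finType) (F : I -> L2 R) (f : I -> T -> R) :
  (forall i, ae01 (fun t => L2fun (F i) t = f i t)) ->
  ae01 (fun t => L2fun (\sum_i F i) t = \sum_i f i t).
Proof.
move=> h; have K (r : seq I) : ae01 (fun t => L2fun (\sum_(i <- r) F i) t = \sum_(i <- r) f i t).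
  elim: r => [|i r IH].
    by apply: ae01S L2fun0 => t _; rewrite !big_nil.
  apply: ae01S (ae01I (ae01I (h i) IH) (L2funD (F i) (\sum_(j <- r) F j))) => t _.
  by rewrite !big_cons => -[[<- <-] <-].
exact: K.
Qed.

Definition sup1 u x : L2 R := \sum_i pr (xv x i) (sup (G i) u).
Definition sup2 u x : L2 R := \sum_i \sum_j pr (xv x i) (pr (xv x j) (sup (H i j) u)).

Lemma sup1_E u x : U u -> H_ 1 x ->
  ae01 (fun t => L2fun (sup1 u x) t = \sum_i loop (xv x i) t * G i (gam u t)).
Proof.
move=> Uu Hx; apply: L2fun_sum => i.
have [c bc] := essb_sup Uu (sG i).
have [_ e] := sob1P (xv_sob1 i Hx).
by apply: ae01S (ae01I (prE (xv x i) bc) (ae01I e (sup_E Uu (sG i)))) => t _ [-> [-> ->]].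
Qed.

Lemma sup2_E u x : U u -> H_ 1 x ->
  ae01 (fun t => L2fun (sup2 u x) t =
    \sum_i \sum_j loop (xv x i) t * loop (xv x j) t * H i j (gam u t)).
Proof.
move=> Uu Hx; apply: L2fun_sum => i; apply: L2fun_sum => j.
have [c bc] := essb_sup Uu (sH i j).
have [_ ei] := sob1P (xv_sob1 i Hx); have [_ ej] := sob1P (xv_sob1 j Hx).
have bi := sob1_essb (xv_sob1 i Hx).
have := ae01I (prE (pr (xv x j) (sup (H i j) u)) bi) (prE (xv x j) bc).
move=> h; apply: ae01S (ae01I h (ae01I ei (ae01I ej (sup_E Uu (sH i j))))) => t _.
by rewrite prC => -[[-> ->] [-> [-> ->]]]; ring.
Qed.

(** The pointwise Taylor estimate holds with one radius and one constant along the compact image of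
    [u], so it survives integration against [w]. *)
Lemma sup_T2 u x (w : L2 R) : U u -> H_ 1 x ->
  T2 (fun s => L2dot (sup g (u + s *: x)) w) (L2dot (sup g u) w)
    (L2dot (sup1 u x) w) (2^-1 * L2dot (sup2 u x) w).
Proof.
move=> Uu Hx; have Hu := U1_H1 Uu.
have [d0 d00 dU] := U1_sub Qopen Uu Hx.
have Ksub : gam u @` (I01 : set R) `<=` O by move=> _ [t /I01E t01 <-]; exact: U1_OQ.
have [d [C [d0' C0 L]]] := sm_ulips oO (gam_compact Hu) Ksub (fun ij : 'I_3 * 'I_3 => sH ij.1 ij.2).
pose k := h1 x + 1.
have k0 : 0 < k by rewrite ltr_wpDl// h1_ge0.
exists (Num.min d0 (d / k)), (9 * C * k ^+ 3 * N0 w); split.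
- by apply: lt_minr => //; exact: divr_gt0.
- by rewrite !mulr_ge0 ?N0_ge0 ?exprn_ge0 ?(ltW k0).
move=> s /lt_min2[s0 sd]; have Us := dU s s0; have Hs := U1_H1 Us.
have [E EE] : exists E, E = sup g (u + s *: x) - (sup g u + s *: sup1 u x + (2^-1 * s ^+ 2) *: sup2 u x).
  by exists (sup g (u + s *: x) - (sup g u + s *: sup1 u x + (2^-1 * s ^+ 2) *: sup2 u x)).
have -> : L2dot (sup g (u + s *: x)) w - (L2dot (sup g u) w + L2dot (sup1 u x) w * s +
   2^-1 * L2dot (sup2 u x) w * s ^+ 2) = L2dot E w.
  rewrite EE L2dotD L2dotN !L2dotD !L2dotZ.
  by move: (L2dot _ _) (L2dot _ _) (L2dot _ _) (L2dot _ _) => p q r t; ring.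
apply: (le_trans (L2dot_CS E w)); rewrite [leRHS]mulrAC.
apply: ler_wpM2r; first exact: N0_ge0.
have Ksd : `|s| * h1 x <= `|s| * k by apply: ler_wpM2l => //; rewrite lerDl.
have eE : ae01 (fun t => L2fun E t = g (gam (u + s *: x) t) - (g (gam u t) +
   s * (\sum_i loop (xv x i) t * G i (gam u t)) +
   2^-1 * s ^+ 2 * (\sum_i \sum_j loop (xv x i) t * loop (xv x j) t * H i j (gam u t)))).
  have e1 := L2funD (sup g (u + s *: x)) (- (sup g u + s *: sup1 u x + (2^-1 * s ^+ 2) *: sup2 u x)).
  rewrite -scaleN1r in e1.
  have e2 := L2funZ (-1) (sup g u + s *: sup1 u x + (2^-1 * s ^+ 2) *: sup2 u x).
  have e3' := L2funD (sup g u + s *: sup1 u x) ((2^-1 * s ^+ 2) *: sup2 u x).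
  have e4 := L2funD (sup g u) (s *: sup1 u x).
  have e5 := L2funZ s (sup1 u x); have e6 := L2funZ (2^-1 * s ^+ 2) (sup2 u x).
  have e7 := sup_E Us sg; have e8 := sup_E Uu sg.
  have e9 := sup1_E Uu Hx; have e10 := sup2_E Uu Hx.
  apply: ae01S (ae01I e1 (ae01I e2 (ae01I e3' (ae01I e4 (ae01I e5 (ae01I e6 (ae01I e7 (ae01I e8 (ae01I e9 e10))))))))).
  move=> t _ [h1' [h2' [h3' [h4' [h5' [h6' [h7' [h8' [h9' h10']]]]]]]]].
  by rewrite EE -scaleN1r h1' h2' h3' h4' h5' h6' h7' h8' h9' h10' mulN1r.
have k3 : 0 <= 9 * C * k ^+ 3 * `|s| ^+ 3 by rewrite !mulr_ge0 ?exprn_ge0 ?(ltW k0).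
apply: essb_N0 => //; apply: ae01S eE => t /I01E t01 ->.
have Kt : (gam u @` (I01 : set R)) (gam u t) by exists t => //; apply/I01E.
have sdk : `|s| * h1 x < d.
  by apply: (le_lt_trans Ksd); rewrite -ltr_pdivlMr.
have [_ hsx] := h1Z s Hx.
have dg : `|gam (u + s *: x) t - gam u t| <= `|s| * h1 x.
  by rewrite -hsx -{2}[s *: x](addKr u) [- u + _]addrC; apply: gamB.
have := ball_taylor2 C0 gG GH (fun i j => L _ Kt (i, j)) (p := gam u t) (q := gam (u + s *: x) t).
rewrite subrr normr0 => /(_ d0' (le_lt_trans dg sdk)) B.
have -> : g (gam (u + s *: x) t) - (g (gam u t) +
   s * (\sum_i loop (xv x i) t * G i (gam u t)) +
   2^-1 * s ^+ 2 * (\sum_i \sum_j loop (xv x i) t * loop (xv x j) t * H i j (gam u t))) =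
  g (gam (u + s *: x) t) - g (gam u t) - \sum_i co i (gam (u + s *: x) t - gam u t) * G i (gam u t) -
  2^-1 * \sum_i \sum_j co i (gam (u + s *: x) t - gam u t) * co j (gam (u + s *: x) t - gam u t) * H i j (gam u t).
  rewrite !opprD !addrA; congr (_ - _ - _).
    by rewrite mulr_sumr; apply: eq_bigr => i _; rewrite gam_lin// mulrA.
  rewrite -mulrA; congr (_ * _); rewrite mulr_sumr; apply: eq_bigr => i _.
  by rewrite mulr_sumr; apply: eq_bigr => j _; rewrite !gam_lin//; ring.
apply: (le_trans B).
have -> : 9 * C * k ^+ 3 * `|s| ^+ 3 = 9 * C * (`|s| * k) ^+ 3 by rewrite exprMn; ring.
apply: ler_wpM2l; first by rewrite mulr_ge0.
by rewrite lerXn2r ?nnegrE ?mulr_ge0 ?(ltW k0)// (le_trans dg).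
Qed.

End taylor.
End sup_taylor.

(** * The Hessian of the reduced functional *)

Section reduced.
Context {R : realType}.
Implicit Types (u v w x y : HL2 R).
Local Hint Resolve mI01 : core.
Variable Q : set (plane R).
Hypothesis Qopen : open Q.
Notation O := (OQ Q).
Notation U := (U1 Q).

(** The [eta] part, indexed like [xv] so that the two can be paired. *)
Definition ev u (i : 'I_3) : L2 R :=
  match val i with 0%N => 0 | 1%N => cp u o2 | _ => cp u o3 end.

Lemma ev_lin (a : R) u v i : ev (a *: u + v) i = a *: ev u i + ev v i.
Proof.
rewrite /ev; case: (val i) => [|[|_]]; by rewrite ?scaler0 ?addr0// cpD cpZ.
Qed.

Lemma evD u v i : ev (u + v) i = ev u i + ev v i.
Proof. by rewrite -[u]scale1r ev_lin !scale1r. Qed.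

Lemma L2diff_lin (a : R) (z z' : L2 R) : sobolev 1 z -> sobolev 1 z' ->
  L2diff (a *: z + z') = a *: L2diff z + L2diff z'.
Proof. by move=> h h'; case: (sob1_lin a h h'). Qed.

Lemma L2diff0 : L2diff (0 : L2 R) = 0.
Proof.
have := L2diff_lin 1 sob1_0 sob1_0; rewrite !scale1r addr0 => /eqP.
by rewrite -subr_eq0 opprD addrA subrr sub0r oppr_eq0 => /eqP.
Qed.

Lemma L2dot0 (z : L2 R) : L2dot 0 z = 0.
Proof. by rewrite -(scale0r (0 : L2 R)) L2dotZ mul0r. Qed.

Lemma T2_sum (I : finType) (f : I -> R -> R) (a b c : I -> R) :
  (forall i, T2 (f i) (a i) (b i) (c i)) ->
  T2 (fun s => \sum_i f i s) (\sum_i a i) (\sum_i b i) (\sum_i c i).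
Proof.
move=> h; have K (r : seq I) : T2 (fun s => \sum_(i <- r) f i s) (\sum_(i <- r) a i)
    (\sum_(i <- r) b i) (\sum_(i <- r) c i).
  elim: r => [|i r IH].
    by apply: T2_poly => s; rewrite !big_nil; ring.
  rewrite !big_cons; apply: (T2_eq (d := 1)) (T2_add (h i) IH) => // s _.
  by rewrite big_cons.
exact: K.
Qed.

Lemma T2_dot (p p' q q' : L2 R) :
  T2 (fun s => L2dot (p + s *: p') (q + s *: q')) (L2dot p q)
    (L2dot p q' + L2dot p' q) (L2dot p' q').
Proof.
apply: T2_poly => s; rewrite L2dotD !L2dotDr !L2dotZ !L2dotZr.
by move: (L2dot _ _) (L2dot _ _) (L2dot _ _) (L2dot _ _) => *; ring.
Qed.

Variables (a : 'I_3 -> V3 R -> R^o) (a1 : 'I_3 -> 'I_3 -> V3 R -> R^o)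
  (a2 : 'I_3 -> 'I_3 -> 'I_3 -> V3 R -> R^o).
Hypothesis aG : forall i, grad_on O (a i) (a1 i).
Hypothesis aH : forall i j, grad_on O (a1 i j) (a2 i j).
Hypothesis sa : forall i j k, sm 2 O (a2 i j k).
Variables (ps : V3 R -> R^o) (ps1 : 'I_3 -> V3 R -> R^o) (ps2 : 'I_3 -> 'I_3 -> V3 R -> R^o).
Hypothesis pG : grad_on O ps ps1.
Hypothesis pH : forall j, grad_on O (ps1 j) (ps2 j).
Hypothesis sp : forall j k, sm 2 O (ps2 j k).

Definition Wf u : R := L2dot (sup ps u) one - 1 + (\sum_i L2dot (ev u i) (ev u i)) / 8.

Definition Sr u : R := \sum_i L2dot (ev u i) (L2diff (xv u i)) +
  \sum_i L2dot (sup (a i) u) (L2diff (xv u i)) - Wf u / mss u.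

(** On the diagonal, [B1] to [B5] are second Taylor coefficients: [B1] of [<eta, z'>], [B2] of the
    magnetic term with [z'] fixed, [B3] of its mixed part, [B4] of [Wf] and [B5] of [|z|^2]. [l1] is
    the first coefficient of [Wf], and [l2] half of that of [|z|^2]. *)
Definition B1 x y : R := \sum_i L2dot (ev x i) (L2diff (xv y i)).
Definition B2 u x y : R := 2^-1 * \sum_i \sum_j \sum_k
  L2dot (pr (xv x j) (pr (xv y k) (sup (a2 i j k) u))) (L2diff (xv u i)).
Definition B3 u x y : R := \sum_i \sum_j L2dot (pr (xv x j) (sup (a1 i j) u)) (L2diff (xv y i)).
Definition B4 u x y : R :=
  2^-1 * \sum_j \sum_k L2dot (pr (xv x j) (pr (xv y k) (sup (ps2 j k) u))) one +
  8^-1 * \sum_i L2dot (ev x i) (ev y i).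
Definition B5 x y : R := \sum_i L2dot (xv x i) (xv y i).
Definition l1 u x : R := \sum_j L2dot (pr (xv x j) (sup (ps1 j) u)) one +
  4^-1 * \sum_i L2dot (ev u i) (ev x i).
Definition l2 u x : R := \sum_i L2dot (xv u i) (xv x i).

(** The bracket is the second Taylor coefficient of the quotient [Wf / |z|^2], formed by the rules
    of [T2_mul] and [T2_inv]. *)
Definition cS u x : R := B1 x x + (B2 u x x + B3 u x x) -
  (Wf u * (4 * l2 u x ^+ 2 / mss u ^+ 3 - B5 x x / mss u ^+ 2) -
   2 * l1 u x * l2 u x / mss u ^+ 2 + B4 u x x / mss u).

Lemma L2dot_suml (I : finType) (F : I -> L2 R) (w : L2 R) : L2dot (\sum_i F i) w = \sum_i L2dot (F i) w.
Proof.
have K (r : seq I) : L2dot (\sum_(i <- r) F i) w = \sum_(i <- r) L2dot (F i) w.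
  elim: r => [|i r IH]; first by rewrite !big_nil L2dot0.
  by rewrite !big_cons L2dotD IH.
exact: K.
Qed.

Lemma mss_xv u : mss u = B5 u u.
Proof. by rewrite /B5 sum3 L2dot0 add0r. Qed.

Let sa1 i j k : sm 1 O (a2 i j k). Proof. exact: smS (sa i j k). Qed.
Let sp1 j k : sm 1 O (ps2 j k). Proof. exact: smS (sp j k). Qed.

Lemma Sr_T2 u x : U u -> H_ 1 x ->
  exists p q : R, T2 (fun s => Sr (u + s *: x)) p q (cS u x).
Proof.
move=> Uu Hx; have Hu := U1_H1 Uu.
have m0 : mss u != 0 by rewrite gt_eqF// mss_gt0//; case: Uu => -[].
have Exv s i : xv (u + s *: x) i = xv u i + s *: xv x i by rewrite addrC xv_lin addrC.
have Eev s i : ev (u + s *: x) i = ev u i + s *: ev x i by rewrite addrC ev_lin addrC.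
have Dxv s i : L2diff (xv (u + s *: x) i) = L2diff (xv u i) + s *: L2diff (xv x i).
  by rewrite Exv addrC (L2diff_lin s (xv_sob1 i Hx) (xv_sob1 i Hu)) addrC.
have Q1 := T2_sum (fun i => T2_dot (ev u i) (ev x i) (L2diff (xv u i)) (L2diff (xv x i))).
(* The factor [z'] is affine in [s], so the magnetic term splits into its expansion at fixed [z']
   and [s] times an expansion paired with the derivative of the direction. *)
have Q2 := T2_sum (fun i => T2_add (sup_T2 Qopen (aG i) (aH i) (sa1 i) (L2diff (xv u i)) Uu Hx)
  (T2_mul (T2_poly (f := fun s => s) (a := 0) (b := 1) (c := 0) (fun s => ltac:(ring)))
    (sup_T2 Qopen (aG i) (aH i) (sa1 i) (L2diff (xv x i)) Uu Hx))).
have Q3 := sup_T2 Qopen pG pH sp1 one Uu Hx.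
have Q4 := T2_sum (fun i => T2_dot (ev u i) (ev x i) (ev u i) (ev x i)).
have Q5 := T2_sum (fun i => T2_dot (xv u i) (xv x i) (xv u i) (xv x i)).
have QW := T2_add (T2_add Q3 (T2_cst (- 1))) (T2_scale 8^-1 Q4).
rewrite -/(B5 u u) -mss_xv in Q5.
have QQ := T2_add (T2_add Q1 Q2) (T2_opp (T2_mul QW (T2_inv m0 Q5))).
eexists; eexists; apply: T2_coef (T2_eq ltr01 _ QQ); [reflexivity|reflexivity| |].
  have E2 : L2dot (sup2 ps2 u x) one =
      \sum_j \sum_k L2dot (pr (xv x j) (pr (xv x k) (sup (ps2 j k) u))) one.
    by rewrite /sup2 L2dot_suml; apply: eq_bigr => i _; rewrite L2dot_suml.
  have E1 : L2dot (sup1 ps1 u x) one = \sum_j L2dot (pr (xv x j) (sup (ps1 j) u)) one.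
    by rewrite /sup1 L2dot_suml.
  have Ed (f : HL2 R -> 'I_3 -> L2 R) : \sum_i (L2dot (f u i) (f x i) + L2dot (f x i) (f u i)) =
      2 * \sum_i L2dot (f u i) (f x i).
    rewrite big_split/= [X in _ + X](eq_bigr (fun i => L2dot (f u i) (f x i))) => [|i _]; last exact: L2dotC.
    by rewrite mulrDl mul1r.
  have EB : \sum_i (2^-1 * L2dot (sup2 (a2 i) u x) (L2diff (xv u i)) +
      (0 * (2^-1 * L2dot (sup2 (a2 i) u x) (L2diff (xv x i))) +
        1 * L2dot (sup1 (a1 i) u x) (L2diff (xv x i)) + 0 * L2dot (sup (a i) u) (L2diff (xv x i)))) =
      B2 u x x + B3 u x x.
    rewrite /B2 /B3 mulr_sumr -big_split; apply: eq_bigr => i _; rewrite !mul0r mul1r addr0 add0r.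
    rewrite /sup2 /sup1 !L2dot_suml; congr (_ * _ + _); apply: eq_bigr => j _; exact: L2dot_suml.
  rewrite EB E2 E1 !Ed -/(l2 u x) -/(B5 x x) -/(B1 x x) /cS /l1 /B4.
  rewrite /Wf -[_ / 8]mulrC.
  move: (L2dot _ one) (\sum_i L2dot (ev u i) (ev u i)) => W1 W2.
  move: (B1 x x) (B2 u x x) (B3 u x x) (B5 x x) (l2 u x) => X1 X2 X3 X5 X6.
  move: (\sum_j L2dot _ one) (\sum_j \sum_k _) (\sum_i L2dot (ev u i) _) (\sum_i L2dot (ev x i) _) => Y1 Y2 Y3 Y4.
  move: (mss u) m0 => m m0; by field.
move=> s _; rewrite /Sr /Wf mss_xv /B5.
congr (_ + _ - _); last congr (_ / _).
- by apply: eq_bigr => i _; rewrite Eev Dxv.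
- by apply: eq_bigr => i _; rewrite Dxv L2dotDr L2dotZr.
- congr (_ - _ + _); rewrite mulrC; congr (_ * _); by apply: eq_bigr => i _; rewrite Eev.
- by apply: eq_bigr => i _; rewrite Exv.
Qed.

End reduced.

(** * Polarization of the second Taylor coefficient *)

Section polar.
Context {R : realType}.
Implicit Types (u v w x y : HL2 R).
Local Hint Resolve mI01 : core.
Variable Q : set (plane R).
Hypothesis Qopen : open Q.
Notation O := (OQ Q).
Notation U := (U1 Q).

Lemma prDl (z z' h : L2 R) c : essb c h -> pr (z + z') h = pr z h + pr z' h.
Proof. by move=> b; have := pr_linl 1 z z' b; rewrite !scale1r. Qed.

Lemma prZl (k : R) (z h : L2 R) c : essb c h -> pr (k *: z) h = k *: pr z h.
Proof. by move=> b; have := pr_linl k z 0 b; rewrite !addr0 pr0 addr0. Qed.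

Lemma prDl_b (z z' h : L2 R) c c' : essb c z -> essb c' z' -> pr (z + z') h = pr z h + pr z' h.
Proof. by move=> b b'; have := pr_linr 1 h b b'; rewrite !scale1r !(prC _ h). Qed.

Lemma essb_xv x i : H_ 1 x -> essb (n1 (xv x i)) (xv x i).
Proof. by move=> Hx; apply: sob1_essb; exact: xv_sob1. Qed.

Variables (a : 'I_3 -> V3 R -> R^o) (a1 : 'I_3 -> 'I_3 -> V3 R -> R^o)
  (a2 : 'I_3 -> 'I_3 -> 'I_3 -> V3 R -> R^o).
Hypothesis aG : forall i, grad_on O (a i) (a1 i).
Hypothesis aH : forall i j, grad_on O (a1 i j) (a2 i j).
Hypothesis sa : forall i j k, sm 2 O (a2 i j k).
Variables (ps : V3 R -> R^o) (ps1 : 'I_3 -> V3 R -> R^o) (ps2 : 'I_3 -> 'I_3 -> V3 R -> R^o).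
Hypothesis pG : grad_on O ps ps1.
Hypothesis pH : forall j, grad_on O (ps1 j) (ps2 j).
Hypothesis sp : forall j k, sm 2 O (ps2 j k).

(** Additivity in both slots at a given pair, all that polarization needs of bilinearity. *)
Definition sym_polar (B : HL2 R -> HL2 R -> R) x y :=
  B (x + y) (x + y) = B x x + B x y + B y x + B y y.

(** The integral of four factors, bracketed so that [w], a derivative that is only square
    integrable, always meets a bounded factor. *)
Definition tri (w h X Y : L2 R) : R := L2dot (pr (pr w h) X) Y.

Lemma triE (w h : L2 R) x y i j c : essb c h -> H_ 1 x -> H_ 1 y ->
  L2dot (pr (xv x i) (pr (xv y j) h)) w = tri w h (xv x i) (xv y j).
Proof. by move=> bh Hx Hy; exact: (L2dot_pr4 w (essb_xv i Hx) (essb_xv j Hy) bh). Qed.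

Lemma tri_add (w h : L2 R) (X X' Y Y' : L2 R) c c' : essb c X -> essb c' X' ->
  tri w h (X + X') (Y + Y') = tri w h X Y + tri w h X Y' + tri w h X' Y + tri w h X' Y'.
Proof.
move=> b b'; rewrite /tri ![pr (pr w h) _]prC (prDl_b _ b b') L2dotD !L2dotDr.
by move: (L2dot _ _) (L2dot _ _) (L2dot _ _) (L2dot _ _) => *; ring.
Qed.

Lemma sym_polar_sum (I : finType) (F : I -> HL2 R -> HL2 R -> R) x y :
  (forall i, sym_polar (F i) x y) -> sym_polar (fun x y => \sum_i F i x y) x y.
Proof. by move=> H; rewrite /sym_polar -!big_split; apply: eq_bigr => i _; exact: H. Qed.

Lemma sym_polar_scale (k : R) F x y : sym_polar F x y -> sym_polar (fun x y => k * F x y) x y.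
Proof. by rewrite /sym_polar => ->; rewrite !mulrDr. Qed.

Lemma sym_polar_add F G x y : sym_polar F x y -> sym_polar G x y ->
  sym_polar (fun x y => F x y + G x y) x y.
Proof. by rewrite /sym_polar => -> ->; ring. Qed.

Lemma polar_pr4 (h w : L2 R) x y i j c : essb c h -> H_ 1 x -> H_ 1 y ->
  sym_polar (fun x y => L2dot (pr (xv x i) (pr (xv y j) h)) w) x y.
Proof.
move=> bh Hx Hy; have [Hxy _] := h1D Hx Hy.
rewrite /sym_polar (triE w i j bh Hxy Hxy) (triE w i j bh Hx Hx) (triE w i j bh Hx Hy).
by rewrite (triE w i j bh Hy Hx) (triE w i j bh Hy Hy) !xvD (tri_add _ _ _ _ (essb_xv i Hx) (essb_xv i Hy)).
Qed.

Lemma polar_dot (f g : HL2 R -> L2 R) x y : f (x + y) = f x + f y -> g (x + y) = g x + g y ->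
  sym_polar (fun x y => L2dot (f x) (g y)) x y.
Proof. by rewrite /sym_polar => -> ->; rewrite L2dotD !L2dotDr; ring. Qed.

Lemma sp1' i j u : U u -> exists c, essb c (sup (ps2 i j) u).
Proof. by move=> Uu; exact: (essb_sup Qopen Uu (sp i j)). Qed.

Lemma sa2' i j k u : U u -> exists c, essb c (sup (a2 i j k) u).
Proof. by move=> Uu; exact: (essb_sup Qopen Uu (sa i j k)). Qed.

Lemma sa1 i j : sm 3 O (a1 i j). Proof. by exists (a2 i j). Qed.
Lemma sp1 j : sm 3 O (ps1 j). Proof. by exists (ps2 j). Qed.
Lemma sps : sm 4 O ps. Proof. by exists ps1 => // j; exact: sp1. Qed.

Lemma polar_B1 x y : H_ 1 x -> H_ 1 y -> sym_polar (@B1 R) x y.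
Proof.
move=> Hx Hy; apply: sym_polar_sum => i; apply: polar_dot; first exact: evD.
by rewrite xvD L2diffD//; exact: xv_sob1.
Qed.

Lemma polar_B2 u x y : U u -> H_ 1 x -> H_ 1 y -> sym_polar (B2 a2 u) x y.
Proof.
move=> Uu Hx Hy; apply: sym_polar_scale.
apply: sym_polar_sum => i; apply: sym_polar_sum => j; apply: sym_polar_sum => k.
have [c b] := sa2' i j k Uu; exact: polar_pr4 b Hx Hy.
Qed.

Lemma polar_B3 u x y : U u -> H_ 1 x -> H_ 1 y -> sym_polar (B3 a1 u) x y.
Proof.
move=> Uu Hx Hy; apply: sym_polar_sum => i; apply: sym_polar_sum => j; apply: polar_dot.
  have [c b] := essb_sup Qopen Uu (sa1 i j).
  by rewrite xvD (prDl _ _ b).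
by rewrite xvD L2diffD//; exact: xv_sob1.
Qed.

Lemma polar_B4 u x y : U u -> H_ 1 x -> H_ 1 y -> sym_polar (B4 ps2 u) x y.
Proof.
move=> Uu Hx Hy; apply: sym_polar_add; apply: sym_polar_scale.
  apply: sym_polar_sum => j; apply: sym_polar_sum => k.
  have [c b] := sp1' j k Uu; exact: polar_pr4 b Hx Hy.
by apply: sym_polar_sum => i; apply: polar_dot; exact: evD.
Qed.

Lemma polar_B5 x y : sym_polar (@B5 R) x y.
Proof. by apply: sym_polar_sum => i; apply: polar_dot; exact: xvD. Qed.

Lemma l1D u x y : U u -> H_ 1 x -> H_ 1 y -> l1 ps1 u (x + y) = l1 ps1 u x + l1 ps1 u y.
Proof.
move=> Uu Hx Hy; rewrite /l1 addrACA -mulrDr -!big_split; congr (_ + _ * _); apply: eq_bigr => i _.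
  by have [c b] := essb_sup Qopen Uu (sp1 i); rewrite xvD (prDl _ _ b) L2dotD.
by rewrite evD L2dotDr.
Qed.

Lemma l2D u x y : l2 u (x + y) = l2 u x + l2 u y.
Proof. by rewrite /l2 -!big_split; apply: eq_bigr => i _; rewrite xvD L2dotDr. Qed.

Lemma cS_polar u x y : U u -> H_ 1 x -> H_ 1 y ->
  cS a1 a2 ps ps1 ps2 u (x + y) - cS a1 a2 ps ps1 ps2 u x - cS a1 a2 ps ps1 ps2 u y =
  B1 x y + B1 y x + (B2 a2 u x y + B2 a2 u y x) + (B3 a1 u x y + B3 a1 u y x) -
  (B4 ps2 u x y + B4 ps2 u y x) / mss u + 2 * Wf ps u / mss u ^+ 2 * B5 x y
  + (2 / mss u ^+ 2) * (l1 ps1 u x * l2 u y + l2 u x * l1 ps1 u y)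
  - 8 * Wf ps u / mss u ^+ 3 * (l2 u x * l2 u y).
Proof.
move=> Uu Hx Hy; rewrite /cS l1D// l2D polar_B1// polar_B2// polar_B3// polar_B4// polar_B5.
have -> : B5 y x = B5 x y by apply: eq_bigr => i _; exact: L2dotC.
move: (B1 x x) (B1 x y) (B1 y x) (B1 y y) (B5 x x) (B5 x y) (B5 y y) => t1 t2 t3 t4 t5 t6 t7.
move: (B2 a2 u x x) (B2 a2 u x y) (B2 a2 u y x) (B2 a2 u y y) => p1 p2 p3 p4.
move: (B3 a1 u x x) (B3 a1 u x y) (B3 a1 u y x) (B3 a1 u y y) => q1 q2 q3 q4.
move: (B4 ps2 u x x) (B4 ps2 u x y) (B4 ps2 u y x) (B4 ps2 u y y) => r1 r2 r3 r4.
move: (l1 ps1 u x) (l1 ps1 u y) (l2 u x) (l2 u y) => l1x l1y l2x l2y.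
move: (Wf ps u) (mss u) => W m.
rewrite -!exprVn; move: (m^-1) => k.
ring.
Qed.

End polar.

(** * Candidates for F and K and their regularity *)

Section identity.
Context {R : realType}.
Implicit Types (u v w x y : HL2 R).
Local Hint Resolve mI01 : core.
Variable Q : set (plane R).
Hypothesis Qopen : open Q.
Notation O := (OQ Q).
Notation oO := (OQ_open Qopen).
Notation U := (U1 Q).
Variables (a : 'I_3 -> V3 R -> R^o) (a1 : 'I_3 -> 'I_3 -> V3 R -> R^o)
  (a2 : 'I_3 -> 'I_3 -> 'I_3 -> V3 R -> R^o).
Hypothesis aG : forall i, grad_on O (a i) (a1 i).
Hypothesis aH : forall i j, grad_on O (a1 i j) (a2 i j).
Hypothesis sa : forall i j k, sm 2 O (a2 i j k).
Variables (ps : V3 R -> R^o) (ps1 : 'I_3 -> V3 R -> R^o) (ps2 : 'I_3 -> 'I_3 -> V3 R -> R^o).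
Hypothesis pG : grad_on O ps ps1.
Hypothesis pH : forall j, grad_on O (ps1 j) (ps2 j).
Hypothesis sp : forall j k, sm 2 O (ps2 j k).

(** The function rot a along the loop; [a1 i j] is the derivative of [a i] in coordinate [j]. *)
Definition bB v : L2 R := sup (a1 i2 i1) v + (-1) *: sup (a1 i1 i2) v.

(** The coefficient matrix of [F]: entry [(i, j)] multiplies the derivative of component [j]. *)
Definition fb (i j : 'I_4) v : L2 R :=
  match val i, val j with
  | 0%N, 1%N => bB v
  | 1%N, 0%N => (-1) *: bB v
  | 0%N, 2%N | 1%N, 3%N => (-1) *: one
  | 2%N, 0%N | 3%N, 1%N => one
  | _, _ => 0
  end.

(** The factor of the [i]-th component of [z'] in entry [(k, j)] of [K]; the symmetrised part stems
    from the second variation of [a i]. *)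
Definition ha i k j v : L2 R :=
  2^-1 *: (sup (a2 i j k) v + sup (a2 i k j) v) + (-1) *: sup (a2 k j i) v.

(* The terms a_{k,ji} come from integrating a_k by parts, so that no symmetry
   of second derivatives is needed. *)
Definition mz k j v : L2 R :=
  pr (L2diff (cp v o0)) (ha i1 k j v) + pr (L2diff (cp v o1)) (ha i2 k j v) +
  ((k == j)%:R * (2 * Wf ps v / mss v ^+ 2)) *: one +
  (- (2 * mss v)^-1) *: (sup (ps2 k j) v + sup (ps2 j k) v).

Definition mu4 (i j : 'I_4) v : L2 R :=
  match val i, val j with
  | 0%N, 0%N => mz i1 i1 v
  | 0%N, 1%N => mz i1 i2 v
  | 1%N, 0%N => mz i2 i1 v
  | 1%N, 1%N => mz i2 i2 v
  | 2%N, 2%N | 3%N, 3%N => (- (4 * mss v)^-1) *: one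
  | _, _ => 0
  end.

Definition Ze (j : 'I_4) v : L2 R :=
  match val j with 0%N => cp v o0 | 1%N => cp v o1 | _ => 0 end.

Definition Om (j : 'I_4) v : L2 R :=
  match val j with
  | 0%N => sup (ps1 i1) v | 1%N => sup (ps1 i2) v
  | 2%N => 4^-1 *: cp v o2 | _ => 4^-1 *: cp v o3
  end.

(* The rank one terms differentiate 1 / |z|^2: 2 Ze and Om are the gradients of
   |z|^2 and Wf. *)
Definition Kop (i j : 'I_4) v (z : L2 R) : L2 R :=
  pr (mu4 i j v) z + L2dot (Om j v) z *: ((2 / mss v ^+ 2) *: Ze i v) +
  L2dot (Ze j v) z *: ((2 / mss v ^+ 2) *: Om i v + (- (8 * Wf ps v / mss v ^+ 3)) *: Ze i v).

Lemma pr_zero_r (z : L2 R) : pr z 0 = 0.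
Proof. by rewrite prC pr0. Qed.

Lemma pr_one_r (z : L2 R) : pr z one = z.
Proof. by rewrite prC pr_one. Qed.

Lemma one_sob : sobolev 1 (one : L2 R). Proof. by case: (@one_sob1 R). Qed.

Lemma prZr (k : R) (z h : L2 R) c : essb c h -> pr z (k *: h) = k *: pr z h.
Proof. by move=> b; have := pr_linr k z b (sob1_essb sob1_0); rewrite !addr0 pr_zero_r addr0. Qed.

Lemma pr_mone_r (z : L2 R) : pr z ((-1) *: one) = - z.
Proof. by rewrite (prZr _ _ (sob1_essb one_sob)) pr_one_r scaleN1r. Qed.

Lemma sup1_lip (f : V3 R -> R^o) : sm 2 O f -> lip1 U (sup f).
Proof. move=> sf; exact: (sup_lip1 (@U1_H1 R Q) oO (@U1_OQ R Q) sf). Qed.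

Lemma bB_lip : lip1 U bB.
Proof.
have L i j : lip1 U (sup (a1 i j)) by apply: sup1_lip; exact: smS (sa1 aH sa i j).
by apply: lip1_add => //; apply: lip1_scale => //; exact: lipS_cst.
Qed.

Lemma one_lip : lip1 U (fun=> one).
Proof. by apply: lipG_cst; [exact: one_sob|exact: n10]. Qed.

Lemma zero_lip : lip1 U (fun=> 0).
Proof. by apply: lipG_cst; [exact: sob1_0|exact: n10]. Qed.

Lemma fb_lip i j : lip1 U (fb i j).
Proof.
have m1 : lip1 U (fun v => (-1) *: one) by apply: lip1_scale; [exact: lipS_cst|exact: one_lip].
have mB : lip1 U (fun v => (-1) *: bB v) by apply: lip1_scale; [exact: lipS_cst|exact: bB_lip].
rewrite /fb; case: (val i) => [|[|[|[|?]]]].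
- by case: (val j) => [|[|[|?]]]; [exact: zero_lip|exact: bB_lip|exact: m1|exact: zero_lip].
- by case: (val j) => [|[|[|[|?]]]]; [exact: mB|exact: zero_lip|exact: zero_lip|exact: m1|exact: zero_lip].
- by case: (val j) => [|?]; [exact: one_lip|exact: zero_lip].
- by case: (val j) => [|[|?]]; [exact: zero_lip|exact: one_lip|exact: zero_lip].
- exact: zero_lip.
Qed.

Lemma mss_lip : lipS U (@mss R).
Proof.
by apply: lipS_add; apply: lipS_dot; apply: lip1_lip0; apply: lip1_cp; exact: U1_H1.
Qed.

Lemma mss_n0 u : U u -> mss u != 0.
Proof. by move=> Uu; rewrite gt_eqF// mss_gt0//; case: Uu => -[]. Qed.

Lemma ps1_lip j : lip1 U (sup (ps1 j)).
Proof. by apply: sup1_lip; exact: smS (sp1 pH sp j). Qed.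

Lemma ps2_lip j k : lip1 U (sup (ps2 j k)).
Proof. by apply: sup1_lip; exact: sp. Qed.

Lemma cp_lip i : lip1 U (cp^~ i).
Proof. by apply: lip1_cp; exact: U1_H1. Qed.

Lemma Wf_lip : lipS U (Wf ps).
Proof.
have l : lip1 U (sup ps) by apply: sup1_lip; do 2!(apply: smS); exact: (sps pG pH sp).
have E : Wf ps = (fun u => (L2dot (sup ps u) one + -1) +
    (L2dot (cp u o2) (cp u o2) + L2dot (cp u o3) (cp u o3)) * 8^-1).
  by apply/funext => u; rewrite /Wf sum3 [L2dot (ev u i0) _]L2dot0 add0r.
have c i : lipS U (fun u => L2dot (cp u i) (cp u i)).
  by apply: lipS_dot; apply: lip1_lip0; exact: cp_lip.
have d : lipS U (fun u => L2dot (sup ps u) one).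
  by apply: lipS_dot; apply: lip1_lip0; [exact: l|exact: one_lip].
rewrite E; apply: lipS_add; first by apply: lipS_add; [exact: d|exact: lipS_cst].
by apply: lipS_mul; [apply: lipS_add; exact: c|exact: lipS_cst].
Qed.

Lemma lipS_X m k : lipS U m -> lipS U (fun v => m v ^+ k).
Proof.
move=> h; elim: k => [|k IH].
  by under eq_fun do rewrite expr0; exact: lipS_cst.
by under eq_fun do rewrite exprS; exact: lipS_mul.
Qed.

Lemma mX_lip k : lipS U (fun v => (mss v ^+ k)^-1).
Proof.
apply: lipS_inv; last by apply: lipS_X; exact: mss_lip.
by move=> u Uu; rewrite expf_neq0// mss_n0.
Qed.

Lemma ha_lip i k j : lip1 U (ha i k j).
Proof.
have l p q r : lip1 U (sup (a2 p q r)) by apply: sup1_lip; exact: sa.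
by apply: lip1_add; apply: lip1_scale; [exact: lipS_cst|exact: lip1_add|exact: lipS_cst|].
Qed.

(** Only the two terms with a derivative of the loop need [nice_prd]; the coefficients of the others
    are Lipschitz into W^{1,2}. *)
Lemma mz_nice k j : nice U (mz k j).
Proof.
apply: nice_add; first apply: nice_add; first apply: nice_add.
- by apply: nice_prd; [exact: U1_H1|exact: ha_lip].
- by apply: nice_prd; [exact: U1_H1|exact: ha_lip].
- apply: nice_lip1; apply: lip1_scale; last exact: one_lip.
  apply: lipS_mul; first exact: lipS_cst.
  by apply: lipS_mul; [apply: lipS_mul; [exact: lipS_cst|exact: Wf_lip]|exact: mX_lip].
- apply: nice_lip1; apply: lip1_scale; last by apply: lip1_add; exact: ps2_lip.
  have -> : (fun v : HL2 R => - (2 * mss v)^-1) = (fun v => - 2^-1 * (mss v ^+ 1)^-1).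
    by apply/funext => v; rewrite expr1 invfM mulNr.
  by apply: lipS_mul; [exact: lipS_cst|exact: mX_lip].
Qed.

Lemma mu4_nice i j : nice U (mu4 i j).
Proof.
have m1 : nice U (fun v => (- (4 * mss v)^-1) *: one).
  apply: nice_lip1; apply: lip1_scale; last exact: one_lip.
  have -> : (fun v : HL2 R => - (4 * mss v)^-1) = (fun v => - 4^-1 * (mss v ^+ 1)^-1).
    by apply/funext => v; rewrite expr1 invfM mulNr.
  by apply: lipS_mul; [exact: lipS_cst|exact: mX_lip].
have z1 : nice U (fun=> 0) by apply: nice_lip1; exact: zero_lip.
rewrite /mu4; case: (val i) => [|[|[|[|?]]]].
- by case: (val j) => [|[|?]]; [exact: mz_nice|exact: mz_nice|exact: z1].
- by case: (val j) => [|[|?]]; [exact: mz_nice|exact: mz_nice|exact: z1].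
- by case: (val j) => [|[|[|?]]]; [exact: z1|exact: z1|exact: m1|exact: z1].
- by case: (val j) => [|[|[|[|?]]]]; [exact: z1|exact: z1|exact: z1|exact: m1|exact: z1].
- exact: z1.
Qed.

Lemma Ze_lip j : lip1 U (Ze j).
Proof.
by rewrite /Ze; case: (val j) => [|[|?]]; [exact: cp_lip|exact: cp_lip|exact: zero_lip].
Qed.

Lemma Om_lip j : lip1 U (Om j).
Proof.
rewrite /Om; case: (val j) => [|[|[|?]]]; [exact: ps1_lip|exact: ps1_lip| |];
  by apply: lip1_scale; [exact: lipS_cst|exact: cp_lip].
Qed.

Lemma Kop_nice i j : opnice U (3 / 4) (Kop i j).
Proof.
have N := @N0_le_Nr R.
have m2 : lipS U (fun v => 2 / mss v ^+ 2) by apply: lipS_mul; [exact: lipS_cst|exact: mX_lip].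
apply: opnice_add; first apply: opnice_add.
- exact: (opnice_mult (ler0n R 20) (@frac_embedding R) (mu4_nice i j)).
- apply: opnice_rank1 => //; first exact: Om_lip.
  by apply: lip1_scale => //; exact: Ze_lip.
- apply: opnice_rank1 => //; first exact: Ze_lip.
  apply: lip1_add; apply: lip1_scale => //; [exact: Om_lip| |exact: Ze_lip].
  have -> : (fun v => - (8 * Wf ps v / mss v ^+ 3)) = (fun v => - 8 * (Wf ps v * (mss v ^+ 3)^-1)).
    by apply/funext => v; rewrite mulNr mulrA.
  by apply: lipS_mul; [exact: lipS_cst|apply: lipS_mul; [exact: Wf_lip|exact: mX_lip]].
Qed.

Definition FF := mop (dop fb).
Definition KK := mop Kop.

Lemma bB_sob u : U u -> sobolev 1 (bB u).
Proof.
move=> Uu; have [d [k [d0 k0 h]]] := bB_lip Uu.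
by have [] := h u u Uu Uu; rewrite ?h1_subrr.
Qed.

Lemma FE u x : U u -> [/\ cp (FF u x) o0 = pr (L2diff (cp x o1)) (bB u) - L2diff (cp x o2),
    cp (FF u x) o1 = - pr (L2diff (cp x o0)) (bB u) - L2diff (cp x o3),
    cp (FF u x) o2 = L2diff (cp x o0) & cp (FF u x) o3 = L2diff (cp x o1)].
Proof.
move=> Uu; have sB := sob1_essb (bB_sob Uu).
by rewrite /FF /mop; split; rewrite cp_mkH sum4 /dop /fb/= ?pr_mone_r ?pr_zero_r ?pr_one_r
  ?(prZr _ _ sB) ?scaleN1r ?addr0 ?add0r.
Qed.

End identity.

(** * The bilinear form of F *)

Section identity.
Context {R : realType}.
Implicit Types (u v w x y : HL2 R).
Local Hint Resolve mI01 : core.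
Variable Q : set (plane R).
Hypothesis Qopen : open Q.
Notation O := (OQ Q).
Notation oO := (OQ_open Qopen).
Notation U := (U1 Q).
Variables (a : 'I_3 -> V3 R -> R^o) (a1 : 'I_3 -> 'I_3 -> V3 R -> R^o)
  (a2 : 'I_3 -> 'I_3 -> 'I_3 -> V3 R -> R^o).
Hypothesis aG : forall i, grad_on O (a i) (a1 i).
Hypothesis aH : forall i j, grad_on O (a1 i j) (a2 i j).
Hypothesis sa : forall i j k, sm 2 O (a2 i j k).
Variables (ps : V3 R -> R^o) (ps1 : 'I_3 -> V3 R -> R^o) (ps2 : 'I_3 -> 'I_3 -> V3 R -> R^o).
Hypothesis pG : grad_on O ps ps1.
Hypothesis pH : forall j, grad_on O (ps1 j) (ps2 j).
Hypothesis sp : forall j k, sm 2 O (ps2 j k).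
Lemma xv0 x : xv x i0 = 0. Proof. by []. Qed.
Lemma xv1 x : xv x i1 = cp x o0. Proof. by []. Qed.
Lemma xv2 x : xv x i2 = cp x o1. Proof. by []. Qed.
Lemma ev0 x : ev x i0 = 0. Proof. by []. Qed.
Lemma L2dot0r (z : L2 R) : L2dot z 0 = 0.
Proof. by rewrite L2dotC L2dot0. Qed.

Lemma sup_sob i j u : U u -> sobolev 1 (sup (a1 i j) u) /\
  L2diff (sup (a1 i j) u) = pr (L2diff (cp u o0)) (sup (a2 i j i1) u) +
    pr (L2diff (cp u o1)) (sup (a2 i j i2) u).
Proof.
move=> Uu.
by have [h1' h2' _] := sup_sob1 (@U1_H1 R Q) oO (@U1_OQ R Q) Uu (aH i j) (fun k => smS (sa i j k)).
Qed.

Lemma B3_ibp u x y i j : U u -> H_ 1 x -> H_ 1 y ->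
  L2dot (pr (xv x j) (sup (a1 i j) u)) (L2diff (xv y i)) =
  - L2dot (pr (L2diff (xv x j)) (sup (a1 i j) u)) (xv y i) -
    L2dot (pr (L2diff (sup (a1 i j) u)) (xv x j)) (xv y i).
Proof.
move=> Uu Hx Hy; have [s _] := sup_sob i j Uu; have sx := xv_sob1 j Hx.
by rewrite ibp ?L2diff_pr//; [rewrite L2dotD opprD|exact: sob1_pr|exact: xv_sob1].
Qed.

Lemma B3_flip u x y i j : U u -> H_ 1 x -> H_ 1 y ->
  L2dot (pr (xv y j) (sup (a1 i j) u)) (L2diff (xv x i)) =
  L2dot (pr (L2diff (xv x i)) (sup (a1 i j) u)) (xv y j).
Proof.
move=> Uu Hx Hy; have [s _] := sup_sob i j Uu; exact: L2dot_pr3 (sob1_essb s).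
Qed.

(** In [B3 x y] the derivative is moved off [y] by parts. Where it falls on [x], the result combines
    with [B3 y x] to the antisymmetric part of the first derivatives, that is rot a; where it falls
    on the coefficient, it leaves the extra sum, which [K] has to remove. *)
Lemma F_form u x y : U u -> H_ 1 x -> H_ 1 y ->
  Hdot (FF a1 u x) y = B1 x y + B1 y x + (B3 a1 u x y + B3 a1 u y x) +
    \sum_k \sum_j L2dot (pr (L2diff (sup (a1 k j) u)) (xv x j)) (xv y k).
Proof.
move=> Uu Hx Hy; rewrite -addrA.
have -> : B3 a1 u x y + B3 a1 u y x +
    \sum_k \sum_j L2dot (pr (L2diff (sup (a1 k j) u)) (xv x j)) (xv y k) =
  \sum_k \sum_j (L2dot (pr (L2diff (xv x j)) (sup (a1 j k) u)) (xv y k) -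
    L2dot (pr (L2diff (xv x j)) (sup (a1 k j) u)) (xv y k)).
  have -> : B3 a1 u y x = \sum_k \sum_j L2dot (pr (L2diff (xv x j)) (sup (a1 j k) u)) (xv y k).
    rewrite /B3 exchange_big; apply: eq_bigr => k _; apply: eq_bigr => j _; exact: B3_flip.
  rewrite /B3 -!big_split; apply: eq_bigr => k _; rewrite -!big_split; apply: eq_bigr => j _.
  rewrite B3_ibp//=; move: (L2dot _ _) (L2dot _ _) (L2dot _ _) => p q r; ring.
have [s12 _] := sup_sob i1 i2 Uu; have [s21 _] := sup_sob i2 i1 Uu.
have [f0 f1 f2 f3] := FE Qopen aH sa x Uu.
have /dom_H sx := Hx; have /dom_H sy := Hy.
have B1E (x' y' : HL2 R) : B1 x' y' = L2dot (cp x' o2) (L2diff (cp y' o0)) +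
    L2dot (cp x' o3) (L2diff (cp y' o1)).
  by rewrite /B1 sum3 ev0 L2dot0 add0r.
have e12 := sob1_essb s12; have e21 := sob1_essb s21.
have bBp (z : L2 R) : pr z (bB a1 u) = pr z (sup (a1 i2 i1) u) - pr z (sup (a1 i1 i2) u).
  rewrite /bB addrC; have := pr_linr (-1) z e12 e21 => ->.
  by rewrite scaleN1r addrC.
rewrite HdotE sum4 f0 f1 f2 f3 !B1E !sum3 !xv0 !xv1 !xv2.
rewrite !L2diff0 !pr0 !L2dot0 !L2dot0r !bBp.
rewrite !(L2dotD, L2dotN).
rewrite (ibp (sx o2) (sy o0)) (ibp (sx o3) (sy o1)).
rewrite (L2dotC (cp y o2)) (L2dotC (cp y o3)).
move: (L2dot (pr _ _) _) (L2dot (pr _ _) _) (L2dot (pr _ _) _) (L2dot (pr _ _) _)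
  (L2dot (pr _ _) _) (L2dot (pr _ _) _) => p1 p2 p3 p4 p5 p6.
move: (L2dot _ _) (L2dot _ _) (L2dot _ _) (L2dot _ _) => q1 q2 q3 q4.
ring.
Qed.

End identity.

(** * The bilinear form of K *)

Section identity.
Context {R : realType}.
Implicit Types (u v w x y : HL2 R).
Local Hint Resolve mI01 : core.
Variable Q : set (plane R).
Hypothesis Qopen : open Q.
Notation O := (OQ Q).
Notation U := (U1 Q).
Variables (a : 'I_3 -> V3 R -> R^o) (a1 : 'I_3 -> 'I_3 -> V3 R -> R^o)
  (a2 : 'I_3 -> 'I_3 -> 'I_3 -> V3 R -> R^o).
Hypothesis aG : forall i, grad_on O (a i) (a1 i).
Hypothesis aH : forall i j, grad_on O (a1 i j) (a2 i j).
Hypothesis sa : forall i j k, sm 2 O (a2 i j k).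
Variables (ps : V3 R -> R^o) (ps1 : 'I_3 -> V3 R -> R^o) (ps2 : 'I_3 -> 'I_3 -> V3 R -> R^o).
Hypothesis pG : grad_on O ps ps1.
Hypothesis pH : forall j, grad_on O (ps1 j) (ps2 j).
Hypothesis sp : forall j k, sm 2 O (ps2 j k).

Lemma essb_lin (k : R) (h h' : L2 R) c c' : essb c h -> essb c' h' ->
  essb (`|k| * c + c') (k *: h + h').
Proof.
move=> b b'; apply: ae01S (ae01I (ae01I b b') (ae01I (L2funD (k *: h) h') (L2funZ k h))) => t _.
move=> [[bt bt'] [-> ->]]; apply: (le_trans (ler_normD _ _)); apply: lerD => //.
by rewrite normrM ler_wpM2l.
Qed.

Lemma essb_scale (k : R) (h : L2 R) c : essb c h -> essb (`|k| * c) (k *: h).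
Proof.
move=> b; apply: ae01S (ae01I b (L2funZ k h)) => t _ [bt ->].
by rewrite normrM ler_wpM2l.
Qed.

Lemma pr_comb (h1 h2 h3 w X Y : L2 R) c1 c2 c3 d : essb c1 h1 -> essb c2 h2 -> essb c3 h3 ->
  essb d X ->
  L2dot (pr (pr w (2^-1 *: (h1 + h2) + (-1) *: h3)) X) Y =
  2^-1 * (tri w h1 X Y + tri w h2 X Y) - tri w h3 X Y.
Proof.
move=> b1 b2 b3 bX.
have b12 : essb (`|1| * c1 + c2) (h1 + h2) by have := essb_lin 1 b1 b2; rewrite scale1r.
have bm := essb_scale (-1) b3.
have e12 := pr_linr 1 w b1 b2; rewrite !scale1r in e12.
rewrite (pr_linr _ _ b12 bm) e12 (prZr _ _ b3) scaleN1r.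
rewrite (prDl _ _ bX) (prZl _ _ bX) (prDl _ _ bX) -[- pr w h3]scaleN1r (prZl _ _ bX) scaleN1r.
by rewrite L2dotD L2dotN L2dotZ L2dotD.
Qed.

Lemma pr_sum4 (P1 P2 q q' X Y : L2 R) (s t d : R) : essb d X ->
  L2dot (pr (P1 + P2 + s *: one + t *: (q + q')) X) Y =
  L2dot (pr P1 X) Y + L2dot (pr P2 X) Y + s * L2dot X Y +
  t * (L2dot (pr q X) Y + L2dot (pr q' X) Y).
Proof.
move=> bX; rewrite !(prDl _ _ bX) !(prZl _ _ bX) !(prDl _ _ bX) pr_one.
by rewrite !L2dotD !L2dotZ L2dotD.
Qed.

Lemma mz_arith (A1 A2 p1 p2 p3 p4 p5 p6 k1 k2 q1 q2 : R) :
  A1 = 2^-1 * (p1 + p2) - p3 -> A2 = 2^-1 * (p4 + p5) - p6 ->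
  A1 + A2 + k1 * q1 + - k2 * q2 =
  0 + (2^-1 * (p1 + p2) + 2^-1 * (p4 + p5)) - (p3 + p6) + k1 * q1 - k2 * q2.
Proof. by move=> -> ->; ring. Qed.

(** The chain rule along the loop expands [L2diff (sup (a1 k j) u)] into precisely the unsymmetrised
    terms of [ha]. *)
Lemma mz_form u x y k j : U u -> H_ 1 x -> H_ 1 y ->
  L2dot (pr (mz a2 ps ps2 k j u) (xv x j)) (xv y k) =
  \sum_i 2^-1 * (tri (L2diff (xv u i)) (sup (a2 i j k) u) (xv x j) (xv y k) +
                 tri (L2diff (xv u i)) (sup (a2 i k j) u) (xv x j) (xv y k))
  - L2dot (pr (L2diff (sup (a1 k j) u)) (xv x j)) (xv y k)
  + (k == j)%:R * (2 * Wf ps u / mss u ^+ 2) * L2dot (xv x j) (xv y k)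
  - (2 * mss u)^-1 * (L2dot (pr (sup (ps2 k j) u) (xv x j)) (xv y k) +
      L2dot (pr (sup (ps2 j k) u) (xv x j)) (xv y k)).
Proof.
move=> Uu Hx Hy; have bX := essb_xv j Hx.
have [_ ->] := sup_sob Qopen aH sa k j Uu.
have E p q r : exists c, essb c (sup (a2 p q r) u) := sa2' Qopen sa p q r Uu.
have C p (w : L2 R) := pr_comb w (xv y k) (projT2 (cid (E p j k))) (projT2 (cid (E p k j))) (projT2 (cid (E k j p))) bX.
have C1 := C i1 (L2diff (cp u o0)); have C2 := C i2 (L2diff (cp u o1)).
rewrite -/(ha a2 i1 k j u) in C1; rewrite -/(ha a2 i2 k j u) in C2.
rewrite {1}/mz (pr_sum4 _ _ _ _ _ _ _ bX).
rewrite (prDl _ _ bX) L2dotD sum3.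
have t0 (h : L2 R) : tri (L2diff (xv u i0)) h (xv x j) (xv y k) = 0 by rewrite /tri xv0 L2diff0 !pr0 L2dot0.
rewrite !t0 addr0 mulr0.
exact: mz_arith C1 C2.
Qed.

Lemma mu_form u x y : H_ 1 x ->
  \sum_i L2dot (\sum_j pr (mu4 a2 ps ps2 i j u) (cp x j)) (cp y i) =
  \sum_k \sum_j L2dot (pr (mz a2 ps ps2 k j u) (xv x j)) (xv y k)
  - (4 * mss u)^-1 * \sum_i L2dot (ev x i) (ev y i).
Proof.
move=> /dom_H Hx.
have M (k : R) i : pr (k *: one) (cp x i) = k *: cp x i.
  by rewrite (prZl _ _ (sob1_essb (Hx i))) pr_one.
rewrite !sum3 !xv0 !ev0 !xv1 !xv2 !pr_zero_r !L2dot0 !L2dot0r !add0r.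
rewrite !sum4 /mu4 /= !M !pr0 !addr0 !add0r !L2dotD !L2dotZ.
move: ((4 * mss u)^-1) => c; by rewrite mulrDr opprD !mulNr !addrA.
Qed.

Lemma rank_form (p q : 'I_4 -> L2 R) (c d : R) x y :
  \sum_i L2dot (\sum_j (L2dot (p j) (cp x j) *: (c *: q i) +
     L2dot (q j) (cp x j) *: (c *: p i + d *: q i))) (cp y i) =
  c * ((\sum_j L2dot (p j) (cp x j)) * (\sum_i L2dot (q i) (cp y i)) +
       (\sum_j L2dot (q j) (cp x j)) * (\sum_i L2dot (p i) (cp y i))) +
  d * ((\sum_j L2dot (q j) (cp x j)) * (\sum_i L2dot (q i) (cp y i))).
Proof.
set X1 := \sum_j L2dot (p j) (cp x j); set X2 := \sum_j L2dot (q j) (cp x j).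
transitivity (\sum_i (X1 * c * L2dot (q i) (cp y i) + X2 * c * L2dot (p i) (cp y i) +
    X2 * d * L2dot (q i) (cp y i))).
  apply: eq_bigr => i _; rewrite L2dot_suml /X1 /X2 !mulr_suml -!big_split/=.
  apply: eq_bigr => j _; rewrite L2dotD !L2dotZ L2dotD !L2dotZ.
  by move: (L2dot _ _) (L2dot _ _) (L2dot _ _) (L2dot _ _) => *; ring.
rewrite !big_split/= -!mulr_sumr.
by move: (\sum_i _) (\sum_i _) X1 X2 => *; ring.
Qed.

Lemma l2_sum u x : \sum_j L2dot (Ze j u) (cp x j) = l2 u x.
Proof. by rewrite sum4 /l2 sum3 /Ze /= L2dot0 xv0 L2dot0 !L2dot0 !addr0 !add0r. Qed.

Lemma l1_sum u x : U u -> H_ 1 x -> \sum_j L2dot (Om ps1 j u) (cp x j) = l1 ps1 u x.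
Proof.
move=> Uu /dom_H Hx; rewrite /l1 !sum3 sum4 /Om /= xv0 ev0 pr0 !L2dot0 !add0r.
have E i j : L2dot (pr (cp x i) (sup (ps1 j) u)) one = L2dot (sup (ps1 j) u) (cp x i).
  by have [c b] := essb_sup Qopen Uu (sp1 pH sp j); exact: L2dot_pr1 b.
by rewrite xv1 xv2 !E !L2dotZ mulrDr !addrA.
Qed.

Lemma pr_flip (h X Y : L2 R) c c' : essb c X -> essb c' Y -> L2dot (pr h X) Y = L2dot (pr h Y) X.
Proof. by move=> bX bY; rewrite (L2dot_pr3 h Y bX) prC (L2dot_pr3 X h bY). Qed.

Lemma triE' (w h : L2 R) x y j k c : essb c h -> H_ 1 x -> H_ 1 y ->
  L2dot (pr (xv y k) (pr (xv x j) h)) w = tri w h (xv x j) (xv y k).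
Proof.
move=> b Hx Hy; rewrite (triE w k j b Hy Hx).
exact: pr_flip (essb_xv k Hy) (essb_xv j Hx).
Qed.

Lemma sum_rev3 (G : 'I_3 -> 'I_3 -> 'I_3 -> R) :
  \sum_i \sum_j \sum_k G i j k = \sum_k \sum_j \sum_i G i j k.
Proof.
under eq_bigr do rewrite exchange_big.
by rewrite exchange_big; apply: eq_bigr => k _; rewrite exchange_big.
Qed.

Lemma sum_rot3 (G : 'I_3 -> 'I_3 -> 'I_3 -> R) :
  \sum_i \sum_k \sum_j G i k j = \sum_k \sum_j \sum_i G i k j.
Proof. by rewrite exchange_big; apply: eq_bigr => k _; rewrite exchange_big. Qed.

Lemma sum_sym3 (c : R) (G H : 'I_3 -> 'I_3 -> 'I_3 -> R) :
  c * (\sum_i \sum_j \sum_k G i j k + \sum_i \sum_k \sum_j H i k j) =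
  \sum_k \sum_j \sum_i c * (G i j k + H i k j).
Proof.
rewrite sum_rev3 (sum_rot3 H) -big_split mulr_sumr; apply: eq_bigr => k _.
rewrite -big_split mulr_sumr; apply: eq_bigr => j _.
by rewrite -big_split mulr_sumr.
Qed.

Lemma sum_sym2 (c : R) (G H : 'I_3 -> 'I_3 -> R) :
  c * (\sum_j \sum_k G j k + \sum_k \sum_j H k j) = c * \sum_k \sum_j (H k j + G j k).
Proof.
congr (_ * _); rewrite exchange_big addrC -big_split; apply: eq_bigr => k _.
by rewrite -big_split.
Qed.

Lemma B2_form u x y : U u -> H_ 1 x -> H_ 1 y -> B2 a2 u x y + B2 a2 u y x =
  \sum_k \sum_j \sum_i 2^-1 * (tri (L2diff (xv u i)) (sup (a2 i j k) u) (xv x j) (xv y k) +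
                 tri (L2diff (xv u i)) (sup (a2 i k j) u) (xv x j) (xv y k)).
Proof.
move=> Uu Hx Hy; rewrite /B2 -mulrDr.
apply: (etrans (sum_sym3 _ (fun i j k => L2dot (pr (xv x j) (pr (xv y k) (sup (a2 i j k) u))) (L2diff (xv u i)))
  (fun i k j => L2dot (pr (xv y k) (pr (xv x j) (sup (a2 i k j) u))) (L2diff (xv u i))))).
apply: eq_bigr => k _; apply: eq_bigr => j _; apply: eq_bigr => i _; congr (_ * (_ + _)).
  by have [c b] := sa2' Qopen sa i j k Uu; exact: triE b Hx Hy.
by have [c b] := sa2' Qopen sa i k j Uu; exact: triE' b Hx Hy.
Qed.

Lemma B4_form u x y : U u -> H_ 1 x -> H_ 1 y -> B4 ps2 u x y + B4 ps2 u y x =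
  2^-1 * \sum_k \sum_j (L2dot (pr (sup (ps2 k j) u) (xv x j)) (xv y k) +
      L2dot (pr (sup (ps2 j k) u) (xv x j)) (xv y k)) +
  4^-1 * \sum_i L2dot (ev x i) (ev y i).
Proof.
move=> Uu Hx Hy; rewrite /B4 addrACA -!mulrDr; congr (_ + _); last first.
  have -> : \sum_i L2dot (ev y i) (ev x i) = \sum_i L2dot (ev x i) (ev y i).
    by apply: eq_bigr => i _; exact: L2dotC.
  by move: (\sum_i _) => r; field.
apply: (etrans (sum_sym2 _ (fun j k => L2dot (pr (xv x j) (pr (xv y k) (sup (ps2 j k) u))) one)
  (fun k j => L2dot (pr (xv y k) (pr (xv x j) (sup (ps2 k j) u))) one))).
congr (_ * _); apply: eq_bigr => k _; apply: eq_bigr => j _; congr (_ + _).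
  by have [c b] := sp1' Qopen sp k j Uu; rewrite (triE' one j k b Hx Hy) /tri pr_one.
by have [c b] := sp1' Qopen sp j k Uu; rewrite (triE one j k b Hx Hy) /tri pr_one.
Qed.

Lemma K_arith (m mu MZ S1 S2 S3 EE b5 B2s B4s l1x l1y l2x l2y W : R) : m != 0 ->
  mu = MZ - (4 * m)^-1 * EE ->
  MZ = S1 - S2 + 2 * W / m ^+ 2 * b5 - (2 * m)^-1 * S3 ->
  B2s = S1 -> B4s = 2^-1 * S3 + 4^-1 * EE ->
  mu + ((2 / m ^+ 2) * (l1x * l2y + l2x * l1y) + - (8 * W / m ^+ 3) * (l2x * l2y)) =
  B2s - S2 - B4s / m + 2 * W / m ^+ 2 * b5 + (2 / m ^+ 2) * (l1x * l2y + l2x * l1y)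
  - 8 * W / m ^+ 3 * (l2x * l2y).
Proof. by move=> m0 -> -> -> ->; field. Qed.

(** Subtracts the sum that [F_form] adds, so that the two forms together give the polarized Taylor
    coefficient. *)
Lemma K_form u x y : U u -> H_ 1 x -> H_ 1 y ->
  Hdot (KK a2 ps ps1 ps2 u x) y = B2 a2 u x y + B2 a2 u y x -
   \sum_k \sum_j L2dot (pr (L2diff (sup (a1 k j) u)) (xv x j)) (xv y k)
   - (B4 ps2 u x y + B4 ps2 u y x) / mss u + 2 * Wf ps u / mss u ^+ 2 * B5 x y
   + (2 / mss u ^+ 2) * (l1 ps1 u x * l2 u y + l2 u x * l1 ps1 u y)
   - 8 * Wf ps u / mss u ^+ 3 * (l2 u x * l2 u y).
Proof.
move=> Uu Hx Hy.
have -> : Hdot (KK a2 ps ps1 ps2 u x) y =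
  \sum_i L2dot (\sum_j pr (mu4 a2 ps ps2 i j u) (cp x j)) (cp y i) +
  \sum_i L2dot (\sum_j (L2dot (Om ps1 j u) (cp x j) *: ((2 / mss u ^+ 2) *: Ze i u) +
     L2dot (Ze j u) (cp x j) *: ((2 / mss u ^+ 2) *: Om ps1 i u +
       (- (8 * Wf ps u / mss u ^+ 3)) *: Ze i u))) (cp y i).
  rewrite HdotE -big_split/=; apply: eq_bigr => i _; rewrite -L2dotD; congr L2dot.
  rewrite /KK /mop cp_mkH -big_split/=; apply: eq_bigr => j _.
  by rewrite /Kop /= -addrA.
rewrite rank_form (l2_sum u x) (l2_sum u y) (l1_sum Uu Hx) (l1_sum Uu Hy).
have MZ : \sum_k \sum_j L2dot (pr (mz a2 ps ps2 k j u) (xv x j)) (xv y k) =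
  \sum_k \sum_j \sum_i 2^-1 * (tri (L2diff (xv u i)) (sup (a2 i j k) u) (xv x j) (xv y k) +
                 tri (L2diff (xv u i)) (sup (a2 i k j) u) (xv x j) (xv y k)) -
   \sum_k \sum_j L2dot (pr (L2diff (sup (a1 k j) u)) (xv x j)) (xv y k) +
   2 * Wf ps u / mss u ^+ 2 * B5 x y -
   (2 * mss u)^-1 * \sum_k \sum_j (L2dot (pr (sup (ps2 k j) u) (xv x j)) (xv y k) +
      L2dot (pr (sup (ps2 j k) u) (xv x j)) (xv y k)).
  have -> : 2 * Wf ps u / mss u ^+ 2 * B5 x y = \sum_k \sum_j (k == j)%:R * (2 * Wf ps u / mss u ^+ 2) * L2dot (xv x j) (xv y k).
    rewrite mulr_sumr; apply: eq_bigr => k _; rewrite (bigD1 k)//= eqxx mul1r big1 ?addr0// => j jk.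
    by rewrite eq_sym (negbTE jk) !mul0r.
  rewrite mulr_sumr -!sumrN -!big_split; apply: eq_bigr => k _.
  rewrite mulr_sumr -!sumrN -!big_split; apply: eq_bigr => j _; exact: mz_form.
exact: K_arith (mss_n0 Uu) (mu_form u y Hx) MZ (B2_form Uu Hx Hy) (B4_form Uu Hx Hy).
Qed.

End identity.

(** * Almost extendability of the reduced functional *)

Section extend.
Context {R : realType}.
Notation T := (measurableTypeR R).
Implicit Types (u v w x y : HL2 R).
Local Hint Resolve mI01 : core.
Variable Q : set (plane R).
Hypothesis Qopen : open Q.
Notation O := (OQ Q).
Notation U := (U1 Q).
Variables (a : 'I_3 -> V3 R -> R^o) (a1 : 'I_3 -> 'I_3 -> V3 R -> R^o)
  (a2 : 'I_3 -> 'I_3 -> 'I_3 -> V3 R -> R^o).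
Hypothesis aG : forall i, grad_on O (a i) (a1 i).
Hypothesis aH : forall i j, grad_on O (a1 i j) (a2 i j).
Hypothesis sa : forall i j k, sm 2 O (a2 i j k).
Variables (ps : V3 R -> R^o) (ps1 : 'I_3 -> V3 R -> R^o) (ps2 : 'I_3 -> 'I_3 -> V3 R -> R^o).
Hypothesis pG : grad_on O ps ps1.
Hypothesis pH : forall j, grad_on O (ps1 j) (ps2 j).
Hypothesis sp : forall j k, sm 2 O (ps2 j k).
Variables (S : HL2 R -> R) (A : HL2 R -> HL2 R -> HL2 R).
Hypothesis SA : hessian_field Q S A.
Hypothesis A_weak : weak_hessian_field Q A.
Hypothesis SE : forall u, U u -> S u = Sr a ps u.

(** Test loops supported in one component reduce this to the density of W^{1,2} in L^2. *)
Lemma Hdot_ext (w w' : HL2 R) : (forall y, H_ 1 y -> Hdot w y = Hdot w' y) -> w = w'.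
Proof.
move=> H; apply: cp_ext => i; apply/eqP; rewrite -subr_eq0; apply/eqP.
apply: L2_density => z sz.
pose y := mkH (fun j => if j == i then z else 0).
have Hy : H_ 1 y.
  by apply/dom_H => j; rewrite cp_mkH; case: ifP => _ //; exact: sob1_0.
have E w0 : Hdot w0 y = L2dot (cp w0 i) z.
  rewrite HdotE (bigD1 i)//= cp_mkH eqxx big1 ?addr0// => j ji.
  by rewrite cp_mkH (negbTE ji) L2dot0r.
by rewrite L2dotD L2dotN -!E H// subrr.
Qed.

Lemma id_arith (b b' b'' s q r v w : R) :
  b + b' + b'' - q + r + v - w = b + b'' + s + (b' - s - q + r + v - w).
Proof. ring. Qed.

(** Both sides define the same bilinear form on [H_1]: on the left by polarizing the Taylor
    coefficient of the action, on the right by [F_form] and [K_form]. *)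
Lemma A_decomp u x : U u -> H_ 1 x -> A u x = FF a1 u x + KK a2 ps ps1 ps2 u x.
Proof.
move=> Uu Hx; apply: Hdot_ext => y Hy.
have T w : H_ 1 w -> exists p q : R, T2 (fun s => S (u + s *: w)) p q (cS a1 a2 ps ps1 ps2 u w).
  move=> Hw; have [p [q h]] := Sr_T2 Qopen aG aH sa pG pH sp Uu Hw.
  have [d d0 dU] := U1_sub Qopen Uu Hw.
  exists p, q; apply: (T2_eq d0) h => s sd; rewrite SE//; exact: dU.
have [Hxy _] := h1D Hx Hy.
have := hess_polar Qopen SA A_weak (c := cS a1 a2 ps ps1 ps2 u) Uu Hx Hy.
move=> -> //; last by move=> w [->|[->|->]]; exact: T.
rewrite (cS_polar Qopen aH sa ps pH sp Uu Hx Hy) HdotD.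
rewrite (F_form Qopen aH sa Uu Hx Hy) (K_form Qopen aH sa ps pH sp Uu Hx Hy).
exact: id_arith.
Qed.

Lemma reduced_extendable : almost_extendable Q A.
Proof.
have UH := @U1_H1 R Q.
have nK i j : opnice U (3 / 4) (Kop a2 ps ps1 ps2 i j) by exact: Kop_nice.
have lF i j : lip1 U (fb a1 i j) by exact: fb_lip.
have F21 : C0_op U (H_ 1) (H_ 2) (H_ 1) (FF a1) by exact: mop_dop21.
exists (FF a1), (KK a2 ps ps1 ps2), (3 / 4); split.
- exact: A_decomp.
- by split=> //; exact: mop_dop10.
- split; first by apply/andP; split; lra.
  split; first exact: (mop_C0r UH nK).
  exact: (mop_C01 nK).
- move=> u Uu; apply: (F_fredholm (b := bB a1 u)); first exact: (bB_sob Qopen aH sa Uu).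
    by case: F21 => + _; apply.
  by move=> x _; exact: (FE Qopen aH sa x Uu).
- by move=> u Uu; exact: (mop_lip UH nK (U1_open_in Qopen) Uu).
Qed.

End extend.

(** * Reduction of the action under rigidity *)

Section coefficients.
Context {R : realType}.
Implicit Types (u w : HL2 R).
Local Hint Resolve mI01 : core.
Variables (Q : set (plane R)) (theta : R -> plane R -> plane R) (f : R -> plane R -> R).
Hypothesis Qopen : open Q.
Hypothesis theta_twisted : twisted_periodic Q theta f.
Notation O := (OQ Q).
Notation oO := (OQ_open Qopen).
Notation U := (U1 Q).
Notation f0 := (f 0 : plane R -> R^o).

(* Coefficients at z of the pull back under csqr of a form with coefficients
   (p, q) at csqr z. *)
Definition cmb (p q : V3 R -> R^o) (i : 'I_3) (x : V3 R) : R^o :=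
  match val i with
  | 0%N => 0
  | 1%N => 2 * (co i1 x * p x + co i2 x * q x)
  | _ => 2 * (- (co i2 x * p x) + co i1 x * q x)
  end.

Lemma cmb_sm k p q i : sm k O p -> sm k O q -> sm k O (cmb p q i).
Proof.
move=> sp sq; rewrite /cmb; case: (val i) => [|[|_]]; first exact: sm_cst.
  by apply: sm_scale; apply: sm_add; apply: sm_mul => //; exact: sm_co.
by apply: sm_scale; apply: sm_add; [apply: sm_opp|]; apply: sm_mul => //; exact: sm_co.
Qed.

Definition av : 'I_3 -> V3 R -> R^o :=
  cmb (fun x => (theta x.1 (csqr x.2)).1) (fun x => (theta x.1 (csqr x.2)).2).

(** The differential of [ph], which by [av1] is the change of [av] from time 0 to time 1. *)
Definition Ph : 'I_3 -> V3 R -> R^o :=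
  cmb (fun x => 'D_((1, 0) : plane R) f0 (csqr x.2)) (fun x => 'D_((0, 1) : plane R) f0 (csqr x.2)).

Definition ph (x : V3 R) : R^o := f0 (csqr x.2).

Lemma av_sm k i : sm k O (av i).
Proof.
have [s1 s2 _ _ _] := theta_twisted.
by apply: cmb_sm; [apply: (sm_sqm (Ck_sm (s1 k)))|apply: (sm_sqm (Ck_sm (s2 k)))].
Qed.

Lemma ph_sm k : sm k O ph.
Proof. by have [_ _ _ sf _] := theta_twisted; apply: (sm_sqm (Ck_sm_snd (sf 0 k))). Qed.

Lemma Ph_sm k i : sm k O (Ph i).
Proof.
have [_ _ _ sf _] := theta_twisted.
have D v : Ck_on k Q (fun x => 'D_v f0 x) by have [_] := sf 0 k.+1; apply.
by apply: cmb_sm; apply: (sm_sqm (Ck_sm_snd (D _))).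
Qed.

Lemma ph_grad : grad_on O ph Ph.
Proof.
have [_ _ _ sf _] := theta_twisted; have [df _] := sf 0 1%N.
move=> x Ox; have [dsq Dsq] := is_diff_sqm x.
have Qx : Q (csqr x.2) by case: Ox.
have csnd : continuous (snd : V3 R -> plane R) by move=> y; exact: cvg_snd.
have lsnd : linear (snd : V3 R -> plane R) by [].
pose Sn : {linear V3 R -> plane R} := HB.pack (snd : V3 R -> plane R) (GRing.isLinear.Build _ _ _ _ _ lsnd).
have dsnd : differentiable (snd : V3 R -> plane R) (sqm x) := linear_differentiable _ (csnd : continuous Sn).
have dfx := df _ Qx.
have d2 : differentiable (f0 \o (snd : V3 R -> plane R)) (sqm x) by exact: differentiable_comp dsnd dfx.
split=> [|v]; first exact: (differentiable_comp dsq d2).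
rewrite deriveE; last exact: (differentiable_comp dsq d2).
rewrite (diff_comp dsq d2)/= Dsq (diff_comp dsnd dfx)/= (diff_lin (sqm x) (csnd : continuous Sn))/=.
have E (p q : R) : ((p, q) : plane R) = p *: ((1, 0) : plane R) + q *: ((0, 1) : plane R).
  by apply: injective_projections; rewrite /= ?[_ *: 1]mulr1 ?[_ *: 0]mulr0 ?addr0 ?add0r.
rewrite [X in diff _ _ X](E (2 * (x.2.1 * v.2.1 - x.2.2 * v.2.2)) (2 * (x.2.1 * v.2.2 + x.2.2 * v.2.1))).
rewrite linearD !linearZ -!deriveE// sum3 /Ph /cmb /= /co /=.
rewrite -![_ *: _]/(_ * _).
move: ('D__ _ _) ('D__ _ _) => p q; ring.
Qed.

Lemma av1 (z : plane R) i : Q (csqr z) -> av i (1, z) = av i (0, z) + Ph i (0, z).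
Proof.
move=> Qz; have [_ _ _ _ h] := theta_twisted; have := h 0 _ Qz; rewrite add0r => E.
rewrite /av /Ph /cmb; case: (val i) => [|[|_]]; rewrite /= ?addr0// E /co /=;
  by move: ('D__ _ _) ('D__ _ _) (theta 0 (csqr z)) => p q [r s] /=; ring.
Qed.

Lemma varthetaE t (z v : plane R) : vartheta theta t z v = v.1 * av i1 (t, z) + v.2 * av i2 (t, z).
Proof.
rewrite /vartheta /av /cmb /dot0 /co /cmul /=; case: (theta t (csqr z)) => p q /=.
case: z v => z1 z2 [v1 v2]; rewrite /= -![2 *: _]/(2 * _); ring.
Qed.

Definition psi (x : V3 R) : R^o := (co i1 x * co i1 x + co i2 x * co i2 x) * ph x.

Lemma psi_sm k : sm k O psi.
Proof. by apply: sm_mul; [apply: sm_add; apply: sm_mul; exact: sm_co|exact: ph_sm]. Qed.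

(** Discharged by [rigid_at]. *)
Hypothesis rigid : forall i (z : plane R) (t : R), Q (csqr z) -> 0 <= t <= 1 ->
  av i (t, z) = av i (0, z) + t * Ph i (0, z).

(** The part of the form that is linear in time contributes the integral of [t_z] times the
    derivative of [ph] along the loop. By parts, the boundary term cancels the term with [f], and
    the derivative [|z|^2 / ||z||^2] of [t_z] produces [psi]. *)
Lemma action_Sr u : U u -> action theta (f 0) u = Sr av psi u.
Proof.
move=> Uu; have Hu := U1_H1 Uu; have /dom_H su := Hu.
have m0 : 0 < mss u by apply: mss_gt0; case: Uu => -[].
pose g i := loop (cp u i).
have [a0 e0] := sob1P (su o0); have [a1 e1] := sob1P (su o1).
pose r (t : R) := g o0 t * g o0 t + g o1 t * g o1 t.
have ar := acD (ac_mul (proj1 a0) (proj1 a0)) (ac_mul (proj1 a1) (proj1 a1)).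
have sr : sqi r by exact: acl_sqi ar.
have mr : mss u = it 0 1 r.
  rewrite /mss !L2dot_itE -itD; try exact: igM_L2.
  apply: ae01_it => //; [by apply: igD => //; exact: igM_L2|exact: sqi_ig|].
  by apply: ae01S (ae01I e0 e1) => t _ [-> ->].
pose tz (t : R) := time u.1 t.
have atz : ac tz (fun t => (mss u)^-1 * r t).
  by apply: ac_eq (acZ (mss u)^-1 (ac_int sr)) => t t01; rewrite /tz /time mulrC.
have r0 t : 0 <= r t by rewrite addr_ge0// -expr2 sqr_ge0.
(* [rigid] speaks only of times in [0, 1]. *)
have tz01 (t : R) : 0 <= t <= 1 -> 0 <= tz t <= 1.
  move=> /andP[t0 t1]; rewrite /tz /time -mssE.
  have i0' : 0 <= int0 t r by apply: it_ge0.
  have i1' : int0 t r <= mss u.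
    by rewrite mr; apply: it_mono => //; exact: sqi_ig.
  by rewrite divr_ge0 ?(ltW m0)//= ler_pdivrMr// mul1r.
have tz1 : tz 1 = 1 by rewrite /tz /time -mssE -[int0 1 _]/(it 0 1 r) -mr divff// gt_eqF.
have tz0 : tz 0 = 0 by rewrite /tz /time int00 mul0r.
pose y (t : R) : R := ph (gam u t).
pose y' (t : R) : R := \sum_i Ph i (gam u t) * gamd u i t.
have ay : ac y y'.
  apply: (chain oO (fun i => proj1 (gam_acl i Hu)) (U1_OQ Uu) ph_grad) => i; exact: Ph_sm.
have y10 : y 1 = y 0.
  by rewrite /y !gamE (proj2 a0) (proj2 a1).
have am := ac_mul atz ay.
have cy := ac_cont ay; have ct := ac_cont atz.
have [cyb hcy] := cont_bd cy; have [ctb hct] := cont_bd ct.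
have sty : sqi (fun t => tz t * y' t).
  by apply: (sqiM_bd (c := ctb)) => //; [exact: cont_meas|exact: (proj1 ay)].
have syr : sqi (fun t => y t * ((mss u)^-1 * r t)).
  by apply: (sqiM_bd (c := cyb)) => //; [exact: cont_meas|apply: sqiZ].
have IBP : it 0 1 (fun t => tz t * y' t) = y 0 - (mss u)^-1 * it 0 1 (fun t => y t * r t).
  have := proj2 am 1; rewrite ler01 lexx => /(_ isT); rewrite tz1 tz0 mul0r mul1r add0r y10 => ->.
  rewrite -[int0 1 _]/(it 0 1 _) itD; [|exact: sqi_ig|exact: sqi_ig].
  have -> : (fun t => y t * ((mss u)^-1 * r t)) = (fun t => (mss u)^-1 * (y t * r t)).
    by apply/funext => t; ring.
  rewrite itZ ?addrK//; apply: sqi_ig.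
  by apply: (sqiM_bd (c := cyb)) => //; exact: cont_meas.
pose d (i : 'I_3) := gamd u i.
have sd i : sqi (d i).
  by rewrite /d /gamd; case: (val i) => [|[|_]]; [exact: sqi_cst|exact: L2fun_sqi|exact: L2fun_sqi].
pose ai i (t : R) : R := av i (gam u t) * d i t.
have sai i : sqi (ai i).
  have ca : {within I01, continuous (fun t => av i (gam u t) : R)}.
    apply: (path_cont (k := 0) (O := O)); [|exact: av_sm|exact: U1_OQ].
    by move=> j; exact: ac_cont (gam_acl j Hu).1.
  have [c hc] := cont_bd ca; apply: (sqiM_bd (c := c)) => //; exact: cont_meas.
have Mg : it 0 1 (fun t => vartheta theta (tz t) (hloop u.1 t) (hfun (hdiff u.1) t)) =
    \sum_i it 0 1 (ai i) + it 0 1 (fun t => tz t * y' t).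
  rewrite -it_sum => [|i]; last exact: sqi_ig.
  rewrite -itD; [|exact: sqi_ig (sqi_sum sai)|exact: sqi_ig].
  apply: eq_Rintegral => t; rewrite inE/= in_itv/= => t01.
  have Ot := U1_OQ Uu t01; rewrite gamE in Ot.
  have Qt : Q (csqr (hloop u.1 t)) by apply/(OQE Q 0).
  rewrite varthetaE !(rigid _ Qt (tz01 t t01)) /ai /y' gamE !sum3 /d /gamd /=.
  rewrite -[hloop u.1 t]/(loop (cp u o0) t, loop (cp u o1) t).
  rewrite -[L2fun (L2diff u.1.1) t]/(L2fun (L2diff (cp u o0)) t).
  rewrite -[L2fun (L2diff u.1.2) t]/(L2fun (L2diff (cp u o1)) t).
  move: (av i1 _) (av i2 _) (Ph i1 _) (Ph i2 _) (av i0 _) (Ph i0 _) (tz t) => q1 q2 q3 q4 q5 q6 q7.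
  move: (L2fun _ t) (L2fun _ t) => q8 q9; ring.
have Ea i : it 0 1 (ai i) = L2dot (sup (av i) u) (L2diff (xv u i)).
  rewrite L2dot_itE; apply: ae01_it => //; [exact: sqi_ig|exact: igM_L2|].
  apply: ae01S (ae01I (sup_E Uu (av_sm 0 i)) _) => [t _ [E1 E2]|]; last first.
    by have := L2fun0 (R := R); apply: ae01S => t _ h; exact: h.
  rewrite /ai E1; congr (_ * _); rewrite /d /gamd /xv; case: (val i) => [|[|_]] //.
  by rewrite L2diff0 E2.
have Ey : it 0 1 (fun t => y t * r t) = L2dot (sup psi u) one.
  rewrite L2dot_one /mn; apply: ae01_it => //; [|exact: ig_L2|].
    apply: sqi_ig; apply: (sqiM_bd (c := cyb)) => //; exact: cont_meas.
  apply: ae01S (sup_E Uu (psi_sm 0)) => t _ ->; rewrite /psi mulrC /y /r.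
  by rewrite gamE /co.
have y0 : f 0 (csqr (hloop u.1 0)) = y 0 by rewrite /y /ph gamE.
rewrite /action /magnetic -[int01 _]/(it 0 1 _) Mg IBP y0 (eq_bigr _ (fun i _ => Ea i)) Ey.
rewrite /Sr /Wf -mssE.
have -> : hdot u.2 (hdiff u.1) = \sum_i L2dot (ev u i) (L2diff (xv u i)).
  by rewrite sum3 [L2dot (ev u i0) _]L2dot0 add0r.
have -> : hdot u.2 u.2 = \sum_i L2dot (ev u i) (ev u i).
  by rewrite sum3 [L2dot (ev u i0) _]L2dot0 add0r.
have := lt0r_neq0 m0; move: (mss u) (y 0) (\sum_i L2dot (ev u i) (L2diff _)) (\sum_i L2dot (ev u i) (ev u i)).
move: (\sum_i L2dot (sup _ _) _) (L2dot _ one) => q1 q2 m q3 q4 q5 m1; by field.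
Qed.

End coefficients.

(** * Rigidity: the time derivative of vartheta is constant *)

Section time_expansion.
Context {R : realType}.

(** First order expansion of [t_z] when [z] moves on a line through a constant loop with
    [|z|^2 = P]: numerator and denominator are quadratic polynomials in [s], and the estimate is
    uniform in [t]. *)
Lemma time_est (P b1 c1 M : R) : 0 < P -> 0 <= M -> `|b1| <= M -> exists d K : R, [/\ 0 < d, 0 <= K &
  forall s t b c : R, `|s| < d -> 0 <= t <= 1 -> `|b| <= M -> `|c| <= M ->
  `|(P * t + s * b + s ^+ 2 * c) / (P + b1 * s + c1 * s ^+ 2) - t - s * (b / P - t * b1 / P)|
     <= K * `|s| ^+ 2].
Proof.
move=> P0 M0 b1M.
have Pn : P != 0 by rewrite gt_eqF.
have iP k : 0 <= P ^- k by rewrite invr_ge0 exprn_ge0// ltW.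
have P1 : 0 <= P^-1 by rewrite invr_ge0 ltW.
have TD : T2 (fun s => P + b1 * s + c1 * s ^+ 2) P b1 c1 by apply: T2_poly.
have [d [C [d0 C0 H]]] := T2_inv Pn TD.
pose c2 := b1 ^+ 2 / P ^+ 3 - c1 / P ^+ 2.
pose K := (P + M + M) * (C + `|c2|) + M / P + M * M / P ^+ 2 + M * M / P ^+ 2.
have K0 : 0 <= K.
  rewrite /K; apply: addr_ge0; [apply: addr_ge0; [apply: addr_ge0|]|].
  - by apply: mulr_ge0; rewrite ?addr_ge0// ltW.
  - exact: mulr_ge0.
  - by apply: mulr_ge0; rewrite ?iP// mulr_ge0.
  - by apply: mulr_ge0; rewrite ?iP// mulr_ge0.
exists (Num.min 1 d), K; split=> //; first exact: lt_minr.
move=> s t b c /lt_min2[s1 sd] /andP[t0 t1] bM cM.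
have {}H := H s sd; rewrite -/c2 in H.
move: ((P + b1 * s + c1 * s ^+ 2)^-1) H => D H.
(* The remainder of the first order expansion of the inverse denominator. *)
pose r := D - (P^-1 - b1 / P ^+ 2 * s).
have rs : `|r| <= (C + `|c2|) * `|s| ^+ 2.
  have -> : r = (D - (P^-1 + - b1 / P ^+ 2 * s + c2 * s ^+ 2)) + c2 * s ^+ 2 by rewrite /r; ring.
  rewrite [leRHS]mulrDl; apply: (le_trans (ler_normD _ _)); apply: lerD; last by rewrite normrM normrX.
  apply: (le_trans H); apply: ler_wpM2l => //.
  by rewrite exprS ler_piMl ?exprn_ge0// ltW.
have -> : (P * t + s * b + s ^+ 2 * c) * D - t - s * (b / P - t * b1 / P) =
  (P * t + s * b + s ^+ 2 * c) * r + (c / P - b * b1 / P ^+ 2 - c * b1 / P ^+ 2 * s) * s ^+ 2.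
  by rewrite /r; field.
have PM : `|P * t + s * b + s ^+ 2 * c| <= P + M + M.
  apply: (le_trans (ler_normD _ _)); apply: lerD.
    apply: (le_trans (ler_normD _ _)); apply: lerD; rewrite normrM.
      by rewrite !ger0_norm ?(ltW P0)// ler_piMr// ltW.
    by rewrite -[leRHS]mul1r; apply: ler_pM => //; exact: ltW.
  rewrite normrM -[leRHS]mul1r; apply: ler_pM => //; rewrite normrX exprn_ile1//; exact: ltW.
have -> : K * `|s| ^+ 2 = (P + M + M) * ((C + `|c2|) * `|s| ^+ 2) +
    (M / P + M * M / P ^+ 2 + M * M / P ^+ 2) * `|s| ^+ 2 by rewrite /K; ring.
apply: (le_trans (ler_normD _ _)); apply: lerD.
  by rewrite normrM; apply: ler_pM.
rewrite normrM normrX; apply: ler_wpM2r; first exact: exprn_ge0.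
apply: (le_trans (ler_normD _ _)); apply: lerD; last first.
  rewrite normrN !normrM (ger0_norm (iP 2%N)) -[leRHS]mulr1; apply: ler_pM => //; last exact: ltW.
    by rewrite !mulr_ge0.
  by apply: ler_wpM2r => //; apply: ler_pM.
apply: (le_trans (ler_normD _ _)); apply: lerD.
  by rewrite normrM (ger0_norm P1) ler_wpM2r.
by rewrite normrN !normrM (ger0_norm (iP 2%N)) ler_wpM2r// ler_pM.
Qed.

End time_expansion.

(** * The action along lines through a constant loop *)

Section constant_loop.
Context {R : realType}.
Notation T := (measurableTypeR R).
Implicit Types (u w : HL2 R).
Local Hint Resolve mI01 : core.
Variables (Q : set (plane R)) (theta : R -> plane R -> plane R) (f : R -> plane R -> R).
Hypothesis Qopen : open Q.
Hypothesis theta_twisted : twisted_periodic Q theta f.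
Notation O := (OQ Q).
Notation U := (U1 Q).
Variables (p v : plane R).
Hypothesis Qp : Q (csqr p).
Hypothesis pn : 0 < dot0 p p.

Variables (g1 : 'I_3 -> V3 R -> R^o).
(** The form [vartheta] evaluated on the fixed vector [v]. *)
Definition gV (x : V3 R) : R^o := v.1 * av theta i1 x + v.2 * av theta i2 x.
Hypothesis g1G : grad_on O gV g1.
Hypothesis g1s : forall i, sm 1 O (g1 i).

(** On a constant loop [t_z] is the identity, so the path to expand around is [t |-> (t, p)]. *)
Definition pth (i : 'I_3) (t : R) : R :=
  match val i with 0%N => t | 1%N => p.1 | _ => p.2 end.
Definition pd (t : R) : V3 R := mk3 pth t.
(** The time derivative of [vartheta] on [v] at [p]; [al] is the derivative in direction [v]
    instead. *)
Definition kk (t : T) : R := g1 i0 (pd t).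
Definition al (t : T) : R := v.1 * g1 i1 (pd t) + v.2 * g1 i2 (pd t).

Lemma pdE t : pd t = (t, p). Proof. by rewrite /pd /mk3 /pth /= -surjective_pairing. Qed.

Lemma pd_O t : O (pd t). Proof. by rewrite pdE; apply/OQE. Qed.

Lemma ac_id : ac ((fun t => t) : T -> R) (cst 1).
Proof.
split; first exact: sqi_cst.
by move=> t /andP[t0 t1]; rewrite -[int0 t _]/(it 0 t _) it_cst// subr0 mul1r add0r.
Qed.

Definition pthd (i : 'I_3) : T -> R := match val i with 0%N => cst 1 | _ => cst 0 end.

Lemma pth_ac i : ac (pth i : T -> R) (pthd i).
Proof.
rewrite /pth /pthd; case: (val i) => [|[|_]]; [exact: ac_id|exact: ac_cst|exact: ac_cst].
Qed.

Lemma pth_cont k (h : V3 R -> R^o) : sm k O h -> {within I01, continuous (fun t => h (pd t) : R)}.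
Proof.
move=> sh; exact: (path_cont (fun i => ac_cont (pth_ac i)) sh (fun t _ => pd_O t)).
Qed.

Definition u0 : HL2 R := mkH (fun i => match val i with
  | 0%N => p.1 *: one | 1%N => p.2 *: one | _ => 0 end).
Definition vc (z : L2 R) : HL2 R := mkH (fun i => match val i with
  | 0%N => v.1 *: z | 1%N => v.2 *: z | _ => 0 end).

Lemma vc_H1 z : sobolev 1 z -> H_ 1 (vc z).
Proof.
move=> sz; apply/dom_H => i; rewrite cp_mkH.
case: (val i) => [|[|_]]; [by case: (sob1Z v.1 sz)|by case: (sob1Z v.2 sz)|exact: sob1_0].
Qed.

Lemma u0_H1 : H_ 1 u0.
Proof.
apply/dom_H => i; rewrite cp_mkH.
case: (val i) => [|[|_]]; [by case: (sob1Z p.1 (one_sob (R := R)))|by case: (sob1Z p.2 (one_sob (R := R)))|exact: sob1_0].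
Qed.

Lemma loop_uv (s t : R) z : sobolev 1 z -> 0 <= t <= 1 ->
  hloop (u0 + s *: vc z).1 t = (p.1 + s * v.1 * loop z t, p.2 + s * v.2 * loop z t).
Proof.
move=> sz t01; rewrite /hloop.
have K (a b : R) : loop (a *: one + s *: (b *: z)) t = a + s * b * loop z t.
  have [_ [_ l1]] := one_sob1 (R := R).
  have [sb [_ lb]] := sob1Z b sz.
  have [s1 [_ ls]] := sob1Z s sb.
  have [_ _ -> //] := sob1_lin a (one_sob (R := R)) s1.
  by rewrite l1// ls// lb// mulr1 mulrA.
by congr (_, _); exact: K.
Qed.

Lemma u0_U1 : U u0.
Proof.
apply: U1E; first exact: u0_H1.
  move/cp01_0 => [a b]; move: pn; rewrite lt_neqAle eq_sym => /andP[+ _].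
  rewrite /dot0.
  have E (c : R) : c *: one = 0 :> L2 R -> c = 0.
    by move=> h; have := mnZ c (one (R := R)); rewrite h mn0 mn1 mulr1.
  have -> : p.1 = 0 by apply: E; rewrite -a cp_mkH.
  have -> : p.2 = 0 by apply: E; rewrite -b cp_mkH.
  by rewrite mul0r addr0 eqxx.
move=> t t01; rewrite gamE; apply/OQE.
have := @loop_uv 0 t 0 sob1_0 t01; rewrite scale0r addr0 !mul0r !addr0 -surjective_pairing => E.
by rewrite -[X in csqr X]/(hloop u0.1 t) E.
Qed.

End constant_loop.

Section constant_loop.
Context {R : realType}.
Notation T := (measurableTypeR R).
Implicit Types (u w : HL2 R).
Local Hint Resolve mI01 : core.
Variables (Q : set (plane R)) (theta : R -> plane R -> plane R) (f : R -> plane R -> R).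
Hypothesis Qopen : open Q.
Hypothesis theta_twisted : twisted_periodic Q theta f.
Notation O := (OQ Q).
Notation U := (U1 Q).
Variables (p v : plane R).
Hypothesis Qp : Q (csqr p).
Hypothesis pn : 0 < dot0 p p.
Notation P := (dot0 p p).
Notation qd := (dot0 p v).
Variables (g1 : 'I_3 -> V3 R -> R^o).
Notation gVv := (gV theta v).
Hypothesis g1G : grad_on O gVv g1.
Hypothesis g1s : forall i, sm 1 O (g1 i).
Notation u0p := (u0 p).
Notation vcv := (vc v).

Section loop_z.
Variable z : L2 R.
Hypothesis sz : sobolev 1 z.
Hypothesis z0 : loop z 0 = 0.
Let g : T -> R := loop z.
Let g' : T -> R := L2fun (L2diff z).
Let X (t : R) : R := int0 t g.
Let X2 (t : R) : R := int0 t (fun t => g t * g t).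
Notation nv := (dot0 v v).

Definition D1 : R := 2 * qd * mn z.
Definition D2 : R := nv * L2dot z z.
Definition DD (s : R) : R := P + D1 * s + D2 * s ^+ 2.

Lemma zac : acl g g'. Proof. by case: (sob1P sz). Qed.
Lemma zae : ae01 (fun t => L2fun z t = g t). Proof. by case: (sob1P sz). Qed.
Lemma sg : sqi g. Proof. exact: acl_sqi (proj1 zac). Qed.
Lemma sg' : sqi g'. Proof. exact: L2fun_sqi. Qed.
Lemma gbd : exists c, forall t, I01 t -> `|g t| <= c. Proof. exact: cont_bd (ac_cont (proj1 zac)). Qed.

Lemma sgg : sqi (fun t => g t * g t).
Proof.
have [c hc] := gbd; apply: (sqiM_bd (c := c)) => //; last exact: sg.
exact: cont_meas (ac_cont (proj1 zac)).
Qed.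

Lemma X1E : X 1 = mn z.
Proof. by apply: ae01_it => //; [exact: sqi_ig sg|exact: ig_L2|apply: ae01S zae => t _ ->]. Qed.

Lemma cp_uv s : [/\ cp (u0p + s *: vcv z) o0 = p.1 *: one + s *: (v.1 *: z),
  cp (u0p + s *: vcv z) o1 = p.2 *: one + s *: (v.2 *: z),
  cp (u0p + s *: vcv z) o2 = 0 & cp (u0p + s *: vcv z) o3 = 0].
Proof. by split; rewrite cpD cpZ !cp_mkH /= ?scaler0 ?addr0. Qed.

Lemma mss_uv s : mss (u0p + s *: vcv z) = DD s.
Proof.
have [c0 c1 _ _] := cp_uv s; rewrite /mss c0 c1 !(L2dotD, L2dotDr, L2dotZ, L2dotZr).
rewrite ![L2dot one z]L2dotC !L2dot_one mn1 /DD /D1 /D2 /dot0.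
move: (mn z) (L2dot z z) => *; ring.
Qed.

(** The time change of the loop [p + s v z], with [DD s] its squared L^2 norm. *)
Definition ts (s t : R) : R := (P * t + s * (2 * qd * X t) + s ^+ 2 * (nv * X2 t)) / DD s.

Lemma time_uv s t : 0 <= t <= 1 -> time (u0p + s *: vcv z).1 t = ts s t.
Proof.
move=> t01; rewrite /time -mssE mss_uv /ts; congr (_ / _).
have /andP[t0 t1] := t01.
have ss : sqi (fun t => (s * (2 * qd)) * g t + s ^+ 2 * nv * (g t * g t)).
  by apply: sqiD; apply: sqiZ; [exact: sg|exact: sgg].
have i1 : ig `[0, t] g by apply: ig_itv => //; exact: sqi_ig sg.
have i2 : ig `[0, t] (fun t => g t * g t) by apply: ig_itv => //; exact: sqi_ig sgg.
have i3 : ig `[0, t] (cst P) by apply: ig_itv => //; exact: ig_cst.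
have m : measurable ([set` `[0, t]] : set T) by [].
transitivity (it 0 t (fun t => P + ((s * (2 * qd)) * g t + s ^+ 2 * nv * (g t * g t)))).
  apply: eq_Rintegral => r; rewrite inE/= in_itv/= => /andP[r0 rt].
  have r01 : 0 <= r <= 1 by rewrite r0 (le_trans rt).
  rewrite (loop_uv p v s sz r01) /dot0 /=; rewrite -/g; ring.
have i4 : ig `[0, t] (fun t => s * (2 * qd) * g t) by exact: igZ.
have i5 : ig `[0, t] (fun t => s ^+ 2 * nv * (g t * g t)) by exact: igZ.
rewrite (itD i3 (igD m i4 i5)) (itD i4 i5) it_cst// subr0.
by rewrite (itZ _ i1) (itZ _ i2) -/(X t) -/(X2 t) -addrA !mulrA.
Qed.

Definition xc (s : R) (i : 'I_3) (t : R) : R :=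
  match val i with 0%N => ts s t | 1%N => p.1 + s * v.1 * g t | _ => p.2 + s * v.2 * g t end.
Definition xs (s t : R) : V3 R := mk3 (xc s) t.

Lemma xs_O s t : U (u0p + s *: vcv z) -> 0 <= t <= 1 -> O (xs s t).
Proof.
move=> Us t01; have := U1_OQ Us t01; rewrite gamE /xs /mk3 /= => /(OQE Q 0) h.
apply/OQE; have := loop_uv p v s sz t01; rewrite /hloop => E.
by move: h; rewrite -[loop (cp _ o0) t]/(loop (u0p + s *: vcv z).1.1 t) -[loop (cp _ o1) t]/(loop (u0p + s *: vcv z).1.2 t) E.
Qed.

Lemma xs_cont s : {within I01, continuous (fun t => ts s t : R)}.
Proof.
have a1 := acZ (s * (2 * qd)) (ac_int sg); have a2 := acZ (s ^+ 2 * nv) (ac_int sgg).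
have a := acZ (DD s)^-1 (acD (acD (acZ P (@ac_id R)) a1) a2).
apply: (ac_cont (ac_eq _ a)) => t t01; rewrite /ts /X /X2; ring.
Qed.

Definition II (s : R) : R := it 0 1 (fun t => g' t * gVv (xs s t)).

Lemma gV_sm k : sm k O gVv.
Proof. by apply: sm_add; apply: sm_scale; apply: (av_sm theta_twisted). Qed.

Lemma xc_cont s i : {within I01, continuous (xc s i)}.
Proof.
rewrite /xc; case: (val i) => [|[|_]]; first exact: xs_cont.
  exact: (ac_cont (acD (ac_cst p.1) (acZ (s * v.1) (proj1 zac)))).
exact: (ac_cont (acD (ac_cst p.2) (acZ (s * v.2) (proj1 zac)))).
Qed.

Lemma sII s : U (u0p + s *: vcv z) -> sqi (fun t => g' t * gVv (xs s t)).
Proof.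
move=> Us; have c := path_cont (fun i => @xc_cont s i) (gV_sm 0) (fun t h => xs_O Us h).
have [b hb] := cont_bd c.
have -> : (fun t => g' t * gVv (xs s t)) = (fun t => gVv (xs s t) * g' t).
  by apply/funext => t; rewrite mulrC.
by apply: (sqiM_bd (c := b)) => //; [exact: cont_meas|exact: sg'].
Qed.

(** As [z] vanishes at 0, the term with [f] is constant, and as [eta = 0], no other term involves
    it. The derivative of the loop carries a factor [s], so a first order expansion of [II] will
    do. *)
Lemma action_uv s : U (u0p + s *: vcv z) ->
  action theta (f 0) (u0p + s *: vcv z) = s * II s + (- f 0 (csqr p) + (DD s)^-1).
Proof.
move=> Us; have [c0 c1 c2 c3] := cp_uv s.
have Mg : int01 (fun t => vartheta theta (time (u0p + s *: vcv z).1 t) (hloop (u0p + s *: vcv z).1 t)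
     (hfun (hdiff (u0p + s *: vcv z).1) t)) = s * II s.
  rewrite -[int01 _]/(it 0 1 _) /II -itZ; last exact: sqi_ig (sII Us).
  have e0 := L2funZ s (v.1 *: L2diff z); have e1 := L2funZ s (v.2 *: L2diff z).
  have e2 := L2funZ v.1 (L2diff z); have e3 := L2funZ v.2 (L2diff z).
  have Dc (a b : R) : L2diff (a *: one + s *: (b *: z)) = s *: (b *: L2diff z).
    have [sb [Db _]] := sob1Z b sz; have [s1 [Ds _]] := sob1Z s sb.
    have [_ [D1 _]] := sob1Z a (one_sob (R := R)); have [so _] := sob1Z a (one_sob (R := R)).
    rewrite L2diffD// D1 Ds Db; have [_ [-> _]] := one_sob1 (R := R).
    by rewrite scaler0 add0r.
  pose d0 := L2fun (L2diff (cp (u0p + s *: vcv z) o0)).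
  pose d1 := L2fun (L2diff (cp (u0p + s *: vcv z) o1)).
  have sa i (d : T -> R) : sqi d -> sqi (fun t => av theta i (xs s t) * d t).
    move=> sd; have c := path_cont (fun i => @xc_cont s i) (av_sm theta_twisted 0 i) (fun t h => xs_O Us h).
    by have [b hb] := cont_bd c; apply: (sqiM_bd (c := b)) => //; exact: cont_meas.
  have sr : sqi (fun t => s * (g' t * gVv (xs s t))) by apply: sqiZ; exact: sII.
  transitivity (it 0 1 (fun t => av theta i1 (xs s t) * d0 t + av theta i2 (xs s t) * d1 t)).
    apply: eq_Rintegral => t; rewrite inE/= in_itv/= => t01.
    rewrite varthetaE (time_uv s t01) (loop_uv p v s sz t01).
    by rewrite mulrC [X in _ + X]mulrC.
  apply: ae01_it => //; [|exact: sqi_ig|].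
    by apply: sqi_ig; apply: sqiD; apply: sa; exact: L2fun_sqi.
  apply: ae01S (ae01I (ae01I e0 e1) (ae01I e2 e3)) => t _ [[E0 E1] [E2 E3]].
  rewrite /d0 /d1 c0 c1 !Dc E0 E1 E2 E3 -/g' /gV.
  move: (av _ _ _) (av _ _ _) => q1 q2; ring.
rewrite /action /magnetic Mg.
have -> : hloop (u0p + s *: vcv z).1 0 = p.
  have h01 : 0 <= (0 : R) <= 1 by apply/andP; split.
  by rewrite (loop_uv p v s sz h01) z0 !mulr0 !addr0 -surjective_pairing.
have -> : hdot (u0p + s *: vcv z).2 (hdiff (u0p + s *: vcv z).1) = 0.
  by rewrite /hdot -[X in L2dot X _ + _]/(cp (u0p + s *: vcv z) o2) -[X in _ + L2dot X _]/(cp (u0p + s *: vcv z) o3) c2 c3 !L2dot0 addr0.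
have -> : hdot (u0p + s *: vcv z).2 (u0p + s *: vcv z).2 = 0.
  by rewrite /hdot -[(u0p + s *: vcv z).2.1]/(cp (u0p + s *: vcv z) o2) -[(u0p + s *: vcv z).2.2]/(cp (u0p + s *: vcv z) o3) c2 c3 !L2dot0 addr0.
by rewrite -mssE mss_uv mul0r subr0 add0r addrA.
Qed.

End loop_z.
End constant_loop.

(** * Second order expansion at a constant loop *)

Section constant_loop.
Context {R : realType}.
Notation T := (measurableTypeR R).
Implicit Types (u w : HL2 R).
Local Hint Resolve mI01 : core.
Variables (Q : set (plane R)) (theta : R -> plane R -> plane R) (f : R -> plane R -> R).
Hypothesis Qopen : open Q.
Hypothesis theta_twisted : twisted_periodic Q theta f.
Notation O := (OQ Q).
Notation oO := (OQ_open Qopen).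
Notation U := (U1 Q).
Variables (p v : plane R).
Hypothesis Qp : Q (csqr p).
Hypothesis pn : 0 < dot0 p p.
Notation P := (dot0 p p).
Notation qd := (dot0 p v).
Notation lam := (2 * qd / P).
Variables (g1 : 'I_3 -> V3 R -> R^o).
Notation gVv := (gV theta v).
Hypothesis g1G : grad_on O gVv g1.
Hypothesis g1s : forall i, sm 1 O (g1 i).
Notation kkp := (kk p g1).
Notation alp := (al p v g1).
Notation u0p := (u0 p).
Notation vcv := (vc v).
Notation pdp := (pd p).

Section estimate.
Variable z : L2 R.
Hypothesis sz : sobolev 1 z.
Hypothesis z0 : loop z 0 = 0.
Let g : T -> R := loop z.
Let g' : T -> R := L2fun (L2diff z).
Let X (t : R) : R := int0 t g.
Let X2 (t : R) : R := int0 t (fun t => g t * g t).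
Notation nv := (dot0 v v).
Notation uz s := (u0p + s *: vcv z).

(** The first variation of the time change; [I0] and [I1] are the Taylor coefficients of [II] that
    result from it. *)
Definition T1 (t : R) : R := lam * (int0 t (loop z) - t * int0 1 (loop z)).
Definition I0 : R := it 0 1 (fun t => g' t * gVv (pdp t)).
Definition I1 : R := it 0 1 (fun t => g' t * (kkp t * T1 t + alp t * g t)).

Let zac' : acl g g' := zac sz.

Lemma T1_ac : ac T1 (fun t => lam * (g t - int0 1 g)).
Proof.
have a := acZ lam (acD (ac_int (sg sz)) (acZ (- int0 1 g) (@ac_id R))).
apply: ac_eqd (ac_eq _ a); last first.
- by move=> t _; rewrite /T1; ring.
- by apply: ae01W => t _; rewrite mulr1.
- by apply: sqiZ; apply: sqiB; [exact: sg|exact: sqi_cst].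
Qed.

Lemma I1_cont : {within I01, continuous (fun t => kkp t * T1 t + alp t * g t : R)}.
Proof.
have cg := ac_cont (proj1 zac'); have cT := ac_cont T1_ac.
have c i := pth_cont Qp (g1s i).
move=> t; apply: cvgD; apply: cvgM; [exact: c|exact: cT| |exact: cg].
by apply: cvgD; apply: cvgMr; exact: c.
Qed.

Lemma I_est : exists d K : R, [/\ 0 < d, 0 <= K & forall s : R, `|s| < d ->
  U (uz s) /\ `|II theta p v z s - (I0 + s * I1)| <= K * `|s| ^+ 2].
Proof.
have [du du0 dU] := U1_sub Qopen (u0_U1 v Qp pn) (vc_H1 v sz).
have [gb hgb] := gbd sz.
have [xb hxb] := cont_bd (ac_cont (ac_int (sg sz))).
have [yb hyb] := cont_bd (ac_cont (ac_int (sgg sz))).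
have I1' : (I01 : set T) 1 by apply/I01E; rewrite ler01 lexx.
have gb0 : 0 <= gb := le_trans (normr_ge0 _) (hgb 1 I1').
have xb0 : 0 <= xb := le_trans (normr_ge0 _) (hxb 1 I1').
have yb0 : 0 <= yb := le_trans (normr_ge0 _) (hyb 1 I1').
pose M := `|2 * qd| * xb + `|nv| * yb.
have M0 : 0 <= M by rewrite addr_ge0 ?mulr_ge0.
have bM t : I01 t -> `|2 * qd * int0 t (loop z)| <= M.
  move=> It; rewrite normrM; apply: (@le_trans _ _ (`|2 * qd| * xb)).
    by apply: ler_wpM2l => //; exact: hxb.
  by rewrite lerDl mulr_ge0.
have cM t : I01 t -> `|nv * int0 t (fun t => loop z t * loop z t)| <= M.
  move=> It; rewrite normrM; apply: (@le_trans _ _ (`|nv| * yb)).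
    by apply: ler_wpM2l => //; exact: hyb.
  by rewrite lerDr mulr_ge0.
have b1M : `|D1 p v z| <= M by rewrite /D1 -X1E//; exact: bM.
have [d1 [K1 [d10 K10 H1]]] := time_est (D2 v z) pn M0 b1M.
have kc : compact (pdp @` (I01 : set R)).
  by apply: mk3_compact => i; exact: ac_cont (pth_ac p i).
have kO : pdp @` (I01 : set R) `<=` O by move=> _ [t _ <-]; exact: pd_O.
have [d2 [C [d20 C0 L]]] := sm_ulips oO kc kO g1s.
pose TB := 2 * M / P.
have TB0 : 0 <= TB by rewrite /TB !mulr_ge0// invr_ge0 ltW.
have T1M t : I01 t -> `|T1 t| <= TB.
  move=> It; have /andP[t0 t1] : 0 <= t <= 1 by apply/I01E.
  have -> : T1 t = (2 * qd * int0 t (loop z) - t * (2 * qd * int0 1 (loop z))) / P by rewrite /T1; ring.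
  rewrite normrM [`|P^-1|]gtr0_norm ?invr_gt0// ler_wpM2r ?invr_ge0 ?(ltW pn)//.
  have -> : 2 * M = M + M by ring.
  apply: (le_trans (ler_normB _ _)); apply: lerD; first exact: bM.
  rewrite normrM -[leRHS]mul1r; apply: ler_pM => //; last exact: bM.
  by rewrite ger0_norm.
(* [|s| * B] bounds the displacement from the path [(t, p)]: the time part moves by at most
   [(K1 + TB) |s|], the spatial part by the next term, and the final 1 makes [B] positive. *)
pose B := K1 + TB + (`|v.1| + `|v.2|) * gb + 1.
have B0 : 0 < B by rewrite ltr_wpDl// !addr_ge0// mulr_ge0// addr_ge0.
pose N := it 0 1 (fun t => `|g' t|).
have N_0 : 0 <= N by apply: it_ge0.
exists (Num.min 1 (Num.min du (Num.min d1 (d2 / B)))), ((3 * C * B ^+ 2 + K1 * C) * N); split.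
- apply: lt_minr => //; apply: lt_minr => //; apply: lt_minr => //; exact: divr_gt0.
- by rewrite mulr_ge0 ?addr_ge0 ?mulr_ge0 ?exprn_ge0 ?(ltW B0).
move=> s /lt_min2[s1 /lt_min2[su /lt_min2[sd1 sd2]]]; have Us := dU s su.
split=> //.
have st := sII theta_twisted sz Us.
have s2 : sqi (fun t => g' t * gVv (pdp t)).
  have c := pth_cont Qp (gV_sm theta_twisted v 0); have [b hb] := cont_bd c.
  apply: (eq_sqi (f := fun t => gVv (pdp t) * g' t)) => [t _|]; first by rewrite mulrC.
  by apply: (sqiM_bd (c := b)) => //; [exact: cont_meas|exact: sg'].
have s3 : sqi (fun t => g' t * (kkp t * T1 t + alp t * g t)).
  have c := I1_cont; have [b hb] := cont_bd c.
  apply: (eq_sqi (f := fun t => (kkp t * T1 t + alp t * g t) * g' t)) => [t _|]; first by rewrite mulrC.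
  by apply: (sqiM_bd (c := b)) => //; [exact: cont_meas|exact: sg'].
pose e t := gVv (xs p v z s t) - gVv (pdp t) - s * (kkp t * T1 t + alp t * g t).
have E : II theta p v z s - (I0 + s * I1) = it 0 1 (fun t => g' t * e t).
  rewrite /II /I0 /I1 -(itZ s (sqi_ig s3)) -(itD (sqi_ig s2) (sqi_ig (sqiZ s s3))).
  rewrite -(itB (sqi_ig st) (sqi_ig (sqiD s2 (sqiZ s s3)))); congr (it 0 1 _).
  apply/funext => t; rewrite /e /= -[L2fun (L2diff z) t]/(g' t); move: (gVv _) (gVv _) (kkp t) (alp t) (T1 t) (g t) (g' t) => *; ring.
have se : sqi (fun t => g' t * e t).
  apply: (eq_sqi (f := fun t => g' t * gVv (xs p v z s t) - (g' t * gVv (pdp t) + s * (g' t * (kkp t * T1 t + alp t * g t))))).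
    by move=> t _ /=; rewrite /e; move: (gVv _) (gVv _) (kkp t) (alp t) (T1 t) (g t) (g' t) => *; ring.
  by apply: sqiB => //; apply: sqiD => //; exact: sqiZ.
have eb t : 0 <= t <= 1 -> `|e t| <= (3 * C * B ^+ 2 + K1 * C) * `|s| ^+ 2.
  move=> t01; have It : (I01 : set T) t by apply/I01E.
  have Kt : (pdp @` (I01 : set R)) (pdp t) by exists t.
  have dT : `|ts p v z s t - t - s * T1 t| <= K1 * `|s| ^+ 2.
    have := H1 s t _ _ sd1 t01 (bM t It) (cM t It).
    have -> : 2 * qd * int0 t (loop z) / P - t * D1 p v z / P = T1 t.
      by rewrite /D1 -X1E// /T1; ring.
    by apply.
  have dt : `|ts p v z s t - t| <= (K1 + TB) * `|s|.
    have -> : ts p v z s t - t = (ts p v z s t - t - s * T1 t) + s * T1 t by rewrite subrK.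
    apply: (le_trans (ler_normD _ _)); rewrite [leRHS]mulrDl; apply: lerD.
      apply: (le_trans dT); apply: ler_wpM2l => //; rewrite ler_iXnr//; exact: ltW.
    by rewrite normrM mulrC ler_wpM2r//; exact: T1M.
  have c0 : co i0 (xs p v z s t - pdp t) = ts p v z s t - t by rewrite coD coN !co_mk3.
  have c1 : co i1 (xs p v z s t - pdp t) = s * v.1 * g t.
    by rewrite coD coN !co_mk3 /xc /pth /= addrC addKr.
  have c2 : co i2 (xs p v z s t - pdp t) = s * v.2 * g t.
    by rewrite coD coN !co_mk3 /xc /pth /= addrC addKr.
  have gt : `|g t| <= gb by exact: hgb.
  have nq : `|xs p v z s t - pdp t| <= `|s| * B.
    apply: (le_trans (norm_co _)); rewrite sum3 c0 c1 c2 !normrM.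
    apply: (@le_trans _ _ ((K1 + TB) * `|s| + (`|s| * `|v.1| * gb + `|s| * `|v.2| * gb))).
      by apply: lerD => //; apply: lerD; apply: ler_wpM2l => //; rewrite mulr_ge0.
    have -> : (K1 + TB) * `|s| + (`|s| * `|v.1| * gb + `|s| * `|v.2| * gb) = `|s| * (B - 1) by rewrite /B; ring.
    by apply: ler_wpM2l => //; rewrite lerBlDr lerDl.
  have nq2 : `|xs p v z s t - pdp t| < d2.
    by apply: (le_lt_trans nq); rewrite -ltr_pdivlMr.
  have := ball_taylor1 C0 g1G (fun i => L _ Kt i) (p := pdp t) (q := xs p v z s t).
  rewrite subrr normr0 => /(_ d20 nq2); rewrite sum3 c0 c1 c2 => TT.
  have kC : `|kkp t| <= C.
    by have [] := L _ Kt i0 (pdp t) (pdp t); rewrite ?subrr ?normr0.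
  have -> : e t = (gVv (xs p v z s t) - gVv (pdp t) - ((ts p v z s t - t) * g1 i0 (pdp t) +
     (s * v.1 * g t * g1 i1 (pdp t) + s * v.2 * g t * g1 i2 (pdp t)))) +
     (ts p v z s t - t - s * T1 t) * kkp t.
    rewrite /e /kk /al; move: (gVv _) (gVv _) (g1 i0 _) (g1 i1 _) (g1 i2 _) (T1 t) (g t) (ts _ _ _ _ _) => *; ring.
  rewrite [leRHS]mulrDl; apply: (le_trans (ler_normD _ _)); apply: lerD.
    apply: (le_trans TT); rewrite -[leRHS]mulrA; apply: ler_wpM2l; first by rewrite mulr_ge0.
    rewrite -exprMn lerXn2r ?nnegrE ?mulr_ge0 ?(ltW B0)//.
    by apply: (le_trans nq); rewrite [leRHS]mulrC.
  by rewrite normrM mulrAC; apply: ler_pM.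
rewrite E; apply: (le_trans (it_norm (sqi_ig se))).
have -> : (3 * C * B ^+ 2 + K1 * C) * N * `|s| ^+ 2 = it 0 1 (fun t => (3 * C * B ^+ 2 + K1 * C) * `|s| ^+ 2 * `|g' t|).
  by rewrite itZ; [rewrite -/N; ring|apply: sqi_ig; apply: sqi_norm; exact: sg'].
apply: it_le.
- by apply: sqi_ig; exact: sqi_norm.
- by apply: sqi_ig; apply: sqiZ; apply: sqi_norm; exact: sg'.
- by move=> t t01; rewrite normrM mulrC ler_wpM2r//; exact: eb.
Qed.

(** [I1] comes from the magnetic term, the bracket from the inverse squared norm. *)
Definition gm : R := I1 + (4 * (qd * mn z) ^+ 2 / P ^+ 3 - nv * L2dot z z / P ^+ 2).

Lemma const_T2 : exists a b : R, T2 (fun s => action theta (f 0) (uz s)) a b gm.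
Proof.
have [d [K [d0 K0 H]]] := I_est.
have TI : T2 (fun s => s * II theta p v z s) 0 I0 I1.
  exists d, K; split=> // s sd; have [_ h] := H s sd.
  have -> : s * II theta p v z s - (0 + I0 * s + I1 * s ^+ 2) = s * (II theta p v z s - (I0 + s * I1)) by ring.
  rewrite normrM; have -> : K * `|s| ^+ 3 = `|s| * (K * `|s| ^+ 2) by ring.
  exact: ler_wpM2l.
have Pn : P != 0 by rewrite gt_eqF.
have TD : T2 (DD p v z) P (D1 p v z) (D2 v z) by apply: T2_poly.
have TT := T2_add TI (T2_add (T2_cst (- f 0 (csqr p))) (T2_inv Pn TD)).
eexists; eexists; apply: (T2_coef _ _ _ (T2_eq d0 _ TT)); [reflexivity|reflexivity| |].
  rewrite /gm add0r; have -> : D1 p v z ^+ 2 = 4 * (qd * mn z) ^+ 2; last by [].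
  by rewrite /D1; move: qd (mn z) => *; ring.
by move=> s sd; have [Us _] := H s sd; rewrite (action_uv theta_twisted sz z0 Us).
Qed.

End estimate.
End constant_loop.

(** * Polarization at a constant loop *)

Section constant_loop.
Context {R : realType}.
Notation T := (measurableTypeR R).
Implicit Types (u w : HL2 R).
Local Hint Resolve mI01 : core.
Variables (Q : set (plane R)) (theta : R -> plane R -> plane R) (f : R -> plane R -> R).
Hypothesis Qopen : open Q.
Hypothesis theta_twisted : twisted_periodic Q theta f.
Notation O := (OQ Q).
Notation oO := (OQ_open Qopen).
Variables (p v : plane R).
Hypothesis Qp : Q (csqr p).
Hypothesis pn : 0 < dot0 p p.
Notation P := (dot0 p p).
Notation qd := (dot0 p v).
Notation lam := (2 * qd / P).
Variables (g1 : 'I_3 -> V3 R -> R^o).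
Notation gVv := (gV theta v).
Hypothesis g1G : grad_on O gVv g1.
Hypothesis g1s : forall i, sm 1 O (g1 i).
Notation kkp := (kk p g1).
Notation alp := (al p v g1).
Notation u0p := (u0 p).
Notation vcv := (vc v).
Notation pdp := (pd p).
Variable g2 : 'I_3 -> 'I_3 -> V3 R -> R^o.
Hypothesis g2G : forall i, grad_on O (g1 i) (g2 i).
Hypothesis g2s : forall i j, sm 1 O (g2 i j).
Variable A : HL2 R -> HL2 R -> HL2 R.
Hypothesis A_hess : hessian_field Q (action theta (f 0)) A.
Hypothesis A_weak : weak_hessian_field Q A.
Notation nv := (dot0 v v).
Notation gmz := (gm p v g1).
Implicit Types z y : L2 R.

Definition kk' (t : T) : R := g2 i0 i0 (pdp t).
Definition al' (t : T) : R := v.1 * g2 i1 i0 (pdp t) + v.2 * g2 i2 i0 (pdp t).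

Lemma g1_ac i : ac (fun t => g1 i (pdp t) : R) (fun t => g2 i i0 (pdp t)).
Proof.
have a := chain oO (pth_ac p) (fun t _ => pd_O Qp t) (g2G i) (g2s i).
have c := pth_cont Qp (g2s i i0).
apply: ac_eqd a; first exact: sqi_cont.
by apply: ae01W => t _; rewrite sum3 /pthd /= !mulr0 !addr0 mulr1.
Qed.

Lemma kk_ac : ac kkp kk'. Proof. exact: g1_ac. Qed.

Lemma al_ac : ac alp al'.
Proof. by apply: acD; apply: acZ; exact: g1_ac. Qed.

Lemma vcD z y : vcv (z + y) = vcv z + vcv y.
Proof.
by apply: cp_ext => i; rewrite cpD !cp_mkH; case: (val i) => [|[|_]]; rewrite ?scalerDr ?addr0.
Qed.

Lemma Hdot_vc (w : HL2 R) z : Hdot w (vcv z) = L2dot (v.1 *: cp w o0 + v.2 *: cp w o1) z.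
Proof.
by rewrite HdotE sum4 !cp_mkH /= !L2dot0r !addr0 !L2dotZr L2dotD !L2dotZ.
Qed.

Definition z00 z := sobolev 1 z /\ loop z 0 = 0.

Lemma z00D z y : z00 z -> z00 y -> z00 (z + y).
Proof.
move=> [sz z0] [sy y0]; split; first exact: sob1D.
have := sob1_lin 1 sz sy; rewrite !scale1r => -[_ _ ->]; last by rewrite lexx ler01.
by rewrite z0 y0 mulr0 addr0.
Qed.

Lemma polar_gm z y : z00 z -> z00 y ->
  Hdot (A u0p (vcv z)) (vcv y) = gmz (z + y) - gmz z - gmz y.
Proof.
move=> hz hy; have Uu := u0_U1 v Qp pn.
have T x : z00 x -> exists a b : R, T2 (fun s => action theta (f 0) (u0p + s *: vcv x)) a b (gmz x).
  by move=> [sx x0]; exact: (const_T2 Qopen theta_twisted Qp pn g1G g1s sx x0).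
(* [hess_polar] wants a coefficient for arbitrary directions; on the directions that occur it agrees
   with [gm]. *)
pose c w : R := 2^-1 * Hdot (A u0p w) w.
have cE x : z00 x -> c (vcv x) = gmz x.
  move=> hx; have [a [b h]] := T x hx; rewrite /c.
  by rewrite (hess_quad Qopen A_hess Uu (vc_H1 v hx.1) h) mulKf.
have hzy := z00D hz hy.
rewrite (hess_polar Qopen A_hess A_weak (c := c) Uu (vc_H1 v hz.1) (vc_H1 v hy.1)).
  by rewrite -vcD (cE _ (z00D hz hy)) (cE _ hz) (cE _ hy).
have hs := z00D hz hy.
by move=> w [->|[->|->]]; [rewrite (cE _ hz); exact: T|rewrite (cE _ hy); exact: T|rewrite -vcD (cE _ hs); exact: T].
Qed.

Section test.
Variables z y : L2 R.
Hypotheses (hz : z00 z) (hy : z00 y).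
Let c : T -> R := loop z.
Let c' : T -> R := L2fun (L2diff z).
Let o : T -> R := loop y.
Let o' : T -> R := L2fun (L2diff y).
Notation Tc := (T1 p v z).
Notation To := (T1 p v y).
(** [La] and [CC] arise when the direction [y], which enters through the integrals in [T1], is freed
    by a further integration by parts. *)
Definition La (t : R) : R := int0 t (fun t => L2fun (L2diff z) t * kkp t).
Definition CC : R := it 0 1 (fun t => t * (L2fun (L2diff z) t * kkp t)).

(* The function representing y |-> <A (v z), v y>; only its values at the two
   ends matter. *)
Definition hh (t : T) : R :=
  - (lam * (loop z t - int0 1 (loop z)) * kkp t + T1 p v z t * kk' t + loop z t * al' t) +
  lam * (La 1 - La t - CC) + (8 * qd ^+ 2 * int0 1 (loop z) / P ^+ 3 - 2 * nv / P ^+ 2 * loop z t).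

(** The loop vanishes at both ends, so no boundary terms appear although [r] need not be
    periodic. *)
Lemma ac_zero (g h : T -> R) : acl g h -> g 0 = 0 -> forall r s : T -> R, ac r s ->
  it 0 1 (fun t => h t * r t) = - it 0 1 (fun t => g t * s t).
Proof.
move=> [ag g1'] g0 r s ar.
have cg := ac_cont ag; have cr := ac_cont ar.
have [bg hg] := cont_bd cg; have [br hr] := cont_bd cr.
have s1 : sqi (fun t => g t * s t) by apply: (sqiM_bd (c := bg)) => //; [exact: cont_meas|case: ar].
have s2 : sqi (fun t => r t * h t) by apply: (sqiM_bd (c := br)) => //; [exact: cont_meas|case: ag].
have := proj2 (ac_mul ag ar) 1; rewrite ler01 lexx => /(_ isT).
rewrite g1' g0 !mul0r add0r -[int0 1 _]/(it 0 1 _) (itD (sqi_ig s1) (sqi_ig s2)) => H.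
have -> : (fun t => h t * r t) = (fun t => r t * h t) by apply/funext => t; rewrite mulrC.
by apply/eqP; rewrite -addr_eq0 addrC -H.
Qed.

Lemma sqi_cM (g h : T -> R) : {within I01, continuous g} -> sqi h -> sqi (fun t => g t * h t).
Proof. by move=> cg sh; have [b hb] := cont_bd cg; apply: (sqiM_bd (c := b)) => //; exact: cont_meas. Qed.

Lemma polar_I1 : I1 p v g1 (z + y) - I1 p v g1 z - I1 p v g1 y =
  it 0 1 (fun t => o' t * (kkp t * Tc t + alp t * c t)) + it 0 1 (fun t => c' t * (kkp t * To t + alp t * o t)).
Proof.
have sq x x' : z00 x -> z00 x' -> sqi (fun t => L2fun (L2diff x) t * (kkp t * T1 p v x' t + alp t * loop x' t)).
  move=> hx hx'; have C := I1_cont Qp g1s hx'.1.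
  apply: (eq_sqi (f := fun t => (kkp t * T1 p v x' t + alp t * loop x' t) * L2fun (L2diff x) t)) => [t _|].
    by rewrite mulrC.
  by apply: sqi_cM => //; exact: L2fun_sqi.
have hs := z00D hz hy.
have E : I1 p v g1 (z + y) = it 0 1 (fun t => (c' t * (kkp t * Tc t + alp t * c t) + o' t * (kkp t * Tc t + alp t * c t)) +
    (c' t * (kkp t * To t + alp t * o t) + o' t * (kkp t * To t + alp t * o t))).
  apply: ae01_it => //; [exact: sqi_ig (sq _ _ hs hs)| |].
    by apply: sqi_ig; apply: sqiD; apply: sqiD; exact: sq.
  rewrite L2diffD; [|exact: hz.1|exact: hy.1].
  apply: ae01S (L2funD (L2diff z) (L2diff y)) => t /I01E t01 ->.
  have L r : 0 <= r <= 1 -> loop (z + y) r = c r + o r.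
    by move=> r01; have := sob1_lin 1 hz.1 hy.1; rewrite !scale1r => -[_ _ ->//]; rewrite mul1r.
  have IL r : 0 <= r <= 1 -> int0 r (loop (z + y)) = int0 r c + int0 r o.
    move=> /andP[r0 r1]; rewrite -![int0 r _]/(it 0 r _) -itD; last 2 first.
    - by apply: ig_itv => //; exact: sqi_ig (sg hz.1).
    - by apply: ig_itv => //; exact: sqi_ig (sg hy.1).
    apply: eq_Rintegral => q; rewrite inE/= in_itv/= => /andP[q0 qr]; apply: L.
    by rewrite q0 (le_trans qr).
  rewrite /T1 (L t t01) (IL t t01) (IL 1); last by rewrite ler01 lexx.
  rewrite -/c -/o -/(c' t) -/(o' t).
  move: (c' t) (o' t) (kkp t) (alp t) (c t) (o t) (int0 t _) (int0 t _) (int0 1 _) (int0 1 _) => *; ring.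
have i1 := sqi_ig (sq _ _ hz hz); have i2 := sqi_ig (sq _ _ hy hz).
have i3 := sqi_ig (sq _ _ hz hy); have i4 := sqi_ig (sq _ _ hy hy).
rewrite E (itD (igD _ i1 i2) (igD _ i3 i4))// (itD i1 i2) (itD i3 i4) /I1.
rewrite -/c -/o -/c' -/o'.
move: (it 0 1 _) (it 0 1 _) (it 0 1 _) (it 0 1 _) => *; ring.
Qed.

End test.
End constant_loop.

(** * The function representing the Hessian at a constant loop *)

Section constant_loop.
Context {R : realType}.
Notation T := (measurableTypeR R).
Implicit Types (u w : HL2 R).
Local Hint Resolve mI01 : core.
Variables (Q : set (plane R)) (theta : R -> plane R -> plane R) (f : R -> plane R -> R).
Hypothesis Qopen : open Q.
Hypothesis theta_twisted : twisted_periodic Q theta f.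
Notation O := (OQ Q).
Variables (p v : plane R).
Hypothesis Qp : Q (csqr p).
Hypothesis pn : 0 < dot0 p p.
Notation P := (dot0 p p).
Notation qd := (dot0 p v).
Notation lam := (2 * qd / P).
Variables (g1 : 'I_3 -> V3 R -> R^o).
Notation gVv := (gV theta v).
Hypothesis g1G : grad_on O gVv g1.
Hypothesis g1s : forall i, sm 1 O (g1 i).
Notation kkp := (kk p g1).
Notation alp := (al p v g1).
Notation u0p := (u0 p).
Notation vcv := (vc v).
Variable g2 : 'I_3 -> 'I_3 -> V3 R -> R^o.
Hypothesis g2G : forall i, grad_on O (g1 i) (g2 i).
Hypothesis g2s : forall i j, sm 1 O (g2 i j).
Variable A : HL2 R -> HL2 R -> HL2 R.
Hypothesis A_hess : hessian_field Q (action theta (f 0)) A.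
Hypothesis A_weak : weak_hessian_field Q A.
Notation nv := (dot0 v v).
Notation gmz := (gm p v g1).
Implicit Types z y : L2 R.
Notation kkp' := (kk' p g2).
Notation alp' := (al' p v g2).

Section test.
Variable z : L2 R.
Hypotheses (hz : z00 z).
Let c : T -> R := loop z.
Let c' : T -> R := L2fun (L2diff z).
Notation Tc := (T1 p v z).
Notation Lz := (La p g1 z).
Notation Cz := (CC p g1 z).
Notation hz' := (hh p v g1 g2 z).

Let ac_c : ac c c'. Proof. exact: (zac hz.1).1. Qed.
Let cc : {within I01, continuous c}. Proof. exact: ac_cont ac_c. Qed.
Let ckk : {within I01, continuous kkp}. Proof. exact: ac_cont (kk_ac Qopen Qp g2G g2s). Qed.
Let cal : {within I01, continuous alp}. Proof. exact: ac_cont (al_ac Qopen v Qp g2G g2s). Qed.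
Let ckk' : {within I01, continuous kkp'}. Proof. exact: (pth_cont Qp (g2s i0 i0)). Qed.
Let cal' : {within I01, continuous alp'}.
Proof. by move=> t; apply: cvgD; apply: cvgMr; [exact: (pth_cont Qp (g2s i1 i0))|exact: (pth_cont Qp (g2s i2 i0))]. Qed.
Let cT : {within I01, continuous Tc}. Proof. exact: ac_cont (T1_ac p v hz.1). Qed.

Let sck : sqi (fun t => c' t * kkp t).
Proof.
apply: (eq_sqi (f := fun t => kkp t * c' t)) => [t _|]; first by rewrite mulrC.
by apply: sqi_cM ckk _; exact: L2fun_sqi.
Qed.

Let aL : ac Lz (fun t => c' t * kkp t). Proof. exact: ac_int sck. Qed.

Lemma hh_cont : {within I01, continuous hz'}.
Proof.
have cL : {within I01, continuous Lz} := ac_cont aL.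
move=> t; apply: cvgD; [apply: cvgD; [apply: cvgN; apply: cvgD; [apply: cvgD|]|]|].
- apply: cvgM; last exact: ckk.
  by apply: cvgMr; apply: cvgB; [exact: cc|exact: cvg_cst].
- by apply: cvgM; [exact: cT|exact: ckk'].
- by apply: cvgM; [exact: cc|exact: cal'].
- apply: cvgMr; apply: cvgB; last exact: cvg_cst.
  by apply: cvgB; [exact: cvg_cst|exact: cL].
- by apply: cvgB; [exact: cvg_cst|apply: cvgMr; exact: cc].
Qed.

(** Terms with the derivative of [y] are integrated by parts ([E1]), and so are those in which [y]
    enters through [T1] ([E2], [E3]). The integrals of [c' al o] cancel, and what remains is linear
    in the values of [y]. *)
Lemma test_hh y : z00 y ->
  Hdot (A u0p (vcv z)) (vcv y) = it 0 1 (fun t => hz' t * loop y t).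
Proof.
move=> hy; rewrite (polar_gm Qopen theta_twisted Qp pn g1G g1s A_hess A_weak hz hy).
pose o : T -> R := loop y; pose o' : T -> R := L2fun (L2diff y).
have ao : acl o o' := zac hy.1.
have so : sqi o := sg hy.1.
have E1 : it 0 1 (fun t => o' t * (kkp t * Tc t + alp t * c t)) =
  - it 0 1 (fun t => o t * (lam * (c t - int0 1 c) * kkp t + Tc t * kkp' t + c t * alp' t)) -
    it 0 1 (fun t => c' t * (alp t * o t)).
  have a1 := acD (ac_mul (T1_ac p v hz.1) (kk_ac Qopen Qp g2G g2s)) (ac_mul ac_c (al_ac Qopen v Qp g2G g2s)).
  have := ac_zero ao hy.2 a1.
  have -> : (fun t => o' t * (Tc t * kkp t + c t * alp t)) = (fun t => o' t * (kkp t * Tc t + alp t * c t)).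
    by apply/funext => t; rewrite [Tc t * _]mulrC [c t * _]mulrC.
  move=> ->; rewrite -opprD; congr (- _).
  have q1 : sqi (fun t => o t * (lam * (c t - int0 1 c) * kkp t + Tc t * kkp' t + c t * alp' t)).
    apply: (eq_sqi (f := fun t => (lam * (c t - int0 1 c) * kkp t + Tc t * kkp' t + c t * alp' t) * o t)) => [t _|].
      by rewrite mulrC.
    apply: sqi_cM so => t; apply: cvgD; [apply: cvgD|]; apply: cvgM.
    - by apply: cvgMr; apply: cvgB; [exact: cc|exact: cvg_cst].
    - exact: ckk.
    - exact: cT.
    - exact: ckk'.
    - exact: cc.
    - exact: cal'.
  have q2 : sqi (fun t => c' t * (alp t * o t)).
    apply: (eq_sqi (f := fun t => (alp t * o t) * c' t)) => [t _|]; first by rewrite mulrC.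
    apply: sqi_cM; last exact: L2fun_sqi.
    by move=> t; apply: cvgM; [exact: cal|exact: (ac_cont ao.1)].
  rewrite -(itD (sqi_ig q1) (sqi_ig q2)); congr (it 0 1 _); apply/funext => t.
  rewrite -/c -/c'.
  move: (o t) (c t) (c' t) (kkp t) (kkp' t) (alp t) (alp' t) (Tc t) (int0 1 _) => *; ring.
have co := ac_cont ao.1.
have sL : sqi Lz := sqi_cont (ac_cont aL).
have sOm := ac_int so.
have q3 : sqi (fun t => Lz t * o t) by apply: sqi_cM so; exact: (ac_cont aL).
have q4 : sqi (fun t => int0 t o * (c' t * kkp t)) by apply: sqi_cM sck; exact: (ac_cont sOm).
have q5 : sqi (fun t => t * (c' t * kkp t)) by apply: sqi_cM sck; exact: (ac_cont (@ac_id R)).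
have E2 : it 0 1 (fun t => int0 t o * (c' t * kkp t)) = Lz 1 * int0 1 o - it 0 1 (fun t => Lz t * o t).
  have := proj2 (ac_mul aL sOm) 1; rewrite ler01 lexx => /(_ isT).
  have -> : Lz 0 = 0 by rewrite /La int00.
  rewrite mul0r add0r -[int0 1 (fun t => _ + _)]/(it 0 1 _) (itD (sqi_ig q3) (sqi_ig q4)) => ->.
  by rewrite addrAC subrr add0r.
have q6 : sqi (fun t => c' t * (alp t * o t)).
  apply: (eq_sqi (f := fun t => (alp t * o t) * c' t)) => [t _|]; first by rewrite mulrC.
  apply: sqi_cM; last exact: L2fun_sqi.
  by move=> t; apply: cvgM; [exact: cal|exact: co].
have E3 : it 0 1 (fun t => c' t * (kkp t * T1 p v y t + alp t * o t)) =
   lam * (Lz 1 * int0 1 o - it 0 1 (fun t => Lz t * o t) - int0 1 o * Cz) + it 0 1 (fun t => c' t * (alp t * o t)).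
  have r1 := sqiZ lam q4; have r2 := sqiZ (- (lam * int0 1 o)) q5.
  have -> : (fun t => c' t * (kkp t * T1 p v y t + alp t * o t)) =
     (fun t => (lam * (int0 t o * (c' t * kkp t)) + - (lam * int0 1 o) * (t * (c' t * kkp t))) + c' t * (alp t * o t)).
    apply/funext => t; rewrite /T1 -/o; move: (c' t) (kkp t) (alp t) (o t) (int0 t o) (int0 1 o) => *; ring.
  rewrite (itD (igD _ (sqi_ig r1) (sqi_ig r2)) (sqi_ig q6))//.
  rewrite (itD (sqi_ig r1) (sqi_ig r2)) (itZ _ (sqi_ig q4)) (itZ _ (sqi_ig q5)) E2 -/Cz.
  move: (Lz 1) (int0 1 o) (it 0 1 _) (it 0 1 _) Cz => *; ring.
have E4 := polar_I1 v Qp g1s hz hy.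
rewrite -/c -/c' -/o -/o' E1 E3 in E4.
have X1c := X1E hz.1; have X1o := X1E hy.1.
have Eg : gmz (z + y) - gmz z - gmz y = (I1 p v g1 (z + y) - I1 p v g1 z - I1 p v g1 y) +
   (8 * qd ^+ 2 * int0 1 c / P ^+ 3 * int0 1 o - 2 * nv / P ^+ 2 * it 0 1 (fun t => c t * o t)).
  have EL : L2dot z y = it 0 1 (fun t => c t * o t).
    apply: L2dot_ae; [exact: (sg hz.1)|exact: so|exact: (zae hz.1)|exact: (zae hy.1)].
  rewrite /gm mnD L2dotD !L2dotDr (L2dotC y z) EL X1c X1o.
  move: (I1 p v g1 (z + y)) (I1 p v g1 z) (I1 p v g1 y) (mn z) (mn y) (L2dot z z) (L2dot y y) (it 0 1 _) => i1 i2 i3 m1 m2 d1 d2 d3.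
  by rewrite -!exprVn; move: (P^-1) => iP; ring.
rewrite Eg E4.
have s1 : sqi (fun t => o t * (lam * (c t - int0 1 c) * kkp t + Tc t * kkp' t + c t * alp' t)).
  apply: (eq_sqi (f := fun t => (lam * (c t - int0 1 c) * kkp t + Tc t * kkp' t + c t * alp' t) * o t)) => [t _|].
    by rewrite mulrC.
  apply: sqi_cM so => t; apply: cvgD; [apply: cvgD|]; apply: cvgM.
  - by apply: cvgMr; apply: cvgB; [exact: cc|exact: cvg_cst].
  - exact: ckk.
  - exact: cT.
  - exact: ckk'.
  - exact: cc.
  - exact: cal'.
have s2 : sqi (fun t => c t * o t) by exact: (sqi_cM cc so).
pose k0 := lam * (Lz 1 - Cz) + 8 * qd ^+ 2 * int0 1 c / P ^+ 3.
have -> : (fun t => hz' t * loop y t) = (fun t => (-1) * (o t * (lam * (c t - int0 1 c) * kkp t + Tc t * kkp' t + c t * alp' t)) +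
    (k0 * o t + (- lam * (Lz t * o t) + - (2 * nv / P ^+ 2) * (c t * o t)))).
  apply/funext => t; rewrite /hh /k0 -/c -/o.
  move: (o t) (c t) (kkp t) (kkp' t) (alp' t) (Tc t) (int0 1 c) (Lz t) (Lz 1) Cz => *; ring.
have z1 := sqi_ig (sqiZ (-1) s1); have z2 := sqi_ig (sqiZ k0 so).
have z3 := sqi_ig (sqiZ (- lam) q3); have z4 := sqi_ig (sqiZ (- (2 * nv / P ^+ 2)) s2).
rewrite (itD z1 (igD _ z2 (igD _ z3 z4)))// (itD z2 (igD _ z3 z4))// (itD z3 z4).
rewrite (itZ _ (sqi_ig s1)) (itZ _ (sqi_ig so)) (itZ _ (sqi_ig q3)) (itZ _ (sqi_ig s2)).
rewrite -[it 0 1 o]/(int0 1 o) /k0.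
move: (it 0 1 (fun t => o t * _)) (it 0 1 (fun t => c' t * _)) (it 0 1 (fun t => Lz t * _)) (it 0 1 (fun t => c t * _)).
move: (Lz 1) Cz (int0 1 o) (int0 1 c) => *; ring.
Qed.

End test.
End constant_loop.

(** * Constancy of the time derivative at a point *)

Section constant_loop.
Context {R : realType}.
Notation T := (measurableTypeR R).
Implicit Types (u w : HL2 R).
Local Hint Resolve mI01 : core.
Variables (Q : set (plane R)) (theta : R -> plane R -> plane R) (f : R -> plane R -> R).
Hypothesis Qopen : open Q.
Hypothesis theta_twisted : twisted_periodic Q theta f.
Notation O := (OQ Q).
Variables (p v : plane R).
Hypothesis Qp : Q (csqr p).
Hypothesis pn : 0 < dot0 p p.
Notation P := (dot0 p p).
Notation qd := (dot0 p v).
Notation lam := (2 * qd / P).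
Variables (g1 : 'I_3 -> V3 R -> R^o).
Notation gVv := (gV theta v).
Hypothesis g1G : grad_on O gVv g1.
Hypothesis g1s : forall i, sm 1 O (g1 i).
Notation kkp := (kk p g1).
Notation u0p := (u0 p).
Notation vcv := (vc v).
Variable g2 : 'I_3 -> 'I_3 -> V3 R -> R^o.
Hypothesis g2G : forall i, grad_on O (g1 i) (g2 i).
Hypothesis g2s : forall i j, sm 1 O (g2 i j).
Variable A : HL2 R -> HL2 R -> HL2 R.
Hypothesis A_hess : hessian_field Q (action theta (f 0)) A.
Hypothesis A_weak : weak_hessian_field Q A.
Notation nv := (dot0 v v).
Implicit Types z y : L2 R.
Lemma sob2_Z (a : R) z : sobolev 2 z -> sobolev 2 (a *: z).
Proof.
by move=> s; have := sob2_lin a s (sob2_one 0); rewrite scale0r addr0.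
Qed.

Lemma sob2_0 : sobolev 2 (0 : L2 R).
Proof. by have := sob2_one (0 : R); rewrite scale0r. Qed.

Lemma u0_U2 : U2 Q u0p.
Proof.
split; first exact: u0_U1.
apply/dom_H => i; rewrite cp_mkH; case: (val i) => [|[|_]]; [exact: sob2_one|exact: sob2_one|exact: sob2_0].
Qed.

Lemma vc_H2 z : sobolev 2 z -> H_ 2 (vcv z).
Proof.
move=> sz; apply/dom_H => i; rewrite cp_mkH.
by case: (val i) => [|[|_]]; [exact: sob2_Z|exact: sob2_Z|exact: sob2_0].
Qed.

(** The [v] component of the Hessian lies in W^{1,2} because [z] is in W^{2,2}, so it has a periodic
    representative. It has the same integrals as [hh] against all loops vanishing at 0; these
    determine continuous functions, so the two agree up to the end points. *)
Lemma hh_periodic z : z00 z -> sobolev 2 z -> hh p v g1 g2 z 0 = hh p v g1 g2 z 1.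
Proof.
move=> hz s2.
have [_ [/(_ _ u0_U2)[Hw _ _] _] _ _ _] := A_weak.
have /dom_H sw := Hw _ (vc_H2 s2).
set w := A u0p (vcv z) in sw.
pose b := v.1 *: cp w o0 + v.2 *: cp w o1.
have sb : sobolev 1 b by apply: sob1D; apply: (sob1Z _ _).1.
have ch : {within I01, continuous (hh p v g1 g2 z)} by exact: (@hh_cont R Q Qopen p v Qp g1 g2 g2G g2s z hz).
have [ab eb] := sob1P sb; have cb := ac_cont ab.1.
have cf : {within I01, continuous (fun t => loop b t - hh p v g1 g2 z t : R)}.
  by move=> t; apply: cvgB; [exact: cb|exact: ch].
have F0 := ae0_cont cf (density (sqi_cont cf) _).
have K : forall t : R, 0 <= t <= 1 -> loop b t - hh p v g1 g2 z t = 0.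
  apply: F0 => g g' lg g0.
  have [sy _ ly] := sob1_toL2 lg; have sg := acl_sqi lg.1.
  have y0 : z00 (toL2 g) by split=> //; rewrite ly// lexx ler01.
  have := test_hh Qopen theta_twisted Qp pn g1G g1s g2G g2s A_hess A_weak hz y0.
  rewrite Hdot_vc -/w -/b (L2dot_ae (acl_sqi ab.1) sg eb (toL2E sg)) => E.
  have cg := ac_cont lg.1.
  have q1 : sqi (fun t => loop b t * g t) by exact: (sqi_cM cb sg).
  have q2 : sqi (fun t => hh p v g1 g2 z t * g t) by exact: (sqi_cM ch sg).
  have -> : (fun t => (loop b t - hh p v g1 g2 z t) * g t) = (fun t => loop b t * g t - hh p v g1 g2 z t * g t).
    by apply/funext => t; rewrite mulrBl.
  rewrite (itB (sqi_ig q1) (sqi_ig q2)) E; apply/eqP; rewrite subr_eq0; apply/eqP.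
  by apply: eq_Rintegral => t; rewrite inE/= in_itv/= => t01; rewrite ly.
have h0 := K 0; have h1' := K 1.
rewrite lexx ler01 in h0; rewrite lexx ler01 in h1'.
move/eqP: (h0 isT) (h1' isT); rewrite subr_eq0 => /eqP <- /eqP.
by rewrite subr_eq0 => /eqP <-; rewrite ab.2.
Qed.

(** Equality of [kk] at 0 and 1 makes its deviation from the mean a loop, so that the primitive
    qualifies as a direction in [H_2]. All terms of [hh] but [lam * (La 1 - La t)] then agree at
    both ends, and [qd != 0] permits division by [lam]. *)
Lemma kk_const : qd != 0 -> kkp 0 = kkp 1 -> forall t, 0 <= t <= 1 -> kkp t = kkp 0.
Proof.
move=> q0 k01.
have ak := kk_ac Qopen Qp g2G g2s; have ck := ac_cont ak.
have sk : sqi kkp := acl_sqi ak.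
pose Kb := it 0 1 kkp.
pose g' (t : T) : R := kkp t + - Kb.
have ag' : acl g' (fun t => kk' p g2 t + 0).
  by split; [exact: (acD ak (ac_cst (- Kb)))|rewrite /g' k01].
have sg' : sqi g' := acl_sqi ag'.1.
pose g (t : T) : R := int0 t g'.
have Ig' : it 0 1 g' = 0.
  by rewrite (itD (sqi_ig sk) (ig_cst _)) it_cst// subr0 mulr1 subrr.
have ag : acl g g' by split; [exact: ac_int|rewrite /g int00; exact: Ig'].
have [sz dz lz] := sob1_toL2 ag.
have [sg1 _ _] := sob1_toL2 ag'.
pose z := toL2 g.
have s2 : sobolev 2 z by apply/sob2E; split=> //; rewrite dz.
have h01 : 0 <= (0 : R) <= 1 by apply/andP; split.
have h11 : 0 <= (1 : R) <= 1 by apply/andP; split.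
have z0 : loop z 0 = 0 by rewrite lz// /g int00.
have z1 : loop z 1 = 0 by rewrite lz// -[g 1]/(it 0 1 g').
have := hh_periodic (conj sz z0) s2.
rewrite /hh z0 z1 /T1 /La !int00 => H.
have L1 : int0 1 (fun t => L2fun (L2diff z) t * kkp t) = 0.
  have l0 : lam != 0 by rewrite mulf_neq0// ?mulf_neq0// invr_eq0 gt_eqF.
  apply: (mulfI l0); rewrite mulr0; move: H; rewrite k01.
  move: (int0 1 _) (int0 1 _) (CC _ _ _) (kkp 1) (kk' _ _ _) (kk' _ _ _) (al' _ _ _ _) (al' _ _ _ _) (P) (qd) (nv).
  move=> x1 x2 x3 x4 x5 x6 x7 x8 x9 x10 x11 /eqP; rewrite -subr_eq0 => /eqP H.
  by rewrite -[RHS]H; ring.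
have sgk : sqi (fun t => kkp t * g' t) by exact: (sqi_cM ck sg').
have L2' : it 0 1 (fun t => kkp t * g' t) = 0.
  rewrite -[RHS]L1; apply: ae01_it => //; [exact: sqi_ig| |].
    apply: sqi_ig; apply: (eq_sqi (f := fun t => kkp t * L2fun (L2diff z) t)) => [t _|]; first by rewrite mulrC.
    by apply: (sqi_cM ck); exact: L2fun_sqi.
  by rewrite dz; apply: ae01S (toL2E sg') => t _ ->; rewrite mulrC.
have S0 : it 0 1 (fun t => g' t ^+ 2) = 0.
  have -> : (fun t => g' t ^+ 2) = (fun t => kkp t * g' t - Kb * g' t).
    by apply/funext => t; rewrite /g'; ring.
  rewrite (itB (sqi_ig sgk) (sqi_ig (sqiZ Kb sg'))) L2' (itZ _ (sqi_ig sg')) Ig'.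
  by rewrite mulr0 subrr.
have ae := Rint_sqr_eq0 mI01 (sqi_meas sg') (proj2 sg') S0.
have KK := ae0_cont (ac_cont ag'.1) ae.
move=> t t01; have := KK t t01; have := KK 0 h01.
by rewrite /g' => /eqP; rewrite addr_eq0 => /eqP -> /eqP; rewrite addr_eq0 => /eqP ->.
Qed.

End constant_loop.

(** * Rigidity at every point and conclusion *)

Section rigidity.
Context {R : realType}.
Variables (Q : set (plane R)) (theta : R -> plane R -> plane R) (f : R -> plane R -> R).
Variable A : HL2 R -> HL2 R -> HL2 R.
Hypothesis Qopen : open Q.
Hypothesis theta_twisted : twisted_periodic Q theta f.
Hypothesis A_hess : hessian_field Q (action theta (f 0)) A.
Hypothesis A_weak : weak_hessian_field Q A.
Notation O := (OQ Q).

Lemma partials k (g : V3 R -> R^o) : sm k.+2 O g -> exists G H,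
  [/\ grad_on O g G, forall i, grad_on O (G i) (H i) & forall i j, sm k O (H i j)].
Proof.
move=> [G gG sG].
have sG' i : exists H : 'I_3 -> V3 R -> R^o, grad_on O (G i) H /\ forall j, sm k O (H j).
  by have [H h1 h2] := sG i; exists H.
have [H HH] := boolp.choice sG'.
by exists G, H; split=> // i; [case: (HH i)|move=> j; case: (HH i)].
Qed.

Definition et : V3 R := ((1 : R^o), (0 : plane R)).

Lemma et_line (q : plane R) (r : R) : (((0 : R^o), q) : V3 R) + r *: et = ((r : R^o), q).
Proof.
rewrite /et; apply: injective_projections => /=; first by rewrite add0r; exact: mulr1.
by rewrite scaler0 addr0.
Qed.

Lemma time_derive (g : V3 R -> R^o) (q : plane R) (s : R) : differentiable g ((s : R^o), q) ->
  is_derive (s : R^o) 1 (fun r : R^o => g ((r : R^o), q)) ('D_et g ((s : R^o), q)).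
Proof.
move=> dg; have := @line_derive R g ((0 : R^o), q) et s; rewrite et_line => /(_ dg).
by congr (is_derive _ _ _ _); apply/funext => r; rewrite et_line.
Qed.

Lemma lin_derive (h g : R -> R) (a b s dh dg : R) :
  is_derive (s : R^o) 1 (h : R^o -> R^o) dh -> is_derive (s : R^o) 1 (g : R^o -> R^o) dg ->
  is_derive (s : R^o) 1 (fun r : R^o => a * h r + b * g r : R^o) (a * dh + b * dg).
Proof. by move=> Hh Hg; exact: (is_deriveD (is_deriveZ a Hh) (is_deriveZ b Hg)). Qed.

Section point.
Variable p : plane R.
Hypothesis Qp : Q (csqr p).
Notation q := (csqr p).

Let P0 (x : V3 R) : R^o := (theta x.1 x.2).1.
Let Q0 (x : V3 R) : R^o := (theta x.1 x.2).2.
Let dP (s : R) : R := 'D_et P0 ((s : R^o), q).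
Let dQ (s : R) : R := 'D_et Q0 ((s : R^o), q).

Let dP_is s : is_derive (s : R^o) 1 (fun r : R^o => (theta r q).1 : R^o) (dP s).
Proof.
have [/(_ 1%N)[d _] _ _ _ _] := theta_twisted.
by apply: (@time_derive P0); exact: d.
Qed.

Let dQ_is s : is_derive (s : R^o) 1 (fun r : R^o => (theta r q).2 : R^o) (dQ s).
Proof.
have [_ /(_ 1%N)[d _] _ _ _] := theta_twisted.
by apply: (@time_derive Q0); exact: d.
Qed.

Lemma theta_derive s : 'D_1 (fun r : R^o => theta r q) (s : R^o) = (dP s, dQ s).
Proof.
have [d1 e1] := dP_is s; have [d2 e2] := dQ_is s.
have D1 : is_diff (s : R^o) (fun r : R^o => (theta r q).1 : R^o) ('d (fun r : R^o => (theta r q).1 : R^o) (s : R^o)).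
  by apply: DiffDef; [exact/derivable1_diffP|reflexivity].
have D2 : is_diff (s : R^o) (fun r : R^o => (theta r q).2 : R^o) ('d (fun r : R^o => (theta r q).2 : R^o) (s : R^o)).
  by apply: DiffDef; [exact/derivable1_diffP|reflexivity].
have [dd DD] := is_diff_pair D1 D2.
have -> : (fun r : R^o => theta r q) = (fun r : R^o => ((theta r q).1, (theta r q).2)).
  by apply/funext => r; rewrite -surjective_pairing.
rewrite deriveE// DD /=.
by congr (_, _); [rewrite -e1|rewrite -e2]; rewrite deriveE//; exact/derivable1_diffP.
Qed.

Lemma dPQ_per : dP 1 = dP 0 /\ dQ 1 = dQ 0.
Proof.
have [_ _ /(_ 0 _ Qp)] := theta_twisted.
by rewrite add0r !theta_derive => -[-> ->].
Qed.

Definition da1 (s : R) : R := 2 * p.1 * dP s + 2 * p.2 * dQ s.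
Definition da2 (s : R) : R := - (2 * p.2) * dP s + 2 * p.1 * dQ s.

Lemma da1_is s : is_derive (s : R^o) 1 (fun r : R^o => av theta i1 ((r : R^o), p)) (da1 s).
Proof.
have := lin_derive (2 * p.1) (2 * p.2) (dP_is s) (dQ_is s); congr (is_derive _ _ _ _).
by apply/funext => r; rewrite /av /cmb /co /=; move: ((theta r q).1) ((theta r q).2) => *; ring.
Qed.

Lemma da2_is s : is_derive (s : R^o) 1 (fun r : R^o => av theta i2 ((r : R^o), p)) (da2 s).
Proof.
have := lin_derive (- (2 * p.2)) (2 * p.1) (dP_is s) (dQ_is s); congr (is_derive _ _ _ _).
by apply/funext => r; rewrite /av /cmb /co /=; move: ((theta r q).1) ((theta r q).2) => *; ring.
Qed.

(** The left side is [kk] for the direction [v]; periodicity of the time derivative of the form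
    gives the equality at 0 and 1 that [kk_const] asks for. *)
Lemma comb_const (v : plane R) : 0 < dot0 p p -> dot0 p v != 0 -> forall t, 0 <= t <= 1 ->
  v.1 * da1 t + v.2 * da2 t = v.1 * da1 0 + v.2 * da2 0.
Proof.
move=> pn qn.
have [g1 [g2 [g1G g2G g2s]]] := partials (gV_sm theta_twisted v 3).
have g1s i : sm 1 O (g1 i) by apply: (@smS _ 1); exists (g2 i).
have E s : kk p g1 s = v.1 * da1 s + v.2 * da2 s.
  have Os : O ((s : R^o), p) by apply/OQE.
  have [dg Dg] := g1G _ Os.
  have [_ <-] := lin_derive v.1 v.2 (da1_is s) (da2_is s).
  have [_ e] := time_derive dg.
  rewrite /kk pdE -[RHS]/('D_1 (fun r : R^o => gV theta v ((r : R^o), p)) (s : R^o)) e Dg sum3 /co /=.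
  by rewrite !mul0r !addr0 mul1r.
move=> t t01; rewrite -!E.
apply: (kk_const Qopen theta_twisted Qp pn g1G g1s g2G g2s A_hess A_weak qn _ t01).
by rewrite !E /da1 /da2; have [-> ->] := dPQ_per.
Qed.

(** The vectors [p] and [p + i p] have inner product [|p|^2] with [p] and are linearly independent,
    so the two resulting combinations determine both coefficients. *)
Lemma da_const : 0 < dot0 p p -> forall t, 0 <= t <= 1 -> da1 t = da1 0 /\ da2 t = da2 0.
Proof.
move=> pn t t01.
have h1' := comb_const pn (v := p) (lt0r_neq0 pn) t01.
have h2' : (p.1 - p.2) * da1 t + (p.2 + p.1) * da2 t = (p.1 - p.2) * da1 0 + (p.2 + p.1) * da2 0.
  apply: (comb_const (v := (p.1 - p.2, p.2 + p.1))) => //.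
  have -> : dot0 p (p.1 - p.2, p.2 + p.1) = dot0 p p by rewrite /dot0 /=; ring.
  exact: lt0r_neq0.
move: h1' h2' (lt0r_neq0 pn); rewrite /dot0.
move: (da1 t) (da2 t) (da1 0) (da2 0) p.1 p.2 => a b c d x y h1' h2' pn0.
split; apply/eqP; rewrite -subr_eq0; apply/eqP; apply: (mulfI pn0); rewrite mulr0.
  have -> : (x * x + y * y) * (a - c) = (x + y) * (x * a + y * b - (x * c + y * d)) -
    y * ((x - y) * a + (y + x) * b - ((x - y) * c + (y + x) * d)) by ring.
  by rewrite h1' h2' !subrr !mulr0 subrr.
have -> : (x * x + y * y) * (b - d) = (y - x) * (x * a + y * b - (x * c + y * d)) +
    x * ((x - y) * a + (y + x) * b - ((x - y) * c + (y + x) * d)) by ring.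
by rewrite h1' h2' !subrr !mulr0 addr0.
Qed.

Lemma line_const (g : R -> R) (d : R -> R) : 
  (forall s : R, is_derive (s : R^o) 1 (g : R^o -> R^o) (d s)) ->
  (forall t, 0 <= t <= 1 -> d t = d 0) -> forall t, 0 <= t <= 1 -> g t = g 0 + t * d 0.
Proof.
move=> Hg Hd t /andP[t0 t1].
have F (r : R) : 0 <= r <= 1 -> is_derive (r : R^o) 1 (fun r : R^o => g (r * t) - r * (t * d 0) : R^o)
    (d (r * t) * t - t * d 0).
  move=> _; apply: is_deriveB; last exact: is_derive_lin.
  exact: (@is_derive1_comp R g (fun r => r * t) r _ _ (Hg _) (is_derive_lin t r)).
have : `|(g (1 * t) - 1 * (t * d 0)) - (g (0 * t) - 0 * (t * d 0))| <= 0.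
  apply: (mean_bound F) => r /andP[r0 r1]; rewrite Hd; last by rewrite mulr_ge0//= mulr_ile1.
  by rewrite [d 0 * t]mulrC subrr normr0.
rewrite !mul1r !mul0r subr0 normr_le0 => /eqP E.
by apply/eqP; rewrite -subr_eq0 opprD addrA addrAC E.
Qed.

Lemma rigid_at i t : 0 <= t <= 1 ->
  av theta i (t, p) = av theta i (0, p) + t * Ph f i (0, p).
Proof.
move=> t01.
have h11 : 0 <= (1 : R) <= 1 by apply/andP; split.
(* At [p = 0] all coefficients vanish, as the squaring map has zero differential there. *)
have [p0|pn] := eqVneq (dot0 p p) 0.
  have [x0 y0] : p.1 = 0 /\ p.2 = 0.
    move/eqP: p0; rewrite /dot0 -!expr2 paddr_eq0 ?sqr_ge0// !sqrf_eq0 => /andP[/eqP -> /eqP ->].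
    by [].
  rewrite /av /Ph /cmb /co /=; case: (val i) => [|[|_]]; rewrite /= ?x0 ?y0 ?mul0r ?oppr0 ?addr0 ?mulr0 ?add0r ?mulr0//.
have pp : 0 < dot0 p p by rewrite lt_neqAle eq_sym pn addr_ge0// -expr2 sqr_ge0.
have C := da_const pp.
have L (j : 'I_3) (d : R -> R) : (forall s : R, is_derive (s : R^o) 1 (fun r : R^o => av theta j ((r : R^o), p)) (d s)) ->
    (forall t, 0 <= t <= 1 -> d t = d 0) -> av theta j (t, p) = av theta j (0, p) + t * Ph f j (0, p).
  move=> Hd Hc; have LC := line_const Hd Hc.
  (* The constant slope is read off at time 1, where [av1] gives the increment over one period. *)
  rewrite (LC t t01); have := LC 1 h11; rewrite mul1r (av1 theta_twisted j Qp) => /addrI ->.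
  by [].
have [i' | [i' | i']] : i = i0 \/ i = i1 \/ i = i2.
  by case: i => [[|[|[|//]]] hi]; [left|right; left|right; right]; exact: val_inj.
- by rewrite i' /av /Ph /cmb /= mulr0 addr0.
- by rewrite i'; apply: (L _ da1 da1_is) => s s01; case: (C s s01).
- by rewrite i'; apply: (L _ da2 da2_is) => s s01; case: (C s s01).
Qed.

End point.

Lemma almost_extendable_action : almost_extendable Q A.
Proof.
have R' i (z : plane R) (t : R) : Q (csqr z) -> 0 <= t <= 1 ->
    av theta i (t, z) = av theta i (0, z) + t * Ph f i (0, z).
  by move=> Qz; exact: rigid_at.
(* Order 4: two derivatives enter the Hessian, and [sup_lip1] needs two more to make the second
   partial derivatives Lipschitz into W^{1,2}. *)
have P i : exists ah : ('I_3 -> V3 R -> R^o) * ('I_3 -> 'I_3 -> V3 R -> R^o),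
    [/\ grad_on O (av theta i) ah.1, forall j, grad_on O (ah.1 j) (ah.2 j) &
     forall j k, sm 2 O (ah.2 j k)].
  by have [G [H [h1' h2' h3']]] := partials (av_sm theta_twisted 4 i); exists (G, H).
have [a12 HA] := boolp.choice P.
have [ps1 [ps2 [pG pH sp]]] := partials (psi_sm theta_twisted 4).
apply: (@reduced_extendable R Q Qopen (av theta) (fun i => (a12 i).1) (fun i => (a12 i).2) _ _ _
  (psi f) ps1 ps2 pG pH sp _ A A_hess A_weak) => [i|i j|i j k|u Uu].
- by case: (HA i).
- by case: (HA i).
- by case: (HA i).
- exact: (action_Sr Qopen theta_twisted R' Uu).
Qed.

End rigidity.

Theorem theoremB (R : realType) (Q : set (plane R))
    (theta : R -> plane R -> plane R) (f : R -> plane R -> R)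
    (A : HL2 R -> HL2 R -> HL2 R)
    (Qopen : open Q) (Q0 : Q 0%R)
    (theta_twisted : twisted_periodic Q theta f)
    (A_hessian : hessian_field Q (action theta (f 0%R)) A)
    (A_weak : weak_hessian_field Q A) :
  almost_extendable Q A.
Proof. exact: almost_extendable_action Qopen theta_twisted A_hessian A_weak. Qed.
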